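(* Let $\alpha\in(0,1)$, $\beta$ with $\alpha+\beta>1$, and let $\phi$ be a sigmoidal function satisfying the assumptions in the context, with decay rate $k\in\mathbb N$ and associated functions $\phi^L,\phi^R$. Put $\gamma=(k,\alpha,\beta,\phi^L(0),\phi^R(0))$. Consider the planar system $$\dot x=(\alpha+\beta\phi(\varepsilon^{-1}(x-1)))y-x,\qquad \dot y=\eta-(\mu+\alpha+\beta\phi(\varepsilon^{-1}(x-1)))y, \qquad (\ast)$$ with parameters $$\eta=1+\varepsilon^{k/(k+1)}\eta_1,\qquad \mu=\varepsilon^{k/(k+1)}\mu_1. \qquad (\ast\ast)$$ Then for every $\gamma$ there exist two numbers $\eta^L_{\mathrm{Het},0}<0$ and $\eta^R_{\mathrm{Het},0}>0$, depending only on $\gamma$, such that the following holds. (a) Let $$\eta^L_{\mathrm{Het}}(\mu_1):=\eta^L_{\mathrm{Het},0}+\frac{\mu_1}{\alpha},\qquad \eta^R_{\mathrm{Het}}(\mu_1):=\eta^R_{\mathrm{Het},0}+\frac{\mu_1}{\alpha+\beta}.$$ Then there exists a unique $\mu_{1*}>0$ such that (a.1) $\eta^L_{\mathrm{Het}}(\mu_1)<\eta^R_{\mathrm{Het}}(\mu_1)$ for all $\mu_1\in[0,\mu_{1*})$; (a.2) $\eta^L_{\mathrm{Het}}(\mu_{1*})=\eta^R_{\mathrm{Het}}(\mu_{1*})$; (a.3) $\eta^L_{\mathrm{Het}}(\mu_1)>\eta^R_{\mathrm{Het}}(\mu_1)$ for all $\mu_1>\mu_{1*}$. (b) Fix $\mu_1\in[0,\mu_{1*})$,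 so that $\eta^L_{\mathrm{Het}}(\mu_1)<\eta^R_{\mathrm{Het}}(\mu_1)$, and let $\eta_1\in(\eta^L_{\mathrm{Het}}(\mu_1),\eta^R_{\mathrm{Het}}(\mu_1))$. Then there exists $\varepsilon_0>0$ such that for all $\varepsilon\in(0,\varepsilon_0)$ there exists an attracting limit cycle $\Gamma^{\mathrm{Relax}}_\varepsilon$ of $(\ast)$ with $(\eta,\mu)$ as in $(\ast\ast)$, and $\Gamma^{\mathrm{Relax}}_\varepsilon\to\Gamma_0$ in Hausdorff distance as $\varepsilon\to0$. On the other hand, if $\eta_1\notin[\eta^L_{\mathrm{Het}}(\mu_1),\eta^R_{\mathrm{Het}}(\mu_1)]$, then there exist $\varepsilon_0>0$ and $c>0$ such that for all $\varepsilon\in(0,\varepsilon_0)$ and $(\eta,\mu)$ as in $(\ast\ast)$ there exist no limit cycles of $(\ast)$ closer to $\Gamma_0$ than $c$ in Hausdorff distance. (c) Fix any $\mu_1>\mu_{1*}$, so that $\eta^L_{\mathrm{Het}}(\mu_1)>\eta^R_{\mathrm{Het}}(\mu_1)$. Then there exist $\varepsilon_0>0$, a constant $c>0$ and a neighborhood $I$ of $\eta=1$ such that for all $\varepsilon\in(0,\varepsilon_0)$, any $\eta\in I$ and $\mu=\varepsilon^{k/(k+1)}\mu_1$, there exist no limit cycles of $(\ast)$ closer to $\Gamma_0$ than $c$ in Hausdorff distance.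
   Context: Assumptions on $\phi$: $\phi:\mathbb R\to\mathbb R$ is smooth with $\phi(z)\in(0,1)$ and $\phi'(z)>0$ for all $z\in\mathbb R$, $\phi(z)\to1$ as $z\to\infty$ and $\phi(z)\to0$ as $z\to-\infty$. Moreover $\phi$ has algebraic decay: there exist $k\in\mathbb N$ (positive) and smooth functions $\phi^L,\phi^R:[0,\infty)\to[0,\infty)$ with $\phi^L(0)>0$, $\phi^R(0)>0$ such that $\phi(z)=(-z)^{-k}\phi^L((-z)^{-1})$ for $z<0$ and $\phi(z)=1-z^{-k}\phi^R(z^{-1})$ for $z>0$. The closed curve $\Gamma_0$: let $p^L=(1,\alpha^{-1})$ and $p^R=(1,(\alpha+\beta)^{-1})$. Let $\Gamma_0^L$ be the forward orbit of $p^R$ under the linear system $\dot x=\alpha y-x$, $\dot y=1-\alpha y$ (considered in $x\le1$), and let $\Gamma_0^R$ be the forward orbit of $p^L$ under the linear system $\dot x=(\alpha+\beta)y-x$, $\dot y=1-(\alpha+\beta)y$ (considered in $x\ge1$). The orbit $\Gamma_0^L$ is asymptotic to $p^L$ and $\Gamma_0^R$ is asymptotic to $p^R$ as $t\to\infty$; $\Gamma_0=\Gamma_0^L\cup\Gamma_0^R$ is a closed curve. A limit cycle is an isolated (nonconstant) periodic orbit. *)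

(* Defs.v *)
From Stdlib Require Import Reals.
From Coquelicot Require Import Coquelicot.

Open Scope R_scope.

(** Difference quotients restricted to [[0,+oo)]: one-sided at [0], two-sided elsewhere. *)
Definition is_derive_halfline (f : R -> R) (x l : R) : Prop :=
  filterlim (fun y => (f y - f x) / (y - x))
    (within (fun y => 0 <= y) (locally' x)) (locally l).

(** [D n] is the n-th derivative; only values on [[0,+oo)] matter. *)
Definition smooth_halfline (f : R -> R) : Prop :=
  exists D : nat -> R -> R,
    (forall x, 0 <= x -> D O x = f x) /\
    (forall n x, 0 <= x -> is_derive_halfline (D n) x (D (S n) x)).

Record halfline_profile (f : R -> R) : Prop := {
  profile_smooth : smooth_halfline f;
  profile_nonneg : forall s, 0 <= s -> 0 <= f s;
  profile_pos0 : 0 < f 0 }.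

(** [phiL], [phiR] are functions on [[0,+oo)]; their values at negative arguments are
    never used. *)
Record sigmoidal (k : nat) (phi phiL phiR : R -> R) : Prop := {
  sigmoidal_smooth : forall n z, ex_derive_n phi n z;
  sigmoidal_range : forall z, 0 < phi z < 1;
  sigmoidal_increasing : forall z, 0 < Derive phi z;
  sigmoidal_right : is_lim phi p_infty 1;
  sigmoidal_left : is_lim phi m_infty 0;
  sigmoidal_profileL : halfline_profile phiL;
  sigmoidal_profileR : halfline_profile phiR;
  sigmoidal_decayL : forall z, z < 0 -> phi z = / (- z) ^ k * phiL (/ (- z));
  sigmoidal_decayR : forall z, 0 < z -> phi z = 1 - / z ^ k * phiR (/ z) }.

Definition plane : Type := (R * R)%type.

(** Solutions are required on all of [R]. For the fields below this loses no orbit: they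
    are smooth with at most linear growth, hence complete. *)
Definition solution (F : plane -> plane) (X : R -> plane) : Prop :=
  forall t : R, is_derive X t (F (X t)).

Definition forward_orbit (F : plane -> plane) (p0 p : plane) : Prop :=
  exists X, solution F X /\ X 0 = p0 /\ exists t, 0 <= t /\ X t = p.

Definition periodic_orbit (F : plane -> plane) (G : plane -> Prop) : Prop :=
  exists (X : R -> plane) (T : R),
    solution F X /\ 0 < T /\ (forall t, X (t + T) = X t) /\
    (exists t, X t <> X 0) /\
    (forall p, G p <-> exists t, X t = p).

Definition open_nbhd (G U : plane -> Prop) : Prop :=
  open U /\ forall p, G p -> U p.

Definition limit_cycle (F : plane -> plane) (G : plane -> Prop) : Prop :=
  periodic_orbit F G /\
  exists U, open_nbhd G U /\
    forall G', periodic_orbit F G' -> (forall p, G' p -> U p) ->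
      forall p, G' p <-> G p.

(** Asymptotic (orbital) stability: Lyapunov stability together with attraction of a
    neighbourhood. *)
Definition attracting (F : plane -> plane) (G : plane -> Prop) : Prop :=
  (forall U, open_nbhd G U -> exists V, open_nbhd G V /\
     forall X, solution F X -> V (X 0) -> forall t, 0 <= t -> U (X t)) /\
  (exists V, open_nbhd G V /\
     forall X, solution F X -> V (X 0) ->
       forall U, open_nbhd G U -> Rbar_locally p_infty (fun t => U (X t))).

(** The norm on [R * R] is Euclidean. *)
Definition dist2 (p q : plane) : R := norm (minus p q).

(** Infimum of the [r >= 0] such that each set lies in the closed [r]-neighbourhood of the
    other; it is [p_infty] when there is no such [r]. *)
Definition hausdorff_dist (A B : plane -> Prop) : Rbar :=
  Glb_Rbar (fun r => 0 <= r /\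
    (forall a, A a -> exists b, B b /\ dist2 a b <= r) /\
    (forall b, B b -> exists a, A a /\ dist2 a b <= r)).

Definition vf (alpha beta : R) (phi : R -> R) (eps eta mu : R) (p : plane) : plane :=
  let (x, y) := p in
  let a := alpha + beta * phi (/ eps * (x - 1)) in
  (a * y - x, eta - (mu + a) * y).

Definition vf_linear (a : R) (p : plane) : plane :=
  let (x, y) := p in (a * y - x, 1 - a * y).

Definition pL (alpha : R) : plane := (1, / alpha).
Definition pR (alpha beta : R) : plane := (1, / (alpha + beta)).

Definition Gamma0L (alpha beta : R) (p : plane) : Prop :=
  forward_orbit (vf_linear alpha) (pR alpha beta) p /\ fst p <= 1.
Definition Gamma0R (alpha beta : R) (p : plane) : Prop :=
  forward_orbit (vf_linear (alpha + beta)) (pL alpha) p /\ 1 <= fst p.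

(** The end point [pL] of the left branch, reached only as [t -> +oo], is the initial point
    of the right branch, and vice versa; so the union is a closed curve. *)
Definition Gamma0 (alpha beta : R) (p : plane) : Prop :=
  Gamma0L alpha beta p \/ Gamma0R alpha beta p.

(** [eps ^ (k / (k + 1))], for [eps > 0]. *)
Definition eps_scale (k : nat) (eps : R) : R := Rpower eps (INR k / INR (k + 1)).

Definition no_limit_cycle_within (c : R) (F : plane -> plane) (G : plane -> Prop) : Prop :=
  ~ exists G', limit_cycle F G' /\ Rbar_lt (hausdorff_dist G' G) c.

(* Main.v *)
Require Import Defs.
From Stdlib Require Import ZArith Reals Lra Lia Classical ClassicalEpsilon FunctionalExtensionality.
From Coquelicot Require Import Coquelicot.
Open Scope R_scope.

(** In coordinates [U >= 0] (distance to the line [x = 1]) and [W] (the height [x + y], measured from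
    the node of the linear system) both sides of the line obey the same equations, a linear node with
    rates [0 < ks < kf] perturbed by the tail of the sigmoid. For small [eps] an orbit enters at
    [W] near [R0], follows the linear orbit and approaches the node at [U = W = 0] along the slow
    direction. In units of [delta = eps ^ (k / (k + 1))] near the node it follows
    [u' = A r - (1 + A) u - C / u ^ k], [r' = m - u], whose orbit along the slow direction either reaches
    [u = 0] or stays away from it, according to the sign of [m - mc]; the critical value [mc] on
    the two sides gives [etaL0] and [etaR0]. Super- and subsolutions certify both alternatives and survive
    the perturbation. If [m > mc] on one side, a neighbourhood of a point of [Gamma0] is trapped on that
    side, so no periodic orbit is near [Gamma0]. If [m < mc] on both sides, each half passage
    exists and contracts, because nearby orbits approach each other during the slow descent; the return
    map has an attracting fixed point, and its orbit is [O(delta)]-close to [Gamma0]. *)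

(** * Calculus *)

(** The scale [delta] comes from a balance: at distance [delta * u] from the line the tail is about
    [c * eps ^ k / (delta * u) ^ k], and this is of order [delta] exactly when
    [delta ^ (k + 1) = eps ^ k]. The special orbit along the slow direction is never constructed as
    a limit [u -> +oo]: a far level [K] with the asymptotic height replaces it, and [mc] is the
    infimum of the values [m] that admit a subsolution. That nothing lies between the two
    alternatives is a dichotomy for every pair [ma < mb]; the spare room between them absorbs the
    perturbation. The obstacle to contraction is that the slope of the tail at the line is of order
    [1 / eps], so comparing two orbits at equal times is useless there. At equal [U] the tail takes
    the same value on both orbits, the field is affine in [W], and no derivative of the tail
    appears; equal times are used only around the maximum of [U], far from the line. Part (c) lets
    [eta] vary over a neighborhood independent of [eps], so trapping has to tolerate drifts [m0] of
    fixed size, not only of order [delta]. *)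

Ltac pos :=
  first [ lra
    | match goal with
      | |- 0 < _ * _ => apply Rmult_lt_0_compat; pos
      | |- 0 <= _ * _ => apply Rmult_le_pos; pos
      | |- 0 < _ / _ => apply Rdiv_lt_0_compat; pos
      | |- 0 <= _ / _ => apply Rdiv_le_0_compat; pos
      | |- 0 < / _ => apply Rinv_0_lt_compat; pos
      | |- 0 <= / _ => apply Rlt_le, Rinv_0_lt_compat; pos
      | |- 0 < exp _ => apply exp_pos
      | |- 0 <= exp _ => apply Rlt_le, exp_pos
      | |- 0 <= Rabs _ => apply Rabs_pos
      | |- 0 < _ ^ _ => apply pow_lt; pos
      | |- 0 <= _ ^ _ => apply pow_le; pos
      | |- 0 < _ + _ => first [ apply Rplus_lt_le_0_compat; pos | apply Rplus_le_lt_0_compat; pos ]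
      | |- 0 <= _ + _ => apply Rplus_le_le_0_compat; pos
      | |- 0 < Rmin _ _ => apply Rmin_glb_lt; pos
      | |- 0 <= INR _ => apply pos_INR
      end ].

Ltac fld := field; repeat split; try lra; try (apply pow_nonzero; lra).

Lemma is_derive_continuity_pt (f : R -> R) (x l : R) :
  is_derive f x l -> continuity_pt f x.
Proof.
  intros H. apply continuity_pt_filterlim.
  exact (ex_derive_continuous f x (ex_intro _ l H)).
Qed.

Lemma continuity_pt_eps (f : R -> R) (x e : R) : continuity_pt f x -> 0 < e ->
  exists d, 0 < d /\ forall y, Rabs (y - x) < d -> Rabs (f y - f x) < e.
Proof.
  intros H He. destruct (H e He) as (d & Hd & Hf).
  exists d; split; [exact Hd|]. intros y Hy.
  destruct (Req_dec y x) as [->|N].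
  - rewrite Rminus_diag, Rabs_R0; exact He.
  - apply Hf. split; [split; [exact I | congruence] | exact Hy].
Qed.

Lemma increment_le (f f' : R -> R) (a b M : R) : a <= b ->
  (forall t, a <= t <= b -> is_derive f t (f' t)) ->
  (forall t, a <= t <= b -> f' t <= M) -> f b - f a <= M * (b - a).
Proof.
  intros Hab Hd Hf.
  destruct (MVT_gen f a b f') as (c & Hc & E).
  - intros x Hx. rewrite Rmin_left, Rmax_right in Hx by lra. apply Hd; lra.
  - intros x Hx. rewrite Rmin_left, Rmax_right in Hx by lra.
    eapply is_derive_continuity_pt, Hd; lra.
  - rewrite Rmin_left, Rmax_right in Hc by lra. rewrite E.
    apply Rmult_le_compat_r; [lra|]. apply Hf; lra.
Qed.

Lemma increment_ge (f f' : R -> R) (a b M : R) : a <= b ->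
  (forall t, a <= t <= b -> is_derive f t (f' t)) ->
  (forall t, a <= t <= b -> M <= f' t) -> M * (b - a) <= f b - f a.
Proof.
  intros Hab Hd Hf.
  assert (H : - f b - - f a <= - M * (b - a)); [|lra].
  apply (increment_le (fun t => - f t) (fun t => - f' t)); [exact Hab| |].
  - intros t Ht. apply (is_derive_opp f t (f' t)), Hd, Ht.
  - intros t Ht. specialize (Hf t Ht). lra.
Qed.

Lemma increment_abs (f f' : R -> R) (a b M : R) : a <= b ->
  (forall t, a <= t <= b -> is_derive f t (f' t)) ->
  (forall t, a <= t <= b -> Rabs (f' t) <= M) -> Rabs (f b - f a) <= M * (b - a).
Proof.
  intros Hab Hd Hf. apply Rabs_le. split.
  - rewrite Ropp_mult_distr_l. apply (increment_ge f f'); auto.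
    intros t Ht. specialize (Hf t Ht). apply Rabs_le_between in Hf. lra.
  - apply (increment_le f f'); auto.
    intros t Ht. specialize (Hf t Ht). apply Rabs_le_between in Hf. lra.
Qed.

(** * Exponential comparison for scalar differential inequalities *)

Lemma is_derive_exp_lin (k s t : R) :
  is_derive (fun t => exp (k * (t - s))) t (k * exp (k * (t - s))).
Proof. auto_derive; [exact I |]. unfold Rminus. ring. Qed.

(** The integrating factor [exp (k * (x - s))] turns the hypothesis into monotonicity. No sign of
    [k] is assumed: positive [k] gives relaxation towards [b], negative [k] a growth bound of
    Gronwall type. *)
Lemma exp_comparison (E E' : R -> R) (k b s t : R) : s <= t ->
  (forall x, s <= x <= t -> is_derive E x (E' x)) ->
  (forall x, s <= x <= t -> E' x <= - k * (E x - b)) ->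
  E t - b <= (E s - b) * exp (- k * (t - s)).
Proof.
  intros Hst Hd Hf.
  assert (H : (E t - b) * exp (k * (t - s)) - (E s - b) * exp (k * (s - s)) <= 0 * (t - s)).
  { apply (increment_le (fun x => (E x - b) * exp (k * (x - s)))
      (fun x => E' x * exp (k * (x - s)) + (E x - b) * (k * exp (k * (x - s))))); [exact Hst| |].
    - intros x Hx.
      apply (is_derive_mult (fun x => E x - b) (fun x => exp (k * (x - s))));
        [| apply is_derive_exp_lin | intros; apply Rmult_comm].
      replace (E' x) with (E' x - 0) by ring.
      apply (is_derive_minus E (fun _ => b)); [apply Hd, Hx | apply (is_derive_const b x)].
    - intros x Hx. specialize (Hf x Hx). pose proof (exp_pos (k * (x - s))). nra. }
  rewrite Rminus_diag, Rmult_0_r, exp_0 in H.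
  replace (- k * (t - s)) with (- (k * (t - s))) by ring. rewrite exp_Ropp.
  pose proof (exp_pos (k * (t - s))) as Hp.
  apply Rmult_le_reg_r with (exp (k * (t - s))); [exact Hp|].
  rewrite Rmult_assoc, Rinv_l by lra. lra.
Qed.

Lemma exp_comparison_ge (E E' : R -> R) (k b s t : R) : s <= t ->
  (forall x, s <= x <= t -> is_derive E x (E' x)) ->
  (forall x, s <= x <= t -> - k * (E x - b) <= E' x) ->
  (E s - b) * exp (- k * (t - s)) <= E t - b.
Proof.
  intros Hst Hd Hf.
  assert (H : - E t - - b <= (- E s - - b) * exp (- k * (t - s))); [|lra].
  apply (exp_comparison (fun t => - E t) (fun t => - E' t)); [exact Hst| |].
  - intros x Hx. apply (is_derive_opp E x (E' x)), Hd, Hx.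
  - intros x Hx. specialize (Hf x Hx). lra.
Qed.

Lemma exp_le (x y : R) : x <= y -> exp x <= exp y.
Proof. intros [H| ->]; [left; apply exp_increasing, H | right; reflexivity]. Qed.

Lemma exp_nonpos_le_1 (x : R) : x <= 0 -> exp x <= 1.
Proof. intros H. rewrite <- exp_0. apply exp_le, H. Qed.

(** A forcing of size [b] against the damping [k] never accumulates beyond [b / k], whatever the
    elapsed time. This matters because the passages become arbitrarily long as [eps -> 0]. *)
Lemma relax_abs (E E' : R -> R) (k b s t : R) : s <= t -> 0 < k -> 0 <= b ->
  (forall x, s <= x <= t -> is_derive E x (E' x)) ->
  (forall x, s <= x <= t -> Rabs (E' x + k * E x) <= b) ->
  Rabs (E t) <= Rabs (E s) * exp (- k * (t - s)) + b / k.
Proof.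
  intros Hst Hk Hb Hd Hf.
  assert (Hbk : 0 <= b / k) by (apply Rdiv_le_0_compat; lra).
  assert (Hkb : k * (b / k) = b) by (field; lra).
  pose proof (exp_pos (- k * (t - s))) as He.
  assert (H1 : E t - b / k <= (E s - b / k) * exp (- k * (t - s))).
  { apply (exp_comparison E E'); auto. intros x Hx. specialize (Hf x Hx).
    apply Rabs_le_between in Hf. lra. }
  assert (H2 : (E s - - (b / k)) * exp (- k * (t - s)) <= E t - - (b / k)).
  { apply (exp_comparison_ge E E'); auto. intros x Hx. specialize (Hf x Hx).
    apply Rabs_le_between in Hf. lra. }
  pose proof (Rle_abs (E s)). pose proof (Rle_abs (- E s)) as H3. rewrite Rabs_Ropp in H3.
  apply Rabs_le. split; nra.
Qed.

(** The supremum of the times up to which [P] holds throughout cannot be below [b]: the second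
    hypothesis carries [P] to the supremum, the third one beyond it. Trapping arguments with several
    simultaneous constraints are run through this principle. *)
Lemma real_induction (P : R -> Prop) (a b : R) : P a ->
  (forall t, a < t <= b -> (forall s, a <= s < t -> P s) -> P t) ->
  (forall t, a <= t < b -> (forall s, a <= s <= t -> P s) ->
     exists h, 0 < h /\ forall s, t < s < t + h -> P s) ->
  forall t, a <= t <= b -> P t.
Proof.
  intros Pa Pcl Pop.
  destruct (Rlt_or_le b a) as [Hba|Hab]; [intros; lra|].
  set (S := fun t => a <= t <= b /\ forall s, a <= s <= t -> P s).
  destruct (completeness S) as [m [Hm1 Hm2]].
  - exists b. intros t Ht. apply Ht.
  - exists a. split; [lra|]. intros s Hs. replace s with a by lra. exact Pa.
  - assert (Ham : a <= m).
    { apply Hm1. split; [lra|]. intros s Hs. replace s with a by lra. exact Pa. }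
    assert (Hmb : m <= b) by (apply Hm2; intros t Ht; apply Ht).
    assert (Hlt : forall s, a <= s < m -> P s).
    { intros s Hs. apply NNPP. intro N.
      assert (m <= s); [|lra]. apply Hm2. intros t [Ht1 Ht2].
      destruct (Rle_lt_dec t s) as [|Hst]; [assumption|].
      exfalso. apply N, Ht2. lra. }
    assert (Hle : forall s, a <= s <= m -> P s).
    { intros s Hs. destruct (Rle_lt_or_eq_dec s m (proj2 Hs)) as [|Heq]; [apply Hlt; lra|].
      subst s. destruct (Rle_lt_or_eq_dec a m Ham) as [|<-]; [apply Pcl; [lra|auto] | exact Pa]. }
    destruct (Rle_lt_or_eq_dec m b Hmb) as [Hmb'| ->]; [|exact Hle].
    destruct (Pop m ltac:(lra) Hle) as (h & Hh & Hp).
    exfalso. set (m' := Rmin b (m + h / 2)).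
    assert (m < m' <= b /\ m' < m + h).
    { unfold m'. split; [split|].
      - apply Rmin_glb_lt; lra.
      - apply Rmin_l.
      - apply Rle_lt_trans with (m + h / 2); [apply Rmin_r|lra]. }
    assert (m' <= m); [|lra]. apply Hm1. split; [lra|].
    intros s Hs. destruct (Rle_lt_dec s m); [apply Hle; lra | apply Hp; lra].
Qed.

(** The boundary case [q t = 0] is included: a constraint that is just attained stays satisfied if
    its derivative points strictly inwards. This is the local step for invariant regions. *)
Lemma pos_right (q : R -> R) (t d : R) : is_derive q t d -> (0 < q t \/ (0 <= q t /\ 0 < d)) ->
  exists h, 0 < h /\ forall s, t < s < t + h -> 0 < q s.
Proof.
  intros Hd [Hp|[Hz Hp]].
  - destruct (continuity_pt_eps q t (q t) (is_derive_continuity_pt _ _ _ Hd) Hp) as (h & Hh & Hq).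
    exists h; split; [exact Hh|]. intros s Hs.
    assert (H : Rabs (q s - q t) < q t) by (apply Hq; rewrite Rabs_pos_eq; lra).
    apply Rabs_lt_between in H. lra.
  - apply is_derive_Reals in Hd. destruct (Hd (d / 2) ltac:(lra)) as ((h & Hh) & Hq). simpl in Hq.
    exists h; split; [exact Hh|]. intros s Hs.
    assert (H : Rabs ((q (t + (s - t)) - q t) / (s - t) - d) < d / 2)
      by (apply Hq; [lra | rewrite Rabs_pos_eq; lra]).
    replace (t + (s - t)) with s in H by ring.
    apply Rabs_lt_between in H.
    assert (0 < (q s - q t) / (s - t)) by lra.
    assert (0 < (q s - q t) / (s - t) * (s - t)) by (apply Rmult_lt_0_compat; lra).
    replace ((q s - q t) / (s - t) * (s - t)) with (q s - q t) in * by (field; lra). lra.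
Qed.

Lemma nonneg_left_limit (q : R -> R) (a t : R) : a < t -> continuity_pt q t ->
  (forall s, a <= s < t -> 0 <= q s) -> 0 <= q t.
Proof.
  intros Hat Hc Hq. destruct (Rle_lt_dec 0 (q t)) as [|Hn]; [assumption|].
  destruct (continuity_pt_eps q t (- q t) Hc ltac:(lra)) as (h & Hh & H).
  set (s := Rmax a (t - h / 2)).
  assert (Hs : a <= s < t /\ t - h < s).
  { unfold s. split; [split; [apply Rmax_l | apply Rmax_lub_lt; lra]|].
    apply Rlt_le_trans with (t - h / 2); [lra | apply Rmax_r]. }
  specialize (H s). rewrite Rabs_left in H by lra. specialize (H ltac:(lra)).
  apply Rabs_lt_between in H. specialize (Hq s ltac:(lra)). lra.
Qed.

Lemma derive_nonpos_at_zero (q : R -> R) (a t d : R) : a < t -> is_derive q t d ->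
  (forall s, a <= s < t -> 0 < q s) -> q t = 0 -> d <= 0.
Proof.
  intros Hat Hd Hq Hz. destruct (Rle_lt_dec d 0) as [|Hp]; [assumption|].
  apply is_derive_Reals in Hd. destruct (Hd (d / 2) ltac:(lra)) as ((h & Hh) & H). simpl in H.
  set (s := Rmax a (t - h / 2)).
  assert (Hs : a <= s < t /\ t - h < s).
  { unfold s. split; [split; [apply Rmax_l | apply Rmax_lub_lt; lra]|].
    apply Rlt_le_trans with (t - h / 2); [lra | apply Rmax_r]. }
  specialize (H (s - t) ltac:(lra)). rewrite Rabs_left in H by lra. specialize (H ltac:(lra)).
  replace (t + (s - t)) with s in H by ring. apply Rabs_lt_between in H.
  specialize (Hq s (proj1 Hs)).
  assert (0 < (q s - q t) / (s - t)) by lra.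
  assert (0 < (q s - q t) / (s - t) * (t - s)) by (apply Rmult_lt_0_compat; lra).
  replace ((q s - q t) / (s - t) * (t - s)) with (q t - q s) in * by (field; lra). lra.
Qed.

(** Barrier principle: the sign of the derivative is examined only at a zero of [q], and there
    positivity at all earlier times may be assumed. Comparison with a super- or subsolution amounts
    to applying it to a difference. *)
Lemma stay_pos (q q' : R -> R) (a b : R) : 0 < q a ->
  (forall t, a <= t <= b -> is_derive q t (q' t)) ->
  (forall t, a < t <= b -> (forall s, a <= s < t -> 0 < q s) -> q t = 0 -> 0 < q' t) ->
  forall t, a <= t <= b -> 0 < q t.
Proof.
  intros Ha Hd Hq. apply real_induction; [exact Ha| |].
  - intros t Ht Hs.
    assert (0 <= q t).
    { apply (nonneg_left_limit q a); [lra | eapply is_derive_continuity_pt, Hd; lra |].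
      intros s Hs'. left. apply Hs, Hs'. }
    destruct (Req_dec (q t) 0) as [Hz|]; [|lra].
    pose proof (derive_nonpos_at_zero q a t (q' t) ltac:(lra) (Hd t ltac:(lra)) Hs Hz).
    specialize (Hq t Ht Hs Hz). lra.
  - intros t Ht Hs. apply (pos_right q t (q' t)); [apply Hd; lra | left; apply Hs; lra].
Qed.

Lemma first_zero (h : R -> R) (a b : R) : a <= b ->
  (forall t, a <= t <= b -> continuity_pt h t) -> 0 < h a -> h b <= 0 ->
  exists t, a < t <= b /\ h t = 0 /\ forall s, a <= s < t -> 0 < h s.
Proof.
  intros Hab Hc Ha Hb. apply NNPP. intro N.
  assert (H : forall t, a <= t <= b -> 0 < h t); [|specialize (H b); lra].
  apply real_induction; [exact Ha| |].
  - intros t Ht Hs.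
    assert (0 <= h t).
    { apply (nonneg_left_limit h a); [lra | apply Hc; lra |].
      intros s Hs'. left. apply Hs, Hs'. }
    destruct (Req_dec (h t) 0) as [Hz|]; [|lra].
    exfalso. apply N. exists t. auto.
  - intros t Ht Hs. assert (Hp : 0 < h t) by (apply Hs; lra).
    destruct (continuity_pt_eps h t (h t) (Hc t ltac:(lra)) Hp) as (d & Hd & Hq).
    exists d; split; [exact Hd|]. intros s Hs'.
    assert (H : Rabs (h s - h t) < h t) by (apply Hq; rewrite Rabs_pos_eq; lra).
    apply Rabs_lt_between in H. lra.
Qed.

(** No monotonicity is assumed; the name refers to the order of the end values. *)
Lemma ivt_decreasing (h : R -> R) (a b v : R) : a <= b ->
  (forall t, a <= t <= b -> continuity_pt h t) -> h b <= v <= h a ->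
  exists t, a <= t <= b /\ h t = v.
Proof.
  intros Hab Hc Hv. destruct (Req_dec (h a) v) as [E|N]; [exists a; split; [lra|exact E]|].
  destruct (first_zero (fun t => h t - v) a b Hab) as (t & Ht & Hz & _); try lra.
  - intros t Ht. apply continuity_pt_minus; [apply Hc, Ht|].
    apply continuity_pt_const. intros x y; reflexivity.
  - exists t. split; lra.
Qed.

(** One-dimensional inverse function theorem along an orbit: strict monotonicity of [U] makes the
    orbit a graph over [U]. For the derivative, [V - l * U] is stationary at [t], so its increment
    is small compared with [s - t], while the increment of [U] is at least
    [Rabs (U' t) / 2 * Rabs (s - t)]. The sign [sg] treats increasing and decreasing [U]
    together. *)
Lemma trajectory_graph (sg : R) (U V U' V' : R -> R) (a b : R) : a < b ->
  (sg = 1 \/ sg = -1) ->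
  (forall t, a <= t <= b -> is_derive U t (U' t)) ->
  (forall t, a <= t <= b -> is_derive V t (V' t)) ->
  (forall t, a <= t <= b -> 0 < sg * U' t) ->
  exists r : R -> R, (forall t, a <= t <= b -> r (U t) = V t) /\
    forall t, a < t < b -> is_derive r (U t) (V' t / U' t).
Proof.
  intros Hab Hsg HU HV Hpos.
  assert (Hmono : forall s t, a <= s < t -> t <= b -> 0 < sg * U t - sg * U s).
  { intros s t Hs Ht.
    destruct (MVT_gen (fun t => sg * U t) s t (fun t => sg * U' t)) as (c & Hc & E).
    - intros x Hx. rewrite Rmin_left, Rmax_right in Hx by lra.
      apply (is_derive_scal U x sg), HU. lra.
    - intros x Hx. rewrite Rmin_left, Rmax_right in Hx by lra.
      eapply is_derive_continuity_pt, (is_derive_scal U x sg), HU. lra.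
    - rewrite Rmin_left, Rmax_right in Hc by lra. rewrite E.
      apply Rmult_lt_0_compat; [apply Hpos|]; lra. }
  assert (Hinj : forall s t, a <= s <= b -> a <= t <= b -> U s = U t -> s = t).
  { intros s t Hs Ht E. destruct (Rtotal_order s t) as [L|[L|L]]; [|exact L|].
    - specialize (Hmono s t ltac:(lra) ltac:(lra)). rewrite E in Hmono. lra.
    - specialize (Hmono t s ltac:(lra) ltac:(lra)). rewrite E in Hmono. lra. }
  (* The height over [v] is read off at a chosen preimage; outside the range of [U] the value is
     arbitrary. *)
  set (r := fun v => V (epsilon (inhabits 0) (fun s => a <= s <= b /\ U s = v))).
  assert (Hr : forall t, a <= t <= b -> r (U t) = V t).
  { intros t Ht. unfold r.
    destruct (epsilon_spec (inhabits 0) (fun s => a <= s <= b /\ U s = U t)) as [H1 H2];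
      [exists t; auto|].
    f_equal. apply Hinj; auto. }
  exists r. split; [exact Hr|]. intros t Ht.
  set (l := V' t / U' t).
  assert (HU0 : 0 < Rabs (U' t)).
  { apply Rabs_pos_lt. intro E. specialize (Hpos t ltac:(lra)). rewrite E in Hpos. lra. }
  apply is_derive_Reals. intros e He.
  pose proof (HU t ltac:(lra)) as HUt. pose proof (HV t ltac:(lra)) as HVt.
  assert (HP : is_derive (fun s => V s - l * U s) t 0).
  { replace 0 with (V' t - l * U' t)
      by (unfold l; field; intro E; rewrite E, Rabs_R0 in HU0; lra).
    apply (is_derive_minus V (fun s => l * U s)); [exact HVt|].
    apply (is_derive_scal U t l), HUt. }
  apply is_derive_Reals in HP. apply is_derive_Reals in HUt.
  destruct (HP (e * Rabs (U' t) / 4)) as ((d1 & Hd1) & H1).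
  { apply Rdiv_lt_0_compat; [apply Rmult_lt_0_compat|]; lra. }
  destruct (HUt (Rabs (U' t) / 2) ltac:(lra)) as ((d2 & Hd2) & H2). simpl in H1, H2.
  set (h := Rmin (Rmin d1 d2) (Rmin (t - a) (b - t)) / 2).
  assert (Hh : 0 < h /\ h < d1 /\ h < d2 /\ a < t - h /\ t + h < b).
  { assert (0 < Rmin (Rmin d1 d2) (Rmin (t - a) (b - t))) by (repeat apply Rmin_glb_lt; lra).
    pose proof (Rmin_l (Rmin d1 d2) (Rmin (t - a) (b - t))).
    pose proof (Rmin_r (Rmin d1 d2) (Rmin (t - a) (b - t))).
    pose proof (Rmin_l d1 d2). pose proof (Rmin_r d1 d2).
    pose proof (Rmin_l (t - a) (b - t)). pose proof (Rmin_r (t - a) (b - t)).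
    unfold h. repeat split; lra. }
  clearbody h. destruct Hh as (Hh0 & Hhd1 & Hhd2 & Hha & Hhb).
  pose proof (Hmono (t - h) t ltac:(lra) ltac:(lra)) as Hm1.
  pose proof (Hmono t (t + h) ltac:(lra) ltac:(lra)) as Hm2.
  (* Increments of [U] smaller than [d] are attained inside [[t - h, t + h]] by the intermediate
     value theorem. *)
  set (d := Rmin (sg * U t - sg * U (t - h)) (sg * U (t + h) - sg * U t)).
  assert (Hd : 0 < d) by (apply Rmin_glb_lt; assumption).
  exists (mkposreal d Hd). simpl. intros x Hx0 Hx.
  assert (Hs : exists s, t - h <= s <= t + h /\ U s = U t + x).
  { destruct (ivt_decreasing (fun s => - sg * U s) (t - h) (t + h) (- sg * (U t + x)))
      as (s & Hs & E); [lra| | |].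
    - intros s Hs. eapply is_derive_continuity_pt, (is_derive_scal U s (- sg)), HU. lra.
    - pose proof (Rmin_l (sg * U t - sg * U (t - h)) (sg * U (t + h) - sg * U t)).
      pose proof (Rmin_r (sg * U t - sg * U (t - h)) (sg * U (t + h) - sg * U t)).
      fold d in H, H0. apply Rabs_lt_between in Hx.
      destruct Hsg as [-> | ->]; lra.
    - exists s. split; [exact Hs|]. destruct Hsg as [-> | ->]; lra. }
  destruct Hs as (s & Hs & Es). rewrite <- Es.
  rewrite Hr by lra. rewrite Hr by lra.
  assert (Hst : s - t <> 0).
  { intro E. replace s with t in Es by lra. lra. }
  assert (Habs : Rabs (s - t) <= h) by (apply Rabs_le; lra).
  specialize (H1 (s - t) Hst ltac:(lra)). specialize (H2 (s - t) Hst ltac:(lra)).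
  replace (t + (s - t)) with s in H1, H2 by ring.
  replace x with (U s - U t) by lra.
  assert (Hden : Rabs (U' t) / 2 * Rabs (s - t) <= Rabs (U s - U t)).
  { assert (Rabs (U' t) / 2 <= Rabs ((U s - U t) / (s - t))).
    { pose proof (Rabs_triang_inv (U' t) (U' t - (U s - U t) / (s - t))) as T.
      replace (U' t - (U' t - (U s - U t) / (s - t))) with ((U s - U t) / (s - t)) in T by ring.
      rewrite (Rabs_minus_sym (U' t)) in T. lra. }
    rewrite Rabs_div in H by exact Hst.
    apply Rmult_le_compat_r with (r := Rabs (s - t)) in H; [|apply Rabs_pos].
    replace (Rabs (U s - U t) / Rabs (s - t) * Rabs (s - t)) with (Rabs (U s - U t)) in H
      by (field; apply Rabs_no_R0, Hst). exact H. }
  assert (Hnum : Rabs (V s - V t - l * (U s - U t)) <= e * Rabs (U' t) / 4 * Rabs (s - t)).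
  { rewrite Rminus_0_r in H1.
    replace (V s - l * U s - (V t - l * U t)) with (V s - V t - l * (U s - U t)) in H1 by ring.
    rewrite Rabs_div in H1 by exact Hst. left.
    apply Rmult_lt_compat_r with (r := Rabs (s - t)) in H1; [|apply Rabs_pos_lt, Hst].
    replace (Rabs (V s - V t - l * (U s - U t)) / Rabs (s - t) * Rabs (s - t))
      with (Rabs (V s - V t - l * (U s - U t))) in H1
      by (field; apply Rabs_no_R0, Hst). exact H1. }
  assert (HUs : U s - U t <> 0) by lra.
  replace ((V s - V t) / (U s - U t) - l) with ((V s - V t - l * (U s - U t)) / (U s - U t))
    by (field; exact HUs).
  rewrite Rabs_div by exact HUs.
  pose proof (Rabs_pos_lt _ HUs) as HUsp. pose proof (Rabs_pos_lt _ Hst) as Hstp.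
  apply Rmult_lt_reg_r with (Rabs (U s - U t)); [exact HUsp|].
  unfold Rdiv at 1. rewrite Rmult_assoc, Rinv_l by lra.
  assert (0 < Rabs (U' t) * Rabs (s - t)) by (apply Rmult_lt_0_compat; lra).
  nra.
Qed.

(** * Existence and continuous dependence *)

Definition lipschitz2 (L : R) (F : R -> R -> R) : Prop :=
  forall x y x' y', Rabs (F x y - F x' y') <= L * (Rabs (x - x') + Rabs (y - y')).

Lemma lipschitz2_continuity (L : R) (F : R -> R -> R) (X Y : R -> R) (t : R) :
  0 < L -> lipschitz2 L F -> continuity_pt X t -> continuity_pt Y t ->
  continuity_pt (fun s => F (X s) (Y s)) t.
Proof.
  intros HL HF HX HY e He.
  destruct (continuity_pt_eps X t (e / (2 * L)) HX) as (d1 & Hd1 & H1);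
    [apply Rdiv_lt_0_compat; lra|].
  destruct (continuity_pt_eps Y t (e / (2 * L)) HY) as (d2 & Hd2 & H2);
    [apply Rdiv_lt_0_compat; lra|].
  exists (Rmin d1 d2). split; [apply Rmin_glb_lt; assumption|].
  intros s [_ Hs]. simpl in *. unfold Rdist in *.
  eapply Rle_lt_trans; [apply HF|].
  specialize (H1 s (Rlt_le_trans _ _ _ Hs (Rmin_l _ _))).
  specialize (H2 s (Rlt_le_trans _ _ _ Hs (Rmin_r _ _))).
  apply Rlt_le_trans with (L * (e / (2 * L) + e / (2 * L))).
  - apply Rmult_lt_compat_l; lra.
  - right. field. lra.
Qed.

Lemma is_derive_primitive (f : R -> R) (x0 t : R) :
  (forall s, continuity_pt f s) -> is_derive (fun t => x0 + RInt f 0 t) t (f t).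
Proof.
  intros Hf.
  assert (Hc : forall s, continuous f s)
    by (intros s; apply continuity_pt_filterlim, Hf).
  replace (f t) with (0 + f t) by ring.
  apply (is_derive_plus (fun _ => x0) (fun t => RInt f 0 t) t 0 (f t));
    [apply (is_derive_const x0 t)|].
  apply (is_derive_RInt f (fun t => RInt f 0 t) 0 t); [|apply Hc].
  exists (mkposreal 1 Rlt_0_1). intros y _.
  apply (RInt_correct f), ex_RInt_continuous. intros z _. apply Hc.
Qed.

(** The weight [exp (l * t)] reproduces itself under integration with the gain [1 / l]; this is the
    mechanism of the weighted norm in the Picard iteration. *)
Lemma exp_integral_bound_pos (h h' : R -> R) (c l t : R) : 0 < l -> 0 <= c -> 0 <= t ->
  (forall s, is_derive h s (h' s)) -> h 0 = 0 ->
  (forall s, 0 <= s -> Rabs (h' s) <= c * exp (l * s)) ->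
  Rabs (h t) <= c / l * exp (l * t).
Proof.
  intros Hl Hc Ht Hd H0 Hb.
  assert (Hcl : 0 <= c / l) by (apply Rdiv_le_0_compat; lra).
  assert (HE : forall s, is_derive (fun s => c / l * exp (l * (s - 0))) s (c * exp (l * s))).
  { intros s. replace (c * exp (l * s)) with (c / l * (l * exp (l * (s - 0))))
      by (rewrite Rminus_0_r; field; lra).
    apply (is_derive_scal (fun s => exp (l * (s - 0))) s (c / l)), is_derive_exp_lin. }
  assert (H1 : (h t - c / l * exp (l * (t - 0))) - (h 0 - c / l * exp (l * (0 - 0))) <= 0 * (t - 0)).
  { apply (increment_le (fun s => h s - c / l * exp (l * (s - 0))) (fun s => h' s - c * exp (l * s)));
      [exact Ht| |].
    - intros s _. apply (is_derive_minus h); auto.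
    - intros s Hs. specialize (Hb s (proj1 Hs)). apply Rabs_le_between in Hb. lra. }
  assert (H2 : 0 * (t - 0) <= (h t + c / l * exp (l * (t - 0))) - (h 0 + c / l * exp (l * (0 - 0)))).
  { apply (increment_ge (fun s => h s + c / l * exp (l * (s - 0))) (fun s => h' s + c * exp (l * s)));
      [exact Ht| |].
    - intros s _. apply (is_derive_plus h); auto.
    - intros s Hs. specialize (Hb s (proj1 Hs)). apply Rabs_le_between in Hb. lra. }
  rewrite Rminus_0_r in H1, H2. replace (l * (0 - 0)) with 0 in * by ring.
  rewrite exp_0, H0 in *. apply Rabs_le. split; lra.
Qed.

Lemma is_derive_reflect (h : R -> R) (t l : R) :
  is_derive h (- t) l -> is_derive (fun s => h (- s)) t (- l).
Proof.
  intros H. replace (- l) with (scal (-1) l) by (unfold scal; simpl; unfold mult; simpl; ring).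
  apply (is_derive_comp h (fun s => - s) t l (-1)); [exact H|].
  auto_derive; [exact I | ring].
Qed.

Lemma exp_integral_bound (h h' : R -> R) (c l t : R) : 0 < l -> 0 <= c ->
  (forall s, is_derive h s (h' s)) -> h 0 = 0 ->
  (forall s, Rabs (h' s) <= c * exp (l * Rabs s)) ->
  Rabs (h t) <= c / l * exp (l * Rabs t).
Proof.
  intros Hl Hc Hd H0 Hb. destruct (Rle_lt_dec 0 t) as [Ht|Ht].
  - rewrite (Rabs_pos_eq t) by exact Ht. apply (exp_integral_bound_pos h h'); auto.
    intros s Hs. specialize (Hb s). rewrite (Rabs_pos_eq s) in Hb by exact Hs. exact Hb.
  - rewrite (Rabs_left t) by exact Ht. replace (h t) with ((fun s => h (- s)) (- t))
      by (simpl; f_equal; ring).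
    apply (exp_integral_bound_pos (fun s => h (- s)) (fun s => - h' (- s))); try lra.
    + intros s. apply is_derive_reflect, Hd.
    + rewrite Ropp_0. exact H0.
    + intros s Hs. specialize (Hb (- s)). rewrite Rabs_Ropp, (Rabs_pos_eq s) in Hb by exact Hs.
      rewrite Rabs_Ropp. exact Hb.
Qed.

Lemma geometric_limit (u : nat -> R) (b : R) :
  (forall n, Rabs (u (S n) - u n) <= b * (1 / 2) ^ n) ->
  exists l, forall n, Rabs (u n - l) <= 2 * b * (1 / 2) ^ n.
Proof.
  intros H.
  assert (Hp : forall n, 0 < (1 / 2) ^ n) by (intros n; apply pow_lt; lra).
  assert (Hb : 0 <= b).
  { pose proof (H 0%nat) as H0. simpl in H0. pose proof (Rabs_pos (u 1%nat - u 0%nat)). lra. }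
  assert (Hd : forall n p, Rabs (u (n + p)%nat - u n) <= 2 * b * ((1 / 2) ^ n - (1 / 2) ^ (n + p))).
  { intros n p. induction p as [|p IH].
    - rewrite Nat.add_0_r, !Rminus_diag, Rabs_R0. lra.
    - rewrite Nat.add_succ_r.
      replace (u (S (n + p)) - u n) with ((u (S (n + p)) - u (n + p)%nat) + (u (n + p)%nat - u n)) by ring.
      eapply Rle_trans; [apply Rabs_triang|]. specialize (H (n + p)%nat). simpl pow. lra. }
  assert (Hd' : forall n m, (n <= m)%nat -> Rabs (u m - u n) <= 2 * b * (1 / 2) ^ n).
  { intros n m Hnm. replace m with (n + (m - n))%nat by lia.
    eapply Rle_trans; [apply Hd|]. specialize (Hp (n + (m - n))%nat). nra. }
  assert (Hsm : forall e, 0 < e -> exists N, 2 * b * (1 / 2) ^ N < e).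
  { intros e He. destruct (pow_lt_1_zero (1 / 2)) with (y := e / (2 * b + 1)) as (N & HN).
    - rewrite Rabs_pos_eq; lra.
    - apply Rdiv_lt_0_compat; lra.
    - exists N. specialize (HN N (Nat.le_refl _)). specialize (Hp N).
      rewrite Rabs_pos_eq in HN by lra.
      apply Rmult_lt_compat_l with (r := 2 * b + 1) in HN; [|lra].
      replace ((2 * b + 1) * (e / (2 * b + 1))) with e in HN by (field; lra). lra. }
  destruct (Rcomplete.R_complete u) as [l Hl].
  { intros e He. destruct (Hsm (e / 2) ltac:(lra)) as (N & HN). exists N.
    intros n m Hn Hm. unfold Rdist.
    replace (u n - u m) with ((u n - u N) - (u m - u N)) by ring.
    eapply Rle_lt_trans; [apply Rabs_triang|]. rewrite Rabs_Ropp.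
    pose proof (Hd' N n Hn). pose proof (Hd' N m Hm). lra. }
  exists l. intros n. apply Rnot_lt_le. intro Hlt.
  destruct (Hl (Rabs (u n - l) - 2 * b * (1 / 2) ^ n) ltac:(lra)) as (N & HN).
  specialize (HN (n + N)%nat ltac:(lia)). unfold Rdist in HN.
  specialize (Hd' n (n + N)%nat ltac:(lia)).
  pose proof (Rabs_triang (u n - u (n + N)%nat) (u (n + N)%nat - l)) as T.
  replace (u n - u (n + N)%nat + (u (n + N)%nat - l)) with (u n - l) in T by ring.
  rewrite (Rabs_minus_sym (u n) (u (n + N)%nat)) in T. lra.
Qed.

Section Picard.
Variables (F1 F2 : R -> R -> R) (L x0 y0 : R).
Hypothesis HL : 0 < L.
Hypothesis HF1 : lipschitz2 L F1.
Hypothesis HF2 : lipschitz2 L F2.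

Let step (P : (R -> R) * (R -> R)) : (R -> R) * (R -> R) :=
  (fun t => x0 + RInt (fun s => F1 (fst P s) (snd P s)) 0 t,
   fun t => y0 + RInt (fun s => F2 (fst P s) (snd P s)) 0 t).
Let P (n : nat) := Nat.iter n step (fun _ => x0, fun _ => y0).

Let P_continuous n : forall t, continuity_pt (fst (P n)) t /\ continuity_pt (snd (P n)) t.
Proof.
  induction n as [|n IH]; intros t.
  - split; apply continuity_pt_const; intros x y; reflexivity.
  - split; eapply is_derive_continuity_pt; simpl;
      [apply (is_derive_primitive (fun s => F1 (fst (P n) s) (snd (P n) s)))
      |apply (is_derive_primitive (fun s => F2 (fst (P n) s) (snd (P n) s)))];
      intros s; destruct (IH s); eapply lipschitz2_continuity; eauto.
Qed.

Let P_derive n t :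
  is_derive (fst (P (S n))) t (F1 (fst (P n) t) (snd (P n) t)) /\
  is_derive (snd (P (S n))) t (F2 (fst (P n) t) (snd (P n) t)).
Proof.
  split; [apply (is_derive_primitive (fun s => F1 (fst (P n) s) (snd (P n) s)))
         |apply (is_derive_primitive (fun s => F2 (fst (P n) s) (snd (P n) s)))];
    intros s; destruct (P_continuous n s); eapply lipschitz2_continuity; eauto.
Qed.

Let P_init n : fst (P n) 0 = x0 /\ snd (P n) 0 = y0.
Proof.
  destruct n as [|n]; [split; reflexivity|].
  simpl. rewrite !RInt_point. unfold zero; simpl. split; ring.
Qed.

Let M := Rabs (F1 x0 y0) + Rabs (F2 x0 y0).
(** [c / 2 = M / (4 * L)] bounds the first increment in the norm weighted by
    [exp (4 * L * Rabs t)]. *)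
Let c := M / (2 * L).

Let c_nonneg : 0 <= c.
Proof.
  unfold c, M. pose proof (Rabs_pos (F1 x0 y0)). pose proof (Rabs_pos (F2 x0 y0)).
  apply Rdiv_le_0_compat; lra.
Qed.

Let exp_ge_1 t : 1 <= exp (4 * L * Rabs t).
Proof.
  rewrite <- exp_0 at 1. apply exp_le. pose proof (Rabs_pos t). nra.
Qed.

(** The two components contribute a Lipschitz factor [2 * L], the weighted integration divides by
    [4 * L], so each iteration halves the distance. The estimate holds on the whole line at once,
    and no patching of local solutions is necessary. *)
Let P_step n : forall t,
  Rabs (fst (P (S n)) t - fst (P n) t) <= c / 2 * (1 / 2) ^ n * exp (4 * L * Rabs t) /\
  Rabs (snd (P (S n)) t - snd (P n) t) <= c / 2 * (1 / 2) ^ n * exp (4 * L * Rabs t).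
Proof.
  induction n as [|n IH]; intros t.
  - assert (HM : M / (4 * L) = c / 2 * (1 / 2) ^ 0) by (unfold c; simpl; field; lra).
    assert (HM0 : 0 <= M) by (unfold M; pose proof (Rabs_pos (F1 x0 y0)); pose proof (Rabs_pos (F2 x0 y0)); lra).
    rewrite <- HM. destruct (P_init 1) as [I1 I2]. split.
    + apply (exp_integral_bound (fun t => fst (P 1) t - x0) (fun t => F1 x0 y0 - 0)); [lra|exact HM0| | |].
      * intros s. apply (is_derive_minus (fst (P 1)) (fun _ => x0));
          [apply (P_derive 0 s) | apply (is_derive_const x0 s)].
      * lra.
      * intros s. rewrite Rminus_0_r. specialize (exp_ge_1 s). unfold M.
        pose proof (Rabs_pos (F1 x0 y0)). pose proof (Rabs_pos (F2 x0 y0)). nra.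
    + apply (exp_integral_bound (fun t => snd (P 1) t - y0) (fun t => F2 x0 y0 - 0)); [lra|exact HM0| | |].
      * intros s. apply (is_derive_minus (snd (P 1)) (fun _ => y0));
          [apply (P_derive 0 s) | apply (is_derive_const y0 s)].
      * lra.
      * intros s. rewrite Rminus_0_r. specialize (exp_ge_1 s). unfold M.
        pose proof (Rabs_pos (F1 x0 y0)). pose proof (Rabs_pos (F2 x0 y0)). nra.
  - assert (Hq : 0 <= c * (1 / 2) ^ n) by (apply Rmult_le_pos; [exact c_nonneg | apply pow_le; lra]).
    assert (HM : L * (c * (1 / 2) ^ n) / (4 * L) = c / 2 * (1 / 2) ^ S n) by (simpl; field; lra).
    rewrite <- HM. destruct (P_init (S n)) as [I1 I2]. destruct (P_init (S (S n))) as [J1 J2]. split.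
    + apply (exp_integral_bound (fun t => fst (P (S (S n))) t - fst (P (S n)) t)
        (fun t => F1 (fst (P (S n)) t) (snd (P (S n)) t) - F1 (fst (P n) t) (snd (P n) t)));
        [lra | nra | | lra |].
      * intros s. apply (is_derive_minus (fst (P (S (S n)))) (fst (P (S n)))); apply P_derive.
      * intros s. eapply Rle_trans; [apply HF1|]. destruct (IH s). nra.
    + apply (exp_integral_bound (fun t => snd (P (S (S n))) t - snd (P (S n)) t)
        (fun t => F2 (fst (P (S n)) t) (snd (P (S n)) t) - F2 (fst (P n) t) (snd (P n) t)));
        [lra | nra | | lra |].
      * intros s. apply (is_derive_minus (snd (P (S (S n)))) (snd (P (S n)))); apply P_derive.
      * intros s. eapply Rle_trans; [apply HF2|]. destruct (IH s). nra.
Qed.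

Let uniform_limit_continuity (f : nat -> R -> R) (g : R -> R) :
  (forall n t, continuity_pt (f n) t) ->
  (forall n t, Rabs (f n t - g t) <= c * (1 / 2) ^ n * exp (4 * L * Rabs t)) ->
  forall t, continuity_pt g t.
Proof.
  intros Hf Hg t e He.
  set (K := c * exp (4 * L * (Rabs t + 1)) + 1).
  assert (HK : 0 < K).
  { unfold K. pose proof (exp_pos (4 * L * (Rabs t + 1))). pose proof c_nonneg. nra. }
  destruct (pow_lt_1_zero (1 / 2)) with (y := e / (3 * K)) as (N & HN).
  { rewrite Rabs_pos_eq; lra. }
  { apply Rdiv_lt_0_compat; lra. }
  specialize (HN N (Nat.le_refl _)).
  assert (Hp : 0 < (1 / 2) ^ N) by (apply pow_lt; lra). rewrite Rabs_pos_eq in HN by lra.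
  assert (HB : forall s, Rabs (s - t) < 1 -> Rabs (f N s - g s) < e / 3).
  { intros s Hs. eapply Rle_lt_trans; [apply Hg|].
    assert (exp (4 * L * Rabs s) <= exp (4 * L * (Rabs t + 1))).
    { apply exp_le. pose proof (Rabs_triang (s - t) t) as T.
      replace (s - t + t) with s in T by ring. nra. }
    apply Rle_lt_trans with (K * (1 / 2) ^ N).
    - unfold K. pose proof c_nonneg. pose proof (exp_pos (4 * L * Rabs s)).
      assert (c * exp (4 * L * Rabs s) <= c * exp (4 * L * (Rabs t + 1)))
        by (apply Rmult_le_compat_l; assumption). nra.
    - apply Rmult_lt_compat_l with (r := K) in HN; [|exact HK].
      replace (K * (e / (3 * K))) with (e / 3) in HN by (field; lra). exact HN. }
  destruct (continuity_pt_eps (f N) t (e / 3) (Hf N t) ltac:(lra)) as (d & Hd & Hc).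
  exists (Rmin d 1). split; [apply Rmin_glb_lt; lra|].
  intros s [_ Hs]. simpl in *. unfold Rdist in *.
  pose proof (Hc s (Rlt_le_trans _ _ _ Hs (Rmin_l _ _))) as H1.
  pose proof (HB s (Rlt_le_trans _ _ _ Hs (Rmin_r _ _))) as H2.
  assert (H3 : Rabs (f N t - g t) < e / 3) by (apply HB; rewrite Rminus_diag, Rabs_R0; lra).
  replace (g s - g t) with (- (f N s - g s) + ((f N s - f N t) + (f N t - g t))) by ring.
  eapply Rle_lt_trans; [apply Rabs_triang|]. rewrite Rabs_Ropp.
  pose proof (Rabs_triang (f N s - f N t) (f N t - g t)). lra.
Qed.

Let small_eq (a K : R) : 0 <= K -> (forall n, Rabs a <= K * (1 / 2) ^ n) -> a = 0.
Proof.
  intros HK H. apply NNPP. intro N. apply Rabs_pos_lt in N.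
  destruct (pow_lt_1_zero (1 / 2)) with (y := Rabs a / (K + 1)) as (n & Hn).
  { rewrite Rabs_pos_eq; lra. }
  { apply Rdiv_lt_0_compat; lra. }
  specialize (Hn n (Nat.le_refl _)). specialize (H n).
  assert (Hp : 0 < (1 / 2) ^ n) by (apply pow_lt; lra). rewrite (Rabs_pos_eq ((1/2)^n)) in Hn by lra.
  apply Rmult_lt_compat_l with (r := K + 1) in Hn; [|lra].
  replace ((K + 1) * (Rabs a / (K + 1))) with (Rabs a) in Hn by (field; lra). lra.
Qed.

Lemma picard : exists X Y : R -> R, X 0 = x0 /\ Y 0 = y0 /\
  forall t, is_derive X t (F1 (X t) (Y t)) /\ is_derive Y t (F2 (X t) (Y t)).
Proof.
  assert (HX : forall t, exists l, forall n, Rabs (fst (P n) t - l) <= c * (1 / 2) ^ n * exp (4 * L * Rabs t)).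
  { intros t. destruct (geometric_limit (fun n => fst (P n) t) (c / 2 * exp (4 * L * Rabs t))) as (l & Hl).
    - intros n. destruct (P_step n t). lra.
    - exists l. intros n. specialize (Hl n). lra. }
  assert (HY : forall t, exists l, forall n, Rabs (snd (P n) t - l) <= c * (1 / 2) ^ n * exp (4 * L * Rabs t)).
  { intros t. destruct (geometric_limit (fun n => snd (P n) t) (c / 2 * exp (4 * L * Rabs t))) as (l & Hl).
    - intros n. destruct (P_step n t). lra.
    - exists l. intros n. specialize (Hl n). lra. }
  set (X := fun t => proj1_sig (constructive_indefinite_description _ (HX t))).
  set (Y := fun t => proj1_sig (constructive_indefinite_description _ (HY t))).
  assert (EX : forall n t, Rabs (fst (P n) t - X t) <= c * (1 / 2) ^ n * exp (4 * L * Rabs t)).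
  { intros n t. unfold X. destruct constructive_indefinite_description as [l Hl]. apply Hl. }
  assert (EY : forall n t, Rabs (snd (P n) t - Y t) <= c * (1 / 2) ^ n * exp (4 * L * Rabs t)).
  { intros n t. unfold Y. destruct constructive_indefinite_description as [l Hl]. apply Hl. }
  clearbody X Y.
  assert (CX : forall t, continuity_pt X t).
  { apply (uniform_limit_continuity (fun n => fst (P n))); [intros n t; apply P_continuous | exact EX]. }
  assert (CY : forall t, continuity_pt Y t).
  { apply (uniform_limit_continuity (fun n => snd (P n))); [intros n t; apply P_continuous | exact EY]. }
  (* Both components are handled at once: the limit satisfies the integral equation because its two
     sides differ by at most a multiple of [(1 / 2) ^ n] for every [n]. *)
  assert (D : forall F z0 (Z : R -> R) (Q : nat -> R -> R), lipschitz2 L F ->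
    (forall n t, Rabs (Q n t - Z t) <= c * (1 / 2) ^ n * exp (4 * L * Rabs t)) ->
    (forall n, Q n 0 = z0) ->
    (forall n t, is_derive (Q (S n)) t (F (fst (P n) t) (snd (P n) t))) ->
    Z 0 = z0 /\ forall t, is_derive Z t (F (X t) (Y t))).
  { intros F z0 Z Q HF HQ HQ0 HQd.
    assert (CF : forall s, continuity_pt (fun s => F (X s) (Y s)) s)
      by (intros s; eapply lipschitz2_continuity; eauto).
    assert (EZ : forall t, Z t = z0 + RInt (fun s => F (X s) (Y s)) 0 t).
    { intros t. apply Rminus_diag_uniq.
      apply small_eq with (2 * c * exp (4 * L * Rabs t)).
      { pose proof (exp_pos (4 * L * Rabs t)). pose proof c_nonneg. nra. }
      intros n.
      assert (Hi : Rabs (Q (S n) t - (z0 + RInt (fun s => F (X s) (Y s)) 0 t))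
                   <= L * (2 * c * (1 / 2) ^ n) / (4 * L) * exp (4 * L * Rabs t)).
      { assert (0 <= c * (1 / 2) ^ n) by (apply Rmult_le_pos; [exact c_nonneg | apply pow_le; lra]).
        apply (exp_integral_bound (fun t => Q (S n) t - (z0 + RInt (fun s => F (X s) (Y s)) 0 t))
          (fun t => F (fst (P n) t) (snd (P n) t) - F (X t) (Y t))); [lra|nra| | |].
        - intros s. apply (is_derive_minus (Q (S n)) (fun t => z0 + RInt (fun s => F (X s) (Y s)) 0 t));
            [apply HQd | apply (is_derive_primitive (fun s => F (X s) (Y s))); exact CF].
        - rewrite HQ0, RInt_point. unfold zero; simpl. ring.
        - intros s. eapply Rle_trans; [apply HF|]. specialize (EX n s). specialize (EY n s). nra. }
      replace (L * (2 * c * (1 / 2) ^ n) / (4 * L)) with (c / 2 * (1 / 2) ^ n) in Hi by (field; lra).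
      specialize (HQ (S n) t). simpl pow in HQ. rewrite Rabs_minus_sym in HQ.
      pose proof (Rabs_triang (Z t - Q (S n) t) (Q (S n) t - (z0 + RInt (fun s => F (X s) (Y s)) 0 t))) as T.
      replace (Z t - Q (S n) t + (Q (S n) t - (z0 + RInt (fun s => F (X s) (Y s)) 0 t)))
        with (Z t - (z0 + RInt (fun s => F (X s) (Y s)) 0 t)) in T by ring.
      pose proof (exp_pos (4 * L * Rabs t)). pose proof c_nonneg.
      assert (0 < (1 / 2) ^ n) by (apply pow_lt; lra).
      assert (0 <= c * exp (4 * L * Rabs t) * (1 / 2) ^ n) by (apply Rmult_le_pos; [apply Rmult_le_pos|]; lra).
      lra. }
    split.
    - rewrite EZ, RInt_point. unfold zero; simpl. ring.
    - intros t. apply (is_derive_ext (fun t => z0 + RInt (fun s => F (X s) (Y s)) 0 t));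
        [intros s; symmetry; apply EZ|].
      apply (is_derive_primitive (fun s => F (X s) (Y s))), CF. }
  destruct (D F1 x0 X (fun n => fst (P n)) HF1 EX (fun n => proj1 (P_init n)) (fun n t => proj1 (P_derive n t)))
    as [X0 DX].
  destruct (D F2 y0 Y (fun n => snd (P n)) HF2 EY (fun n => proj2 (P_init n)) (fun n t => proj2 (P_derive n t)))
    as [Y0 DY].
  exists X, Y. auto.
Qed.

End Picard.

(** The squared distance avoids the non-smooth absolute value. With [a] and [b] the two differences,
    its derivative is at most [2 * L * (Rabs a + Rabs b) ^ 2], hence at most
    [4 * L * (a ^ 2 + b ^ 2)]. *)
Lemma gronwall2 (X1 Y1 X2 Y2 dX dY : R -> R) (L s t : R) : s <= t -> 0 <= L ->
  (forall x, s <= x <= t -> is_derive (fun x => X1 x - X2 x) x (dX x)) ->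
  (forall x, s <= x <= t -> is_derive (fun x => Y1 x - Y2 x) x (dY x)) ->
  (forall x, s <= x <= t -> Rabs (dX x) <= L * (Rabs (X1 x - X2 x) + Rabs (Y1 x - Y2 x))) ->
  (forall x, s <= x <= t -> Rabs (dY x) <= L * (Rabs (X1 x - X2 x) + Rabs (Y1 x - Y2 x))) ->
  (X1 t - X2 t) ^ 2 + (Y1 t - Y2 t) ^ 2
    <= ((X1 s - X2 s) ^ 2 + (Y1 s - Y2 s) ^ 2) * exp (4 * L * (t - s)).
Proof.
  intros Hst HL HX HY bX bY.
  pose proof (exp_comparison (fun x => (X1 x - X2 x) ^ 2 + (Y1 x - Y2 x) ^ 2)
    (fun x => 2 * (X1 x - X2 x) * dX x + 2 * (Y1 x - Y2 x) * dY x) (- (4 * L)) 0 s t Hst) as H.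
  rewrite !Rminus_0_r, Ropp_involutive in H. apply H; clear H.
  - intros x Hx.
    apply (is_derive_plus (fun x => (X1 x - X2 x) ^ 2) (fun x => (Y1 x - Y2 x) ^ 2)).
    + replace (2 * (X1 x - X2 x) * dX x) with (INR 2 * dX x * (X1 x - X2 x) ^ pred 2) by (simpl; ring).
      apply (is_derive_pow (fun x => X1 x - X2 x)), HX, Hx.
    + replace (2 * (Y1 x - Y2 x) * dY x) with (INR 2 * dY x * (Y1 x - Y2 x) ^ pred 2) by (simpl; ring).
      apply (is_derive_pow (fun x => Y1 x - Y2 x)), HY, Hx.
  - intros x Hx. specialize (bX x Hx). specialize (bY x Hx).
    set (a := X1 x - X2 x) in *. set (b := Y1 x - Y2 x) in *.
    assert (H1 : 2 * a * dX x <= 2 * (Rabs a * (L * (Rabs a + Rabs b)))).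
    { rewrite Rmult_assoc. apply Rmult_le_compat_l; [lra|].
      eapply Rle_trans; [apply Rle_abs|]. rewrite Rabs_mult.
      apply Rmult_le_compat_l; [apply Rabs_pos | exact bX]. }
    assert (H2 : 2 * b * dY x <= 2 * (Rabs b * (L * (Rabs a + Rabs b)))).
    { rewrite Rmult_assoc. apply Rmult_le_compat_l; [lra|].
      eapply Rle_trans; [apply Rle_abs|]. rewrite Rabs_mult.
      apply Rmult_le_compat_l; [apply Rabs_pos | exact bY]. }
    rewrite Rminus_0_r, <- (pow2_abs a), <- (pow2_abs b).
    pose proof (pow2_ge_0 (Rabs a - Rabs b)).
    assert (0 <= L * (Rabs a - Rabs b) ^ 2) by (apply Rmult_le_pos; assumption).
    nra.
Qed.

(** * The scaled system near the nodes *)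

Lemma stay_pos_left (q q' : R -> R) (a b : R) : 0 < q b ->
  (forall t, a <= t <= b -> is_derive q t (q' t)) ->
  (forall t, a <= t < b -> (forall s, t < s <= b -> 0 < q s) -> q t = 0 -> q' t < 0) ->
  forall t, a <= t <= b -> 0 < q t.
Proof.
  intros Hb Hd Hq t Ht. replace t with (- - t) by ring.
  apply (stay_pos (fun s => q (- s)) (fun s => - q' (- s)) (- b) (- a)); [| | |lra].
  - rewrite Ropp_involutive. exact Hb.
  - intros s Hs. apply is_derive_reflect, Hd. lra.
  - intros s Hs Hpos Hz. assert (q' (- s) < 0); [|lra].
    apply Hq; [lra| |exact Hz]. intros x Hx. replace x with (- - x) by ring.
    apply Hpos. lra.
Qed.

Lemma last_zero (h : R -> R) (a b : R) : a <= b ->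
  (forall t, a <= t <= b -> continuity_pt h t) -> 0 < h b -> h a <= 0 ->
  exists t, a <= t < b /\ h t = 0 /\ forall s, t < s <= b -> 0 < h s.
Proof.
  intros Hab Hc Hb Ha.
  destruct (first_zero (fun s => h (- s)) (- b) (- a)) as (t & Ht & Hz & Hpos).
  - lra.
  - intros t Ht. apply (continuity_pt_comp Ropp h).
    + apply continuity_pt_opp, derivable_continuous_pt, derivable_pt_id.
    + apply Hc. lra.
  - rewrite Ropp_involutive. exact Hb.
  - rewrite Ropp_involutive. exact Ha.
  - exists (- t). split; [lra|]. split; [exact Hz|]. intros s Hs.
    replace s with (- - s) by ring. apply Hpos. lra.
Qed.

Lemma inv_pow_pos (k : nat) (u : R) : 0 < u -> 0 < / u ^ k.
Proof. intros H. apply Rinv_0_lt_compat, pow_lt, H. Qed.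

Lemma inv_pow_le (k : nat) (u v : R) : 0 < u <= v -> / v ^ k <= / u ^ k.
Proof.
  intros H. apply Rinv_le_contravar; [apply pow_lt; lra | apply pow_incr; lra].
Qed.

Lemma inv_le_inv_pow (k : nat) (u : R) : (0 < k)%nat -> 0 < u <= 1 -> / u <= / u ^ k.
Proof.
  intros Hk Hu. apply Rinv_le_contravar; [apply pow_lt; lra|].
  destruct k as [|k]; [lia|]. simpl.
  assert (u ^ k <= 1) by (rewrite <- (pow1 k); apply pow_incr; lra).
  pose proof (pow_lt u k ltac:(lra)). nra.
Qed.

Lemma inv_pow_le_inv (k : nat) (u : R) : (0 < k)%nat -> 1 <= u -> / u ^ k <= / u.
Proof.
  intros Hk Hu. apply Rinv_le_contravar; [lra|].
  destruct k as [|k]; [lia|]. simpl. pose proof (pow_R1_Rle u k Hu). nra.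
Qed.

Lemma is_derive_inv_pow (k : nat) (u : R) : 0 < u ->
  is_derive (fun u => / u ^ k) u (- INR k * / u ^ (k + 1)).
Proof.
  intros Hu. pose proof (pow_lt u k Hu).
  auto_derive; [lra|]. destruct k as [|k].
  - simpl. field. lra.
  - rewrite Nat.add_1_r. simpl pred. rewrite S_INR. simpl pow.
    pose proof (pow_lt u k Hu). field. lra.
Qed.

(** In units of [delta = eps ^ (k / (k + 1))] around the node, the distance [u] to the switching
    line and the height [r] obey [u' = A r - G u], [r' = - (u - m)]; [G] is the [u]-nullcline. *)
Definition nullcline (k : nat) (A C u : R) : R := (1 + A) * u + C * / u ^ k.

(** A subsolution that keeps orbits above it, hence away from [u = 0]. *)
Definition blocking (k : nat) (A kf ks C m : R) : Prop :=
  exists (us K M : R) (g dg : R -> R), 0 < us < K /\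
    (forall u, us <= u <= K -> is_derive g u (dg u)) /\
    (forall u, us <= u <= K -> Rabs (dg u) <= M) /\
    nullcline k A C us <= A * g us /\
    (forall u, us <= u <= K -> u - m <= dg u * (nullcline k A C u - A * g u)) /\
    kf * (g K - K / ks) < m.

(** A supersolution that forces orbits to reach [u = 0]. *)
Definition passing (k : nat) (A kf ks C m : R) : Prop :=
  exists (u1 K M d0 : R) (f df : R -> R), 0 < u1 < K /\ 0 < d0 /\
    (forall u, u1 <= u <= K -> is_derive f u (df u)) /\
    (forall u, u1 <= u <= K -> Rabs (df u) <= M) /\
    (forall u, u1 <= u <= K -> d0 <= nullcline k A C u - A * f u) /\
    (forall u, u1 <= u <= K -> df u * (nullcline k A C u - A * f u) <= u - m) /\
    K / ks + m / kf + C * / K ^ k / A <= f K /\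
    INR k * C <= ks * K ^ (k + 1) /\
    A * f u1 + 2 * A * Rabs m * u1 + 1 <= C * / u1 ^ k.

(** * Sub- and supersolutions of the limit equation and the critical value *)

Section Limit.
Variables (k : nat) (A kf ks C : R).
Hypothesis Hk : (0 < k)%nat.
Hypothesis Hks : 0 < ks < kf.
Hypothesis HA : A = kf * ks.
Hypothesis HA1 : 1 + A = kf + ks.
Hypothesis HC : 0 < C.

Let G := nullcline k A C.

Let A_pos : 0 < A.
Proof. rewrite HA. apply Rmult_lt_0_compat; lra. Qed.

Lemma is_derive_nullcline (u : R) : 0 < u ->
  is_derive (nullcline k A C) u ((1 + A) - C * (INR k * / u ^ (k + 1))).
Proof.
  intros Hu. unfold nullcline.
  replace ((1 + A) - C * (INR k * / u ^ (k + 1)))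
    with ((1 + A) * 1 + C * (- INR k * / u ^ (k + 1))) by ring.
  apply (is_derive_plus (fun u => (1 + A) * u) (fun u => C * / u ^ k)).
  - apply (is_derive_scal (fun u => u) u (1 + A)), (is_derive_id u).
  - apply (is_derive_scal (fun u => / u ^ k) u C), is_derive_inv_pow, Hu.
Qed.

Let dG_le (u : R) : 0 < u -> (1 + A) - C * (INR k * / u ^ (k + 1)) <= 1 + A.
Proof.
  intros Hu. pose proof (inv_pow_pos (k + 1) u Hu). pose proof (pos_INR k).
  assert (0 <= INR k * / u ^ (k + 1)) by (apply Rmult_le_pos; lra). nra.
Qed.

Let G_lipschitz (u1 : R) : 0 < u1 -> exists LG, 0 < LG /\
  forall u v, u1 <= u -> u1 <= v -> Rabs (G u - G v) <= LG * Rabs (u - v).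
Proof.
  intros Hu1. exists (1 + A + C * (INR k * / u1 ^ (k + 1))).
  pose proof (inv_pow_pos (k + 1) u1 Hu1). pose proof (pos_INR k).
  assert (0 <= INR k * / u1 ^ (k + 1)) by (apply Rmult_le_pos; lra).
  split; [nra|].
  assert (W : forall u v, u1 <= u <= v ->
    Rabs (G v - G u) <= (1 + A + C * (INR k * / u1 ^ (k + 1))) * (v - u)).
  { intros u v Huv.
    apply (increment_abs G (fun u => (1 + A) - C * (INR k * / u ^ (k + 1)))); [lra| |].
    - intros t Ht. apply is_derive_nullcline. lra.
    - intros t Ht. pose proof (inv_pow_le (k + 1) u1 t ltac:(lra)).
      pose proof (inv_pow_pos (k + 1) t ltac:(lra)).
      assert (INR k * / t ^ (k + 1) <= INR k * / u1 ^ (k + 1)) by (apply Rmult_le_compat_l; lra).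
      assert (0 <= INR k * / t ^ (k + 1)) by (apply Rmult_le_pos; lra).
      apply Rabs_le. split; nra. }
  intros u v Hu Hv. destruct (Rle_lt_dec u v).
  - rewrite Rabs_minus_sym, (Rabs_minus_sym u), (Rabs_pos_eq (v - u)) by lra. apply W; lra.
  - rewrite (Rabs_pos_eq (u - v)) by lra. apply W; lra.
Qed.

Let clamp (a b s : R) : R := Rmax a (Rmin b s).

Let clamp_bounds (a b s : R) : a <= b -> a <= clamp a b s <= b.
Proof.
  intros H. unfold clamp. split; [apply Rmax_l|]. apply Rmax_lub; [exact H | apply Rmin_l].
Qed.

Let clamp_lipschitz (a b s t : R) : Rabs (clamp a b s - clamp a b t) <= Rabs (s - t).
Proof.
  unfold clamp, Rmax, Rmin.
  repeat (destruct Rle_dec); unfold Rabs; repeat (destruct Rcase_abs); lra.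
Qed.

Let clamp_id (a b s : R) : a <= s <= b -> clamp a b s = s.
Proof. intros H. unfold clamp. rewrite Rmin_right, Rmax_right; lra. Qed.

Let Rmax_lipschitz (d x y : R) : Rabs (Rmax x d - Rmax y d) <= Rabs (x - y).
Proof.
  unfold Rmax. repeat (destruct Rle_dec); unfold Rabs; repeat (destruct Rcase_abs); lra.
Qed.

Let quotient_lipschitz (n n' D D' N d : R) : 0 < d -> d <= D -> d <= D' -> Rabs n' <= N ->
  Rabs (n / D - n' / D') <= / d * Rabs (n - n') + N / d ^ 2 * Rabs (D - D').
Proof.
  intros Hd HD HD' HN.
  replace (n / D - n' / D') with (/ D * (n - n') + n' * (/ D * / D') * (D' - D)) by (fld).
  eapply Rle_trans; [apply Rabs_triang|]. apply Rplus_le_compat.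
  - rewrite Rabs_mult. apply Rmult_le_compat_r; [apply Rabs_pos|].
    rewrite Rabs_pos_eq; [apply Rinv_le_contravar; lra | left; apply Rinv_0_lt_compat; lra].
  - rewrite Rabs_mult, (Rabs_minus_sym D' D). apply Rmult_le_compat_r; [apply Rabs_pos|].
    rewrite Rabs_mult. unfold Rdiv. apply Rmult_le_compat; [apply Rabs_pos|apply Rabs_pos|exact HN|].
    assert (0 < / D) by (apply Rinv_0_lt_compat; lra).
    assert (0 < / D') by (apply Rinv_0_lt_compat; lra).
    assert (/ D <= / d) by (apply Rinv_le_contravar; lra).
    assert (/ D' <= / d) by (apply Rinv_le_contravar; lra).
    rewrite Rabs_pos_eq by nra. replace (/ d ^ 2) with (/ d * / d) by (fld).
    apply Rmult_le_compat; lra.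
Qed.

(** Dividing [r' = m - u] by [u' = A * r - G u] gives the orbit equation
    [dr / du = (u - m) / (G u - A * r)], singular where the orbit turns back. Cutting the
    denominator off at [d > 0] makes it globally Lipschitz, so a solution through [(K, f0)] exists
    down to [u1] in any case; whether the cut-off was active is decided afterwards. *)
Lemma regularized_solution (u1 K d m f0 : R) : 0 < u1 < K -> 0 < d ->
  exists f : R -> R, f K = f0 /\
  forall u, u1 <= u <= K -> is_derive f u ((u - m) / Rmax (G u - A * f u) d).
Proof.
  intros Hu Hd. destruct (G_lipschitz u1 (proj1 Hu)) as (LG & HLG & HG).
  set (N := K + Rabs m).
  assert (HN : 0 < N) by (unfold N; pose proof (Rabs_pos m); lra).
  (* The variable [u] is clamped to [[u1, K]] as well, because [G] is singular at [0]. To fit the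
     planar existence result, [u] becomes a first component with unit speed. *)
  set (F2 := fun s f : R => (clamp u1 K s - m) / Rmax (G (clamp u1 K s) - A * f) d).
  assert (Hdi : 0 < / d) by (apply Rinv_0_lt_compat, Hd).
  assert (HNd : 0 < N / d ^ 2) by (apply Rdiv_lt_0_compat; [lra | apply pow_lt, Hd]).
  set (L := / d + N / d ^ 2 * (LG + A)).
  assert (HL : 0 < L) by (unfold L; nra).
  destruct (picard (fun _ _ => 1) F2 L K f0 HL) as (X & Y & X0 & Y0 & HXY).
  - intros x y x' y'. rewrite Rminus_diag, Rabs_R0.
    pose proof (Rabs_pos (x - x')). pose proof (Rabs_pos (y - y')). nra.
  - intros s f s' f'. unfold F2.
    pose proof (clamp_bounds u1 K s ltac:(lra)). pose proof (clamp_bounds u1 K s' ltac:(lra)).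
    pose proof (clamp_lipschitz u1 K s s') as Hcl.
    eapply Rle_trans.
    { apply quotient_lipschitz with (d := d) (N := N);
        [exact Hd | apply Rmax_r | apply Rmax_r |].
      unfold N. pose proof (Rabs_triang (clamp u1 K s') (- m)) as T. rewrite Rabs_Ropp in T.
      rewrite (Rabs_pos_eq (clamp u1 K s')) in T by lra. unfold Rminus. lra. }
    replace (clamp u1 K s - m - (clamp u1 K s' - m)) with (clamp u1 K s - clamp u1 K s') by ring.
    set (c := clamp u1 K s) in *. set (c' := clamp u1 K s') in *.
    assert (HD : Rabs (Rmax (G c - A * f) d - Rmax (G c' - A * f') d)
                 <= LG * Rabs (s - s') + A * Rabs (f - f')).
    { eapply Rle_trans; [apply Rmax_lipschitz|].
      replace (G c - A * f - (G c' - A * f')) with ((G c - G c') + - (A * (f - f'))) by ring.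
      eapply Rle_trans; [apply Rabs_triang|]. rewrite Rabs_Ropp, Rabs_mult, (Rabs_pos_eq A) by lra.
      apply Rplus_le_compat_r. eapply Rle_trans; [apply HG; lra|].
      apply Rmult_le_compat_l; lra. }
    pose proof (Rabs_pos (s - s')) as P1. pose proof (Rabs_pos (f - f')) as P2.
    apply Rle_trans with (/ d * Rabs (s - s') + N / d ^ 2 * (LG * Rabs (s - s') + A * Rabs (f - f'))).
    + apply Rplus_le_compat; apply Rmult_le_compat_l; lra.
    + unfold L. assert (0 <= / d * Rabs (f - f')) by (apply Rmult_le_pos; lra).
      assert (0 <= N / d ^ 2 * (LG * Rabs (f - f'))) by (apply Rmult_le_pos; [|apply Rmult_le_pos]; lra).
      assert (0 <= N / d ^ 2 * (A * Rabs (s - s'))) by (apply Rmult_le_pos; [|apply Rmult_le_pos]; lra).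
      lra.
  - assert (EX : forall t, X t = K + t).
    { intros t. assert (E : X t - t = X 0 - 0); [|lra].
      destruct (MVT_gen (fun t => X t - t) 0 t (fun _ => 1 - 1)) as (c & _ & E).
      - intros x _. apply (is_derive_minus X (fun t => t)); [apply HXY | apply (is_derive_id x)].
      - intros x _. apply (is_derive_continuity_pt (fun t => X t - t) x (1 - 1)), (is_derive_minus X (fun t => t));
          [apply HXY | apply (is_derive_id x)].
      - lra. }
    exists (fun u => Y (u - K)). split; [rewrite Rminus_diag; exact Y0|].
    intros u Hu'. destruct (HXY (u - K)) as [_ HY]. rewrite EX in HY. unfold F2 in HY.
    replace (K + (u - K)) with u in HY by ring. rewrite clamp_id in HY by exact Hu'.
    replace ((u - m) / Rmax (G u - A * Y (u - K)) d)
      with (scal 1 ((u - m) / Rmax (G u - A * Y (u - K)) d))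
      by (unfold scal; simpl; unfold mult; simpl; ring).
    apply (is_derive_comp Y (fun u => u - K)); [exact HY|].
    auto_derive; [exact I | ring].
Qed.

Let is_derive_gap (f : R -> R) (u l : R) : 0 < u -> is_derive f u l ->
  is_derive (fun u => G u - A * f u) u ((1 + A) - C * (INR k * / u ^ (k + 1)) - A * l).
Proof.
  intros Hu Hf. apply (is_derive_minus G (fun u => A * f u)); [apply is_derive_nullcline, Hu|].
  apply (is_derive_scal f u A), Hf.
Qed.

Lemma Rinv_pow_eventually_large (b : R) : exists u1, 0 < u1 <= 1 / 2 /\ b <= C * / u1 ^ k.
Proof.
  set (u1 := Rmin (1 / 2) (C / (Rabs b + 1))).
  pose proof (Rabs_pos b) as Hb. pose proof (Rle_abs b) as Hb'.
  assert (Hc : 0 < C / (Rabs b + 1)) by (apply Rdiv_lt_0_compat; lra).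
  assert (Hu1 : 0 < u1) by (apply Rmin_glb_lt; lra).
  pose proof (Rmin_l (1 / 2) (C / (Rabs b + 1))) as M1.
  pose proof (Rmin_r (1 / 2) (C / (Rabs b + 1))) as M2. fold u1 in M1, M2.
  exists u1. split; [lra|].
  apply Rle_trans with (C * / u1).
  - apply Rmult_le_reg_r with u1; [exact Hu1|]. rewrite Rmult_assoc, Rinv_l, Rmult_1_r by lra.
    apply Rmult_le_compat_r with (r := Rabs b + 1) in M2; [|lra].
    unfold Rdiv in M2. rewrite Rmult_assoc, Rinv_l in M2 by lra. nra.
  - apply Rmult_le_compat_l; [lra|]. apply inv_le_inv_pow; [exact Hk | lra].
Qed.

(** Two regularized orbits, for [m1 < m2] inside the interval, start at [u = K] on the slow line
    [r = K / ks + m / kf], where the fast coordinate [ks * r - u] is in equilibrium up to the tail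
    term. They stay [D0] apart. If the upper one keeps clear of the nullcline, the lower one clears
    it by [A * D0], its cut-off is inactive, and it is a supersolution for [ma]. If the upper one
    touches the nullcline, its part between [K] and the contact nearest to [K] is a subsolution for
    [mb]. *)
Lemma passing_or_blocking (ma mb : R) : ma < mb ->
  passing k A kf ks C ma \/ blocking k A kf ks C mb.
Proof.
  (* Thirds: [ma < m1 < m2 < mb] with gaps [e]. The gap below [m1] pays for the tail at [K] on the
     passing side, the gap above [m2] for the cut-off on the blocking side, and the middle one
     separates the two orbits. *)
  intros Hab. set (e := (mb - ma) / 3). assert (He : 0 < e) by (unfold e; lra).
  set (m1 := ma + e). set (m2 := ma + 2 * e).
  assert (Emb : mb = m2 + e) by (unfold m2, e; lra).
  assert (E12 : m2 = m1 + e) by (unfold m1, m2; lra).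
  assert (E1a : m1 = ma + e) by reflexivity.
  (* [(1 + A) * D0 = e / 2] leaves half of [e] at a contact in [S3], and [D0] is below the initial
     separation [e / kf] since [kf < 1 + A]. *)
  set (D0 := e / (2 * (1 + A))). set (d := A * D0).
  assert (HD0 : 0 < D0) by (unfold D0; apply Rdiv_lt_0_compat; lra).
  assert (ED0 : (1 + A) * D0 = e / 2) by (unfold D0; field; lra).
  assert (Hd : 0 < d) by (unfold d; apply Rmult_lt_0_compat; lra).
  (* [K] is so large that the tail term at [K] fits into the slack [e / kf] and that
     [ks * u + C / u ^ k] is nondecreasing from [K] on. *)
  assert (HK : exists K, 1 <= K /\ C * / K ^ k <= A * (e / kf) /\ INR k * C <= ks * K ^ (k + 1) /\
             Rabs ma + Rabs mb < K).
  { set (K := 1 + C / (A * (e / kf)) + INR k * C / ks + Rabs ma + Rabs mb).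
    assert (0 < e / kf) by (apply Rdiv_lt_0_compat; lra).
    assert (0 < A * (e / kf)) by (apply Rmult_lt_0_compat; lra).
    assert (0 < C / (A * (e / kf))) by (apply Rdiv_lt_0_compat; lra).
    pose proof (pos_INR k).
    assert (0 <= INR k * C / ks) by (apply Rdiv_le_0_compat; [apply Rmult_le_pos|]; lra).
    pose proof (Rabs_pos ma). pose proof (Rabs_pos mb).
    assert (HK1 : 1 <= K) by (unfold K; lra). exists K. repeat split; [exact HK1| | |].
    - apply Rle_trans with (C * / K).
      + apply Rmult_le_compat_l; [lra|]. apply inv_pow_le_inv; assumption.
      + apply Rmult_le_reg_r with K; [lra|]. rewrite Rmult_assoc, Rinv_l, Rmult_1_r by lra.
        assert (HK2 : C / (A * (e / kf)) <= K) by (unfold K; lra).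
        apply Rmult_le_compat_l with (r := A * (e / kf)) in HK2; [|lra].
        replace (A * (e / kf) * (C / (A * (e / kf)))) with C in HK2 by (fld).
        exact HK2.
    - apply Rle_trans with (ks * K).
      + assert (HK2 : INR k * C / ks <= K) by (unfold K; lra).
        apply Rmult_le_compat_l with (r := ks) in HK2; [|lra].
        replace (ks * (INR k * C / ks)) with (INR k * C) in HK2 by (fld). exact HK2.
      + apply Rmult_le_compat_l; [lra|]. rewrite Nat.add_1_r. simpl.
        pose proof (pow_R1_Rle K k HK1). nra.
    - unfold K. lra. }
  destruct HK as (K & HK1 & HKC & HKk & HKm).
  assert (Hm2K : m2 < K /\ m1 < K /\ Rabs m1 <= K).
  { revert HKm. unfold m1, m2, e. unfold Rabs. repeat destruct Rcase_abs; intros; repeat split; lra. }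
  (* [B] will bound the lower orbit at [u1] independently of [u1], so [u1] can be chosen afterwards
     to make the tail term dominate. *)
  set (B := K / ks + m1 / kf + Rabs m1 * K / d).
  destruct (Rinv_pow_eventually_large (A * B + 2 * A * Rabs ma + 1)) as (u1 & Hu1 & HCu1).
  assert (Hu1K : 0 < u1 < K) by lra.
  destruct (regularized_solution u1 K d m1 (K / ks + m1 / kf) Hu1K Hd) as (f1 & f1K & Df1).
  destruct (regularized_solution u1 K d m2 (K / ks + m2 / kf) Hu1K Hd) as (f2 & f2K & Df2).
  assert (EGK : G K - A * f2 K = ks * (K - m2) + C * / K ^ k).
  { rewrite f2K. unfold G, nullcline. rewrite HA1, HA. fld. }
  pose proof (inv_pow_pos k K ltac:(lra)) as HKp.
  (* On this line the regularized equation gives [A * (u - m2) / s u = 1 + A], which is at least the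
     slope of [G]. Hence the gap [G u - A * f2 u] cannot come down to [s u] as [u] decreases. *)
  set (s := fun u => A / (1 + A) * (u - m2)).
  assert (HAA : 0 < A / (1 + A)) by (apply Rdiv_lt_0_compat; lra).
  assert (Es : forall u, m2 + e / 2 <= u -> d <= s u).
  { intros u Hu. unfold s. apply Rle_trans with (A / (1 + A) * (e / 2)).
    - right. unfold d. rewrite <- ED0. field. lra.
    - apply Rmult_le_compat_l; lra. }
  assert (HAks : A / (1 + A) < ks).
  { apply Rmult_lt_reg_r with (1 + A); [lra|]. unfold Rdiv. rewrite Rmult_assoc, Rinv_l by lra.
    rewrite HA1 at 1. rewrite HA. nra. }
  assert (S1 : forall u, u1 <= u <= K -> m2 + e / 2 <= u -> s u < G u - A * f2 u).
  { intros u Hu Hu'. assert (0 < G u - A * f2 u - s u); [|lra].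
    apply (stay_pos_left (fun u => G u - A * f2 u - s u)
      (fun u => (1 + A) - C * (INR k * / u ^ (k + 1)) - A * ((u - m2) / Rmax (G u - A * f2 u) d)
                - A / (1 + A)) u K); [| | |lra].
    - rewrite EGK. unfold s. nra.
    - intros t Ht. apply (is_derive_minus (fun u => G u - A * f2 u) s).
      + apply is_derive_gap; [lra | apply Df2; lra].
      + unfold s. auto_derive; [exact I | ring].
    - intros t Ht _ Hz. pose proof (Es t ltac:(lra)) as Hst.
      replace (G t - A * f2 t) with (s t) by lra. rewrite Rmax_left by exact Hst.
      replace (A * ((t - m2) / s t)) with (1 + A)
        by (unfold s; field; split; [lra | split; lra]).
      pose proof (dG_le t ltac:(lra)). lra. }
  assert (S2 : forall u, u1 <= u <= K -> m2 < u -> A * (u - m2) <= (1 + A) * Rmax (G u - A * f2 u) d).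
  { intros u Hu Hu'. destruct (Rle_lt_dec (m2 + e / 2) u) as [H|H].
    - specialize (S1 u Hu H). pose proof (Rmax_l (G u - A * f2 u) d) as M.
      assert (Hs : s u <= Rmax (G u - A * f2 u) d) by lra.
      apply Rmult_le_compat_l with (r := 1 + A) in Hs; [|lra].
      replace ((1 + A) * s u) with (A * (u - m2)) in Hs by (unfold s; field; lra). exact Hs.
    - pose proof (Rmax_r (G u - A * f2 u) d) as M.
      apply Rmult_le_compat_l with (r := 1 + A) in M; [|lra].
      assert ((1 + A) * d = A * (e / 2)) by (unfold d; rewrite <- ED0; ring). nra. }
  (* When the separation equals [D0], the two cut-off denominators differ by at most [d], and the
     lower bound [S2] on that of the upper orbit makes the sign strict. *)
  assert (S3 : forall u, u1 <= u <= K -> D0 < f2 u - f1 u).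
  { intros u Hu. assert (0 < f2 u - f1 u - D0); [|lra].
    apply (stay_pos_left (fun u => f2 u - f1 u - D0)
      (fun u => (u - m2) / Rmax (G u - A * f2 u) d - (u - m1) / Rmax (G u - A * f1 u) d - 0) u1 K);
      [| | |exact Hu].
    - rewrite f1K, f2K, E12. assert (D0 < e / kf); [|unfold Rdiv in *; lra].
      apply Rmult_lt_reg_l with (1 + A); [lra|]. rewrite ED0.
      apply Rmult_lt_reg_r with kf; [lra|]. replace ((1 + A) * (e / kf) * kf) with ((1 + A) * e) by (fld).
      rewrite HA1. nra.
    - intros t Ht. apply (is_derive_minus (fun u => f2 u - f1 u) (fun _ => D0));
        [|apply (is_derive_const D0 t)].
      apply (is_derive_minus f2 f1); [apply Df2 | apply Df1]; exact Ht.
    - intros t Ht _ Hz. specialize (S2 t ltac:(lra)).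
      assert (H12 : G t - A * f1 t = G t - A * f2 t + d) by (unfold d; replace (f1 t) with (f2 t - D0) by lra; ring).
      set (P2 := Rmax (G t - A * f2 t) d) in *. set (P1 := Rmax (G t - A * f1 t) d) in *.
      assert (HP2 : d <= P2) by apply Rmax_r.
      assert (HP : P2 <= P1 <= P2 + d).
      { unfold P1, P2. rewrite H12. unfold Rmax. repeat destruct Rle_dec; lra. }
      assert (Hnum : (t - m2) * P1 - (t - m1) * P2 < 0).
      { assert (He2 : 0 < e * P2) by (apply Rmult_lt_0_compat; lra).
        replace ((t - m2) * P1 - (t - m1) * P2) with ((t - m2) * (P1 - P2) - e * P2)
          by (rewrite E12; ring).
        destruct (Rle_lt_dec t m2) as [H|H].
        - assert (0 <= (m2 - t) * (P1 - P2)) by (apply Rmult_le_pos; lra). lra.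
        - specialize (S2 H).
          assert ((t - m2) * (P1 - P2) <= (t - m2) * d) by (apply Rmult_le_compat_l; lra).
          assert ((t - m2) * d <= (e / 2) * P2); [|lra].
          unfold d. rewrite <- ED0. replace ((t - m2) * (A * D0)) with (D0 * (A * (t - m2))) by ring.
          replace ((1 + A) * D0 * P2) with (D0 * ((1 + A) * P2)) by ring.
          apply Rmult_le_compat_l; lra. }
      replace ((t - m2) / P2 - (t - m1) / P1 - 0) with (((t - m2) * P1 - (t - m1) * P2) * / (P1 * P2))
        by (fld).
      assert (0 < / (P1 * P2)) by (apply Rinv_0_lt_compat, Rmult_lt_0_compat; lra).
      apply Ropp_lt_cancel. rewrite Ropp_0, Ropp_mult_distr_l. apply Rmult_lt_0_compat; lra. }
  destruct (classic (exists u, u1 <= u <= K /\ G u - A * f2 u <= 0)) as [(ub & Hub & Hhit)|Hno].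
  - right.
    assert (HGK : 0 < G K - A * f2 K) by (rewrite EGK; nra).
    assert (Dgap : forall t, u1 <= t <= K -> is_derive (fun u => G u - A * f2 u) t
      ((1 + A) - C * (INR k * / t ^ (k + 1)) - A * ((t - m2) / Rmax (G t - A * f2 t) d))).
    { intros t Ht. apply is_derive_gap; [lra | apply Df2, Ht]. }
    destruct (last_zero (fun u => G u - A * f2 u) ub K) as (us & Hus & Hz & Hpos);
      [lra | | exact HGK | exact Hhit |].
    { intros t Ht. eapply is_derive_continuity_pt, Dgap. lra. }
    exists us, K, ((K + Rabs m2) / d), f2, (fun u => (u - m2) / Rmax (G u - A * f2 u) d).
    split; [lra|]. split; [intros u Hu; apply Df2; lra|]. split; [|split; [|split]].
    + intros u Hu. unfold Rdiv. rewrite Rabs_mult.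
      pose proof (Rmax_r (G u - A * f2 u) d).
      apply Rmult_le_compat; [apply Rabs_pos | apply Rabs_pos | |].
      * unfold Rminus. eapply Rle_trans; [apply Rabs_triang|]. rewrite Rabs_Ropp, Rabs_pos_eq; lra.
      * rewrite Rabs_pos_eq; [apply Rinv_le_contravar; lra | left; apply Rinv_0_lt_compat; lra].
    + fold G. lra.
    + intros u Hu. fold G.
      assert (Hp : 0 <= G u - A * f2 u).
      { destruct (Req_dec u us) as [->|]; [lra | left; apply Hpos; lra]. }
      destruct (Rle_lt_dec d (G u - A * f2 u)) as [Hl|Hl].
      * rewrite Rmax_left by exact Hl. replace ((u - m2) / (G u - A * f2 u) * (G u - A * f2 u)) with (u - m2)
          by (fld). lra.
      (* Cut-off active: the product is [(u - m2) * (p / d)] with [0 <= p / d <= 1], and the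
         distance [e] from [m2] to [mb] covers its difference from [u - mb]. *)
      * rewrite Rmax_right by lra.
        set (p := G u - A * f2 u) in *.
        assert (Hpd : 0 <= p / d <= 1).
        { split; [apply Rdiv_le_0_compat; lra|]. apply Rmult_le_reg_r with d; [lra|].
          unfold Rdiv. rewrite Rmult_assoc, Rinv_l; lra. }
        replace ((u - m2) / d * p) with ((u - m2) * (p / d)) by (fld).
        destruct (Rle_lt_dec (m2 + e / 2) u) as [H|H].
        -- specialize (S1 u ltac:(lra) H). specialize (Es u H). unfold p in *. lra.
        -- nra.
    + rewrite f2K. replace (kf * (K / ks + m2 / kf - K / ks)) with m2 by (fld). lra.
  - left.
    assert (Hp2 : forall u, u1 <= u <= K -> 0 < G u - A * f2 u).
    { intros u Hu. apply Rnot_le_lt. intro. apply Hno. exists u. auto. }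
    assert (Hp1 : forall u, u1 <= u <= K -> d <= G u - A * f1 u).
    { intros u Hu. specialize (Hp2 u Hu). specialize (S3 u Hu). unfold d. nra. }
    exists u1, K, ((K + Rabs m1) / d), d, f1, (fun u => (u - m1) / Rmax (G u - A * f1 u) d).
    split; [exact Hu1K|]. split; [exact Hd|]. split; [exact Df1|].
    split; [|split; [exact Hp1|split; [|split; [|split; [exact HKk|]]]]].
    + intros u Hu. unfold Rdiv. rewrite Rabs_mult.
      pose proof (Rmax_r (G u - A * f1 u) d).
      apply Rmult_le_compat; [apply Rabs_pos | apply Rabs_pos | |].
      * unfold Rminus. eapply Rle_trans; [apply Rabs_triang|]. rewrite Rabs_Ropp, Rabs_pos_eq; lra.
      * rewrite Rabs_pos_eq; [apply Rinv_le_contravar; lra | left; apply Rinv_0_lt_compat; lra].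
    + intros u Hu. fold G. specialize (Hp1 u Hu). rewrite Rmax_left by exact Hp1.
      replace ((u - m1) / (G u - A * f1 u) * (G u - A * f1 u)) with (u - m1) by (fld). lra.
    + rewrite f1K, E1a. apply Rmult_le_compat_r with (r := / A) in HKC;
        [|left; apply Rinv_0_lt_compat; lra].
      replace (A * (e / kf) * / A) with (e / kf) in HKC by (fld).
      unfold Rdiv in *. lra.
    + assert (Hf1 : - (Rabs m1 / d) * (K - u1) <= f1 K - f1 u1).
      { apply (increment_ge f1 (fun u => (u - m1) / Rmax (G u - A * f1 u) d)); [lra | exact Df1 |].
        intros u Hu. specialize (Hp1 u Hu). rewrite Rmax_left by exact Hp1.
        set (p := G u - A * f1 u) in *. pose proof (Rle_abs m1). pose proof (Rabs_pos m1).
        assert (Hip : 0 < / p <= / d)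
          by (split; [apply Rinv_0_lt_compat; lra | apply Rinv_le_contravar; lra]).
        unfold Rdiv. nra. }
      assert (HB : f1 u1 <= B).
      { unfold B. rewrite <- f1K. assert (0 <= Rabs m1 / d) by (apply Rdiv_le_0_compat; [apply Rabs_pos|lra]).
        replace (Rabs m1 * K / d) with (Rabs m1 / d * K) by (fld). nra. }
      pose proof (Rabs_pos ma).
      assert (A * f1 u1 <= A * B) by (apply Rmult_le_compat_l; lra).
      assert (A * Rabs ma * u1 <= A * Rabs ma * 1) by (apply Rmult_le_compat_l; [nra|lra]).
      lra.
Qed.

(** A supersolution lies above the slow line [u / ks + m / kf], yet below the nullcline. At [u = 1]
    this bounds [m]; when [1] is outside [[u1, K]], the conditions at the ends of the range take
    over. It follows that blocking does occur, so the infimum in [critical_value] is over a nonempty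
    set. *)
Lemma passing_bounded (m : R) : passing k A kf ks C m -> m < 1 + C / ks.
Proof.
  intros (u1 & K & M & d0 & f & df & Hu & Hd0 & Df & _ & Hgap & Hsup & HfK & _ & Hu1).
  assert (Hl : forall u, u1 <= u <= K -> 0 < f u - u / ks - m / kf).
  { apply (stay_pos_left (fun u => f u - u / ks - m / kf) (fun u => df u - 1 / ks - 0)).
    - pose proof (inv_pow_pos k K ltac:(lra)).
      assert (0 < C * / K ^ k / A) by (apply Rdiv_lt_0_compat; [apply Rmult_lt_0_compat|]; lra).
      lra.
    - intros t Ht. apply (is_derive_minus (fun u => f u - u / ks) (fun _ => m / kf));
        [|apply (is_derive_const (m / kf) t)].
      apply (is_derive_minus f (fun u => u / ks)); [apply Df, Ht|].
      auto_derive; [exact I | field; lra].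
    - intros t Ht _ Hz. specialize (Hgap t ltac:(lra)). specialize (Hsup t ltac:(lra)).
      assert (Ef : f t = t / ks + m / kf) by lra.
      assert (EP : nullcline k A C t - A * f t = ks * (t - m) + C * / t ^ k).
      { rewrite Ef. unfold nullcline. rewrite HA1, HA. fld. }
      set (p := nullcline k A C t - A * f t) in *.
      pose proof (inv_pow_pos k t ltac:(lra)).
      assert (df t * p < 1 / ks * p).
      { apply Rle_lt_trans with (t - m); [exact Hsup|].
        replace (1 / ks * p) with (t - m + C * / t ^ k / ks) by (rewrite EP; fld).
        assert (0 < C * / t ^ k / ks) by (apply Rdiv_lt_0_compat; [apply Rmult_lt_0_compat|]; lra). lra. }
      apply Rmult_lt_reg_r in H0; lra. }
  assert (HAf : forall u, u1 <= u <= K -> kf * u + ks * m < A * f u).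
  { intros u Hu'. specialize (Hl u Hu').
    replace (kf * u + ks * m) with (A * (u / ks + m / kf)) by (rewrite HA; field; lra). nra. }
  assert (Hgoal : ks * m < ks + C -> m < 1 + C / ks).
  { intros H. apply Rmult_lt_reg_l with ks; [lra|].
    replace (ks * (1 + C / ks)) with (ks + C) by (fld). exact H. }
  apply Hgoal.
  destruct (Rlt_le_dec 1 u1) as [H1|H1].
  - specialize (HAf u1 ltac:(lra)).
    pose proof (inv_pow_le k 1 u1 ltac:(lra)) as Hi. rewrite pow1, Rinv_1 in Hi.
    pose proof (Rabs_pos m). assert (0 <= 2 * A * Rabs m * u1) by (repeat apply Rmult_le_pos; lra).
    nra.
  - destruct (Rlt_le_dec K 1) as [H2|H2].
    + specialize (HAf K ltac:(lra)). specialize (Hgap K ltac:(lra)).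
      unfold nullcline in Hgap. rewrite HA1 in Hgap.
      assert (A * (K / ks + m / kf + C * / K ^ k / A) <= A * f K) by (apply Rmult_le_compat_l; lra).
      replace (A * (K / ks + m / kf + C * / K ^ k / A)) with (kf * K + ks * m + C * / K ^ k) in H
        by (rewrite HA; fld).
      nra.
    + specialize (HAf 1 ltac:(lra)). specialize (Hgap 1 ltac:(lra)).
      unfold nullcline in Hgap. rewrite pow1, Rinv_1, HA1 in Hgap. nra.
Qed.

(** For small [m] a subsolution followed down from [K] keeps a gap of at least [d] to the nullcline
    and so cannot meet it at [us]. The bound being uniform, the critical value is strictly positive,
    which yields the signs of [etaL0] and [etaR0]. *)
Lemma blocking_positive : exists m0, 0 < m0 /\ forall m, blocking k A kf ks C m -> m0 <= m.
Proof.
  (* Left of [u2] the tail term is so steep that [G] lies above a line of slope [-1], and this line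
     serves as barrier there. The barrier to the right of [u2] relies on [u - m] being bounded
     below, which fails near [0]. *)
  destruct (Rinv_pow_eventually_large (2 + A)) as (u2 & Hu2 & HCu2).
  set (mn := Rmin ks C). assert (Hmn : 0 < mn) by (apply Rmin_glb_lt; lra).
  pose proof (Rmin_l ks C) as Hmn1. pose proof (Rmin_r ks C) as Hmn2. fold mn in Hmn1, Hmn2.
  set (d := Rmin (mn / 4) (A * u2 / (4 * (1 + A)))).
  assert (Hd : 0 < d).
  { apply Rmin_glb_lt; [lra|]. apply Rdiv_lt_0_compat; [apply Rmult_lt_0_compat|]; lra. }
  pose proof (Rmin_l (mn / 4) (A * u2 / (4 * (1 + A)))) as Hd1.
  pose proof (Rmin_r (mn / 4) (A * u2 / (4 * (1 + A)))) as Hd2. fold d in Hd1, Hd2.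
  assert (Hd2' : (1 + A) * d <= A * u2 / 4).
  { apply Rmult_le_compat_l with (r := 1 + A) in Hd2; [|lra].
    replace ((1 + A) * (A * u2 / (4 * (1 + A)))) with (A * u2 / 4) in Hd2 by (fld). exact Hd2. }
  set (m0 := Rmin (u2 / 4) (Rmin (mn / (4 * ks)) (d / (2 * A)))).
  assert (Hm0 : 0 < m0).
  { repeat apply Rmin_glb_lt; [lra| |]; apply Rdiv_lt_0_compat; lra. }
  exists m0. split; [exact Hm0|]. intros m (us & K & M & g & dg & Hus & Dg & _ & Hgus & Hsub & HgK).
  apply Rnot_lt_le. intro Hm.
  assert (Hm1 : m < u2 / 4) by (eapply Rlt_le_trans; [exact Hm | apply Rmin_l]).
  assert (Hm2 : ks * m < mn / 4).
  { assert (m < mn / (4 * ks)).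
    { eapply Rlt_le_trans; [exact Hm|]. eapply Rle_trans; [apply Rmin_r | apply Rmin_l]. }
    apply Rmult_lt_compat_l with (r := ks) in H; [|lra].
    replace (ks * (mn / (4 * ks))) with (mn / 4) in H by (fld). exact H. }
  assert (Hm3 : A * m < d / 2).
  { assert (m < d / (2 * A)).
    { eapply Rlt_le_trans; [exact Hm|]. eapply Rle_trans; [apply Rmin_r | apply Rmin_r]. }
    apply Rmult_lt_compat_l with (r := A) in H; [|lra].
    replace (A * (d / (2 * A))) with (d / 2) in H by (fld). exact H. }
  assert (HAg : A * g K < kf * K + ks * m).
  { replace (A * g K) with (ks * (kf * (g K - K / ks)) + kf * K) by (rewrite HA; field; lra). nra. }
  assert (HKC : mn <= ks * K + C * / K ^ k).
  { pose proof (inv_pow_pos k K ltac:(lra)). destruct (Rle_lt_dec 1 K); [nra|].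
    pose proof (inv_pow_le k K 1 ltac:(lra)) as Hi. rewrite pow1, Rinv_1 in Hi. nra. }
  assert (Phase1 : forall u, Rmax us u2 <= u <= K -> 0 < G u - A * g u - d).
  { intros u Hu.
    apply (stay_pos_left (fun u => G u - A * g u - d)
      (fun u => (1 + A) - C * (INR k * / u ^ (k + 1)) - A * dg u - 0) (Rmax us u2) K); [| | |exact Hu].
    - unfold G, nullcline. rewrite HA1. nra.
    - intros t Ht. pose proof (Rmax_l us u2).
      apply (is_derive_minus (fun u => G u - A * g u) (fun _ => d));
        [|apply (is_derive_const d t)].
      apply is_derive_gap; [lra | apply Dg; lra].
    - intros t Ht _ Hz. pose proof (Rmax_l us u2). pose proof (Rmax_r us u2).
      specialize (Hsub t ltac:(lra)). fold G in Hsub.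
      replace (G t - A * g t) with d in Hsub by lra.
      pose proof (dG_le t ltac:(lra)).
      assert (1 + A < A * dg t); [|lra].
      apply Rmult_lt_reg_r with d; [exact Hd|].
      apply Rle_lt_trans with (A * u2 / 4); [exact Hd2'|].
      replace (A * dg t * d) with (A * (dg t * d)) by ring. nra. }
  destruct (Rle_lt_dec u2 us) as [H|H].
  - specialize (Phase1 us). rewrite Rmax_left in Phase1 by lra. specialize (Phase1 ltac:(lra)).
    fold G in Hgus. lra.
  - set (b := Rmin u2 K). assert (Hb : us < b <= K /\ b <= u2).
    { unfold b. split; [split; [apply Rmin_glb_lt; lra | apply Rmin_r] | apply Rmin_l]. }
    assert (Line : forall u, 0 < u <= u2 -> G u2 + (u2 - u) <= G u).
    { intros u Hu. unfold G, nullcline.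
      destruct k as [|j] eqn:Ek; [lia|].
      assert (Hj : / u2 ^ j <= / u ^ j) by (apply inv_pow_le; lra).
      pose proof (inv_pow_pos j u2 ltac:(lra)) as Hj0.
      assert (HE : / u = / u2 + (u2 - u) * (/ u * / u2)) by (fld).
      simpl pow in *. rewrite !Rinv_mult in *.
      assert (Hi2 : 2 <= / u2).
      { apply Rmult_le_reg_r with u2; [lra|]. rewrite Rinv_l; lra. }
      assert (Hii : / u2 <= / u) by (apply Rinv_le_contravar; lra).
      assert (H1 : (u2 - u) * (2 + A) <= C * (/ u * / u ^ j) - C * (/ u2 * / u2 ^ j)).
      { apply Rle_trans with (C * ((/ u - / u2) * / u2 ^ j)).
        - rewrite HE. replace (C * ((/ u2 + (u2 - u) * (/ u * / u2) - / u2) * / u2 ^ j))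
            with ((u2 - u) * (C * (/ u2 * / u2 ^ j) * / u)) by ring.
          apply Rmult_le_compat_l; [lra|].
          rewrite <- (Rmult_1_r (2 + A)). apply Rmult_le_compat; lra.
        - rewrite <- Rmult_minus_distr_l. apply Rmult_le_compat_l; [lra|].
          rewrite Rmult_minus_distr_r. apply Rplus_le_compat_r, Rmult_le_compat_l; lra. }
      lra. }
    assert (Hq : 0 < G u2 + (u2 - us) - d - A * g us).
    { apply (stay_pos_left (fun u => G u2 + (u2 - u) - d - A * g u) (fun u => -1 - A * dg u) us b);
        [| | |lra].
      - unfold b. destruct (Rle_lt_dec u2 K) as [HK|HK].
        + rewrite Rmin_left by exact HK. specialize (Phase1 u2).
          rewrite Rmax_right in Phase1 by lra. specialize (Phase1 ltac:(lra)). lra.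
        + rewrite Rmin_right by lra. unfold G, nullcline. rewrite HA1.
          pose proof (inv_pow_le k u2 1 ltac:(lra)) as Hi. rewrite pow1, Rinv_1 in Hi.
          apply Rmult_le_compat_l with (r := C) in Hi; [|lra].
          assert (kf * K <= kf * u2) by (apply Rmult_le_compat_l; lra).
          assert (0 < ks * u2) by (apply Rmult_lt_0_compat; lra). lra.
      - intros t Ht. apply (is_derive_minus (fun u => G u2 + (u2 - u) - d) (fun u => A * g u)).
        + auto_derive; [exact I | ring].
        + apply (is_derive_scal g t A), Dg. lra.
      - intros t Ht _ Hz. specialize (Hsub t ltac:(lra)). specialize (Line t ltac:(lra)).
        fold G in Hsub. assert (d <= G t - A * g t) by lra.
        apply Rnot_le_lt. intro Hdg.
        assert (dg t * (G t - A * g t) <= dg t * d) by (apply Rmult_le_compat_neg_l; nra).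
        assert (A * dg t * d <= -1 * d) by (apply Rmult_le_compat_r; lra).
        assert (A * (t - m) <= A * (dg t * d)) by (apply Rmult_le_compat_l; lra).
        assert (0 < A * t) by (apply Rmult_lt_0_compat; lra). lra. }
    specialize (Line us ltac:(lra)). fold G in Hgus. lra.
Qed.

(** [mc] is the infimum of the blocking values, obtained as minus the supremum of their negatives.
    Below it the dichotomy for two values between [m] and [mc] can only end in passing; above it the
    infimum property applies. The strict room between [m] and [m'] is what the perturbed system
    consumes. *)
Lemma critical_value : exists mc, 0 < mc /\
  (forall m, m < mc -> exists m', m < m' /\ passing k A kf ks C m') /\
  (forall m, mc < m -> exists m', m' < m /\ blocking k A kf ks C m').
Proof.
  destruct blocking_positive as (m0 & Hm0 & Hbl).
  destruct (completeness (fun x => blocking k A kf ks C (- x))) as [x [Hx1 Hx2]].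
  - exists (- m0). intros x Hx. specialize (Hbl _ Hx). lra.
  - exists (- (2 + C / ks)). rewrite Ropp_involutive.
    destruct (passing_or_blocking (1 + C / ks) (2 + C / ks)) as [H|H]; [lra| |exact H].
    apply passing_bounded in H. lra.
  - exists (- x). split; [|split].
    + assert (x <= - m0); [|lra]. apply Hx2. intros y Hy. specialize (Hbl _ Hy). lra.
    + intros m Hm.
      destruct (passing_or_blocking (m + (- x - m) / 3) (m + 2 * (- x - m) / 3)) as [H|H]; [lra| |].
      * exists (m + (- x - m) / 3). split; [lra | exact H].
      * exfalso. assert (- (m + 2 * (- x - m) / 3) <= x); [|lra].
        apply Hx1. rewrite Ropp_involutive. exact H.
    + intros m Hm. apply NNPP. intro N.
      assert (x <= - m); [|lra]. apply Hx2. intros y Hy.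
      apply Rnot_lt_le. intro. apply N. exists (- y). split; [lra | exact Hy].
Qed.

End Limit.

(** * The two half systems *)

Definition eventually0 (P : R -> Prop) : Prop :=
  exists e0, 0 < e0 /\ forall e, 0 < e < e0 -> P e.

Lemma eventually0_and (P Q : R -> Prop) :
  eventually0 P -> eventually0 Q -> eventually0 (fun e => P e /\ Q e).
Proof.
  intros (a & Ha & HP) (b & Hb & HQ). exists (Rmin a b). split; [apply Rmin_glb_lt; assumption|].
  intros e He. pose proof (Rmin_l a b). pose proof (Rmin_r a b). split; [apply HP | apply HQ]; lra.
Qed.

Lemma eventually0_impl (P Q : R -> Prop) :
  eventually0 P -> (forall e, 0 < e -> P e -> Q e) -> eventually0 Q.
Proof. intros (a & Ha & HP) H. exists a. split; [exact Ha|]. intros e He. apply H, HP; lra. Qed.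

(** Both sides of the switching line, in one set of coordinates: [U >= 0] is the distance to the
    line and [W] the height [x + y] measured from the node ([sg = 1], [A = alpha] on the left;
    [sg = -1], [A = alpha + beta] on the right). [psi e] is the tail of the sigmoid and [y] has
    become [1 / A - sg * (W - U)]. *)
Definition field_U (A beta sg : R) (psi : R -> R) (U W : R) : R :=
  A * W - (1 + A) * U - beta * psi U * (1 / A - sg * (W - U)).

Definition field_W (mu m0 U W : R) : R := m0 - ((1 - mu) * U + mu * W).

Definition half_solution (A beta sg : R) (psi : R -> R) (mu m0 : R) (U W : R -> R) (a : R) : Prop :=
  forall t, a <= t ->
    is_derive U t (field_U A beta sg psi (U t) (W t)) /\ is_derive W t (field_W mu m0 (U t) (W t)).

(** The properties of the sigmoid that the planar analysis uses, for both tails at once. The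
    asymptotics hold on [u >= u1] and the Lipschitz bound on [U >= U1], neither uniformly up to the
    line; close to the line only range and monotonicity are available. *)
Record tail_family (k : nat) (c psi0 : R) (dl : R -> R) (psi : R -> R -> R) : Prop := {
  tail_dl_pos : forall e, 0 < e -> 0 < dl e;
  tail_dl_small : forall x, 0 < x -> eventually0 (fun e => dl e < x);
  tail_psi0 : psi0 < 1;
  tail_range : forall e U, 0 < e -> 0 <= U -> 0 < psi e U <= psi0;
  tail_decreasing : forall e U V, 0 < e -> 0 <= U <= V -> psi e V <= psi e U;
  tail_asymptotics : forall u1 x, 0 < u1 -> 0 < x -> eventually0 (fun e =>
    forall u, u1 <= u -> Rabs (psi e (dl e * u) / dl e * u ^ k - c) <= x);
  tail_lipschitz : forall U1, 0 < U1 -> exists L, 0 < L /\ eventually0 (fun e =>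
    forall U V, U1 <= U -> U1 <= V -> Rabs (psi e U - psi e V) <= L * Rabs (U - V)) }.

(** The solution of the limit [eps = 0] that enters at [U = 0], [W = R0]. *)
Definition lin_U (kf ks R0 t : R) : R := kf * ks * R0 * (exp (- ks * t) - exp (- kf * t)) / (kf - ks).
Definition lin_W (kf ks R0 t : R) : R := R0 * (kf * exp (- ks * t) - ks * exp (- kf * t)) / (kf - ks).

Lemma lin_U_pos (kf ks R0 t : R) : 0 < ks < kf -> 0 < R0 -> 0 < t -> 0 < lin_U kf ks R0 t.
Proof.
  intros Hk HR Ht. unfold lin_U.
  assert (exp (- kf * t) < exp (- ks * t)) by (apply exp_increasing, Rmult_lt_compat_r; lra).
  apply Rdiv_lt_0_compat; [|lra]. repeat apply Rmult_lt_0_compat; lra.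
Qed.

Lemma exp_eventually_small (r x : R) : 0 < r -> 0 < x -> exists t, 1 <= t /\ exp (- r * t) <= x.
Proof.
  intros Hr Hx. exists (Rmax 1 (- ln x / r)). split; [apply Rmax_l|].
  rewrite <- (exp_ln x) at 2 by exact Hx. apply exp_le.
  pose proof (Rmax_r 1 (- ln x / r)) as M. apply Rmult_le_compat_l with (r := r) in M; [|lra].
  replace (r * (- ln x / r)) with (- ln x) in M by (field; lra). lra.
Qed.

Lemma tail_upper (k : nat) (c psi0 : R) (dl : R -> R) (psi : R -> R -> R) :
  tail_family k c psi0 dl psi -> forall u1, 0 < u1 ->
  eventually0 (fun e => forall u, u1 <= u -> psi e (dl e * u) <= dl e * ((c + 1) * / u ^ k)).
Proof.
  intros T u1 Hu1. eapply eventually0_impl; [apply (tail_asymptotics _ _ _ _ _ T u1 1); lra|].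
  intros e He H u Hu. specialize (H u Hu). simpl in H. apply Rabs_le_between in H.
  pose proof (tail_dl_pos _ _ _ _ _ T e He) as Hd. pose proof (pow_lt u k ltac:(lra)) as Hp.
  pose proof (inv_pow_pos k u ltac:(lra)) as Hip.
  replace (psi e (dl e * u)) with (dl e * (psi e (dl e * u) / dl e * u ^ k * / u ^ k)) by (fld).
  apply Rmult_le_compat_l; [lra|]. apply Rmult_le_compat_r; lra.
Qed.

Section Trap.
Variables (k : nat) (A kf ks beta sg c psi0 : R) (dl : R -> R) (psi : R -> R -> R).
Hypothesis Hks : 0 < ks < kf.
Hypothesis HA : A = kf * ks.
Hypothesis HA1 : 1 + A = kf + ks.
Hypothesis Hbeta : 0 < beta.
Hypothesis Hc : 0 < c.
Hypothesis Hsg : sg = 1 \/ sg = -1.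
Hypothesis HT : tail_family k c psi0 dl psi.

Let C := beta * c / A.

Let A_pos : 0 < A.
Proof. rewrite HA. apply Rmult_lt_0_compat; lra. Qed.

(** [ks * W - U] and [kf * W - U] are eigencoordinates of the linear part, with rates [kf] and [ks];
    the tail, [m0] and [mu] enter as forcing. The first one vanishes on the slow direction
    [U = ks * W]. *)
Lemma fast_derive (mu m0 e U W : R) :
  ks * field_W mu m0 U W - field_U A beta sg (psi e) U W =
  - kf * (ks * W - U) + beta * psi e U * (1 / A - sg * (W - U)) + ks * (m0 - mu * (W - U)).
Proof.
  unfold field_W, field_U. replace (1 + A) with (kf + ks) by lra.
  replace (A * W) with (kf * ks * W) by (rewrite HA; ring). ring.
Qed.

Lemma slow_derive (mu m0 e U W : R) :
  kf * field_W mu m0 U W - field_U A beta sg (psi e) U W =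
  - ks * (kf * W - U) + beta * psi e U * (1 / A - sg * (W - U)) + kf * (m0 - mu * (W - U)).
Proof.
  unfold field_W, field_U. replace (1 + A) with (kf + ks) by lra.
  replace (A * W) with (kf * ks * W) by (rewrite HA; ring). ring.
Qed.

Lemma is_derive_combination (U W : R -> R) (q t u r : R) :
  is_derive U t u -> is_derive W t r -> is_derive (fun s => q * W s - U s) t (q * r - u).
Proof.
  intros HU HR. apply (is_derive_minus (fun s => q * W s) U); [apply (is_derive_scal W t q), HR | exact HU].
Qed.

Let small_factor (K x : R) : 0 <= K -> 0 < x -> exists y, 0 < y /\ K * y <= x.
Proof.
  intros HK Hx. exists (x / (K + 1)). split; [apply Rdiv_lt_0_compat; lra|].
  apply Rmult_le_reg_r with (K + 1); [lra|].
  replace (K * (x / (K + 1)) * (K + 1)) with (K * x) by (field; lra). lra.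
Qed.

Let sg_abs (x Y : R) : Rabs x <= Y -> - Y <= sg * x <= Y.
Proof. intros H. apply Rabs_le_between in H. destruct Hsg as [-> | ->]; lra. Qed.

(** The half plane and one bound on each eigencoordinate cut out a triangle, because the two
    eigendirections differ; its diameter is of order [nu]. *)
Let trap_bounds (d b nu Y U W : R) : 0 < d -> 0 <= U ->
  d * ((1 + A) * (1 + Rabs b)) <= nu -> 4 * (1 + ks) * nu <= (kf - ks) * Y ->
  0 <= ks * W - U - ks * d * b -> 0 <= nu - (kf * W - U) -> Rabs (W - U) <= Y.
Proof.
  intros Hd HU Hnu HY Hf Hs. set (D := d * Rabs b).
  assert (HD0 : 0 <= D) by (unfold D; pos).
  assert (HDb : - D <= d * b).
  { unfold D. rewrite Ropp_mult_distr_r. apply Rmult_le_compat_l; [lra|].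
    pose proof (Rle_abs (- b)) as H. rewrite Rabs_Ropp in H. lra. }
  assert (HD1 : (kf + ks) * D <= nu).
  { rewrite <- HA1. assert (0 <= d * (1 + A)) by pos. unfold D. lra. }
  assert (0 <= kf * D) by pos. assert (0 <= ks * D) by pos.
  assert (Hksb : - (ks * D) <= ks * d * b).
  { rewrite Rmult_assoc, Ropp_mult_distr_r. apply Rmult_le_compat_l; lra. }
  assert (Hnu0 : 0 <= nu) by lra.
  assert (HkY : (1 + ks) * (4 * D) <= (1 + ks) * Y).
  { apply Rmult_le_reg_l with (kf - ks); [lra|].
    assert (0 <= (1 + ks) * (4 * (nu - (kf - ks) * D))) by pos.
    assert (0 <= ks * ((kf - ks) * Y)).
    { apply Rmult_le_pos; [lra|]. assert (0 <= 4 * (1 + ks) * nu) by pos. lra. }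
    lra. }
  apply Rmult_le_reg_l in HkY; [|lra].
  assert (0 <= ks * nu) by pos.
  assert (HW : (kf - ks) * W <= (kf - ks) * (Y / 2)) by lra.
  apply Rmult_le_reg_l in HW; [|lra].
  assert (HU' : (kf - ks) * U <= (kf - ks) * (Y / 2)).
  { assert (ks * (kf * W - U) <= ks * nu) by (apply Rmult_le_compat_l; lra).
    assert (kf * - (ks * D) <= kf * (ks * W - U)) by (apply Rmult_le_compat_l; lra).
    assert (A * D <= nu) by (rewrite <- HA1 in HD1; lra).
    rewrite HA in *. lra. }
  apply Rmult_le_reg_l in HU'; [|lra].
  assert (HW' : ks * - D <= ks * W) by lra.
  apply Rmult_le_reg_l in HW'; [|lra].
  apply Rabs_le. lra.
Qed.

(** The trap has four walls: [U >= d * us], a lower wall for the fast eigencoordinate, an upper wall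
    for the slow one, and the scaled graph of the subsolution raised by [h]. Wherever a wall is
    attained the motion is strictly inwards, because [m - m'] leaves room for the tail error and for
    [mu]. The linear orbit from [R0] is inside at time [t0], and membership excludes [U = 0] for
    ever. *)
Lemma trapping (m' m mu1 R0 : R) : 0 < R0 -> 0 <= mu1 -> m' < m -> blocking k A kf ks C m' ->
  exists t0 rad th : R, 0 < t0 /\ 0 < rad /\ 0 < th /\
  eventually0 (fun e => forall m0 U W a, dl e * m <= m0 <= th ->
    half_solution A beta sg (psi e) (dl e * mu1) m0 U W a ->
    Rabs (U a - lin_U kf ks R0 t0) <= rad -> Rabs (W a - lin_W kf ks R0 t0) <= rad ->
    forall t, a <= t -> 0 < U t).
Proof.
  intros HR0 Hmu1 Hm (us & K & M & g & dg & Hus & Dg & Mdg & Hgus & Hsub & HgK).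
  set (et := m - m'). assert (Het : 0 < et) by (unfold et; lra).
  assert (HM : 0 <= M) by (eapply Rle_trans; [apply Rabs_pos | apply (Mdg us); lra]).
  (* Raising the graph by [h] gives a strict inequality at [us], where the subsolution may only just
     meet the nullcline; [h] is small against the slack [et]. *)
  destruct (small_factor (A * M + kf) (et / 4)) as (h & Hh & Hh'); [pos|lra|].
  assert (HAM : 0 <= A * M * h) by (apply Rmult_le_pos; [apply Rmult_le_pos|]; lra).
  assert (Hkh : 0 < kf * h) by (apply Rmult_lt_0_compat; lra).
  assert (HhM : A * M * h <= et / 4) by lra.
  assert (Hhk : kf * h <= et / 4) by lra.
  (* [kf * b] lies halfway between [m'] and [m]: the fast wall [ks * d * b] is below the equilibrium
     of the fast coordinate and, at [U = d * K], above the raised graph. *)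
  set (b := m' / kf + et / (2 * kf)).
  assert (Hb : kf * b = m - et / 2) by (unfold b, et; field; lra).
  assert (HgKb : g K + h < K / ks + b).
  { apply Rmult_lt_reg_l with kf; [lra|]. unfold et in *.
    replace (kf * (g K + h)) with (kf * (g K - K / ks) + kf * (K / ks) + kf * h) by ring. lra. }
  set (z := beta * (c + 1) * / us ^ k).
  assert (Hz : 0 < z) by (unfold z; pose proof (inv_pow_pos k us ltac:(lra)); repeat apply Rmult_lt_0_compat; lra).
  (* [Y] will bound [Rabs (W - U)] inside the trap, which keeps [y] near [1 / A] and makes the [mu]
     term harmless. *)
  destruct (small_factor (z * (1 + M) + (1 + mu1) + A)
    (Rmin (Rmin (A * h / 4) (et / 8)) (1 / 2))) as (Y & HY & HY').
  { pos. }
  { pos. }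
  assert (HYa : z * Y <= A * h / 4 /\ M * (z * Y) <= et / 8 /\ mu1 * Y <= et / 8 /\ A * Y <= 1 / 2).
  { pose proof (Rmin_l (Rmin (A * h / 4) (et / 8)) (1 / 2)).
    pose proof (Rmin_r (Rmin (A * h / 4) (et / 8)) (1 / 2)).
    pose proof (Rmin_l (A * h / 4) (et / 8)). pose proof (Rmin_r (A * h / 4) (et / 8)).
    assert (0 <= z * Y) by pos. assert (0 <= M * (z * Y)) by pos.
    assert (0 <= mu1 * Y) by pos. assert (0 < A * Y) by pos.
    replace ((z * (1 + M) + (1 + mu1) + A) * Y) with (z * Y + M * (z * Y) + Y + mu1 * Y + A * Y) in HY' by ring.
    repeat split; lra. }
  destruct HYa as (HY1 & HY2 & HY3 & HY4). clear HY'.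
  destruct (small_factor (beta / A * / us ^ k * (1 + M)) (Rmin (A * h / 4) (et / 8))) as (x & Hx & Hx').
  { pose proof (inv_pow_pos k us ltac:(lra)). assert (0 < beta / A) by (apply Rdiv_lt_0_compat; lra).
    apply Rmult_le_pos; [apply Rmult_le_pos|]; lra. }
  { pos. }
  set (w := beta / A * / us ^ k) in *.
  assert (Hw : 0 < w).
  { unfold w. pose proof (inv_pow_pos k us ltac:(lra)). assert (0 < beta / A) by (apply Rdiv_lt_0_compat; lra).
    apply Rmult_lt_0_compat; lra. }
  assert (Hxa : w * x <= A * h / 4 /\ M * (w * x) <= et / 8).
  { pose proof (Rmin_l (A * h / 4) (et / 8)). pose proof (Rmin_r (A * h / 4) (et / 8)).
    assert (0 <= w * x) by pos. assert (0 <= M * (w * x)) by pos.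
    replace (w * (1 + M) * x) with (w * x + M * (w * x)) in Hx' by ring. split; lra. }
  destruct Hxa as (Hx1 & Hx2). clear Hx'.
  destruct (small_factor (4 * (1 + ks) / (kf - ks)) Y) as (nu & Hnu & HnuY).
  { apply Rdiv_le_0_compat; lra. }
  { exact HY. }
  assert (HnuY' : 4 * (1 + ks) * nu <= (kf - ks) * Y).
  { apply Rmult_le_compat_l with (r := kf - ks) in HnuY; [|lra].
    replace ((kf - ks) * (4 * (1 + ks) / (kf - ks) * nu)) with (4 * (1 + ks) * nu) in HnuY by (field; lra).
    exact HnuY. }
  (* At [t0] the slow coordinate of the linear orbit is at most [nu / 2], while its fast coordinate
     is still positive; both inequalities survive a change of size [rad]. *)
  destruct (exp_eventually_small ks (nu / (2 * kf * R0))) as (t0 & Ht0 & Ht0');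
    [lra | pos |].
  set (Uq := lin_U kf ks R0 t0). set (Rq := lin_W kf ks R0 t0).
  assert (HUq : 0 < Uq) by (apply lin_U_pos; lra).
  assert (HWf : ks * Rq - Uq = ks * R0 * exp (- kf * t0)) by (unfold Uq, Rq, lin_U, lin_W; field; lra).
  assert (HWs : kf * Rq - Uq = kf * R0 * exp (- ks * t0)) by (unfold Uq, Rq, lin_U, lin_W; field; lra).
  assert (HWf0 : 0 < ks * Rq - Uq).
  { rewrite HWf. pose proof (exp_pos (- kf * t0)). repeat apply Rmult_lt_0_compat; lra. }
  assert (HWs0 : kf * Rq - Uq <= nu / 2).
  { rewrite HWs. apply Rmult_le_compat_l with (r := kf * R0) in Ht0'; [|pos].
    replace (kf * R0 * (nu / (2 * kf * R0))) with (nu / 2) in Ht0' by (field; lra). exact Ht0'. }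
  destruct (small_factor (kf + ks + 1) (Rmin (Rmin (nu / 4) ((ks * Rq - Uq) / 2)) (Uq / 2)))
    as (rad & Hrad & Hrad'); [lra | repeat apply Rmin_glb_lt; lra |].
  assert (Hrada : (kf + 1) * rad <= nu / 4 /\ (ks + 1) * rad <= (ks * Rq - Uq) / 2 /\ rad <= Uq / 2).
  { pose proof (Rmin_l (Rmin (nu / 4) ((ks * Rq - Uq) / 2)) (Uq / 2)).
    pose proof (Rmin_r (Rmin (nu / 4) ((ks * Rq - Uq) / 2)) (Uq / 2)).
    pose proof (Rmin_l (nu / 4) ((ks * Rq - Uq) / 2)). pose proof (Rmin_r (nu / 4) ((ks * Rq - Uq) / 2)).
    assert ((kf + ks + 1) * rad = (kf + 1) * rad + ks * rad) by ring.
    assert ((kf + ks + 1) * rad = (ks + 1) * rad + kf * rad) by ring.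
    assert ((kf + ks + 1) * rad = rad + (ks + kf) * rad) by ring.
    assert (0 < kf * rad) by pos. assert (0 < ks * rad) by pos. repeat split; lra. }
  destruct Hrada as (Hr1 & Hr2 & Hr3).
  (* Admissible drift, of the size of the trap and not of [d]: the slow wall at [nu] tolerates every
     [m0 <= th]. This bound later becomes the neighborhood of [eta = 1]. *)
  set (th := ks * nu / (4 * kf)).
  assert (Hth : 0 < th) by (unfold th; pos).
  assert (Hkth : kf * th = ks * nu / 4) by (unfold th; field; lra).
  exists t0, rad, th. split; [lra|]. split; [exact Hrad|]. split; [exact Hth|].
  set (dmax := Rmin (Rmin (nu / ((1 + A) * (1 + Rabs b))) ((ks * Rq - Uq) / (2 * ks * (1 + Rabs b))))
         (Rmin (Uq / (4 * K)) (ks * nu / (8 * (z * (1 / A + Y) + kf * mu1 * Y + 1))))).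
  pose proof (Rabs_pos b) as Hb0.
  assert (HAY : 0 < 1 / A) by (apply Rdiv_lt_0_compat; lra).
  assert (Hzz : 0 <= z * (1 / A + Y) + kf * mu1 * Y).
  { assert (0 <= z * (1 / A + Y)) by (apply Rmult_le_pos; lra).
    assert (0 <= kf * mu1 * Y) by (repeat apply Rmult_le_pos; lra). lra. }
  assert (Hdmax : 0 < dmax) by (unfold dmax; pos).
  eapply eventually0_impl.
  { apply eventually0_and; [apply (tail_dl_small _ _ _ _ _ HT dmax Hdmax)|].
    apply eventually0_and; [apply (tail_upper _ _ _ _ _ HT us); lra|].
    apply (tail_asymptotics _ _ _ _ _ HT us x); lra. }
  intros e He (Hdl & Hup & Has) m0 U W a Hm0 Hsol HUa HRa. simpl in Has.
  set (d := dl e) in *.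
  assert (Hd : 0 < d) by apply (tail_dl_pos _ _ _ _ _ HT e He).
  assert (Hd1 : d * ((1 + A) * (1 + Rabs b)) <= nu).
  { assert (d <= nu / ((1 + A) * (1 + Rabs b))).
    { left. eapply Rlt_le_trans; [exact Hdl|]. eapply Rle_trans; [apply Rmin_l | apply Rmin_l]. }
    apply Rmult_le_compat_r with (r := (1 + A) * (1 + Rabs b)) in H; [|pos].
    replace (nu / ((1 + A) * (1 + Rabs b)) * ((1 + A) * (1 + Rabs b))) with nu in H by (field; lra). exact H. }
  assert (Hd2 : 2 * ks * (d * (1 + Rabs b)) <= ks * Rq - Uq).
  { assert (d <= (ks * Rq - Uq) / (2 * ks * (1 + Rabs b))).
    { left. eapply Rlt_le_trans; [exact Hdl|]. eapply Rle_trans; [apply Rmin_l | apply Rmin_r]. }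
    apply Rmult_le_compat_r with (r := 2 * ks * (1 + Rabs b)) in H; [|pos].
    replace ((ks * Rq - Uq) / (2 * ks * (1 + Rabs b)) * (2 * ks * (1 + Rabs b))) with (ks * Rq - Uq) in H
      by (field; lra). lra. }
  assert (Hd3 : d * K <= Uq / 4).
  { assert (d <= Uq / (4 * K)).
    { left. eapply Rlt_le_trans; [exact Hdl|]. eapply Rle_trans; [apply Rmin_r | apply Rmin_l]. }
    apply Rmult_le_compat_r with (r := K) in H; [|lra].
    replace (Uq / (4 * K) * K) with (Uq / 4) in H by (field; lra). exact H. }
  assert (Hd4 : d * (z * (1 / A + Y) + kf * mu1 * Y) <= ks * nu / 8).
  { assert (d <= ks * nu / (8 * (z * (1 / A + Y) + kf * mu1 * Y + 1))).
    { left. eapply Rlt_le_trans; [exact Hdl|]. eapply Rle_trans; [apply Rmin_r | apply Rmin_r]. }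
    set (zz := z * (1 / A + Y) + kf * mu1 * Y) in *.
    apply Rmult_le_compat_r with (r := zz + 1) in H; [|lra].
    replace (ks * nu / (8 * (zz + 1)) * (zz + 1)) with (ks * nu / 8) in H by (field; lra). lra. }
  clear Hdl. clearbody dmax.
  (* Beyond [K] the raised subsolution is continued by a constant; there the fast wall is higher, so
     this part of the graph is never touched. *)
  set (gh := fun u => g (Rmin u K) + h).
  set (P := fun t => 0 <= U t - d * us /\ 0 <= ks * W t - U t - ks * d * b /\
                     0 <= nu - (kf * W t - U t) /\ 0 <= W t - d * gh (U t / d)).
  pose proof (Rle_abs b) as Hbb. pose proof (Rle_abs (- b)) as Hbb'. rewrite Rabs_Ropp in Hbb'.
  assert (HPY : forall t, P t -> Rabs (W t - U t) <= Y).
  { intros t (P1 & P2 & P3 & _).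
    assert (0 < d * us) by pos.
    apply trap_bounds with d b nu; lra. }
  assert (HcontP : forall t, 0 <= U t - d * us -> a <= t -> continuity_pt (fun s => W s - d * gh (U s / d)) t).
  { intros t P1 Ht. destruct (Hsol t Ht) as [DU DR].
    apply continuity_pt_minus; [eapply is_derive_continuity_pt, DR|].
    apply (continuity_pt_mult (fun _ => d)); [apply continuity_pt_const; intros ? ?; reflexivity|].
    apply (continuity_pt_comp (fun s => U s / d) gh).
    - apply (continuity_pt_mult U (fun _ => / d)); [eapply is_derive_continuity_pt, DU|].
      apply continuity_pt_const; intros ? ?; reflexivity.
    - apply continuity_pt_plus; [|apply continuity_pt_const; intros ? ?; reflexivity].
      apply (continuity_pt_comp (fun u => Rmin u K) g).
      + intros y Hy. exists y. split; [exact Hy|]. intros u [_ Hu]. simpl in *. unfold Rdist in *.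
        eapply Rle_lt_trans; [|exact Hu]. unfold Rmin.
        repeat destruct Rle_dec; unfold Rabs; repeat destruct Rcase_abs; lra.
      + eapply is_derive_continuity_pt, Dg.
        assert (us <= U t / d).
        { apply Rmult_le_reg_r with d; [lra|]. unfold Rdiv. rewrite Rmult_assoc, Rinv_l; lra. }
        split; [apply Rmin_glb; lra | apply Rmin_r]. }
  assert (Pcont : forall t, a < t -> (forall s, a <= s < t -> P s) -> P t).
  { intros t Ht Hs. destruct (Hsol t ltac:(lra)) as [DU DR].
    assert (Q1 : 0 <= U t - d * us).
    { apply (nonneg_left_limit (fun t => U t - d * us) a); [exact Ht| |intros s Hs'; apply (Hs s Hs')].
      apply continuity_pt_minus; [eapply is_derive_continuity_pt, DU|].
      apply continuity_pt_const; intros ? ?; reflexivity. }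
    assert (Q2 : 0 <= ks * W t - U t - ks * d * b).
    { apply (nonneg_left_limit (fun t => ks * W t - U t - ks * d * b) a); [exact Ht| |intros s Hs'; apply (Hs s Hs')].
      apply continuity_pt_minus; [|apply continuity_pt_const; intros ? ?; reflexivity].
      eapply is_derive_continuity_pt, (is_derive_combination U W ks); [exact DU | exact DR]. }
    assert (Q3 : 0 <= nu - (kf * W t - U t)).
    { apply (nonneg_left_limit (fun t => nu - (kf * W t - U t)) a); [exact Ht| |intros s Hs'; apply (Hs s Hs')].
      apply continuity_pt_minus; [apply continuity_pt_const; intros ? ?; reflexivity|].
      eapply is_derive_continuity_pt, (is_derive_combination U W kf); [exact DU | exact DR]. }
    split; [exact Q1|]. split; [exact Q2|]. split; [exact Q3|].
    apply (nonneg_left_limit (fun t => W t - d * gh (U t / d)) a);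
      [exact Ht | apply HcontP; [exact Q1 | lra] | intros s Hs'; apply (Hs s Hs')]. }
  assert (Popen : forall t, a <= t -> P t -> exists hh, 0 < hh /\ forall s, t < s < t + hh -> P s).
  { intros t Ht HP. pose proof (HPY t HP) as HYt. destruct HP as (P1 & P2 & P3 & P4). pose proof (HcontP t P1 Ht) as Hcg. destruct (Hsol t Ht) as [DU DR].
    set (V := U t) in *. set (Q := W t) in *.
    assert (HV : 0 < V) by (assert (0 < d * us) by pos; lra).
    set (u := V / d). assert (Eu : V = d * u) by (unfold u; field; lra).
    assert (Hu : us <= u).
    { apply Rmult_le_reg_l with d; [lra|]. rewrite <- Eu. lra. }
    pose proof (sg_abs _ _ HYt) as Hsy.
    apply Rabs_le_between in HYt.
    pose proof (tail_range _ _ _ _ _ HT e V He ltac:(lra)) as Hpsi.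
    assert (HY0 : Y <= 1 / A / 2).
    { apply Rmult_le_reg_l with A; [lra|]. replace (A * (1 / A / 2)) with (1 / 2) by (field; lra). lra. }
    assert (Hyp : 0 < 1 / A - sg * (Q - V)) by lra.
    assert (Hpsu : psi e V <= d * ((c + 1) * / us ^ k)).
    { rewrite Eu. eapply Rle_trans; [apply Hup, Hu|]. apply Rmult_le_compat_l; [lra|].
      apply Rmult_le_compat_l; [lra|]. apply inv_pow_le; lra. }
    assert (Hpsz : beta * psi e V <= d * z) by (unfold z; apply Rmult_le_compat_l with (r := beta) in Hpsu; lra).
    assert (Herr : Rabs (beta * psi e V * (1 / A - sg * (Q - V)) - d * (C * / u ^ k)) <= d * (w * x + z * Y)).
    { replace (beta * psi e V * (1 / A - sg * (Q - V)) - d * (C * / u ^ k))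
        with (d * (beta / A * / u ^ k * (psi e (d * u) / d * u ^ k - c)) + - (beta * psi e V * (sg * (Q - V))))
        by (rewrite <- Eu; unfold C; fld).
      eapply Rle_trans; [apply Rabs_triang|]. rewrite Rmult_plus_distr_l. apply Rplus_le_compat.
      - rewrite Rabs_mult, (Rabs_pos_eq d) by lra. apply Rmult_le_compat_l; [lra|].
        rewrite Rabs_mult. pose proof (inv_pow_pos k u ltac:(lra)).
        assert (0 < beta / A) by (apply Rdiv_lt_0_compat; lra).
        apply Rmult_le_compat; [apply Rabs_pos | apply Rabs_pos | | apply Has, Hu].
        rewrite Rabs_pos_eq by (apply Rmult_le_pos; lra). unfold w.
        apply Rmult_le_compat_l; [lra|]. apply inv_pow_le; lra.
      - rewrite Rabs_Ropp, Rabs_mult.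
        replace (d * (z * Y)) with (d * z * Y) by ring.
        apply Rmult_le_compat; [apply Rabs_pos | apply Rabs_pos | |].
        + rewrite Rabs_pos_eq by pos. exact Hpsz.
        + apply Rabs_le. lra. }
    apply Rabs_le_between in Herr.
    destruct (pos_right (fun s => U s - d * us) t (field_U A beta sg (psi e) V Q - 0)) as (h1 & Hh1 & H1).
    { apply (is_derive_minus U (fun _ => d * us)); [exact DU | apply (is_derive_const (d * us) t)]. }
    { destruct (Req_dec V (d * us)) as [E|N]; [right|left; fold V; lra]. split; [fold V; lra|].
      assert (E' : u = us) by (apply Rmult_eq_reg_l with d; lra).
      rewrite E' in *. unfold gh in P4. fold u in P4. rewrite E', Rmin_left in P4 by lra.
      unfold field_U. unfold nullcline in Hgus.
      assert (A * (d * (g us + h)) <= A * Q) by (apply Rmult_le_compat_l; lra).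
      assert (d * ((1 + A) * us + C * / us ^ k) <= d * (A * g us)) by (apply Rmult_le_compat_l; lra).
      assert (d * (w * x) <= d * (A * h / 4)) by (apply Rmult_le_compat_l; lra).
      assert (d * (z * Y) <= d * (A * h / 4)) by (apply Rmult_le_compat_l; lra).
      assert (0 < d * (A * h)) by (repeat apply Rmult_lt_0_compat; lra).
      rewrite Eu at 1. lra. }
    destruct (pos_right (fun s => ks * W s - U s - ks * d * b) t
      (ks * field_W (d * mu1) m0 V Q - field_U A beta sg (psi e) V Q - 0)) as (h2 & Hh2 & H2).
    { apply (is_derive_minus (fun s => ks * W s - U s) (fun _ => ks * d * b));
        [apply is_derive_combination; assumption | apply (is_derive_const (ks * d * b) t)]. }
    { destruct (Req_dec (ks * Q - V - ks * d * b) 0) as [E|N]; [right|left; fold V Q; lra]. split; [fold V Q; lra|].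
      rewrite fast_derive. replace (ks * Q - V) with (ks * d * b) by lra.
      assert (0 <= beta * psi e V * (1 / A - sg * (Q - V))).
      { apply Rmult_le_pos; [apply Rmult_le_pos|]; lra. }
      assert (d * mu1 * (Q - V) <= d * (et / 8)).
      { rewrite Rmult_assoc. apply Rmult_le_compat_l; [lra|].
        apply Rle_trans with (mu1 * Y); [apply Rmult_le_compat_l; lra | exact HY3]. }
      assert (HH : 0 < ks * (d * (et / 4))) by (repeat apply Rmult_lt_0_compat; lra).
      assert (ks * (d * m - d * (et / 8)) <= ks * (m0 - d * mu1 * (Q - V))) by (apply Rmult_le_compat_l; lra).
      replace (- kf * (ks * d * b)) with (- (ks * d * (kf * b))) by ring. rewrite Hb.
      unfold Rdiv in *. lra. }
    destruct (pos_right (fun s => nu - (kf * W s - U s)) t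
      (0 - (kf * field_W (d * mu1) m0 V Q - field_U A beta sg (psi e) V Q))) as (h3 & Hh3 & H3).
    { apply (is_derive_minus (fun _ => nu) (fun s => kf * W s - U s));
        [apply (is_derive_const nu t) | apply is_derive_combination; assumption]. }
    { destruct (Req_dec (nu - (kf * Q - V)) 0) as [E|N]; [right|left; fold V Q; lra]. split; [fold V Q; lra|].
      rewrite slow_derive. replace (kf * Q - V) with nu by lra.
      assert (beta * psi e V * (1 / A - sg * (Q - V)) <= d * z * (1 / A + Y)).
      { apply Rmult_le_compat; [pos | lra | exact Hpsz | lra]. }
      assert (- (d * mu1 * (Q - V)) <= d * mu1 * Y).
      { rewrite Ropp_mult_distr_r. apply Rmult_le_compat_l; [pos | lra]. }
      assert (kf * (m0 - d * mu1 * (Q - V)) <= kf * (th + d * mu1 * Y)) by (apply Rmult_le_compat_l; lra).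
      assert (0 < ks * nu) by pos.
      lra. }
    assert (Hq4 : exists h4, 0 < h4 /\ forall s, t < s < t + h4 -> 0 < W s - d * gh (U s / d)).
    { destruct (Req_dec (Q - d * gh u) 0) as [E|N].
      - assert (HuK : u < K).
        { apply Rnot_le_lt. intro HKu. unfold gh in E. rewrite Rmin_right in E by exact HKu.
          assert (d * (g K + h) < d * (K / ks + b)) by (apply Rmult_lt_compat_l; lra).
          assert (d * K <= V) by (rewrite Eu; apply Rmult_le_compat_l; lra).
          assert (ks * (d * (K / ks + b)) = d * K + ks * d * b) by (field; lra).
          assert (ks * (d * (g K + h)) < ks * (d * (K / ks + b))) by (apply Rmult_lt_compat_l; lra).
          replace Q with (d * (g K + h)) in P2 by lra. lra. }
        assert (Egh : Q = d * (g u + h)) by (unfold gh in E; rewrite Rmin_left in E; lra).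
        destruct (pos_right (fun s => W s - d * (g (U s / d) + h)) t
          (field_W (d * mu1) m0 V Q - d * (field_U A beta sg (psi e) V Q * / d * dg u + 0))) as (h4 & Hh4 & H4).
        { apply (is_derive_minus W (fun s => d * (g (U s / d) + h))); [exact DR|].
          apply (is_derive_scal (fun s => g (U s / d) + h) t d).
          apply (is_derive_plus (fun s => g (U s / d)) (fun _ => h)); [|apply (is_derive_const h t)].
          apply (is_derive_comp g (fun s => U s / d)); [apply Dg; fold u; lra|].
          apply (is_derive_ext (fun s => / d * U s)); [intros s; unfold Rdiv; apply Rmult_comm|].
          rewrite (Rmult_comm _ (/ d)). apply (is_derive_scal U t (/ d)), DU. }
        { right. fold V Q u. split; [lra|].
          specialize (Hsub u ltac:(lra)). specialize (Mdg u ltac:(lra)). unfold nullcline in Hsub.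
          set (er := beta * psi e V * (1 / A - sg * (Q - V)) - d * (C * / u ^ k)) in *.
          assert (EU : field_U A beta sg (psi e) V Q = d * (A * (g u + h) - (1 + A) * u - C * / u ^ k) - er).
          { unfold field_U, er. rewrite Egh at 1. rewrite Eu at 1. ring. }
          rewrite EU. unfold field_W.
          replace (m0 - ((1 - d * mu1) * V + d * mu1 * Q)
                   - d * ((d * (A * (g u + h) - (1 + A) * u - C * / u ^ k) - er) * / d * dg u + 0))
            with (m0 - V - d * (mu1 * (Q - V)) + d * (dg u * ((1 + A) * u + C * / u ^ k - A * g u))
                  - dg u * (d * (A * h)) + dg u * er)
            by (generalize (C * / u ^ k) as CC; intros CC; field; lra).
          assert (G1 : d * (u - m') <= d * (dg u * ((1 + A) * u + C * / u ^ k - A * g u)))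
            by (apply Rmult_le_compat_l; lra).
          assert (G2 : d * (mu1 * (Q - V)) <= d * (et / 8)).
          { apply Rmult_le_compat_l; [lra|].
            apply Rle_trans with (mu1 * Y); [apply Rmult_le_compat_l; lra | exact HY3]. }
          assert (G3 : dg u * (d * (A * h)) <= d * (et / 4)).
          { apply Rle_trans with (M * (d * (A * h))).
            - apply Rmult_le_compat_r; [pos|]. eapply Rle_trans; [apply Rle_abs | exact Mdg].
            - replace (M * (d * (A * h))) with (d * (A * M * h)) by ring.
              apply Rmult_le_compat_l; lra. }
          assert (G4 : - (d * (et / 4)) <= dg u * er).
          { assert (Rabs (dg u * er) <= d * (et / 4)).
            { rewrite Rabs_mult. apply Rle_trans with (M * (d * (w * x + z * Y))).
              - apply Rmult_le_compat; [apply Rabs_pos | apply Rabs_pos | exact Mdg |].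
                apply Rabs_le. lra.
              - replace (M * (d * (w * x + z * Y))) with (d * (M * (w * x) + M * (z * Y))) by ring.
                apply Rmult_le_compat_l; lra. }
            apply Rabs_le_between in H. lra. }
          assert (G5 : 0 < d * et) by pos.
          rewrite Eu at 1. unfold et in *. lra. }
        destruct (pos_right (fun s => d * K - U s) t (0 - field_U A beta sg (psi e) V Q))
          as (h5 & Hh5 & H5).
        { apply (is_derive_minus (fun _ => d * K) U); [apply (is_derive_const (d * K) t) | exact DU]. }
        { left. fold V. rewrite Eu. assert (d * u < d * K) by (apply Rmult_lt_compat_l; lra). lra. }
        exists (Rmin h4 h5). split; [apply Rmin_glb_lt; assumption|]. intros s Hs.
        pose proof (Rmin_l h4 h5). pose proof (Rmin_r h4 h5).
        specialize (H4 s ltac:(lra)). specialize (H5 s ltac:(lra)).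
        unfold gh. rewrite Rmin_left; [exact H4|].
        apply Rmult_le_reg_r with d; [lra|]. unfold Rdiv. rewrite Rmult_assoc, Rinv_l; lra.
      - fold V Q u in P4. assert (Hp : 0 < Q - d * gh u) by lra.
        destruct (continuity_pt_eps _ _ (Q - d * gh u) Hcg Hp) as (h4 & Hh4 & H4).
        exists h4. split; [exact Hh4|]. intros s Hs.
        assert (H : Rabs (s - t) < h4) by (rewrite Rabs_pos_eq; lra). specialize (H4 s H). fold V Q u in H4.
        apply Rabs_lt_between in H4. lra. }
    destruct Hq4 as (h4 & Hh4 & H4).
    exists (Rmin (Rmin h1 h2) (Rmin h3 h4)).
    split; [repeat apply Rmin_glb_lt; assumption|]. intros s Hs.
    pose proof (Rmin_l (Rmin h1 h2) (Rmin h3 h4)). pose proof (Rmin_r (Rmin h1 h2) (Rmin h3 h4)).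
    pose proof (Rmin_l h1 h2). pose proof (Rmin_r h1 h2).
    pose proof (Rmin_l h3 h4). pose proof (Rmin_r h3 h4).
    repeat split; left; [apply H1 | apply H2 | apply H3 | apply H4]; lra. }
  assert (Pa : P a).
  { fold Uq in HUa. fold Rq in HRa. apply Rabs_le_between in HUa, HRa.
    assert (HUK : d * K < U a) by lra.
    assert (HWfa : ks * d * b <= (ks * W a - U a) ).
    { assert (ks * (d * b) <= ks * (d * (1 + Rabs b))) by (repeat apply Rmult_le_compat_l; lra).
      assert (ks * (- rad) <= ks * (W a - Rq)) by (apply Rmult_le_compat_l; lra). lra. }
    split; [|split; [|split]].
    - assert (d * us < d * K) by (apply Rmult_lt_compat_l; lra). lra.
    - lra.
    - assert (kf * (W a - Rq) <= kf * rad) by (apply Rmult_le_compat_l; lra). lra.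
    - unfold gh. rewrite Rmin_right.
      + assert (d * (g K + h) < d * (K / ks + b)) by (apply Rmult_lt_compat_l; lra).
        assert (ks * (d * (K / ks + b)) = d * K + ks * d * b) by (field; lra).
        assert (ks * (d * (g K + h)) < ks * (d * (K / ks + b))) by (apply Rmult_lt_compat_l; lra).
        left. apply Rmult_lt_reg_l with ks; lra.
      + apply Rmult_le_reg_r with d; [lra|]. unfold Rdiv. rewrite Rmult_assoc, Rinv_l; lra. }
  intros t Ht.
  assert (HPt : P t).
  { apply (real_induction P a t); [exact Pa | | | lra].
    - intros s Hs Hall. apply Pcont; [lra | exact Hall].
    - intros s Hs Hall. apply Popen; [lra | apply Hall; lra]. }
  destruct HPt as (P1 & _). assert (0 < d * us) by pos. lra.
Qed.

End Trap.

(** * One passage through a half plane *)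

(** Counterpart of [relax_abs] for short times: the bound grows with time but does not degenerate as
    [k -> 0]. *)
Lemma relax_abs_time (E E' : R -> R) (k b s t : R) : s <= t -> 0 <= k -> 0 <= b ->
  (forall x, s <= x <= t -> is_derive E x (E' x)) ->
  (forall x, s <= x <= t -> Rabs (E' x + k * E x) <= b) ->
  Rabs (E t) <= Rabs (E s) + b * (t - s).
Proof.
  intros Hst Hk Hb Hd Hf.
  assert (H : Rabs (E t * exp (k * (t - s)) - E s * exp (k * (s - s))) <= b * exp (k * (t - s)) * (t - s)).
  { apply (increment_abs (fun x => E x * exp (k * (x - s)))
      (fun x => E' x * exp (k * (x - s)) + E x * (k * exp (k * (x - s))))); [exact Hst| |].
    - intros x Hx. apply (is_derive_mult E (fun x => exp (k * (x - s))));
        [apply Hd, Hx | apply is_derive_exp_lin | intros; apply Rmult_comm].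
    - intros x Hx. replace (E' x * exp (k * (x - s)) + E x * (k * exp (k * (x - s))))
        with ((E' x + k * E x) * exp (k * (x - s))) by ring.
      rewrite Rabs_mult, (Rabs_pos_eq (exp _)) by pos.
      apply Rmult_le_compat; [apply Rabs_pos | pos | apply Hf, Hx |].
      apply exp_le, Rmult_le_compat_l; lra. }
  rewrite Rminus_diag, Rmult_0_r, exp_0, Rmult_1_r in H.
  assert (He : 1 <= exp (k * (t - s))).
  { rewrite <- exp_0. apply exp_le. pos. }
  pose proof (Rabs_triang (E t * exp (k * (t - s)) - E s) (E s)) as T.
  replace (E t * exp (k * (t - s)) - E s + E s) with (E t * exp (k * (t - s))) in T by ring.
  rewrite Rabs_mult, (Rabs_pos_eq (exp _)) in T by lra.
  apply Rmult_le_reg_r with (exp (k * (t - s))); [lra|].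
  pose proof (Rabs_pos (E s)) as HE.
  assert (Rabs (E s) * 1 <= Rabs (E s) * exp (k * (t - s))) by (apply Rmult_le_compat_l; lra).
  lra.
Qed.

Lemma sg_mult_abs (sg x : R) : sg = 1 \/ sg = -1 -> Rabs (sg * x) = Rabs x.
Proof.
  intros [-> | ->]; [rewrite Rmult_1_l; reflexivity|].
  replace (-1 * x) with (- x) by ring. apply Rabs_Ropp.
Qed.

Section Approach.
Variables (k : nat) (A kf ks beta sg c psi0 : R) (dl : R -> R) (psi : R -> R -> R) (m mu1 : R).
Hypothesis Hks : 0 < ks < kf.
Hypothesis HA : A = kf * ks.
Hypothesis HA1 : 1 + A = kf + ks.
Hypothesis Hbeta : 0 < beta.
Hypothesis Hc : 0 < c.
Hypothesis Hsg : sg = 1 \/ sg = -1.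
Hypothesis HT : tail_family k c psi0 dl psi.
Hypothesis HA' : 0 < A + sg * beta.
Hypothesis Hmu1 : 0 <= mu1.

Let R0 := beta / (A * (A + sg * beta)).
Let sol (e : R) := half_solution A beta sg (psi e) (dl e * mu1) (dl e * m).

Let A_pos : 0 < A.
Proof. rewrite HA. pos. Qed.

Let R0_pos : 0 < R0.
Proof. unfold R0. pos. Qed.

(** [W - U] is [1 / A - y] up to sign, and the equation for [y] is linear in [y] with positive
    damping. This bounds [y] from hardly any information about [U]. *)
Lemma difference_derive (mu m0 e U W : R) :
  field_W mu m0 U W - field_U A beta sg (psi e) U W =
  - (A + mu + sg * beta * psi e U) * (W - U) + (m0 + beta * psi e U / A).
Proof. unfold field_W, field_U. field. lra. Qed.

Definition rate_min : R := Rmin A (A + sg * beta).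

Lemma rate_min_pos : 0 < rate_min.
Proof. unfold rate_min. pos. Qed.

Lemma rate_ge (e U : R) : 0 < e -> 0 <= U -> rate_min <= A + sg * beta * psi e U.
Proof.
  intros He HU. pose proof (tail_range _ _ _ _ _ HT e U He HU) as Hp.
  pose proof (tail_psi0 _ _ _ _ _ HT) as H0. unfold rate_min.
  destruct Hsg as [-> | ->].
  - eapply Rle_trans; [apply Rmin_l|]. assert (0 <= 1 * beta * psi e U) by pos. lra.
  - eapply Rle_trans; [apply Rmin_r|]. assert (beta * psi e U <= beta * 1) by (apply Rmult_le_compat_l; lra). lra.
Qed.

Lemma small_data (x : R) : 0 < x -> eventually0 (fun e => dl e < x /\ Rabs (dl e * m) <= x /\ 0 <= dl e * mu1 <= x).
Proof.
  intros Hx. pose proof (Rabs_pos m) as Hm.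
  eapply eventually0_impl.
  { apply (tail_dl_small _ _ _ _ _ HT (x / (1 + Rabs m + mu1))). pos. }
  intros e He H. pose proof (tail_dl_pos _ _ _ _ _ HT e He) as Hd.
  apply Rmult_lt_compat_r with (r := 1 + Rabs m + mu1) in H; [|lra].
  replace (x / (1 + Rabs m + mu1) * (1 + Rabs m + mu1)) with x in H by (field; lra).
  assert (0 <= dl e * mu1) by pos. assert (0 <= dl e * Rabs m) by pos.
  rewrite Rabs_mult, (Rabs_pos_eq (dl e)) by lra. repeat split; lra.
Qed.

Lemma difference_bounded : exists Ym, 0 < Ym /\
  eventually0 (fun e => forall U W s, sol e U W 0 -> Rabs (W 0 - U 0) <= 2 * R0 -> 0 <= s ->
    (forall t, 0 <= t <= s -> 0 <= U t) -> forall t, 0 <= t <= s -> Rabs (W t - U t) <= Ym).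
Proof.
  pose proof rate_min_pos as Hr.
  assert (Hba : 0 < beta / A) by pos.
  set (Ym := 2 * R0 + (2 + beta / A) / rate_min).
  assert (HY : (2 + beta / A) <= rate_min * Ym).
  { unfold Ym. rewrite Rmult_plus_distr_l.
    replace (rate_min * ((2 + beta / A) / rate_min)) with (2 + beta / A) by (field; lra).
    assert (0 < rate_min * (2 * R0)) by pos. lra. }
  assert (HYm : 2 * R0 < Ym) by (unfold Ym; assert (0 < (2 + beta / A) / rate_min) by pos; lra).
  exists Ym. split; [lra|].
  eapply eventually0_impl; [apply (small_data 1); lra|].
  intros e He (Hd & Hdm & Hdmu) U W s Hsol H0 Hs HU.
  pose proof (tail_psi0 _ _ _ _ _ HT) as Hpsi0.
  apply Rabs_le_between in H0. apply Rabs_le_between in Hdm.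
  assert (DD : forall t, 0 <= t <= s -> is_derive (fun t => W t - U t) t
     (- (A + dl e * mu1 + sg * beta * psi e (U t)) * (W t - U t) + (dl e * m + beta * psi e (U t) / A))).
  { intros t Ht. rewrite <- difference_derive.
    apply (is_derive_minus W U); apply Hsol; lra. }
  assert (Hpos : forall t, 0 <= t <= s ->
     (2 + beta / A) <= (A + dl e * mu1 + sg * beta * psi e (U t)) * Ym /\
     0 <= beta * psi e (U t) / A <= beta / A).
  { intros t Ht. pose proof (rate_ge e (U t) He (HU t Ht)) as H1.
    pose proof (tail_range _ _ _ _ _ HT e (U t) He (HU t Ht)) as H2. split.
    - eapply Rle_trans; [exact HY|]. apply Rmult_le_compat_r; lra.
    - replace (beta * psi e (U t) / A) with (beta / A * psi e (U t)) by (field; lra).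
      split; [pos|]. rewrite <- (Rmult_1_r (beta / A)) at 2. apply Rmult_le_compat_l; lra. }
  assert (H1 : forall t, 0 <= t <= s -> 0 < Ym - (W t - U t)).
  { apply (stay_pos (fun t => Ym - (W t - U t)) (fun t => 0 -
     (- (A + dl e * mu1 + sg * beta * psi e (U t)) * (W t - U t) + (dl e * m + beta * psi e (U t) / A)))).
    - lra.
    - intros t Ht. apply (is_derive_minus (fun _ => Ym) (fun t => W t - U t));
        [apply (is_derive_const Ym t) | apply DD, Ht].
    - intros t Ht _ Hz. replace (W t - U t) with Ym by lra. specialize (Hpos t ltac:(lra)). lra. }
  assert (H2 : forall t, 0 <= t <= s -> 0 < Ym + (W t - U t)).
  { apply (stay_pos (fun t => Ym + (W t - U t)) (fun t => 0 +
     (- (A + dl e * mu1 + sg * beta * psi e (U t)) * (W t - U t) + (dl e * m + beta * psi e (U t) / A)))).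
    - lra.
    - intros t Ht. apply (is_derive_plus (fun _ => Ym) (fun t => W t - U t));
        [apply (is_derive_const Ym t) | apply DD, Ht].
    - intros t Ht _ Hz. replace (W t - U t) with (- Ym) by lra. specialize (Hpos t ltac:(lra)). lra. }
  intros t Ht. apply Rabs_le. specialize (H1 t Ht). specialize (H2 t Ht). lra.
Qed.

(** Put [A' = A + sg * beta]. At the entry point the tail-free speed [A * R0] equals [beta / A'],
    and the tail takes away at most the fraction [psi0 < 1] of it. The speed bound is therefore
    uniform in [e], although the tail is not small at the line. *)
Lemma launch : exists rad tau c0, 0 < rad <= R0 / 4 /\ 0 < tau /\ 0 < c0 /\
  eventually0 (fun e => forall U W, sol e U W 0 -> U 0 = 0 -> Rabs (W 0 - R0) <= rad ->
    forall t, 0 <= t <= tau ->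
      c0 * t <= U t /\ c0 <= field_U A beta sg (psi e) (U t) (W t)).
Proof.
  pose proof (tail_psi0 _ _ _ _ _ HT) as Hpsi0.
  set (A' := A + sg * beta) in *.
  (* Half of the guaranteed initial speed; the other half absorbs the variation over a box of size
     [r]. *)
  set (c0 := beta / A' * (1 - psi0) / 2).
  assert (Hc0 : 0 < c0) by (unfold c0; pos).
  set (r := Rmin (c0 / (3 * A + 3 * beta + 1)) (R0 / 4)).
  assert (Hr : 0 < r) by (unfold r; pos).
  assert (Hrc : (3 * A + 3 * beta + 1) * r <= c0).
  { assert (r <= c0 / (3 * A + 3 * beta + 1)) by apply Rmin_l.
    apply Rmult_le_compat_l with (r := 3 * A + 3 * beta + 1) in H; [|lra].
    replace ((3 * A + 3 * beta + 1) * (c0 / (3 * A + 3 * beta + 1))) with c0 in H by (field; lra). exact H. }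
  set (M := 1 + A * (R0 + 2 * r) + (1 + A) * r + beta * (1 / A' + 3 * r) + R0 + 3 * r).
  assert (H1A' : 0 < 1 / A') by pos.
  assert (HM : 0 < M) by (unfold M; pos).
  set (tau := r / (2 * M)). assert (Htau : 0 < tau) by (unfold tau; pos).
  assert (HMt : M * tau = r / 2) by (unfold tau; field; lra).
  exists r, tau, c0. split; [split; [exact Hr | apply Rmin_r]|]. split; [exact Htau|]. split; [exact Hc0|].
  eapply eventually0_impl; [apply (small_data 1); lra|].
  intros e He (Hd & Hdm & Hdmu) U W Hsol HU0 HW0.
  assert (Box : forall u w, 0 <= u <= r -> Rabs (w - R0) <= 2 * r ->
    c0 <= field_U A beta sg (psi e) u w <= M /\ Rabs (field_W (dl e * mu1) (dl e * m) u w) <= M).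
  { intros u w Hu Hw. pose proof (tail_range _ _ _ _ _ HT e u He (proj1 Hu)) as Hp.
    pose proof (sg_mult_abs sg (w - R0 - u) Hsg) as Hs.
    assert (Ey : 1 / A - sg * (w - u) = 1 / A' - sg * (w - R0 - u)).
    { unfold R0. fold A'. replace (1 / A) with (1 / A' + sg * (beta / (A * A'))).
      - ring.
      - pose proof HA' as HA2. unfold A' in HA2 |- *. field. split; lra. }
    assert (Hs' : Rabs (sg * (w - R0 - u)) <= 3 * r).
    { rewrite Hs. eapply Rle_trans; [apply Rabs_triang|]. rewrite Rabs_Ropp, (Rabs_pos_eq u); lra. }
    apply Rabs_le_between in Hs', Hw. apply Rabs_le_between in Hdm.
    assert (Hy1 : beta * psi e u * (1 / A - sg * (w - u)) <= beta * psi0 * (1 / A') + beta * (3 * r)).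
    { rewrite Ey. apply Rle_trans with (beta * psi e u * (1 / A' + 3 * r)).
      - apply Rmult_le_compat_l; [pos | lra].
      - assert (beta * (1 / A') * psi e u <= beta * (1 / A') * psi0) by (apply Rmult_le_compat_l; [pos|lra]).
        assert (beta * (3 * r) * psi e u <= beta * (3 * r) * 1) by (apply Rmult_le_compat_l; [pos|lra]).
        lra. }
    assert (Hy2 : - (beta * (3 * r)) <= beta * psi e u * (1 / A - sg * (w - u))).
    { rewrite Ey. apply Rle_trans with (beta * psi e u * - (3 * r)).
      - assert (beta * (3 * r) * psi e u <= beta * (3 * r) * 1) by (apply Rmult_le_compat_l; [pos|lra]). lra.
      - apply Rmult_le_compat_l; [pos | lra]. }
    assert (EA : A * R0 = beta * (1 / A')) by (unfold R0; fold A'; field; lra).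
    assert (Ec : c0 + c0 = beta * (1 / A') - beta * psi0 * (1 / A')) by (unfold c0; field; lra).
    assert (A * (R0 - 2 * r) <= A * w <= A * (R0 + 2 * r)) by (split; apply Rmult_le_compat_l; lra).
    assert (0 <= (1 + A) * u <= (1 + A) * r) by (split; [pos | apply Rmult_le_compat_l; lra]).
    assert (beta * psi0 * (1 / A') <= beta * (1 / A')).
    { rewrite Rmult_assoc. apply Rmult_le_compat_l; [lra|].
      rewrite <- (Rmult_1_l (1 / A')) at 2. apply Rmult_le_compat_r; lra. }
    unfold field_U, field_W. split; [split|].
    - lra.
    - unfold M. assert (0 < beta * (1 / A')) by pos. lra.
    - set (mu := dl e * mu1) in *.
      assert (mu * (w - u) <= 1 * (R0 + 2 * r)) by (apply Rle_trans with (mu * (R0 + 2 * r)); [apply Rmult_le_compat_l; lra | apply Rmult_le_compat_r; lra]).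
      assert (- (1 * (3 * r)) <= mu * (w - u)).
      { assert (mu * - (3 * r) <= mu * (w - u)) by (apply Rmult_le_compat_l; lra).
        assert (mu * (3 * r) <= 1 * (3 * r)) by (apply Rmult_le_compat_r; lra). lra. }
      assert (0 < A * (R0 + 2 * r)) by pos. assert (0 < (1 + A) * r) by pos.
      assert (0 < beta * (1 / A' + 3 * r)) by pos.
      apply Rabs_le. unfold M. split; lra. }
  apply Rabs_le_between in HW0.
  assert (Hin : forall t, 0 <= t <= tau -> 0 <= U t < r /\ Rabs (W t - R0) < 2 * r).
  { apply real_induction.
    - rewrite HU0. split; [lra|]. apply Rabs_def1; lra.
    - intros t Ht Hall.
      assert (CU : continuity_pt U t) by exact (is_derive_continuity_pt _ _ _ (proj1 (Hsol t ltac:(lra)))).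
      assert (CW : continuity_pt W t) by exact (is_derive_continuity_pt _ _ _ (proj2 (Hsol t ltac:(lra)))).
      assert (U1 : 0 <= U t) by (apply (nonneg_left_limit U 0); [lra | exact CU | intros s Hs; apply Hall, Hs]).
      assert (U2 : 0 <= r - U t).
      { apply (nonneg_left_limit (fun t => r - U t) 0); [lra | | intros s Hs; specialize (Hall s Hs); lra].
        apply continuity_pt_minus; [apply continuity_pt_const; intros ? ?; reflexivity | exact CU]. }
      assert (W1 : 0 <= 2 * r - (W t - R0)).
      { apply (nonneg_left_limit (fun t => 2 * r - (W t - R0)) 0); [lra | |].
        - apply continuity_pt_minus; [apply continuity_pt_const; intros ? ?; reflexivity |].
          apply continuity_pt_minus; [exact CW | apply continuity_pt_const; intros ? ?; reflexivity].
        - intros s Hs. destruct (Hall s Hs) as [_ H]. apply Rabs_lt_between in H. lra. }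
      assert (W2 : 0 <= 2 * r + (W t - R0)).
      { apply (nonneg_left_limit (fun t => 2 * r + (W t - R0)) 0); [lra | |].
        - apply continuity_pt_plus; [apply continuity_pt_const; intros ? ?; reflexivity |].
          apply continuity_pt_minus; [exact CW | apply continuity_pt_const; intros ? ?; reflexivity].
        - intros s Hs. destruct (Hall s Hs) as [_ H]. apply Rabs_lt_between in H. lra. }
      assert (B : forall s, 0 <= s <= t -> 0 <= U s <= r /\ Rabs (W s - R0) <= 2 * r).
      { intros s Hs. destruct (Req_dec s t) as [->|N].
        - split; [lra | apply Rabs_le; lra].
        - destruct (Hall s ltac:(lra)). split; lra. }
      assert (IU : U t - U 0 <= M * (t - 0)).
      { apply (increment_le U (fun t => field_U A beta sg (psi e) (U t) (W t))); [lra | intros s Hs; apply Hsol; lra|].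
        intros s Hs. apply Box; apply B, Hs. }
      assert (IW : Rabs (W t - W 0) <= M * (t - 0)).
      { apply (increment_abs W (fun t => field_W (dl e * mu1) (dl e * m) (U t) (W t))); [lra | intros s Hs; apply Hsol; lra|].
        intros s Hs. apply Box; apply B, Hs. }
      assert (M * t <= M * tau) by (apply Rmult_le_compat_l; lra).
      apply Rabs_le_between in IW.
      split; [lra | apply Rabs_def1; lra].
    - intros t Ht Hall. destruct (Hall t ltac:(lra)) as [HUt HWt]. destruct (Hsol t ltac:(lra)) as [DU DW].
      destruct (Box (U t) (W t)) as [[B1 _] _]; [lra | lra |].
      destruct (pos_right U t _ DU) as (h1 & Hh1 & H1); [right; lra|].
      destruct (continuity_pt_eps U t (r - U t) (is_derive_continuity_pt _ _ _ DU) ltac:(lra)) as (h2 & Hh2 & H2).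
      destruct (continuity_pt_eps W t (2 * r - Rabs (W t - R0)) (is_derive_continuity_pt _ _ _ DW) ltac:(lra)) as (h3 & Hh3 & H3).
      exists (Rmin h1 (Rmin h2 h3)). split; [pos|]. intros s Hs.
      pose proof (Rmin_l h1 (Rmin h2 h3)). pose proof (Rmin_r h1 (Rmin h2 h3)).
      pose proof (Rmin_l h2 h3). pose proof (Rmin_r h2 h3).
      specialize (H1 s ltac:(lra)). specialize (H2 s ltac:(rewrite Rabs_pos_eq; lra)).
      specialize (H3 s ltac:(rewrite Rabs_pos_eq; lra)).
      apply Rabs_lt_between in H2. split; [lra|].
      replace (W s - R0) with ((W s - W t) + (W t - R0)) by ring.
      eapply Rle_lt_trans; [apply Rabs_triang|]. lra. }
  assert (F : forall t, 0 <= t <= tau -> c0 <= field_U A beta sg (psi e) (U t) (W t)).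
  { intros t Ht. destruct (Hin t Ht). apply Box; lra. }
  intros t Ht. split; [|apply F, Ht].
  replace (U t) with (U t - U 0) by lra. replace t with (t - 0) at 1 by ring.
  apply (increment_ge U (fun t => field_U A beta sg (psi e) (U t) (W t))); [lra | intros s Hs; apply Hsol; lra|].
  intros s Hs. apply F. lra.
Qed.

Let forcing_bound (Ym : R) : 0 < Ym -> exists Cb, 0 < Cb /\ eventually0 (fun e =>
  forall q U D, 0 <= q <= kf -> 0 <= U -> Rabs D <= Ym ->
    Rabs (beta * psi e U * (1 / A - sg * D) + q * (dl e * m - dl e * mu1 * D)) <= Cb /\
    (dl e <= U -> Rabs (beta * psi e U * (1 / A - sg * D) + q * (dl e * m - dl e * mu1 * D)) <= Cb * dl e)).
Proof.
  intros HY. set (Yy := 1 / A + Ym). assert (0 < 1 / A) by pos.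
  pose proof (Rabs_pos m) as Hm.
  set (Cb := beta * Yy + beta * (c + 1) * Yy + kf * (1 + Rabs m + mu1 * Ym)).
  assert (HCb1 : 0 < beta * Yy) by (unfold Yy; pos).
  assert (HCb2 : 0 < beta * (c + 1) * Yy) by (unfold Yy; pos).
  assert (HCb3 : 0 < kf * (1 + Rabs m + mu1 * Ym)) by pos.
  exists Cb. split; [unfold Cb; lra|].
  eapply eventually0_impl.
  { apply eventually0_and; [apply (small_data 1); lra | apply (tail_upper _ _ _ _ _ HT 1); lra]. }
  intros e He ((Hd & _ & _) & Hup) q U D Hq HU HD.
  pose proof (tail_dl_pos _ _ _ _ _ HT e He) as Hd0. set (d := dl e) in *.
  pose proof (tail_range _ _ _ _ _ HT e U He HU) as Hp. pose proof (tail_psi0 _ _ _ _ _ HT) as Hpsi0.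
  assert (Hy : Rabs (1 / A - sg * D) <= Yy).
  { eapply Rle_trans; [apply Rabs_triang|]. rewrite Rabs_Ropp, (sg_mult_abs sg _ Hsg), (Rabs_pos_eq (1 / A)) by lra.
    unfold Yy. lra. }
  assert (Hq2 : Rabs (q * (d * m - d * mu1 * D)) <= d * (kf * (1 + Rabs m + mu1 * Ym))).
  { rewrite Rabs_mult, (Rabs_pos_eq q) by lra.
    assert (Rabs (d * m - d * mu1 * D) <= d * (Rabs m + mu1 * Ym)).
    { eapply Rle_trans; [apply Rabs_triang|].
      rewrite Rabs_Ropp, !Rabs_mult, (Rabs_pos_eq d), (Rabs_pos_eq mu1) by lra.
      assert (d * mu1 * Rabs D <= d * mu1 * Ym) by (apply Rmult_le_compat_l; [pos | lra]). lra. }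
    assert (0 <= d * (Rabs m + mu1 * Ym)) by pos.
    apply Rle_trans with (kf * (d * (Rabs m + mu1 * Ym))).
    - apply Rmult_le_compat; [lra | apply Rabs_pos | lra | exact H0].
    - assert (0 < kf * d) by pos. lra. }
  assert (G1 : d * (kf * (1 + Rabs m + mu1 * Ym)) <= 1 * (kf * (1 + Rabs m + mu1 * Ym))) by (apply Rmult_le_compat_r; lra).
  split.
  - eapply Rle_trans; [apply Rabs_triang|].
    assert (Rabs (beta * psi e U * (1 / A - sg * D)) <= beta * Yy).
    { rewrite Rabs_mult, (Rabs_pos_eq (beta * psi e U)) by pos.
      apply Rmult_le_compat; [pos | apply Rabs_pos | | exact Hy].
      rewrite <- (Rmult_1_r beta) at 2. apply Rmult_le_compat_l; lra. }
    unfold Cb. lra.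
  - intros HdU. eapply Rle_trans; [apply Rabs_triang|].
    assert (Rabs (beta * psi e U * (1 / A - sg * D)) <= d * (beta * (c + 1) * Yy)).
    { rewrite Rabs_mult, (Rabs_pos_eq (beta * psi e U)) by pos.
      replace (d * (beta * (c + 1) * Yy)) with (beta * (d * (c + 1)) * Yy) by ring.
      apply Rmult_le_compat; [pos | apply Rabs_pos | | exact Hy].
      apply Rmult_le_compat_l; [lra|].
      set (u := U / d). assert (Eu : U = d * u) by (unfold u; field; lra).
      assert (Hu : 1 <= u) by (apply Rmult_le_reg_l with d; [lra|]; rewrite <- Eu; lra).
      rewrite Eu. eapply Rle_trans; [apply Hup, Hu|]. apply Rmult_le_compat_l; [lra|].
      rewrite <- (Rmult_1_r (c + 1)) at 2. apply Rmult_le_compat_l; [lra|].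
      pose proof (inv_pow_le k 1 u ltac:(lra)) as Hi. rewrite pow1, Rinv_1 in Hi. exact Hi. }
    assert (0 < d * (beta * Yy)) by pos. unfold Cb. lra.
Qed.

(** The forcing of the eigencoordinates is of order [1] only while [U < d], and the launch ends this
    after time [d / c0]; from then on it is of order [d] and is damped. Both phases contribute
    [O(d)], whatever the length of the passage. *)
Lemma linear_regime (tau c0 : R) : 0 < tau -> 0 < c0 -> exists Ce, 0 < Ce /\
  eventually0 (fun e => forall U W s, sol e U W 0 -> U 0 = 0 -> Rabs (W 0) <= 2 * R0 ->
    (forall t, 0 <= t <= tau -> c0 * t <= U t) -> tau <= s ->
    (forall t, tau <= t <= s -> dl e <= U t) ->
    forall t, 0 <= t <= s ->
      Rabs (ks * W t - U t - ks * W 0 * exp (- kf * t)) <= Ce * dl e /\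
      Rabs (kf * W t - U t - kf * W 0 * exp (- ks * t)) <= Ce * dl e).
Proof.
  intros Htau Hc0. destruct difference_bounded as (Ym & HYm & HD).
  destruct (forcing_bound Ym HYm) as (Cb & HCb & HF).
  set (Ce := Cb / c0 + Cb / ks).
  assert (HCe1 : 0 < Cb / c0) by pos. assert (HCe2 : 0 < Cb / ks) by pos.
  exists Ce. split; [unfold Ce; lra|].
  eapply eventually0_impl.
  { apply eventually0_and; [exact HD|]. apply eventually0_and; [exact HF|].
    apply (small_data (c0 * tau)). pos. }
  clear HD HF. intros e He (HD & HF & (Hd & _ & _)) U W s Hsol HU0 HW0 Hlaunch Hs HUd.
  pose proof (tail_dl_pos _ _ _ _ _ HT e He) as Hd0. set (d := dl e) in *.
  assert (HU : forall t, 0 <= t <= s -> 0 <= U t).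
  { intros t Ht. destruct (Rle_lt_dec t tau).
    - specialize (Hlaunch t ltac:(lra)). assert (0 <= c0 * t) by pos. lra.
    - specialize (HUd t ltac:(lra)). lra. }
  set (ta := d / c0). assert (Hta : 0 < ta) by (unfold ta; pos).
  assert (Eta : c0 * ta = d) by (unfold ta; field; lra).
  assert (Hta2 : ta < tau) by (apply Rmult_lt_reg_l with c0; lra).
  assert (HUd' : forall t, ta <= t <= s -> d <= U t).
  { intros t Ht. destruct (Rle_lt_dec t tau).
    - specialize (Hlaunch t ltac:(lra)). assert (c0 * ta <= c0 * t) by (apply Rmult_le_compat_l; lra). lra.
    - apply HUd. lra. }
  assert (HDs : forall t, 0 <= t <= s -> Rabs (W t - U t) <= Ym).
  { apply HD; [exact Hsol | rewrite HU0, Rminus_0_r; exact HW0 | lra | exact HU]. }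
  (* One computation for both eigencoordinates: [(q, r)] is [(ks, kf)] or [(kf, ks)]. *)
  assert (Main : forall q r, q <= kf -> ks <= r -> 0 <= q ->
    (forall u w, q * field_W (d * mu1) (d * m) u w - field_U A beta sg (psi e) u w =
       - r * (q * w - u) + beta * psi e u * (1 / A - sg * (w - u)) + q * (d * m - d * mu1 * (w - u))) ->
    forall t, 0 <= t <= s -> Rabs (q * W t - U t - q * W 0 * exp (- r * t)) <= Ce * d).
  { intros q r Hq Hr Hq0 Hder t Ht.
    set (E := fun t => q * W t - U t - q * W 0 * exp (- r * t)).
    set (E' := fun t => q * field_W (d * mu1) (d * m) (U t) (W t) - field_U A beta sg (psi e) (U t) (W t)
                        - q * W 0 * (- r * exp (- r * t))).
    assert (DE : forall t, 0 <= t -> is_derive E t (E' t)).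
    { intros x Hx. destruct (Hsol x Hx) as [DU DW].
      apply (is_derive_minus (fun t => q * W t - U t) (fun t => q * W 0 * exp (- r * t))).
      - apply (is_derive_combination U W q); assumption.
      - apply (is_derive_scal (fun t => exp (- r * t)) x (q * W 0)).
        auto_derive; [exact I | ring]. }
    assert (HE : forall t, E' t + r * E t = beta * psi e (U t) * (1 / A - sg * (W t - U t))
                  + q * (d * m - d * mu1 * (W t - U t))).
    { intros x. unfold E', E. rewrite Hder. ring. }
    assert (E0 : E 0 = 0) by (unfold E; rewrite HU0, Rmult_0_r, exp_0; ring).
    assert (S0 : forall x, 0 <= x <= ta -> x <= s -> Rabs (E x) <= Cb * ta).
    { intros x Hx Hxs. apply Rle_trans with (Rabs (E 0) + Cb * (x - 0)).
      - apply (relax_abs_time E E' r); [lra | lra | lra | intros z Hz; apply DE; lra |].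
        intros z Hz. rewrite HE. apply HF; [lra | apply HU; lra | apply HDs; lra].
      - rewrite E0, Rabs_R0. assert (Cb * (x - 0) <= Cb * ta) by (apply Rmult_le_compat_l; lra). lra. }
    assert (Cb * ta = Cb / c0 * d) by (unfold ta; field; lra).
    assert (0 < Cb / ks * d) by pos.
    change (Rabs (E t) <= Ce * d). unfold Ce.
    destruct (Rle_lt_dec t ta) as [Htta|Htta]; [specialize (S0 t ltac:(lra) ltac:(lra)); lra|].
    pose proof (S0 ta ltac:(lra) ltac:(lra)) as S1.
    assert (S2 : Rabs (E t) <= Rabs (E ta) * exp (- r * (t - ta)) + Cb * d / r).
    { apply (relax_abs E E'); [lra | lra | pos | intros x Hx; apply DE; lra |].
      intros x Hx. rewrite HE. apply HF; [lra | apply HU; lra | apply HDs; lra | apply HUd'; lra]. }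
    assert (S3 : exp (- r * (t - ta)) <= 1).
    { apply exp_nonpos_le_1. assert (0 <= r * (t - ta)) by pos. lra. }
    pose proof (Rabs_pos (E ta)).
    assert (Rabs (E ta) * exp (- r * (t - ta)) <= Rabs (E ta) * 1) by (apply Rmult_le_compat_l; lra).
    assert (Cb * d / r <= Cb / ks * d).
    { unfold Rdiv. replace (Cb * / ks * d) with (Cb * d * / ks) by ring.
      apply Rmult_le_compat_l; [pos|]. apply Rinv_le_contravar; lra. }
    lra. }
  intros t Ht. split.
  - apply Main; [lra | lra | lra | | exact Ht]. intros u w. apply fast_derive; assumption.
  - apply Main; [lra | lra | lra | | exact Ht]. intros u w. apply slow_derive; assumption.
Qed.

(** [K1] is the height, in units of [delta], at which the linear description is abandoned. *)
Lemma approach (rad tau c0 Ce K1 : R) : 0 < rad <= R0 / 4 -> 0 < tau -> 0 < c0 -> 0 < Ce ->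
  1 <= K1 -> (kf + ks) * Ce + 1 < (kf - ks) * K1 -> exists C3, 0 < C3 /\
  forall x, 0 < x ->
  eventually0 (fun e => exists smax, forall U W, sol e U W 0 -> U 0 = 0 -> Rabs (W 0 - R0) <= rad ->
    (forall t, 0 <= t <= tau -> c0 * t <= U t) ->
    (forall s, tau <= s -> (forall t, tau <= t <= s -> dl e <= U t) ->
      forall t, 0 <= t <= s ->
      Rabs (ks * W t - U t - ks * W 0 * exp (- kf * t)) <= Ce * dl e /\
      Rabs (kf * W t - U t - kf * W 0 * exp (- ks * t)) <= Ce * dl e) ->
    exists ts, tau < ts <= smax /\ U ts = K1 * dl e /\ (forall t, tau <= t < ts -> K1 * dl e < U t) /\
      exp (- ks * ts) <= C3 * dl e /\ exp (- kf * ts) <= x * dl e).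
Proof.
  intros Hrad Htau Hc0 HCe HK1 HK1'.
  (* After [tau] the fast exponential is at most the fraction [1 - q] of the slow one, so [U] is at
     least a multiple of the slow exponential, up to [O(d)]. This converts [U ts = K1 * d] into the
     upper bound [C3 * d] for [exp (- ks * ts)]. *)
  set (q := 1 - exp (- (kf - ks) * tau)).
  assert (Hq : 0 < q).
  { unfold q. assert (exp (- (kf - ks) * tau) < 1); [|lra]. rewrite <- exp_0. apply exp_increasing.
    assert (0 < (kf - ks) * tau) by pos. lra. }
  set (C3 := ((kf - ks) * K1 + (kf + ks) * Ce) / (kf * ks * (R0 / 2) * q)).
  assert (HC3 : 0 < C3) by (unfold C3; pos).
  exists C3. split; [exact HC3|]. intros x Hx.
  (* [ts] exceeds any given [S] for small [e], and then the ratio of the fast to the slow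
     exponential is at most [x / C3], which leaves a fast part of at most [x * d]. *)
  destruct (exp_eventually_small (kf - ks) (x / C3)) as (S & HS & HSx); [lra | pos |].
  eapply eventually0_impl.
  { apply (small_data (Rmin (c0 * tau / K1) (exp (- ks * S) / C3))). pose proof (exp_pos (- ks * S)). pos. }
  intros e He (Hd & _ & _). pose proof (tail_dl_pos _ _ _ _ _ HT e He) as Hd0. set (d := dl e) in *.
  assert (Hd1 : d * K1 < c0 * tau).
  { assert (H : d < c0 * tau / K1) by (eapply Rlt_le_trans; [exact Hd | apply Rmin_l]).
    apply Rmult_lt_compat_r with (r := K1) in H; [|lra].
    replace (c0 * tau / K1 * K1) with (c0 * tau) in H by (field; lra). exact H. }
  assert (Hd2 : C3 * d < exp (- ks * S)).
  { assert (H : d < exp (- ks * S) / C3) by (eapply Rlt_le_trans; [exact Hd | apply Rmin_r]).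
    apply Rmult_lt_compat_l with (r := C3) in H; [|lra].
    replace (C3 * (exp (- ks * S) / C3)) with (exp (- ks * S)) in H by (field; lra). exact H. }
  (* [s1] does not depend on the orbit. If [U] stayed above [K1 * d] up to [tau + s1], the decayed
     slow exponential would contradict [(kf + ks) * Ce + 1 < (kf - ks) * K1]. *)
  destruct (exp_eventually_small ks (d / (kf * ks * (2 * R0)))) as (s1 & Hs1 & Hs1'); [lra | pos |].
  exists (tau + s1). intros U W Hsol HU0 HW0 Hl Hlin.
  apply Rabs_le_between in HW0.
  assert (Htau0 : 0 < U tau - K1 * d) by (specialize (Hl tau ltac:(lra)); lra).
  assert (Hdrop : exists t, tau <= t <= tau + s1 /\ U t - K1 * d <= 0).
  { apply NNPP. intro N.
    assert (HU : forall t, tau <= t <= tau + s1 -> K1 * d < U t).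
    { intros t Ht. apply Rnot_le_lt. intro. apply N. exists t. split; [exact Ht | lra]. }
    assert (H1d : 1 * d <= K1 * d) by (apply Rmult_le_compat_r; lra).
    destruct (Hlin (tau + s1) ltac:(lra)) with (t := tau + s1) as [L1 L2].
    { intros t Ht. specialize (HU t Ht). lra. }
    { lra. }
    specialize (HU (tau + s1) ltac:(lra)).
    apply Rabs_le_between in L1, L2.
    assert (Hexp : exp (- ks * (tau + s1)) <= exp (- ks * s1)).
    { apply exp_le. assert (0 < ks * tau) by pos. lra. }
    assert (He1 : kf * ks * (2 * R0) * exp (- ks * (tau + s1)) <= d).
    { apply Rle_trans with (kf * ks * (2 * R0) * (d / (kf * ks * (2 * R0)))); [|right; field; lra].
      apply Rmult_le_compat_l; [pos | lra]. }
    set (E1 := exp (- ks * (tau + s1))) in *. set (E2 := exp (- kf * (tau + s1))) in *.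
    assert (HE1 : 0 < E1) by apply exp_pos. assert (HE2 : 0 < E2) by apply exp_pos.
    set (u := U (tau + s1)) in *. set (w := W (tau + s1)) in *.
    assert (Eu : (kf - ks) * u = ks * (kf * w - u) - kf * (ks * w - u)) by ring.
    assert (ks * (kf * w - u) <= ks * (kf * W 0 * E1 + Ce * d)) by (apply Rmult_le_compat_l; lra).
    assert (- (kf * (Ce * d)) <= kf * (ks * w - u)).
    { assert (0 <= ks * W 0 * E2) by pos.
      assert (kf * - (Ce * d) <= kf * (ks * w - u)) by (apply Rmult_le_compat_l; lra). lra. }
    assert (kf * ks * W 0 * E1 <= kf * ks * (2 * R0) * E1).
    { apply Rmult_le_compat_r; [lra|]. apply Rmult_le_compat_l; [pos | lra]. }
    assert ((kf - ks) * (K1 * d) < (kf - ks) * u) by (apply Rmult_lt_compat_l; lra).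
    assert (((kf + ks) * Ce + 1) * d < (kf - ks) * K1 * d) by (apply Rmult_lt_compat_r; lra).
    lra. }
  destruct Hdrop as (s2 & Hs2 & Hdrop).
  destruct (first_zero (fun t => U t - K1 * d) tau s2) as (ts & Hts & Hz & Hpos); [lra | | exact Htau0 | exact Hdrop |].
  { intros t Ht. apply continuity_pt_minus; [exact (is_derive_continuity_pt _ _ _ (proj1 (Hsol t ltac:(lra))))|].
    apply continuity_pt_const; intros ? ?; reflexivity. }
  assert (H1d : 1 * d <= K1 * d) by (apply Rmult_le_compat_r; lra).
  assert (Hts0 : exp (- ks * ts) <= C3 * d).
  { destruct (Hlin ts ltac:(lra)) with (t := ts) as [L1 L2].
    { intros t Ht. destruct (Req_dec t ts) as [->|]; [lra|]. specialize (Hpos t ltac:(lra)). lra. }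
    { lra. }
    apply Rabs_le_between in L1, L2.
    assert (HE : exp (- kf * ts) <= exp (- ks * ts) * (1 - q)).
    { unfold q. replace (1 - (1 - exp (- (kf - ks) * tau))) with (exp (- (kf - ks) * tau)) by ring.
      rewrite <- exp_plus. apply exp_le. assert ((kf - ks) * tau <= (kf - ks) * ts) by (apply Rmult_le_compat_l; lra). lra. }
    set (E1 := exp (- ks * ts)) in *. set (E2 := exp (- kf * ts)) in *.
    assert (HE1 : 0 < E1) by apply exp_pos. assert (HE2 : 0 < E2) by apply exp_pos.
    set (w := W ts) in *.
    assert (Eu : (kf - ks) * U ts = ks * (kf * w - U ts) - kf * (ks * w - U ts)) by ring.
    replace (U ts) with (K1 * d) in * by lra.
    assert (ks * (kf * W 0 * E1 - Ce * d) <= ks * (kf * w - K1 * d)) by (apply Rmult_le_compat_l; lra).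
    assert (kf * (ks * w - K1 * d) <= kf * (ks * W 0 * E2 + Ce * d)) by (apply Rmult_le_compat_l; lra).
    assert (H5 : kf * ks * W 0 * (E1 * q) <= ((kf - ks) * K1 + (kf + ks) * Ce) * d).
    { assert (kf * ks * W 0 * E2 <= kf * ks * W 0 * (E1 * (1 - q))) by (apply Rmult_le_compat_l; [pos | lra]). lra. }
    assert (H6 : kf * ks * (R0 / 2) * (E1 * q) <= kf * ks * W 0 * (E1 * q)).
    { apply Rmult_le_compat_r; [pos|]. apply Rmult_le_compat_l; [pos | lra]. }
    apply Rmult_le_reg_l with (kf * ks * (R0 / 2) * q); [pos|].
    unfold C3. replace (kf * ks * (R0 / 2) * q * (((kf - ks) * K1 + (kf + ks) * Ce) / (kf * ks * (R0 / 2) * q) * d))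
      with (((kf - ks) * K1 + (kf + ks) * Ce) * d) by (field; lra).
    lra. }
  assert (HtsS : S < ts).
  { apply Rnot_le_lt. intro. assert (exp (- ks * S) <= exp (- ks * ts)); [|lra].
    apply exp_le. assert (ks * ts <= ks * S) by (apply Rmult_le_compat_l; lra). lra. }
  exists ts. split; [lra|]. split; [lra|]. split; [|split; [exact Hts0|]].
  - intros t Ht. destruct (Req_dec t tau) as [->|]; [lra|]. specialize (Hpos t ltac:(lra)). lra.
  - replace (- kf * ts) with (- ks * ts + - (kf - ks) * ts) by ring. rewrite exp_plus.
    assert (H2 : exp (- (kf - ks) * ts) <= x / C3).
    { eapply Rle_trans; [|exact HSx]. apply exp_le.
      assert ((kf - ks) * S <= (kf - ks) * ts) by (apply Rmult_le_compat_l; lra). lra. }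
    replace (x * d) with (C3 * d * (x / C3)) by (field; lra).
    apply Rmult_le_compat; [pos | pos | exact Hts0 | exact H2].
Qed.

End Approach.

(** * Descent from [U = K1 * d] to the line: scaled system, then true system *)

Lemma is_derive_shift (f : R -> R) (a t l : R) : is_derive f (a + t) l -> is_derive (fun t => f (a + t)) t l.
Proof.
  intros H. replace l with (scal 1 l) by (unfold scal; simpl; unfold mult; simpl; ring).
  apply (is_derive_comp f (fun t => a + t) t l 1); [exact H|]. auto_derive; [exact I | ring].
Qed.

Lemma continuity_pt_minus_const (f : R -> R) (b t : R) : continuity_pt f t -> continuity_pt (fun s => f s - b) t.
Proof. intros H. apply continuity_pt_minus; [exact H | apply continuity_pt_const; intros ? ?; reflexivity]. Qed.

(** The speed bound need only hold as long as [u] has stayed above the level, so it may itself be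
    derived from that fact. *)
Lemma reach_level (u du : R -> R) (a b p : R) : 0 < p -> b < u a ->
  (forall t, a <= t -> is_derive u t (du t)) ->
  (forall s, a <= s -> (forall t, a <= t <= s -> b <= u t) -> forall t, a <= t <= s -> du t <= - p) ->
  exists t1, a < t1 <= a + (u a - b) / p /\ u t1 = b /\ (forall t, a <= t < t1 -> b < u t) /\
    forall t, a <= t <= t1 -> du t <= - p.
Proof.
  intros Hp Hb Hd Hdu. set (T := a + (u a - b) / p).
  assert (HT : a < T) by (unfold T; assert (0 < (u a - b) / p) by pos; lra).
  assert (Hex : exists t, a <= t <= T /\ u t <= b).
  { apply NNPP. intro N.
    assert (Hall : forall t, a <= t <= T -> b < u t).
    { intros t Ht. apply Rnot_le_lt. intro. apply N. exists t. auto. }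
    assert (u T - u a <= - p * (T - a)).
    { apply (increment_le u du); [lra | intros t Ht; apply Hd; lra |].
      apply (Hdu T); [lra|]. intros t Ht. left. apply Hall, Ht. }
    assert (p * (T - a) = u a - b) by (unfold T; field; lra).
    specialize (Hall T ltac:(lra)). lra. }
  destruct Hex as (t & Ht & Hut).
  destruct (first_zero (fun t => u t - b) a t) as (t1 & Ht1 & Hz & Hpos); [lra | | lra | lra |].
  { intros s Hs. apply continuity_pt_minus_const.
    exact (is_derive_continuity_pt _ _ _ (Hd s ltac:(lra))). }
  exists t1. split; [lra|]. split; [lra|]. split.
  - intros s Hs. specialize (Hpos s Hs). lra.
  - apply Hdu; [lra|]. intros s Hs. destruct (Req_dec s t1) as [->|]; [lra|].
    specialize (Hpos s ltac:(lra)). lra.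
Qed.

Section Descent.
Variables (k : nat) (A kf ks C m m' : R).
Hypothesis Hks : 0 < ks < kf.
Hypothesis HA : A = kf * ks.
Hypothesis HA1 : 1 + A = kf + ks.
Hypothesis HC : 0 < C.
Hypothesis Hm : m < m'.

Let G := nullcline k A C.

Let A_pos : 0 < A.
Proof. rewrite HA. pos. Qed.

Let nullcline_monotone (K u : R) : 0 < K <= u -> INR k * C <= ks * K ^ (k + 1) ->
  ks * K + C * / K ^ k <= ks * u + C * / u ^ k.
Proof.
  intros Hu Hk.
  assert (H : 0 * (u - K) <= (ks * u + C * / u ^ k) - (ks * K + C * / K ^ k)); [|lra].
  apply (increment_ge (fun u => ks * u + C * / u ^ k) (fun u => ks * 1 + C * (- INR k * / u ^ (k + 1)))); [lra| |].
  - intros t Ht. apply (is_derive_plus (fun u => ks * u) (fun u => C * / u ^ k)).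
    + apply (is_derive_scal (fun u => u) t ks), (is_derive_id t).
    + apply (is_derive_scal (fun u => / u ^ k) t C), is_derive_inv_pow. lra.
  - intros t Ht. assert (K ^ (k + 1) <= t ^ (k + 1)) by (apply pow_incr; lra).
    assert (Hp : 0 < t ^ (k + 1)) by (apply pow_lt; lra).
    apply Rmult_le_reg_r with (t ^ (k + 1)); [exact Hp|].
    replace ((ks * 1 + C * (- INR k * / t ^ (k + 1))) * t ^ (k + 1)) with (ks * t ^ (k + 1) - INR k * C) by (field; lra).
    assert (ks * K ^ (k + 1) <= ks * t ^ (k + 1)) by (apply Rmult_le_compat_l; lra). lra.
Qed.

(** Far out the fast coordinate [w = ks * r - u] relaxes to its equilibrium, and [K1] is taken so
    large that this happens before [u] reaches [K]. The orbit then crosses [u = K] below the graph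
    of [f], and the supersolution keeps it below, with speed at least [d0 / 2], down to [u1]. The
    exit data [u1] and [f1] depend on neither [Cw] nor [K1]. *)
Lemma scaled_descent : passing k A kf ks C m' -> exists u1 f1, 0 < u1 /\
  A * f1 + 2 * A * Rabs m' * u1 + 1 <= C * / u1 ^ k /\
  forall Cw, 0 < Cw -> exists K1min, u1 < K1min /\ forall K1, K1min <= K1 ->
  exists Tm pm zt, 0 < Tm /\ 0 < pm /\ 0 < zt /\
  forall u r du dr : R -> R, u 0 = K1 -> Rabs (ks * r 0 - u 0) <= Cw ->
    (forall t, 0 <= t -> is_derive u t (du t) /\ is_derive r t (dr t)) ->
    (forall S, 0 <= S -> (forall t, 0 <= t <= S -> u1 <= u t) -> forall t, 0 <= t <= S ->
       Rabs (du t - (A * r t - G (u t))) <= zt /\ Rabs (dr t - (m - u t)) <= zt) ->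
    exists t1, 0 < t1 <= Tm /\ u t1 = u1 /\ r t1 <= f1 /\
      (forall t, 0 <= t < t1 -> u1 < u t) /\ (forall t, 0 <= t <= t1 -> du t <= - pm).
Proof.
  intros (u1 & K & M & d0 & f & df & Hu1 & Hd0 & Df & Mdf & Hgap & Hsup & HfK & HkC & Hf1).
  exists u1, (f u1). split; [lra|]. split; [exact Hf1|]. intros Cw HCw.
  assert (HM : 0 <= M) by (eapply Rle_trans; [apply Rabs_pos | apply (Mdf u1); lra]).
  set (et := m' - m). assert (Het : 0 < et) by (unfold et; lra).
  pose proof (inv_pow_pos k K ltac:(lra)) as HKp.
  set (CK := C * / K ^ k) in *. assert (HCK : 0 < CK) by (unfold CK; pos).
  (* [w < Wl] at [u = K] says exactly that [r < f K]. *)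
  set (Wl := ks * f K - K).
  assert (HWl : ks * m' + CK <= kf * Wl).
  { unfold Wl. assert (H : A * (K / ks + m' / kf + CK / A) <= A * f K) by (apply Rmult_le_compat_l; lra).
    replace (A * (K / ks + m' / kf + CK / A)) with (kf * K + ks * m' + CK) in H by (rewrite HA; field; lra).
    rewrite HA in H. lra. }
  assert (HgapK : d0 <= ks * K + CK - kf * Wl).
  { specialize (Hgap K ltac:(lra)). unfold nullcline in Hgap. fold CK in Hgap. rewrite HA1, HA in Hgap.
    unfold Wl. lra. }
  (* Size of the tolerated perturbation: small against the drift slack [et = m' - m], against the
     gap [d0], and against [et] divided by the slope bound [M] of the supersolution. *)
  set (zt := Rmin (Rmin (et * ks / (4 * (1 + ks))) (d0 / 2)) (Rmin 1 (et / (2 * (M + 1))))).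
  assert (Hzt : 0 < zt) by (unfold zt; pos).
  assert (Hz : (1 + ks) * zt <= et * ks / 4 /\ zt <= d0 / 2 /\ zt <= 1 /\ (M + 1) * zt <= et / 2).
  { pose proof (Rmin_l (Rmin (et * ks / (4 * (1 + ks))) (d0 / 2)) (Rmin 1 (et / (2 * (M + 1))))) as Z1.
    pose proof (Rmin_r (Rmin (et * ks / (4 * (1 + ks))) (d0 / 2)) (Rmin 1 (et / (2 * (M + 1))))) as Z2.
    pose proof (Rmin_l (et * ks / (4 * (1 + ks))) (d0 / 2)) as Z3.
    pose proof (Rmin_r (et * ks / (4 * (1 + ks))) (d0 / 2)) as Z4.
    pose proof (Rmin_l 1 (et / (2 * (M + 1)))) as Z5. pose proof (Rmin_r 1 (et / (2 * (M + 1)))) as Z6.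
    fold zt in Z1, Z2. repeat split; [| lra | lra |].
    - assert (Z : zt <= et * ks / (4 * (1 + ks))) by lra.
      apply Rmult_le_compat_l with (r := 1 + ks) in Z; [|lra].
      replace ((1 + ks) * (et * ks / (4 * (1 + ks)))) with (et * ks / 4) in Z by (field; lra). exact Z.
    - assert (Z : zt <= et / (2 * (M + 1))) by lra.
      apply Rmult_le_compat_l with (r := M + 1) in Z; [|lra].
      replace ((M + 1) * (et / (2 * (M + 1)))) with (et / 2) in Z by (field; lra). exact Z. }
  destruct Hz as (Hz1 & Hz2 & Hz3 & Hz4). clearbody zt.
  pose proof (Rabs_pos m) as Hm0. pose proof (Rle_abs m) as Hm1. pose proof (Rle_abs (- m)) as Hm2.
  rewrite Rabs_Ropp in Hm2.
  set (F := CK + ks * Rabs m + 1 + ks). assert (HF : 0 < F) by (unfold F; pos).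
  set (Cw2 := Cw + F / kf). assert (HCw2 : 0 < Cw2) by (unfold Cw2; pos).
  set (bw := (CK + ks * m + (1 + ks) * zt) / kf).
  assert (Hbw : kf * bw = CK + ks * m + (1 + ks) * zt) by (unfold bw; field; lra).
  set (ew := ks * et / (4 * kf)). assert (Hew : 0 < ew) by (unfold ew; pos).
  assert (Hkew : kf * ew = ks * et / 4) by (unfold ew; field; lra).
  assert (Hbw' : bw <= Wl - 3 * ew).
  { apply Rmult_le_reg_l with kf; [lra|]. unfold et in *. lra. }
  pose proof (Rabs_pos bw) as Hbw0.
  (* After time [Td] a fast coordinate of initial size [Cw2] has come within [ew] of its asymptotic
     upper bound [bw]. *)
  destruct (exp_eventually_small kf (ew / (Cw2 + Rabs bw + 1))) as (Td & HTd & HTd'); [lra | pos |].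
  assert (HTd2 : (Cw2 + Rabs bw) * exp (- kf * Td) <= ew).
  { apply Rmult_le_compat_l with (r := Cw2 + Rabs bw + 1) in HTd'; [|lra].
    replace ((Cw2 + Rabs bw + 1) * (ew / (Cw2 + Rabs bw + 1))) with ew in HTd' by (field; lra).
    pose proof (exp_pos (- kf * Td)). lra. }
  set (Cc := kf * Cw2 + CK + 1). assert (HCc : 0 < Cc) by (unfold Cc; pos).
  (* Above [Kl] the linear term alone gives descent at speed [1], whatever the fast coordinate does
     within its bound. *)
  set (Kl := K + (kf * Cw2 + 2) / ks).
  assert (HKl0 : 0 < (kf * Cw2 + 2) / ks) by pos.
  assert (HKl : ks * Kl = ks * K + kf * Cw2 + 2) by (unfold Kl; field; lra).
  assert (HCcs : 0 < Cc / ks) by pos.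
  (* The factor [exp (ks * Td)] outweighs the largest possible descent during [Td], so [u] is still
     above [Kl] when the fast coordinate has settled. *)
  exists ((Kl + Cc / ks) * exp (ks * Td)).
  assert (Hexp1 : 1 <= exp (ks * Td)) by (rewrite <- exp_0; apply exp_le; pos).
  assert (HKmin : Kl + Cc / ks <= (Kl + Cc / ks) * exp (ks * Td)).
  { rewrite <- (Rmult_1_r (Kl + Cc / ks)) at 1. apply Rmult_le_compat_l; [unfold Kl; lra | lra]. }
  split; [unfold Kl in *; lra|].
  intros K1 HK1. set (p1 := Rmin 1 (d0 / 2)). assert (Hp1 : 0 < p1) by (unfold p1; pos).
  assert (HK1K : K < K1) by (unfold Kl in *; lra).
  exists ((K1 - K) / p1 + (K - u1) / (d0 / 2)), p1, zt.
  split; [assert (0 < (K1 - K) / p1) by pos; assert (0 < (K - u1) / (d0 / 2)) by pos; lra|].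
  split; [exact Hp1|]. split; [exact Hzt|].
  intros u r du dr Hu0 Hw0 Hder Herr.
  set (w := fun t => ks * r t - u t). set (dw := fun t => ks * dr t - du t).
  assert (Dw : forall t, 0 <= t -> is_derive w t (dw t)).
  { intros t Ht. destruct (Hder t Ht). apply is_derive_combination; assumption. }
  assert (Stage1 : forall S, 0 <= S -> (forall t, 0 <= t <= S -> K <= u t) -> forall t, 0 <= t <= S ->
    Rabs (w t) <= Cw2 /\ du t <= - p1 /\ (t <= Td -> Kl <= u t) /\ (Td <= t -> w t < Wl)).
  { intros S HS HuK.
    assert (Her : forall t, 0 <= t <= S -> Rabs (du t - (A * r t - G (u t))) <= zt /\ Rabs (dr t - (m - u t)) <= zt).
    { apply Herr; [exact HS|]. intros t Ht. specialize (HuK t Ht). lra. }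
    assert (HCu : forall t, 0 <= t <= S -> 0 < C * / u t ^ k <= CK).
    { intros t Ht. specialize (HuK t Ht). pose proof (inv_pow_pos k (u t) ltac:(lra)).
      split; [pos|]. unfold CK. apply Rmult_le_compat_l; [lra|]. apply inv_pow_le. lra. }
    assert (Hdw : forall t, 0 <= t <= S -> Rabs (dw t + kf * w t - (C * / u t ^ k + ks * m)) <= (1 + ks) * zt).
    { intros t Ht. destruct (Her t Ht) as [E1 E2].
      replace (dw t + kf * w t - (C * / u t ^ k + ks * m))
        with (ks * (dr t - (m - u t)) + - (du t - (A * r t - G (u t)))).
      - eapply Rle_trans; [apply Rabs_triang|]. rewrite Rabs_Ropp, Rabs_mult, (Rabs_pos_eq ks) by lra.
        assert (ks * Rabs (dr t - (m - u t)) <= ks * zt) by (apply Rmult_le_compat_l; lra). lra.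
      - unfold dw, w, G, nullcline. rewrite HA1, HA. ring. }
    assert (Hdu : forall t, 0 <= t <= S -> Rabs (du t - (- ks * u t + kf * w t - C * / u t ^ k)) <= zt).
    { intros t Ht. destruct (Her t Ht) as [E1 _].
      replace (- ks * u t + kf * w t - C * / u t ^ k) with (A * r t - G (u t)); [exact E1|].
      unfold w, G, nullcline. rewrite HA1, HA. ring. }
    assert (Hw : forall t, 0 <= t <= S -> Rabs (w t) <= Cw2).
    { intros t Ht. unfold Cw2. eapply Rle_trans.
      - apply (relax_abs w dw kf F 0 t); [lra | lra | lra | intros x Hx; apply Dw; lra |].
        intros x Hx. specialize (Hdw x ltac:(lra)). specialize (HCu x ltac:(lra)).
        apply Rabs_le_between in Hdw.
        assert (ks * zt <= ks * 1) by (apply Rmult_le_compat_l; lra).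
        assert (ks * m <= ks * Rabs m) by (apply Rmult_le_compat_l; lra).
        assert (ks * - m <= ks * Rabs m) by (apply Rmult_le_compat_l; lra).
        apply Rabs_le. unfold F. split; lra.
      - assert (Rabs (w 0) * exp (- kf * (t - 0)) <= Cw * 1); [|lra].
        apply Rmult_le_compat; [apply Rabs_pos | pos | exact Hw0 |].
        apply exp_nonpos_le_1. assert (0 <= kf * (t - 0)) by pos. lra. }
    intros t Ht. specialize (Hw t Ht) as Hwt. split; [exact Hwt|].
    assert (Hlow : t <= Td -> Kl <= u t).
    { intros HtTd.
      assert (H : (u 0 - - (Cc / ks)) * exp (- ks * (t - 0)) <= u t - - (Cc / ks)).
      { apply (exp_comparison_ge u du); [lra | intros x Hx; apply Hder; lra |].
        intros x Hx. specialize (Hdu x ltac:(lra)). specialize (HCu x ltac:(lra)). specialize (Hw x ltac:(lra)).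
        apply Rabs_le_between in Hdu, Hw.
        replace (- ks * (u x - - (Cc / ks))) with (- ks * u x - Cc) by (field; lra).
        assert (kf * - Cw2 <= kf * w x) by (apply Rmult_le_compat_l; lra). unfold Cc. lra. }
      rewrite Hu0 in H. rewrite Rminus_0_r in H.
      assert (Hx1 : exp (- ks * Td) <= exp (- ks * t)).
      { apply exp_le. assert (ks * t <= ks * Td) by (apply Rmult_le_compat_l; lra). lra. }
      assert (Hx2 : (Kl + Cc / ks) * exp (ks * Td) * exp (- ks * Td) = Kl + Cc / ks).
      { rewrite Rmult_assoc, <- exp_plus. replace (ks * Td + - ks * Td) with 0 by ring. rewrite exp_0. ring. }
      pose proof (exp_pos (- ks * Td)) as Hx3. pose proof (exp_pos (- ks * t)).
      assert (Hx4 : (Kl + Cc / ks) * exp (ks * Td) * exp (- ks * Td) <= (K1 - - (Cc / ks)) * exp (- ks * t)).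
      { apply Rmult_le_compat; [unfold Kl; pos | lra | lra | lra]. }
      lra. }
    assert (Hhigh : Td <= t -> w t <= Wl - 2 * ew).
    { intros HtTd.
      assert (H : w t - bw <= (w 0 - bw) * exp (- kf * (t - 0))).
      { apply (exp_comparison w dw); [lra | intros x Hx; apply Dw; lra |].
        intros x Hx. specialize (Hdw x ltac:(lra)). specialize (HCu x ltac:(lra)).
        apply Rabs_le_between in Hdw. lra. }
      rewrite Rminus_0_r in H.
      assert (Hx1 : exp (- kf * t) <= exp (- kf * Td)).
      { apply exp_le. assert (kf * Td <= kf * t) by (apply Rmult_le_compat_l; lra). lra. }
      assert (Hx2 : (w 0 - bw) * exp (- kf * t) <= (Cw2 + Rabs bw) * exp (- kf * Td)).
      { pose proof (exp_pos (- kf * t)). apply Rle_trans with ((Cw2 + Rabs bw) * exp (- kf * t)).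
        - apply Rmult_le_compat_r; [lra|]. specialize (Hw 0 ltac:(lra)). apply Rabs_le_between in Hw.
          pose proof (Rle_abs (- bw)) as Hb. rewrite Rabs_Ropp in Hb. lra.
        - apply Rmult_le_compat_l; lra. }
      lra. }
    split; [|split; [exact Hlow | intros H; specialize (Hhigh H); lra]].
    specialize (Hdu t Ht). specialize (HCu t Ht). apply Rabs_le_between in Hdu.
    destruct (Rle_lt_dec t Td) as [H|H].
    - specialize (Hlow H). apply Rle_trans with (-1); [|unfold p1; pose proof (Rmin_l 1 (d0 / 2)); lra].
      assert (ks * Kl <= ks * u t) by (apply Rmult_le_compat_l; lra).
      apply Rabs_le_between in Hwt.
      assert (kf * w t <= kf * Cw2) by (apply Rmult_le_compat_l; lra).
      assert (0 < ks * K) by pos. lra.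
    - specialize (Hhigh ltac:(lra)). apply Rle_trans with (- (d0 / 2)); [|unfold p1; pose proof (Rmin_r 1 (d0 / 2)); lra].
      assert (kf * w t <= kf * Wl) by (apply Rmult_le_compat_l; lra).
      specialize (HuK t Ht). pose proof (nullcline_monotone K (u t) ltac:(lra) HkC) as Hmon. fold CK in Hmon. lra. }
  destruct (reach_level u du 0 K p1 Hp1) as (tK & HtK & HuK & HposK & HduK).
  { lra. }
  { intros t Ht. apply Hder, Ht. }
  { intros s Hs HuK t Ht. apply (Stage1 s Hs HuK t Ht). }
  assert (HuK' : forall t, 0 <= t <= tK -> K <= u t).
  { intros t Ht. destruct (Req_dec t tK) as [->|]; [lra|]. left. apply HposK. lra. }
  destruct (Stage1 tK ltac:(lra) HuK' tK ltac:(lra)) as (HwK & _ & HlowK & HhighK).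
  assert (HtKTd : Td <= tK).
  { apply Rnot_lt_le. intro H. specialize (HlowK ltac:(lra)). unfold Kl in HlowK. lra. }
  specialize (HhighK HtKTd).
  assert (HrK : r tK < f K).
  { unfold w, Wl in HhighK. rewrite HuK in HhighK. apply Rmult_lt_reg_l with ks; lra. }
  assert (Stage2 : forall s, tK <= s -> (forall t, tK <= t <= s -> u1 <= u t) -> forall t, tK <= t <= s ->
    (u t <= K /\ r t < f (u t)) /\ du t <= - (d0 / 2)).
  { intros s Hs Hus.
    assert (Hus' : forall t, 0 <= t <= s -> u1 <= u t).
    { intros t Ht. destruct (Rle_lt_dec t tK); [specialize (HuK' t ltac:(lra)); lra | apply Hus; lra]. }
    assert (Hfu : forall t, tK <= t <= s -> u t <= K ->
       is_derive (fun t => f (u t) - r t) t (du t * df (u t) - dr t)).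
    { intros t Ht HtK'. destruct (Hder t ltac:(lra)) as [Du Dr].
      apply (is_derive_minus (fun t => f (u t)) r); [|exact Dr].
      apply (is_derive_comp f u); [apply Df; split; [apply Hus; lra | exact HtK'] | exact Du]. }
    assert (Hspeed : forall t, tK <= t <= s -> u t <= K -> r t <= f (u t) -> du t <= - (d0 / 2)).
    { intros t Ht H1 H2. destruct (Herr s ltac:(lra) Hus' t ltac:(lra)) as [E1 _]. apply Rabs_le_between in E1.
      specialize (Hgap (u t) ltac:(split; [apply Hus; lra | exact H1])). fold G in Hgap.
      assert (A * r t <= A * f (u t)) by (apply Rmult_le_compat_l; lra). lra. }
    assert (Hin : forall t, tK <= t <= s -> u t <= K /\ r t < f (u t)).
    { apply real_induction.
      - rewrite HuK. split; [lra | exact HrK].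
      - intros t Ht Hall.
        assert (HtK1 : u t <= K).
        { assert (0 <= K - u t); [|lra].
          apply (nonneg_left_limit (fun t => K - u t) tK); [lra | | intros x Hx; specialize (Hall x Hx); lra].
          apply continuity_pt_minus; [apply continuity_pt_const; intros ? ?; reflexivity|].
          exact (is_derive_continuity_pt _ _ _ (proj1 (Hder t ltac:(lra)))). }
        split; [exact HtK1|].
        assert (Hq : 0 <= f (u t) - r t).
        { apply (nonneg_left_limit (fun t => f (u t) - r t) tK); [lra | | intros x Hx; specialize (Hall x Hx); lra].
          exact (is_derive_continuity_pt _ _ _ (Hfu t ltac:(lra) HtK1)). }
        (* At a first contact with the graph the supersolution inequality for [m'] makes the
           derivative of [f (u t) - r t] at least [m' - m] minus the perturbation, hence positive,
           which is impossible. *)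
        destruct (Req_dec (f (u t) - r t) 0) as [Hz|Hz]; [|lra]. exfalso.
        pose proof (derive_nonpos_at_zero _ tK t _ ltac:(lra) (Hfu t ltac:(lra) HtK1)) as Hd.
        specialize (Hd ltac:(intros x Hx; specialize (Hall x Hx); lra) Hz).
        destruct (Herr s ltac:(lra) Hus' t ltac:(lra)) as [E1 E2]. apply Rabs_le_between in E2.
        assert (Hut : u1 <= u t <= K) by (split; [apply Hus; lra | exact HtK1]).
        specialize (Hsup (u t) Hut). fold G in Hsup. specialize (Mdf (u t) Hut).
        set (er := du t - (A * r t - G (u t))) in *.
        assert (Edu : du t = er - (G (u t) - A * f (u t))) by (unfold er; replace (f (u t)) with (r t) by lra; ring).
        rewrite Edu in Hd.
        assert (Rabs (er * df (u t)) <= zt * M).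
        { rewrite Rabs_mult. apply Rmult_le_compat; [apply Rabs_pos | apply Rabs_pos | exact E1 | exact Mdf]. }
        apply Rabs_le_between in H. unfold et in *. lra.
      - intros t Ht Hall. destruct (Hall t ltac:(lra)) as [H1 H2].
        pose proof (Hspeed t ltac:(lra) H1 ltac:(lra)) as H3.
        destruct (Hder t ltac:(lra)) as [Du Dr].
        destruct (pos_right (fun x => u t - u x) t (0 - du t)) as (h1 & Hh1 & P1).
        { apply (is_derive_minus (fun _ => u t) u); [apply (is_derive_const (u t) t) | exact Du]. }
        { right. lra. }
        destruct (pos_right (fun x => f (u x) - r x) t _ (Hfu t ltac:(lra) H1)) as (h2 & Hh2 & P2).
        { left. lra. }
        exists (Rmin h1 h2). split; [pos|]. intros x Hx.
        pose proof (Rmin_l h1 h2). pose proof (Rmin_r h1 h2).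
        specialize (P1 x ltac:(lra)). specialize (P2 x ltac:(lra)). split; lra. }
    intros t Ht. destruct (Hin t Ht) as [H1 H2]. split; [split; assumption|]. apply Hspeed; lra. }
  destruct (reach_level u du tK u1 (d0 / 2)) as (t1 & Ht1 & Hu1' & Hpos1 & Hdu1).
  { lra. }
  { lra. }
  { intros t Ht. apply Hder. lra. }
  { intros s Hs Hus t Ht. apply (Stage2 s Hs Hus t Ht). }
  exists t1. rewrite HuK in Ht1. rewrite Hu0 in HtK. split; [lra|]. split; [exact Hu1'|].
  assert (Hus1 : forall t, tK <= t <= t1 -> u1 <= u t).
  { intros t Ht. destruct (Req_dec t t1) as [->|]; [lra|]. left. apply Hpos1. lra. }
  split; [|split].
  - destruct (Stage2 t1 ltac:(lra) Hus1 t1 ltac:(lra)) as [[_ H] _]. rewrite Hu1' in H. lra.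
  - intros t Ht. destruct (Rle_lt_dec t tK); [specialize (HuK' t ltac:(lra)); lra | apply Hpos1; lra].
  - intros t Ht. destruct (Rle_lt_dec t tK); [apply HduK; lra|].
    apply Rle_trans with (- (d0 / 2)); [apply Hdu1; lra|]. unfold p1. pose proof (Rmin_r 1 (d0 / 2)). lra.
Qed.

End Descent.

Section TrueDescent.
Variables (k : nat) (A kf ks beta sg c psi0 : R) (dl : R -> R) (psi : R -> R -> R) (m m' mu1 : R).
Hypothesis Hks : 0 < ks < kf.
Hypothesis HA : A = kf * ks.
Hypothesis HA1 : 1 + A = kf + ks.
Hypothesis Hbeta : 0 < beta.
Hypothesis Hc : 0 < c.
Hypothesis Hsg : sg = 1 \/ sg = -1.
Hypothesis HT : tail_family k c psi0 dl psi.
Hypothesis HA' : 0 < A + sg * beta.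
Hypothesis Hmu1 : 0 <= mu1.
Hypothesis Hm : m < m'.

Let C := beta * c / A.
Let sol (e : R) := half_solution A beta sg (psi e) (dl e * mu1) (dl e * m).

Let A_pos : 0 < A.
Proof. rewrite HA. pos. Qed.

Let C_pos : 0 < C.
Proof. unfold C. pos. Qed.

(** Here the scaled field originates: with [y] within [O(d)] of [1 / A], the term [beta * psi * y]
    is [d * C / u ^ k] up to [o(d)], where [C = beta * c / A]. *)
Lemma nonlinearity_error (u1 B x : R) : 0 < u1 -> 0 < B -> 0 < x -> eventually0 (fun e =>
  forall u D, u1 <= u -> Rabs D <= B * dl e ->
    Rabs (beta * psi e (dl e * u) * (1 / A - sg * D) - dl e * (C * / u ^ k)) <= x * dl e /\
    beta * psi e (dl e * u) <= dl e * (beta * (c + 1) * / u1 ^ k)).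
Proof.
  intros Hu1 HB Hx. pose proof (inv_pow_pos k u1 Hu1) as Hi.
  set (z := beta * (c + 1) * / u1 ^ k). assert (Hz : 0 < z) by (unfold z; pos).
  set (w := beta / A * / u1 ^ k). assert (Hw : 0 < w) by (unfold w; pos).
  eapply eventually0_impl.
  { apply eventually0_and; [apply (small_data k c psi0 dl psi m mu1 HT Hmu1 (x / (2 * z * B))); pos|].
    apply eventually0_and; [apply (tail_upper _ _ _ _ _ HT u1 Hu1)|].
    apply (tail_asymptotics _ _ _ _ _ HT u1 (x / (2 * w))); pos. }
  intros e He ((Hd & _ & _) & Hup & Has) u D Hu HD.
  pose proof (tail_dl_pos _ _ _ _ _ HT e He) as Hd0. simpl in Has. set (d := dl e) in *.
  assert (Hpsi : beta * psi e (d * u) <= d * z).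
  { unfold z. replace (d * (beta * (c + 1) * / u1 ^ k)) with (beta * (d * ((c + 1) * / u1 ^ k))) by ring.
    apply Rmult_le_compat_l; [lra|]. eapply Rle_trans; [apply Hup, Hu|].
    apply Rmult_le_compat_l; [lra|]. apply Rmult_le_compat_l; [lra|]. apply inv_pow_le; lra. }
  split; [|exact Hpsi].
  assert (Hpp : 0 < psi e (d * u)) by (apply (tail_range _ _ _ _ _ HT e); [exact He | pos]).
  replace (beta * psi e (d * u) * (1 / A - sg * D) - d * (C * / u ^ k))
    with (d * (beta / A * / u ^ k * (psi e (d * u) / d * u ^ k - c)) + - (beta * psi e (d * u) * (sg * D)))
    by (unfold C; fld).
  eapply Rle_trans; [apply Rabs_triang|].
  assert (E1 : Rabs (d * (beta / A * / u ^ k * (psi e (d * u) / d * u ^ k - c))) <= d * (x / 2)).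
  { rewrite Rabs_mult, (Rabs_pos_eq d) by lra. apply Rmult_le_compat_l; [lra|].
    rewrite Rabs_mult. pose proof (inv_pow_pos k u ltac:(lra)). assert (0 < beta / A) by pos.
    apply Rle_trans with (w * (x / (2 * w))); [|right; field; lra].
    apply Rmult_le_compat; [apply Rabs_pos | apply Rabs_pos | | apply Has, Hu].
    rewrite Rabs_pos_eq by pos. unfold w.
    apply Rmult_le_compat_l; [lra|]. apply inv_pow_le; lra. }
  assert (E2 : Rabs (- (beta * psi e (d * u) * (sg * D))) <= d * (x / 2)).
  { rewrite Rabs_Ropp, Rabs_mult, (sg_mult_abs sg _ Hsg), (Rabs_pos_eq (beta * _)) by pos.
    apply Rle_trans with (d * z * (B * d)).
    - apply Rmult_le_compat; [pos | apply Rabs_pos | exact Hpsi | exact HD].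
    - rewrite Rmult_assoc. apply Rmult_le_compat_l; [lra|].
      apply Rmult_lt_compat_l with (r := z * B) in Hd; [|pos].
      replace (z * B * (x / (2 * z * B))) with (x / 2) in Hd by (field; lra). lra. }
  lra.
Qed.

(** The scaled descent applies to [U / d] and [W / d] down to [u1]. Below [u1] the asymptotics are
    no longer uniform, but the tail decreases in [U], so it is at least its value at [d * u1]; the
    last condition of [passing] says that this value outweighs the other terms by a unit margin
    during the time [2 * u1] in which the line is reached. *)
Lemma descent (Cw : R) : passing k A kf ks C m' -> 0 < Cw -> exists K1min, 0 < K1min /\
  forall K1, K1min <= K1 -> exists Tm pm Cd, 0 < Tm /\ 0 < pm /\ 0 < Cd /\
  eventually0 (fun e => forall U W ts, sol e U W ts -> U ts = K1 * dl e ->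
    Rabs (ks * W ts - U ts) <= Cw * dl e ->
    exists T, ts < T <= ts + Tm /\ U T = 0 /\ (forall t, ts <= t < T -> 0 < U t) /\
      forall t, ts <= t <= T -> U t <= K1 * dl e /\ Rabs (W t) <= Cd * dl e /\
        field_U A beta sg (psi e) (U t) (W t) <= - pm * dl e).
Proof.
  intros Hpass HCw.
  destruct (scaled_descent k A kf ks C m m' Hks HA HA1 C_pos Hm Hpass) as (u1 & f1 & Hu1 & Hf1 & Hdesc).
  destruct (Hdesc Cw HCw) as (K1min & HK1min & Hdesc'). clear Hdesc.
  exists K1min. split; [lra|]. intros K1 HK1.
  destruct (Hdesc' K1 HK1) as (Tm & pm & zt & HTm & Hpm & Hzt & Hsc). clear Hdesc'.
  pose proof (rate_min_pos A kf ks beta sg Hks HA HA') as Hr.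
  pose proof (Rabs_pos m) as Hm0. pose proof (Rabs_pos m') as Hm0'.
  pose proof (Rle_abs m') as Hmm'. pose proof (Rle_abs m) as Hmm1. pose proof (Rle_abs (- m)) as Hmm2.
  rewrite Rabs_Ropp in Hmm2.
  pose proof (inv_pow_pos k u1 Hu1) as Hi.
  set (z := beta * (c + 1) * / u1 ^ k). assert (Hz : 0 < z) by (unfold z; pos).
  set (B := (K1 + Cw) / ks + K1 + (Rabs m + z / A + 1) / rate_min A beta sg).
  assert (HB0 : 0 < (K1 + Cw) / ks) by pos.
  assert (HzA : 0 < z / A) by pos.
  assert (HB1 : 0 < (Rabs m + z / A + 1) / rate_min A beta sg) by pos.
  assert (HB : 0 < B) by (unfold B; lra).
  assert (HBr : Rabs m + z / A + 1 <= rate_min A beta sg * B).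
  { unfold B. rewrite Rmult_plus_distr_l.
    replace (rate_min A beta sg * ((Rabs m + z / A + 1) / rate_min A beta sg)) with (Rabs m + z / A + 1) by (field; lra).
    assert (0 < rate_min A beta sg * ((K1 + Cw) / ks + K1)) by pos. lra. }
  (* Bound for [W / d] on the last stretch of duration at most [2 * u1], where the forcing of [W] is
     at most [d * (Rabs m + u1)]. *)
  set (B3 := B + u1 + (Rabs m + u1) * (2 * u1)).
  assert (HB3 : 0 < B3) by (unfold B3; pos).
  exists (Tm + 2 * u1), (Rmin pm (1 / 2)), (B + K1 + B3).
  split; [lra|]. split; [pos|]. split; [lra|].
  set (x := Rmin zt (1 / 8)). assert (Hx : 0 < x) by (unfold x; pos).
  pose proof (Rmin_l zt (1 / 8)) as Hx1. pose proof (Rmin_r zt (1 / 8)) as Hx2. fold x in Hx1, Hx2.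
  set (dm := Rmin (Rmin 1 (zt / (mu1 * B + 1))) (Rmin (1 / (16 * A * u1 * (mu1 * B3 + 1))) (Rmin (1 / (1 + mu1)) (1 / A / (B3 + u1))))).
  assert (Hdm : 0 < dm) by (unfold dm; pos).
  eapply eventually0_impl.
  { apply eventually0_and; [apply (small_data k c psi0 dl psi m mu1 HT Hmu1 dm Hdm)|].
    apply eventually0_and; [apply (nonlinearity_error u1 B x); lra|].
    apply (nonlinearity_error u1 (B3 + u1) x); lra. }
  intros e He ((Hd & _ & _) & Herr & Herr3) U W ts Hsol HUts HWts.
  pose proof (tail_dl_pos _ _ _ _ _ HT e He) as Hd0. set (d := dl e) in *.
  assert (Hdd : d < 1 /\ d * (mu1 * B) <= zt /\ 16 * A * u1 * (d * (mu1 * B3)) <= 1 /\ d * mu1 <= 1 /\ (B3 + u1) * d <= 1 / A).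
  { assert (D1 : d < 1) by (eapply Rlt_le_trans; [exact Hd|]; eapply Rle_trans; [apply Rmin_l | apply Rmin_l]).
    assert (D2 : d <= zt / (mu1 * B + 1)) by (left; eapply Rlt_le_trans; [exact Hd|]; eapply Rle_trans; [apply Rmin_l | apply Rmin_r]).
    assert (D3 : d <= 1 / (16 * A * u1 * (mu1 * B3 + 1))) by (left; eapply Rlt_le_trans; [exact Hd|]; eapply Rle_trans; [apply Rmin_r | apply Rmin_l]).
    assert (D4 : d <= 1 / (1 + mu1)) by (left; eapply Rlt_le_trans; [exact Hd|]; eapply Rle_trans; [apply Rmin_r|]; eapply Rle_trans; [apply Rmin_r | apply Rmin_l]).
    assert (D5 : d <= 1 / A / (B3 + u1)) by (left; eapply Rlt_le_trans; [exact Hd|]; eapply Rle_trans; [apply Rmin_r|]; eapply Rle_trans; [apply Rmin_r | apply Rmin_r]).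
    assert (P1 : 0 <= mu1 * B) by pos. assert (P2 : 0 <= mu1 * B3) by pos. assert (P3 : 0 < A * u1) by pos.
    split; [exact D1|]. split; [|split; [|split]].
    - apply Rmult_le_compat_r with (r := mu1 * B + 1) in D2; [|lra].
      replace (zt / (mu1 * B + 1) * (mu1 * B + 1)) with zt in D2 by (field; lra). lra.
    - apply Rmult_le_compat_r with (r := 16 * A * u1 * (mu1 * B3 + 1)) in D3; [|pos].
      replace (1 / (16 * A * u1 * (mu1 * B3 + 1)) * (16 * A * u1 * (mu1 * B3 + 1))) with 1 in D3 by (field; lra).
      assert (0 < A * u1 * d) by pos. lra.
    - apply Rmult_le_compat_r with (r := 1 + mu1) in D4; [|lra].
      replace (1 / (1 + mu1) * (1 + mu1)) with 1 in D4 by (field; lra). lra.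
    - apply Rmult_le_compat_l with (r := B3 + u1) in D5; [|lra].
      replace ((B3 + u1) * (1 / A / (B3 + u1))) with (1 / A) in D5 by (field; lra). exact D5. }
  destruct Hdd as (Hd1 & HdB & HdB3 & Hdmu & HdA).
  set (mu := d * mu1) in *. assert (Hmu0 : 0 <= mu) by (unfold mu; pos).
  set (fU := fun t => field_U A beta sg (psi e) (U t) (W t)).
  set (fW := fun t => field_W mu (d * m) (U t) (W t)).
  assert (DU : forall t, ts <= t -> is_derive U t (fU t)) by (intros t Ht; apply Hsol, Ht).
  assert (DW : forall t, ts <= t -> is_derive W t (fW t)) by (intros t Ht; apply Hsol, Ht).
  assert (HW0 : Rabs (W ts) <= (K1 + Cw) / ks * d).
  { rewrite HUts in HWts. apply Rabs_le_between in HWts.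
    apply Rabs_le. split; apply Rmult_le_reg_l with ks; try lra.
    - replace (ks * - ((K1 + Cw) / ks * d)) with (- ((K1 + Cw) * d)) by (field; lra).
      assert (0 < K1 * d) by pos. lra.
    - replace (ks * ((K1 + Cw) / ks * d)) with ((K1 + Cw) * d) by (field; lra). lra. }
  assert (HD0 : Rabs (W ts - U ts) < B * d).
  { eapply Rle_lt_trans; [apply Rabs_triang|]. rewrite Rabs_Ropp, HUts, (Rabs_pos_eq (K1 * d)) by pos.
    assert (0 < (Rabs m + z / A + 1) / rate_min A beta sg * d) by pos. unfold B. lra. }
  assert (HD : forall s, ts <= s -> (forall t, ts <= t <= s -> u1 * d <= U t) ->
    forall t, ts <= t <= s -> Rabs (W t - U t) <= B * d).
  { intros s Hs HU.
    assert (DD : forall t, ts <= t <= s -> is_derive (fun t => W t - U t) t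
       (- (A + mu + sg * beta * psi e (U t)) * (W t - U t) + (d * m + beta * psi e (U t) / A))).
    { intros t Ht. rewrite <- (difference_derive A kf ks beta sg psi Hks HA).
      apply (is_derive_minus W U); [apply DW | apply DU]; lra. }
    assert (Hp : forall t, ts <= t <= s -> d * (Rabs m + z / A + 1) <= (A + mu + sg * beta * psi e (U t)) * (B * d) /\
       0 <= beta * psi e (U t) / A <= d * (z / A)).
    { intros t Ht. specialize (HU t Ht). assert (0 < u1 * d) by pos.
      pose proof (rate_ge k A kf ks beta sg c psi0 dl psi m mu1 Hks HA Hbeta Hsg HT HA' e (U t) He ltac:(lra)) as H1.
      pose proof (tail_range _ _ _ _ _ HT e (U t) He ltac:(lra)) as H2. split.
      - apply Rle_trans with (d * (rate_min A beta sg * B)); [apply Rmult_le_compat_l; lra|].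
        replace (d * (rate_min A beta sg * B)) with (rate_min A beta sg * (B * d)) by ring.
        apply Rmult_le_compat_r; [pos | lra].
      - assert (HUd : U t = d * (U t / d)) by (field; lra).
        destruct (Herr (U t / d) 0) as [_ Hps].
        { apply Rmult_le_reg_r with d; [lra|]. unfold Rdiv. rewrite Rmult_assoc, Rinv_l; lra. }
        { rewrite Rabs_R0. pos. }
        rewrite <- HUd in Hps. fold z in Hps.
        split; [pos|]. unfold Rdiv. rewrite <- Rmult_assoc. apply Rmult_le_compat_r; [pos | lra]. }
    assert (Hdm2 : d * m <= d * Rabs m) by (apply Rmult_le_compat_l; lra).
    assert (Hdm3 : d * - m <= d * Rabs m) by (apply Rmult_le_compat_l; lra).
    apply Rabs_lt_between in HD0.
    assert (H1 : forall t, ts <= t <= s -> 0 < B * d - (W t - U t)).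
    { apply (stay_pos (fun t => B * d - (W t - U t)) (fun t => 0 -
       (- (A + mu + sg * beta * psi e (U t)) * (W t - U t) + (d * m + beta * psi e (U t) / A)))).
      - lra.
      - intros t Ht. apply (is_derive_minus (fun _ => B * d) (fun t => W t - U t));
          [apply (is_derive_const (B * d) t) | apply DD, Ht].
      - intros t Ht _ Hzz. replace (W t - U t) with (B * d) by lra. specialize (Hp t ltac:(lra)). lra. }
    assert (H2 : forall t, ts <= t <= s -> 0 < B * d + (W t - U t)).
    { apply (stay_pos (fun t => B * d + (W t - U t)) (fun t => 0 +
       (- (A + mu + sg * beta * psi e (U t)) * (W t - U t) + (d * m + beta * psi e (U t) / A)))).
      - lra.
      - intros t Ht. apply (is_derive_plus (fun _ => B * d) (fun t => W t - U t));
          [apply (is_derive_const (B * d) t) | apply DD, Ht].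
      - intros t Ht _ Hzz. replace (W t - U t) with (- (B * d)) by lra. specialize (Hp t ltac:(lra)). lra. }
    intros t Ht. apply Rabs_le. specialize (H1 t Ht). specialize (H2 t Ht). lra. }
  destruct (Hsc (fun t => U (ts + t) / d) (fun t => W (ts + t) / d) (fun t => fU (ts + t) / d) (fun t => fW (ts + t) / d))
    as (t1 & Ht1 & Hut1 & Hrt1 & Hpos1 & Hdu1).
  { rewrite Rplus_0_r, HUts. field. lra. }
  { rewrite Rplus_0_r. replace (ks * (W ts / d) - U ts / d) with ((ks * W ts - U ts) / d) by (field; lra).
    unfold Rdiv. rewrite Rabs_mult, (Rabs_pos_eq (/ d)) by pos.
    apply Rmult_le_reg_r with d; [lra|]. rewrite Rmult_assoc, Rinv_l; lra. }
  { intros t Ht. unfold Rdiv. split.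
    - apply (is_derive_ext (fun t => / d * U (ts + t))); [intros s; apply Rmult_comm|].
      rewrite (Rmult_comm (fU (ts + t))). apply (is_derive_scal (fun t => U (ts + t)) t (/ d)).
      apply is_derive_shift, DU. lra.
    - apply (is_derive_ext (fun t => / d * W (ts + t))); [intros s; apply Rmult_comm|].
      rewrite (Rmult_comm (fW (ts + t))). apply (is_derive_scal (fun t => W (ts + t)) t (/ d)).
      apply is_derive_shift, DW. lra. }
  { intros S HS HuS t Ht.
    assert (HUS : forall s, ts <= s <= ts + S -> u1 * d <= U s).
    { intros s Hs. specialize (HuS (s - ts) ltac:(lra)). replace (ts + (s - ts)) with s in HuS by ring.
      apply Rmult_le_compat_r with (r := d) in HuS; [|lra].
      replace (U s / d * d) with (U s) in HuS by (field; lra). exact HuS. }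
    pose proof (HD (ts + S) ltac:(lra) HUS (ts + t) ltac:(lra)) as HDt.
    specialize (HuS t Ht). set (u := U (ts + t) / d) in *. set (w := W (ts + t)) in *.
    assert (Eu : U (ts + t) = d * u) by (unfold u; field; lra).
    unfold fU, fW. fold w. rewrite Eu in HDt |- *. split.
    - destruct (Herr u (w - d * u) HuS HDt) as [E1 _].
      replace (field_U A beta sg (psi e) (d * u) w / d - (A * (w / d) - nullcline k A C u))
        with (- (/ d * (beta * psi e (d * u) * (1 / A - sg * (w - d * u)) - d * (C * / u ^ k))))
        by (unfold field_U, nullcline; generalize (C * / u ^ k) as CC; intros CC; field; lra).
      rewrite Rabs_Ropp, Rabs_mult, (Rabs_pos_eq (/ d)) by pos.
      apply Rmult_le_reg_l with d; [lra|]. rewrite <- Rmult_assoc, Rinv_r, Rmult_1_l by lra.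
      assert (x * d <= zt * d) by (apply Rmult_le_compat_r; lra). lra.
    - replace (field_W mu (d * m) (d * u) w / d - (m - u)) with (- (mu1 * (w - d * u)))
        by (unfold field_W, mu; field; lra).
      rewrite Rabs_Ropp, Rabs_mult, (Rabs_pos_eq mu1) by lra.
      apply Rle_trans with (mu1 * (B * d)); [apply Rmult_le_compat_l; lra | lra]. }
  set (s1 := ts + t1) in *.
  assert (HUs1 : U s1 = u1 * d).
  { replace (U s1) with (U s1 / d * d) by (field; lra). rewrite Hut1. reflexivity. }
  assert (Hup1 : forall t, ts <= t < s1 -> u1 * d < U t).
  { intros t Ht. specialize (Hpos1 (t - ts) ltac:(unfold s1 in Ht; lra)). replace (ts + (t - ts)) with t in Hpos1 by ring.
    apply Rmult_lt_compat_r with (r := d) in Hpos1; [|lra].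
    replace (U t / d * d) with (U t) in Hpos1 by (field; lra). exact Hpos1. }
  assert (Hup1' : forall t, ts <= t <= s1 -> u1 * d <= U t).
  { intros t Ht. destruct (Req_dec t s1) as [->|]; [lra|]. left. apply Hup1. lra. }
  assert (Hsp1 : forall t, ts <= t <= s1 -> fU t <= - pm * d).
  { intros t Ht. specialize (Hdu1 (t - ts) ltac:(unfold s1 in Ht; lra)). replace (ts + (t - ts)) with t in Hdu1 by ring.
    apply Rmult_le_compat_r with (r := d) in Hdu1; [|lra].
    replace (fU t / d * d) with (fU t) in Hdu1 by (field; lra). exact Hdu1. }
  assert (HUK1 : forall t, ts <= t <= s1 -> U t <= K1 * d).
  { intros t Ht. assert (U t - U ts <= - pm * d * (t - ts)).
    { apply (increment_le U fU); [lra | intros s Hs; apply DU; lra | intros s Hs; apply Hsp1; lra]. }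
    assert (0 <= pm * d * (t - ts)) by pos. lra. }
  assert (HW1 : forall t, ts <= t <= s1 -> Rabs (W t) <= (B + K1) * d).
  { intros t Ht. pose proof (HD s1 ltac:(unfold s1; lra) Hup1' t Ht) as H1.
    replace (W t) with ((W t - U t) + U t) by ring. eapply Rle_trans; [apply Rabs_triang|].
    assert (0 < u1 * d) by pos. specialize (HUK1 t Ht). specialize (Hup1' t Ht).
    rewrite (Rabs_pos_eq (U t)) by lra. lra. }
  assert (HWs1 : Rabs (W s1) <= (B + u1) * d).
  { pose proof (HD s1 ltac:(unfold s1; lra) Hup1' s1 ltac:(unfold s1; lra)) as H1.
    replace (W s1) with ((W s1 - U s1) + U s1) by ring. eapply Rle_trans; [apply Rabs_triang|].
    rewrite HUs1, (Rabs_pos_eq (u1 * d)) in * by pos. lra. }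
  assert (HWf1 : W s1 <= f1 * d).
  { apply Rmult_le_compat_r with (r := d) in Hrt1; [|lra].
    replace (W s1 / d * d) with (W s1) in Hrt1 by (field; lra). exact Hrt1. }
  assert (Last : forall s, s1 <= s <= s1 + 2 * u1 -> (forall t, s1 <= t <= s -> 0 <= U t) ->
    forall t, s1 <= t <= s -> U t <= u1 * d /\ Rabs (W t) <= B3 * d /\ fU t <= - (1 / 2) * d).
  { intros s Hs HU0.
    assert (Inner : forall t, s1 <= t <= s -> (forall r, s1 <= r <= t -> U r <= u1 * d) ->
       Rabs (W t) <= B3 * d /\ fU t <= - (1 / 2) * d).
    { intros t Ht HUu.
      assert (HWt : forall r, s1 <= r <= t -> Rabs (W r) <= B3 * d).
      { intros r Hr'. eapply Rle_trans.
        - apply (relax_abs_time W fW mu (d * (Rabs m + u1)) s1 r); [lra | lra | pos | intros q Hq; apply DW; unfold s1 in *; lra |].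
          intros q Hq. unfold fW, field_W. replace (d * m - ((1 - mu) * U q + mu * W q) + mu * W q) with (d * m - (1 - mu) * U q) by ring.
          specialize (HUu q ltac:(lra)). specialize (HU0 q ltac:(lra)).
          assert (0 <= (1 - mu) * U q <= U q) by (split; [pos | assert (0 <= mu * U q) by pos; lra]).
          assert (d * m <= d * Rabs m) by (apply Rmult_le_compat_l; lra).
          assert (d * - m <= d * Rabs m) by (apply Rmult_le_compat_l; lra).
          apply Rabs_le. split; lra.
        - assert (d * (Rabs m + u1) * (r - s1) <= d * (Rabs m + u1) * (2 * u1)) by (apply Rmult_le_compat_l; [pos | lra]).
          unfold B3. lra. }
      split; [apply HWt; lra|].
      assert (HWup : W t - W s1 <= d * (Rabs m' + mu1 * (B3 * d)) * (t - s1)).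
      { apply (increment_le W fW); [lra | intros q Hq; apply DW; unfold s1 in *; lra |].
        intros q Hq. unfold fW, field_W. specialize (HU0 q ltac:(lra)). specialize (HWt q Hq). apply Rabs_le_between in HWt.
        assert (0 <= (1 - mu) * U q) by pos.
        assert (mu * - (B3 * d) <= mu * W q) by (apply Rmult_le_compat_l; lra).
        assert (d * m <= d * Rabs m') by (apply Rmult_le_compat_l; lra).
        unfold mu in *. lra. }
      assert (HWup2 : A * W t <= d * (A * f1 + 2 * A * Rabs m' * u1 + 1 / 8)).
      { assert (W t <= f1 * d + d * (Rabs m' + mu1 * (B3 * d)) * (2 * u1)).
        { assert (d * (Rabs m' + mu1 * (B3 * d)) * (t - s1) <= d * (Rabs m' + mu1 * (B3 * d)) * (2 * u1))
            by (apply Rmult_le_compat_l; [pos | lra]). lra. }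
        assert (A * W t <= A * (f1 * d + d * (Rabs m' + mu1 * (B3 * d)) * (2 * u1))) by (apply Rmult_le_compat_l; lra).
        assert (d * (16 * A * u1 * (d * (mu1 * B3))) <= d * 1) by (apply Rmult_le_compat_l; lra).
        lra. }
      specialize (HUu t ltac:(lra)). specialize (HU0 t ltac:(lra)). specialize (HWt t ltac:(lra)).
      destruct (Herr3 u1 (W t - U t)) as [E1 _]; [lra | |].
      { eapply Rle_trans; [apply Rabs_triang|]. rewrite Rabs_Ropp, (Rabs_pos_eq (U t)); lra. }
      apply Rabs_le_between in E1.
      assert (Hy : 0 <= 1 / A - sg * (W t - U t)).
      { pose proof (Rle_abs (sg * (W t - U t))) as Hab. rewrite (sg_mult_abs sg _ Hsg) in Hab.
        pose proof (Rabs_triang (W t) (- U t)) as Htr. rewrite Rabs_Ropp, (Rabs_pos_eq (U t)) in Htr by lra.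
        unfold Rminus in Hab |- *. lra. }
      pose proof (tail_decreasing _ _ _ _ _ HT e (U t) (d * u1) He ltac:(lra)) as Hdec.
      set (y := 1 / A - sg * (W t - U t)) in *.
      assert (Hpsi1 : 0 < psi e (d * u1)) by (apply (tail_range _ _ _ _ _ HT e); [exact He | pos]).
      assert (HCu : 1 <= C * / u1 ^ k - (A * f1 + 2 * A * Rabs m' * u1)) by lra.
      assert (Hprod : d * (A * f1 + 2 * A * Rabs m' * u1 + 7 / 8) <= beta * psi e (d * u1) * y).
      { assert (d * 1 <= d * (C * / u1 ^ k - (A * f1 + 2 * A * Rabs m' * u1))) by (apply Rmult_le_compat_l; lra).
        assert (x * d <= 1 / 8 * d) by (apply Rmult_le_compat_r; lra). lra. }
      assert (Hfull : d * (A * f1 + 2 * A * Rabs m' * u1 + 7 / 8) <= beta * psi e (U t) * y).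
      { eapply Rle_trans; [exact Hprod|]. apply Rmult_le_compat_r; [exact Hy|]. apply Rmult_le_compat_l; lra. }
      unfold fU, field_U. fold y. assert (0 <= (1 + A) * U t) by pos. lra. }
    assert (HUu : forall t, s1 <= t <= s -> U t <= u1 * d).
    { apply real_induction.
      - lra.
      - intros t Ht Hall. assert (0 <= u1 * d - U t); [|lra].
        apply (nonneg_left_limit (fun t => u1 * d - U t) s1); [lra | | intros r Hr'; specialize (Hall r Hr'); lra].
        apply continuity_pt_minus; [apply continuity_pt_const; intros ? ?; reflexivity|].
        exact (is_derive_continuity_pt _ _ _ (DU t ltac:(unfold s1 in *; lra))).
      - intros t Ht Hall. destruct (Inner t ltac:(lra) Hall) as [_ Hf].
        destruct (pos_right (fun r => U t - U r) t (0 - fU t)) as (h1 & Hh1 & P1).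
        { apply (is_derive_minus (fun _ => U t) U); [apply (is_derive_const (U t) t) | apply DU; unfold s1 in *; lra]. }
        { right. lra. }
        exists h1. split; [exact Hh1|]. intros r Hr'. specialize (P1 r Hr'). specialize (Hall t ltac:(lra)). lra. }
    intros t Ht. split; [apply HUu, Ht|]. apply Inner; [exact Ht|]. intros r Hr'. apply HUu. lra. }
  assert (Hex : exists t, s1 <= t <= s1 + 2 * u1 /\ U t <= 0).
  { apply NNPP. intro N.
    assert (HU0 : forall t, s1 <= t <= s1 + 2 * u1 -> 0 < U t).
    { intros t Ht. apply Rnot_le_lt. intro. apply N. exists t. auto. }
    assert (U (s1 + 2 * u1) - U s1 <= - (1 / 2) * d * (s1 + 2 * u1 - s1)).
    { apply (increment_le U fU); [lra | intros q Hq; apply DU; unfold s1 in *; lra |].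
      intros q Hq. apply (Last (s1 + 2 * u1)); [lra | | exact Hq]. intros t Ht. left. apply HU0, Ht. }
    specialize (HU0 (s1 + 2 * u1) ltac:(lra)). lra. }
  destruct Hex as (s2 & Hs2 & HUs2).
  destruct (first_zero U s1 s2) as (T & HT1 & HTz & HTpos); [lra | | rewrite HUs1; pos | exact HUs2 |].
  { intros t Ht. exact (is_derive_continuity_pt _ _ _ (DU t ltac:(unfold s1 in *; lra))). }
  assert (HT0 : forall t, s1 <= t <= T -> 0 <= U t).
  { intros t Ht. destruct (Req_dec t T) as [->|]; [lra|]. left. apply HTpos. lra. }
  exists T. split; [unfold s1 in *; lra|]. split; [exact HTz|].
  pose proof (Rmin_l pm (1 / 2)) as Hpl. pose proof (Rmin_r pm (1 / 2)) as Hpr.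
  assert (Hpm1 : Rmin pm (1 / 2) * d <= pm * d) by (apply Rmult_le_compat_r; lra).
  assert (Hpm2 : Rmin pm (1 / 2) * d <= 1 / 2 * d) by (apply Rmult_le_compat_r; lra).
  assert (0 < u1 * d) by pos.
  assert (u1 * d <= K1 * d) by (apply Rmult_le_compat_r; lra).
  assert (0 < B3 * d) by pos. assert (0 < (B + K1) * d) by pos.
  split.
  - intros t Ht. destruct (Rle_lt_dec t s1); [specialize (Hup1' t ltac:(lra)); lra | apply HTpos; lra].
  - intros t Ht. fold (fU t). destruct (Rle_lt_dec t s1).
    + specialize (HUK1 t ltac:(lra)). specialize (HW1 t ltac:(lra)). specialize (Hsp1 t ltac:(lra)).
      split; [lra|]. split; lra.
    + destruct (Last T ltac:(lra) HT0 t ltac:(lra)) as (L1 & L2 & L3). split; [lra|]. split; lra.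
Qed.

End TrueDescent.

(** A passage through the half plane [U >= 0], from the line back to the line: until [tau] it leaves
    the line, from [T0] to [ts] it follows the slow direction of the node down to [U = K1 * d], and
    until [T] it crosses the region [U = O(d)]. *)
Record transits (kf ks d tau c0 T0 K1 pm Cs Um Ym : R) (fU fW U W : R -> R) (ts T : R) : Prop := {
  tr_times : T0 <= ts < T;
  tr_duration : T <= ts + Cs;
  tr_late : exp (- ks * ts) <= Cs * d;
  tr_launch : forall t, 0 <= t <= tau -> c0 * t <= U t /\ c0 <= fU t;
  tr_bounds : forall t, 0 <= t <= T -> 0 <= U t <= Um /\ Rabs (W t - U t) <= Ym;
  tr_above : forall t, tau <= t <= ts -> K1 * d <= U t;
  tr_at : U ts = K1 * d;
  tr_slow : forall t, T0 <= t <= ts ->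
    - (2 * ks) * U t <= fU t <= - (ks / 2) * U t /\ - (5 / 4) * U t <= fW t <= - (3 / 4) * U t;
  tr_end : U T = 0;
  tr_positive : forall t, ts <= t < T -> 0 < U t;
  tr_descent : forall t, ts <= t <= T -> U t <= K1 * d /\ Rabs (W t) <= Cs * d /\ fU t <= - pm * d;
  tr_linear : forall t, 0 <= t <= T ->
    Rabs (ks * W t - U t - ks * W 0 * exp (- kf * t)) <= Cs * d /\
    Rabs (kf * W t - U t - kf * W 0 * exp (- ks * t)) <= Cs * d }.

Section Transit.
Variables (k : nat) (A kf ks beta sg c psi0 : R) (dl : R -> R) (psi : R -> R -> R) (m m' mu1 : R).
Hypothesis Hks : 0 < ks < kf.
Hypothesis HA : A = kf * ks.
Hypothesis HA1 : 1 + A = kf + ks.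
Hypothesis Hbeta : 0 < beta.
Hypothesis Hc : 0 < c.
Hypothesis Hsg : sg = 1 \/ sg = -1.
Hypothesis HT : tail_family k c psi0 dl psi.
Hypothesis HA' : 0 < A + sg * beta.
Hypothesis Hmu1 : 0 <= mu1.
Hypothesis Hm : m < m'.
Hypothesis Hpass : passing k A kf ks (beta * c / A) m'.

Let R0 := beta / (A * (A + sg * beta)).
Let sol (e : R) := half_solution A beta sg (psi e) (dl e * mu1) (dl e * m).
Let fU (e : R) (U W : R -> R) (t : R) := field_U A beta sg (psi e) (U t) (W t).
Let fW (e : R) (U W : R -> R) (t : R) := field_W (dl e * mu1) (dl e * m) (U t) (W t).

Let A_pos : 0 < A.
Proof. rewrite HA. pos. Qed.

Let R0_pos : 0 < R0.
Proof. unfold R0. pos. Qed.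

Lemma transit : exists rad tau c0 T0 K1 pm Cs Um Ym : R,
  0 < rad <= R0 / 4 /\ 0 < tau <= 1 /\ 0 < c0 /\ 1 <= T0 /\ 0 < K1 /\ 0 < pm /\ 0 < Cs /\ 0 < Um /\ 0 < Ym /\
  exp (- (kf - ks) * T0) <= 1 / 2 /\
  eventually0 (fun e => exists Tmax, forall U W, sol e U W 0 -> U 0 = 0 -> Rabs (W 0 - R0) <= rad ->
    exists ts T, T <= Tmax /\
      transits kf ks (dl e) tau c0 T0 K1 pm Cs Um Ym (fU e U W) (fW e U W) U W ts T).
Proof.
  destruct (launch k A kf ks beta sg c psi0 dl psi m mu1) as (rad & tau' & c0 & Hrad & Htau' & Hc0 & EL);
    try assumption. fold R0 in Hrad, EL.
  set (tau := Rmin tau' 1). assert (Htau : 0 < tau) by (unfold tau; pos).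
  assert (Htau1 : tau <= tau' /\ tau <= 1) by (split; [apply Rmin_l | apply Rmin_r]).
  destruct (linear_regime k A kf ks beta sg c psi0 dl psi m mu1) with (tau := tau) (c0 := c0) as (Ce & HCe & ELin);
    try assumption. fold R0 in ELin.
  destruct (difference_bounded k A kf ks beta sg c psi0 dl psi m mu1) as (Ym & HYm & ED); try assumption.
  fold R0 in ED.
  destruct (descent k A kf ks beta sg c psi0 dl psi m m' mu1) with (Cw := Ce + 1) as (K1min & HK1min & EDesc);
    try assumption; [lra|].
  pose proof (Rabs_pos m) as Hm0.
  assert (H1A : 0 < 1 / A) by pos.
  (* From [T0] on the fast exponential is negligible against the slow one, so that [U' / U] is near
     [- ks] and [W' / U] near [-1]; [tr_slow] records crude versions of this. *)
  destruct (exp_eventually_small (kf - ks) (Rmin (1 / 2) (ks / (32 * (kf - ks))))) as (T0 & HT0 & HxT0).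
  { lra. } { pos. }
  set (x0 := exp (- (kf - ks) * T0)) in *.
  assert (Hx0 : 0 < x0) by (unfold x0; pos).
  assert (Hx01 : x0 <= 1 / 2) by (eapply Rle_trans; [exact HxT0 | apply Rmin_l]).
  assert (Hx02 : 32 * (kf - ks) * x0 <= ks).
  { assert (H : x0 <= ks / (32 * (kf - ks))) by (eapply Rle_trans; [exact HxT0 | apply Rmin_r]).
    apply Rmult_le_compat_l with (r := 32 * (kf - ks)) in H; [|lra].
    replace (32 * (kf - ks) * (ks / (32 * (kf - ks)))) with ks in H by (field; lra). exact H. }
  set (N := beta * (c + 1) * (1 / A + Ym)). assert (HN : 0 < N) by (unfold N; pos).
  (* Besides the thresholds of the descent and the approach, each summand makes one error of order
     [d] a small fraction of [U >= K1 * d]: that of the linear approximation, the tail, and the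
     drift of [W]. *)
  set (K1 := 1 + K1min + ((kf + ks) * Ce + 1) / (kf - ks) + 8 * kf * Ce / ks + 8 * N / ks + 4 * (mu1 * Ym + Rabs m)).
  assert (HK1a : 0 < ((kf + ks) * Ce + 1) / (kf - ks)) by pos.
  assert (HK1b : 0 < 8 * kf * Ce / ks) by pos. assert (HK1c : 0 < 8 * N / ks) by pos.
  assert (HK1d : 0 <= 4 * (mu1 * Ym + Rabs m)) by pos.
  assert (HK1 : 1 <= K1) by (unfold K1; lra).
  assert (HK1lin : (kf + ks) * Ce + 1 < (kf - ks) * K1).
  { assert (H : ((kf + ks) * Ce + 1) / (kf - ks) < K1) by (unfold K1; lra).
    apply Rmult_lt_compat_l with (r := kf - ks) in H; [|lra].
    replace ((kf - ks) * (((kf + ks) * Ce + 1) / (kf - ks))) with ((kf + ks) * Ce + 1) in H by (field; lra). exact H. }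
  assert (HK1Ce : 8 * kf * Ce <= ks * K1).
  { assert (H : 8 * kf * Ce / ks <= K1) by (unfold K1; lra). apply Rmult_le_compat_l with (r := ks) in H; [|lra].
    replace (ks * (8 * kf * Ce / ks)) with (8 * kf * Ce) in H by (field; lra). exact H. }
  assert (HK1N : 8 * N <= ks * K1).
  { assert (H : 8 * N / ks <= K1) by (unfold K1; lra). apply Rmult_le_compat_l with (r := ks) in H; [|lra].
    replace (ks * (8 * N / ks)) with (8 * N) in H by (field; lra). exact H. }
  assert (HK1m : 4 * (mu1 * Ym + Rabs m) <= K1) by (unfold K1; lra).
  destruct (EDesc K1 ltac:(unfold K1; lra)) as (Tm & pm & Cd & HTm & Hpm & HCd & EDesc'). clear EDesc.
  destruct (approach k A kf ks beta sg c psi0 dl psi m mu1) with (rad := rad) (tau := tau) (c0 := c0) (Ce := Ce) (K1 := K1)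
    as (C3 & HC3 & EAppr); try assumption. fold R0 in EAppr.
  specialize (EAppr (1 / (2 * ks * R0)) ltac:(pos)).
  set (Cs := Ce + Cd + Tm + C3 + (ks * Cd + K1 + ks * (2 * R0) * C3) + (kf * Cd + K1 + kf * (2 * R0) * C3)).
  assert (HCs1 : 0 < ks * Cd + K1 + ks * (2 * R0) * C3) by pos.
  assert (HCs2 : 0 < kf * Cd + K1 + kf * (2 * R0) * C3) by pos.
  set (Um := (kf * ks * (2 * R0) + (kf + ks) * Ce) / (kf - ks) + K1).
  assert (HUm0 : 0 < (kf * ks * (2 * R0) + (kf + ks) * Ce) / (kf - ks)) by pos.
  exists rad, tau, c0, T0, K1, pm, Cs, Um, Ym.
  split; [exact Hrad|]. split; [lra|]. split; [exact Hc0|]. split; [exact HT0|]. split; [lra|]. split; [exact Hpm|].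
  split; [unfold Cs; lra|]. split; [unfold Um; lra|]. split; [exact HYm|]. split; [exact Hx01|].
  eapply eventually0_impl.
  { apply eventually0_and; [exact EL|]. apply eventually0_and; [exact ELin|]. apply eventually0_and; [exact ED|].
    apply eventually0_and; [exact EDesc'|]. apply eventually0_and; [exact EAppr|].
    apply eventually0_and; [apply (tail_upper _ _ _ _ _ HT 1); lra|].
    apply (small_data k c psi0 dl psi m mu1 HT Hmu1 (Rmin 1 (exp (- ks * T0) / C3))). pos. }
  clear EL ELin ED EDesc' EAppr.
  intros e He (EL & ELin & ED & EDesc & (smax & EAppr) & Eup & (Hd & _ & _)).
  pose proof (tail_dl_pos _ _ _ _ _ HT e He) as Hd0. set (d := dl e) in *.
  assert (Hd1 : d < 1) by (eapply Rlt_le_trans; [exact Hd | apply Rmin_l]).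
  assert (HdT0 : C3 * d < exp (- ks * T0)).
  { assert (H : d < exp (- ks * T0) / C3) by (eapply Rlt_le_trans; [exact Hd | apply Rmin_r]).
    apply Rmult_lt_compat_l with (r := C3) in H; [|lra].
    replace (C3 * (exp (- ks * T0) / C3)) with (exp (- ks * T0)) in H by (field; lra). exact H. }
  exists (smax + Tm). intros U W Hsol HU0 HW0.
  specialize (EL U W Hsol HU0 HW0).
  assert (HL : forall t, 0 <= t <= tau -> c0 * t <= U t) by (intros t Ht; apply EL; lra).
  apply Rabs_le_between in HW0 as HW0'.
  assert (HW2 : Rabs (W 0) <= 2 * R0) by (apply Rabs_le; lra).
  assert (Hlin : forall s, tau <= s -> (forall t, tau <= t <= s -> d <= U t) -> forall t, 0 <= t <= s ->
      Rabs (ks * W t - U t - ks * W 0 * exp (- kf * t)) <= Ce * d /\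
      Rabs (kf * W t - U t - kf * W 0 * exp (- ks * t)) <= Ce * d).
  { intros s Hs HU. apply (ELin U W s); assumption. }
  destruct (EAppr U W Hsol HU0 HW0 HL Hlin) as (ts & Hts & HUts & Habove & Hexp & Hexpf). clear EAppr ELin.
  assert (Habove' : forall t, tau <= t <= ts -> K1 * d <= U t).
  { intros t Ht. destruct (Req_dec t ts) as [->|]; [lra|]. left. apply Habove. lra. }
  assert (Hd1K : 1 * d <= K1 * d) by (apply Rmult_le_compat_r; lra).
  assert (Hlin' : forall t, 0 <= t <= ts ->
      Rabs (ks * W t - U t - ks * W 0 * exp (- kf * t)) <= Ce * d /\
      Rabs (kf * W t - U t - kf * W 0 * exp (- ks * t)) <= Ce * d).
  { apply Hlin; [lra|]. intros t Ht. specialize (Habove' t Ht). lra. }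
  assert (HT0ts : T0 < ts).
  { apply Rnot_le_lt. intro. assert (exp (- ks * T0) <= exp (- ks * ts)); [|lra].
    apply exp_le. assert (ks * ts <= ks * T0) by (apply Rmult_le_compat_l; lra). lra. }
  assert (Hsol' : sol e U W ts) by (intros t Ht; apply Hsol; lra).
  assert (HWfts : Rabs (ks * W ts - U ts) <= (Ce + 1) * d).
  { destruct (Hlin' ts ltac:(lra)) as [L1 _]. apply Rabs_le_between in L1.
    assert (0 <= ks * W 0 * exp (- kf * ts)) by pos.
    assert (ks * W 0 * exp (- kf * ts) <= d).
    { apply Rle_trans with (ks * (2 * R0) * (1 / (2 * ks * R0) * d)); [|right; field; lra].
      apply Rmult_le_compat; [pos | pos | apply Rmult_le_compat_l; lra | exact Hexpf]. }
    apply Rabs_le. lra. }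
  destruct (EDesc U W ts Hsol' HUts HWfts) as (T & HTT & HUT & Hpos & Hdesc). clear EDesc.
  assert (HUnn : forall t, 0 <= t <= T -> 0 <= U t).
  { intros t Ht. destruct (Rle_lt_dec t tau); [specialize (HL t ltac:(lra)); assert (0 <= c0 * t) by pos; lra|].
    destruct (Rle_lt_dec t ts); [specialize (Habove' t ltac:(lra)); lra|].
    destruct (Req_dec t T) as [->|]; [lra|]. left. apply Hpos. lra. }
  assert (HYb : forall t, 0 <= t <= T -> Rabs (W t - U t) <= Ym).
  { apply (ED U W T Hsol); [rewrite HU0, Rminus_0_r; exact HW2 | lra | exact HUnn]. }
  assert (Eu : forall t, (kf - ks) * U t = ks * (kf * W t - U t) - kf * (ks * W t - U t)) by (intros t; ring).
  exists ts, T. split; [lra|]. constructor.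
  - lra.
  - unfold Cs. lra.
  - eapply Rle_trans; [exact Hexp|]. apply Rmult_le_compat_r; [lra|]. unfold Cs. lra.
  - intros t Ht. apply EL. lra.
  - intros t Ht. split; [|apply HYb, Ht]. split; [apply HUnn, Ht|].
    destruct (Rle_lt_dec t ts) as [Hle|Hgt].
    + destruct (Hlin' t ltac:(lra)) as [L1 L2]. apply Rabs_le_between in L1, L2.
      assert (Hx1 : exp (- ks * t) <= 1) by (apply exp_nonpos_le_1; assert (0 <= ks * t) by pos; lra).
      pose proof (exp_pos (- ks * t)). 
      assert (0 <= ks * W 0 * exp (- kf * t)) by pos.
      assert (ks * (kf * W t - U t) <= ks * (kf * (2 * R0) + Ce)).
      { apply Rmult_le_compat_l; [lra|].
        assert (kf * W 0 * exp (- ks * t) <= kf * (2 * R0) * 1).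
        { apply Rmult_le_compat; [pos | lra | apply Rmult_le_compat_l; lra | lra]. }
        assert (Ce * d <= Ce * 1) by (apply Rmult_le_compat_l; lra). lra. }
      assert (kf * - Ce <= kf * (ks * W t - U t)).
      { apply Rmult_le_compat_l; [lra|]. assert (Ce * d <= Ce * 1) by (apply Rmult_le_compat_l; lra). lra. }
      apply Rle_trans with ((kf * ks * (2 * R0) + (kf + ks) * Ce) / (kf - ks)); [|unfold Um; lra].
      apply Rmult_le_reg_l with (kf - ks); [lra|].
      replace ((kf - ks) * ((kf * ks * (2 * R0) + (kf + ks) * Ce) / (kf - ks)))
        with (kf * ks * (2 * R0) + (kf + ks) * Ce) by (field; lra).
      rewrite Eu. lra.
    + destruct (Hdesc t ltac:(lra)) as (D1 & _). assert (K1 * d <= K1 * 1) by (apply Rmult_le_compat_l; lra). unfold Um. lra.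
  - exact Habove'.
  - exact HUts.
  - intros t Ht. specialize (Habove' t ltac:(lra)) as HUt.
    destruct (Hlin' t ltac:(lra)) as [L1 L2]. apply Rabs_le_between in L1, L2.
    specialize (HYb t ltac:(lra)) as HY.
    set (u := U t) in *. set (w := W t) in *.
    assert (Hu : 0 < u) by (assert (0 < K1 * d) by pos; lra).
    assert (HdU : forall q, 0 <= q -> q * d * K1 <= q * u).
    { intros q Hq. rewrite Rmult_assoc. apply Rmult_le_compat_l; lra. }
    assert (HE : exp (- kf * t) <= exp (- ks * t) * x0).
    { unfold x0. rewrite <- exp_plus. apply exp_le.
      assert ((kf - ks) * T0 <= (kf - ks) * t) by (apply Rmult_le_compat_l; lra). lra. }
    set (E1 := exp (- ks * t)) in *. set (E2 := exp (- kf * t)) in *.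
    assert (HE1 : 0 < E1) by apply exp_pos. assert (HE2 : 0 < E2) by apply exp_pos.
    (* the fast component is negligible compared with [U] *)
    assert (Hslow : kf * ks * W 0 * E1 <= 4 * (kf - ks) * u).
    { assert (H1 : kf * ks * W 0 * (E1 * (1 - x0)) <= (kf - ks) * u + (kf + ks) * Ce * d).
      { assert (ks * (kf * W 0 * E1 - Ce * d) <= ks * (kf * w - u)) by (apply Rmult_le_compat_l; lra).
        assert (kf * (ks * w - u) <= kf * (ks * W 0 * E2 + Ce * d)) by (apply Rmult_le_compat_l; lra).
        assert (kf * ks * W 0 * E2 <= kf * ks * W 0 * (E1 * x0)) by (apply Rmult_le_compat_l; [pos | lra]).
        specialize (Eu t). fold u w in Eu. lra. }
      assert (H2 : (kf + ks) * Ce * d <= (kf - ks) * u).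
      { apply Rle_trans with ((kf - ks) * (K1 * d)); [|apply Rmult_le_compat_l; lra].
        rewrite <- Rmult_assoc. apply Rmult_le_compat_r; lra. }
      assert (H3 : kf * ks * W 0 * (E1 * (1 / 2)) <= kf * ks * W 0 * (E1 * (1 - x0))).
      { apply Rmult_le_compat_l; [pos|]. apply Rmult_le_compat_l; lra. }
      lra. }
    assert (Hfast : kf * (ks * W 0 * E2) <= ks / 8 * u).
    { apply Rle_trans with (kf * ks * W 0 * (E1 * x0)).
      - rewrite <- !Rmult_assoc. rewrite (Rmult_assoc (kf * ks * W 0)). apply Rmult_le_compat_l; [pos | exact HE].
      - replace (kf * ks * W 0 * (E1 * x0)) with (x0 * (kf * ks * W 0 * E1)) by ring.
        apply Rle_trans with (x0 * (4 * (kf - ks) * u)); [apply Rmult_le_compat_l; lra|].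
        replace (x0 * (4 * (kf - ks) * u)) with (32 * (kf - ks) * x0 * u / 8) by field.
        assert (32 * (kf - ks) * x0 * u <= ks * u) by (apply Rmult_le_compat_r; lra). lra. }
    assert (HCeu : 8 * (kf * Ce * d) <= ks * u).
    { apply Rle_trans with (ks * (K1 * d)); [|apply Rmult_le_compat_l; lra].
      assert (8 * kf * Ce * d <= ks * K1 * d) by (apply Rmult_le_compat_r; lra). lra. }
    assert (HNu : 8 * (N * d) <= ks * u).
    { apply Rle_trans with (ks * (K1 * d)); [|apply Rmult_le_compat_l; lra].
      assert (8 * N * d <= ks * K1 * d) by (apply Rmult_le_compat_r; lra). lra. }
    assert (Hnl : Rabs (beta * psi e u * (1 / A - sg * (w - u))) <= N * d).
    { pose proof (tail_range _ _ _ _ _ HT e u He ltac:(lra)) as Hp.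
      rewrite Rabs_mult, (Rabs_pos_eq (beta * _)) by pos.
      unfold N. replace (beta * (c + 1) * (1 / A + Ym) * d) with (beta * (d * (c + 1)) * (1 / A + Ym)) by ring.
      apply Rmult_le_compat; [pos | apply Rabs_pos | |].
      - apply Rmult_le_compat_l; [lra|].
        set (v := u / d). assert (Ev : u = d * v) by (unfold v; field; lra).
        assert (Hv : 1 <= v) by (apply Rmult_le_reg_l with d; [lra|]; rewrite <- Ev; lra).
        rewrite Ev. eapply Rle_trans; [apply Eup, Hv|]. apply Rmult_le_compat_l; [lra|].
        rewrite <- (Rmult_1_r (c + 1)) at 2. apply Rmult_le_compat_l; [lra|].
        pose proof (inv_pow_le k 1 v ltac:(lra)) as Hi. rewrite pow1, Rinv_1 in Hi. exact Hi.
      - eapply Rle_trans; [apply Rabs_triang|]. rewrite Rabs_Ropp, (sg_mult_abs sg _ Hsg), (Rabs_pos_eq (1 / A)) by lra. lra. }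
    apply Rabs_le_between in Hnl.
    assert (EfU : fU e U W t = - ks * u + kf * (ks * w - u) - beta * psi e u * (1 / A - sg * (w - u))).
    { unfold fU, field_U. fold u w. replace (1 + A) with (kf + ks) by lra.
      replace (A * w) with (kf * ks * w) by (rewrite HA; ring). ring. }
    assert (Hk1 : kf * (ks * w - u) <= kf * (ks * W 0 * E2 + Ce * d)) by (apply Rmult_le_compat_l; lra).
    assert (Hk2 : kf * - (Ce * d) <= kf * (ks * w - u)).
    { apply Rmult_le_compat_l; [lra|]. assert (0 <= ks * W 0 * E2) by pos. lra. }
    assert (EfW : fW e U W t = - u - d * (mu1 * (w - u)) + d * m).
    { unfold fW, field_W. fold u w d. ring. }
    apply Rabs_le_between in HY.
    assert (Hmu : - (mu1 * Ym) <= mu1 * (w - u) <= mu1 * Ym).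
    { split; [rewrite Ropp_mult_distr_r|]; apply Rmult_le_compat_l; lra. }
    assert (Hm4 : 4 * (d * (mu1 * Ym + Rabs m)) <= u).
    { apply Rle_trans with (K1 * d); [|lra]. assert (4 * (mu1 * Ym + Rabs m) * d <= K1 * d) by (apply Rmult_le_compat_r; lra). lra. }
    assert (Hdm : d * - (mu1 * Ym + Rabs m) <= d * (- (mu1 * (w - u)) + m) <= d * (mu1 * Ym + Rabs m)).
    { pose proof (Rle_abs m). pose proof (Rle_abs (- m)) as Hma. rewrite Rabs_Ropp in Hma.
      split; apply Rmult_le_compat_l; lra. }
    rewrite EfU, EfW. assert (0 < ks * u) by pos. lra.
  - exact HUT.
  - exact Hpos.
  - intros t Ht. destruct (Hdesc t Ht) as (D1 & D2 & D3). split; [exact D1|]. split; [|exact D3].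
    eapply Rle_trans; [exact D2|]. apply Rmult_le_compat_r; [lra|]. unfold Cs. lra.
  - intros t Ht. destruct (Rle_lt_dec t ts) as [Hle|Hgt].
    + destruct (Hlin' t ltac:(lra)) as [L1 L2].
      assert (Ce * d <= Cs * d) by (apply Rmult_le_compat_r; [lra | unfold Cs; lra]). lra.
    + destruct (Hdesc t ltac:(lra)) as (D1 & D2 & _). specialize (HUnn t ltac:(lra)).
      assert (HE1 : exp (- ks * t) <= C3 * d).
      { eapply Rle_trans; [|exact Hexp]. apply exp_le. assert (ks * ts <= ks * t) by (apply Rmult_le_compat_l; lra). lra. }
      assert (HE2 : exp (- kf * t) <= exp (- ks * t)).
      { apply exp_le. assert (0 <= (kf - ks) * t) by pos. lra. }
      assert (G : forall q r, 0 <= q -> 0 <= exp (- r * t) <= C3 * d ->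
        Rabs (q * W t - U t - q * W 0 * exp (- r * t)) <= (q * Cd + K1 + q * (2 * R0) * C3) * d).
      { intros q r Hq Hr. apply Rabs_le_between in D2.
        assert (q * - (Cd * d) <= q * W t <= q * (Cd * d)) by (split; apply Rmult_le_compat_l; lra).
        assert (0 <= q * W 0 * exp (- r * t) <= q * (2 * R0) * (C3 * d)).
        { split; [apply Rmult_le_pos; [apply Rmult_le_pos|]; lra|].
          apply Rmult_le_compat; [pos | lra | apply Rmult_le_compat_l; lra | lra]. }
        apply Rabs_le. assert (0 <= K1 * d) by pos. assert (0 <= q * (Cd * d)) by pos.
        assert (0 <= q * (2 * R0) * (C3 * d)) by pos. split; lra. }
      pose proof (exp_pos (- ks * t)). pose proof (exp_pos (- kf * t)).
      split; (eapply Rle_trans; [apply G; lra|]); (apply Rmult_le_compat_r; [lra | unfold Cs; lra]).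
Qed.

End Transit.

Lemma pow2_le_abs (x y : R) : 0 <= y -> x ^ 2 <= y ^ 2 -> Rabs x <= y.
Proof.
  intros Hy H. apply Rnot_lt_le. intro N. rewrite <- (pow2_abs x) in H.
  pose proof (Rabs_pos x). assert (0 < (Rabs x - y) * (Rabs x + y)) by (apply Rmult_lt_0_compat; lra). nra.
Qed.

Lemma linear_decay (q r : R -> R) (w s t : R) : s <= t ->
  (forall x, s <= x <= t -> is_derive q x (- r x * q x)) ->
  (forall x, s <= x <= t -> w <= r x) -> Rabs (q t) <= Rabs (q s) * exp (- w * (t - s)).
Proof.
  intros Hst Hd Hr.
  assert (H : (q t) ^ 2 - 0 <= ((q s) ^ 2 - 0) * exp (- (2 * w) * (t - s))).
  { apply (exp_comparison (fun x => q x ^ 2) (fun x => INR 2 * (- r x * q x) * q x ^ pred 2)); [exact Hst| |].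
    - intros x Hx. apply (is_derive_pow q), Hd, Hx.
    - intros x Hx. specialize (Hr x Hx). simpl. 
      assert (0 <= (r x - w) * (q x * q x)) by (apply Rmult_le_pos; [lra | apply Rle_0_sqr]). lra. }
  apply pow2_le_abs; [pos|]. rewrite Rpow_mult_distr, pow2_abs.
  replace (exp (- w * (t - s)) ^ 2) with (exp (- (2 * w) * (t - s))); [lra|].
  simpl. rewrite Rmult_1_r, <- exp_plus. f_equal. ring.
Qed.

(** Continuation by tangents preserves differentiability at the end points, so that
    [trajectory_graph], stated for interior points, also serves on closed intervals. *)
Lemma affine_extension (f f' : R -> R) (a b : R) : a < b ->
  (forall t, a <= t <= b -> is_derive f t (f' t)) ->
  exists g g', (forall t, a <= t <= b -> g t = f t /\ g' t = f' t) /\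
    (forall t, t < a -> g' t = f' a) /\ (forall t, b < t -> g' t = f' b) /\
    forall t, is_derive g t (g' t).
Proof.
  intros Hab Hd.
  set (g := fun t => if Rlt_dec t a then f a + f' a * (t - a)
                     else if Rlt_dec b t then f b + f' b * (t - b) else f t).
  set (g' := fun t => if Rlt_dec t a then f' a else if Rlt_dec b t then f' b else f' t).
  assert (Haff : forall p q c t, is_derive (fun t => p + q * (t - c)) t q).
  { intros p q c t. auto_derive; [exact I | ring]. }
  exists g, g'. split; [|split; [|split]].
  - intros t Ht. unfold g, g'. destruct (Rlt_dec t a); [lra|]. destruct (Rlt_dec b t); [lra|]. auto.
  - intros t Ht. unfold g'. destruct (Rlt_dec t a); [reflexivity | lra].
  - intros t Ht. unfold g'. destruct (Rlt_dec t a); [lra|]. destruct (Rlt_dec b t); [reflexivity | lra].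
  - intros t. apply is_derive_Reals. intros e He.
    assert (Hloc : exists d, 0 < d /\ forall h, h <> 0 -> Rabs h < d ->
      Rabs ((g (t + h) - g t) / h - g' t) < e).
    { destruct (Rlt_dec t a) as [H1|H1].
      - exists (a - t). split; [lra|]. intros h Hh Hha. apply Rabs_lt_between in Hha.
        unfold g, g'. destruct (Rlt_dec (t + h) a); [|lra]. destruct (Rlt_dec t a); [|lra].
        replace ((f a + f' a * (t + h - a) - (f a + f' a * (t - a))) / h - f' a) with 0 by (field; exact Hh).
        rewrite Rabs_R0. exact He.
      - destruct (Rlt_dec b t) as [H2|H2].
        + exists (t - b). split; [lra|]. intros h Hh Hha. apply Rabs_lt_between in Hha.
          unfold g, g'. destruct (Rlt_dec (t + h) a); [lra|]. destruct (Rlt_dec b (t + h)); [|lra].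
          destruct (Rlt_dec t a); [lra|]. destruct (Rlt_dec b t); [|lra].
          replace ((f b + f' b * (t + h - b) - (f b + f' b * (t - b))) / h - f' b) with 0 by (field; exact Hh).
          rewrite Rabs_R0. exact He.
        + pose proof (Hd t ltac:(lra)) as Ht. apply is_derive_Reals in Ht. destruct (Ht e He) as ((d & Hdp) & Hq).
          simpl in Hq.
          set (da := if Rlt_dec a t then t - a else b - a). set (db := if Rlt_dec t b then b - t else b - a).
          assert (Hda : 0 < da) by (unfold da; destruct (Rlt_dec a t); lra).
          assert (Hdb : 0 < db) by (unfold db; destruct (Rlt_dec t b); lra).
          exists (Rmin d (Rmin da db)). split; [apply Rmin_glb_lt; [exact Hdp | apply Rmin_glb_lt; assumption]|]. intros h Hh Hha.
          assert (Hd1 : Rabs h < d) by (eapply Rlt_le_trans; [exact Hha | apply Rmin_l]).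
          assert (Hd2 : Rabs h < da) by (eapply Rlt_le_trans; [exact Hha|]; eapply Rle_trans; [apply Rmin_r | apply Rmin_l]).
          assert (Hd3 : Rabs h < db) by (eapply Rlt_le_trans; [exact Hha|]; eapply Rle_trans; [apply Rmin_r | apply Rmin_r]).
          apply Rabs_lt_between in Hd2, Hd3. unfold da, db in Hd2, Hd3.
          assert (Eg : g t = f t) by (unfold g; destruct (Rlt_dec t a); [lra|]; destruct (Rlt_dec b t); [lra | reflexivity]).
          assert (Eg' : g' t = f' t) by (unfold g'; destruct (Rlt_dec t a); [lra|]; destruct (Rlt_dec b t); [lra | reflexivity]).
          rewrite Eg, Eg'. unfold g.
          destruct (Rlt_dec (t + h) a) as [H3|H3].
          * destruct (Rlt_dec a t) as [Hta|Hta]; [lra|]. replace a with t by lra.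
            { replace ((f t + f' t * (t + h - t) - f t) / h - f' t) with 0 by (field; exact Hh). rewrite Rabs_R0. exact He. }
          * destruct (Rlt_dec b (t + h)) as [H4|H4]; [|apply Hq; assumption].
            destruct (Rlt_dec t b) as [Htb|Htb]; [lra|]. replace b with t by lra.
            { replace ((f t + f' t * (t + h - t) - f t) / h - f' t) with 0 by (field; exact Hh). rewrite Rabs_R0. exact He. } }
    destruct Hloc as (d & Hdp & Hq). exists (mkposreal d Hdp). exact Hq.
Qed.

Lemma trajectory_graph_closed (sg : R) (U V U' V' : R -> R) (a b : R) : a < b ->
  (sg = 1 \/ sg = -1) ->
  (forall t, a <= t <= b -> is_derive U t (U' t)) ->
  (forall t, a <= t <= b -> is_derive V t (V' t)) ->
  (forall t, a <= t <= b -> 0 < sg * U' t) ->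
  exists r : R -> R, (forall t, a <= t <= b -> r (U t) = V t) /\
    forall t, a <= t <= b -> is_derive r (U t) (V' t / U' t).
Proof.
  intros Hab Hsg HU HV Hpos.
  destruct (affine_extension U U' a b Hab HU) as (X & X' & EX & EXa & EXb & DX).
  destruct (affine_extension V V' a b Hab HV) as (Y & Y' & EY & EYa & EYb & DY).
  destruct (trajectory_graph sg X Y X' Y' (a - 1) (b + 1)) as (r & Hr & Dr).
  - lra.
  - exact Hsg.
  - intros t _. apply DX.
  - intros t _. apply DY.
  - intros t Ht. destruct (Rlt_dec t a); [rewrite EXa by lra; apply Hpos; lra|].
    destruct (Rlt_dec b t); [rewrite EXb by lra; apply Hpos; lra|].
    rewrite (proj2 (EX t ltac:(lra))). apply Hpos. lra.
  - exists r. split.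
    + intros t Ht. rewrite <- (proj1 (EX t Ht)), <- (proj1 (EY t Ht)). apply Hr. lra.
    + intros t Ht. rewrite <- (proj1 (EX t Ht)), <- (proj2 (EX t Ht)), <- (proj2 (EY t Ht)). apply Dr. lra.
Qed.

Lemma ivt_increasing (h : R -> R) (a b v : R) : a <= b ->
  (forall t, a <= t <= b -> continuity_pt h t) -> h a <= v <= h b ->
  exists t, a <= t <= b /\ h t = v.
Proof.
  intros Hab Hc Hv. destruct (ivt_decreasing (fun t => - h t) a b (- v)) as (t & Ht & E); [lra | | lra |].
  - intros t Ht. apply continuity_pt_opp, Hc, Ht.
  - exists t. split; [exact Ht | lra].
Qed.

(** Two orbits compared at equal [U]: the height difference [q] solves
    [q' = - (mu + (A + sg * beta * psi) * W' / U') q], with [W' / U'] the slope of the first orbit. *)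
Lemma orbit_comparison (dir A beta sg mu m0 w : R) (psi : R -> R) (U1 W1 U2 W2 : R -> R) (a b s t : R) :
  let fU U W := field_U A beta sg psi U W in
  let fW U W := field_W mu m0 U W in
  a < b -> s <= t -> dir = 1 \/ dir = -1 ->
  (forall x, a <= x <= b -> is_derive U1 x (fU (U1 x) (W1 x)) /\ is_derive W1 x (fW (U1 x) (W1 x))) ->
  (forall x, s <= x <= t -> is_derive U2 x (fU (U2 x) (W2 x)) /\ is_derive W2 x (fW (U2 x) (W2 x))) ->
  (forall x, a <= x <= b -> 0 < dir * fU (U1 x) (W1 x)) ->
  (forall x, s <= x <= t -> exists y, a <= y <= b /\ U1 y = U2 x) ->
  (forall x y, s <= x <= t -> a <= y <= b -> U1 y = U2 x ->
     w <= mu + (A + sg * beta * psi (U2 x)) * (fW (U1 y) (W1 y) / fU (U1 y) (W1 y))) ->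
  forall y z, a <= y <= b -> a <= z <= b -> U1 y = U2 s -> U1 z = U2 t ->
  Rabs (W2 t - W1 z) <= Rabs (W2 s - W1 y) * exp (- w * (t - s)).
Proof.
  intros fU fW Hab Hst Hdir H1 H2 Hpos Hex Hrate y z Hy Hz Ey Ez.
  destruct (trajectory_graph_closed dir U1 W1 (fun x => fU (U1 x) (W1 x)) (fun x => fW (U1 x) (W1 x)) a b)
    as (r & Hr & Dr); [exact Hab | exact Hdir | intros x Hx; apply H1, Hx | intros x Hx; apply H1, Hx | exact Hpos |].
  rewrite <- (Hr y Hy), <- (Hr z Hz), Ey, Ez.
  set (pre := fun x => epsilon (inhabits 0) (fun y => a <= y <= b /\ U1 y = U2 x)).
  assert (Hpre : forall x, s <= x <= t -> a <= pre x <= b /\ U1 (pre x) = U2 x).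
  { intros x Hx. apply (epsilon_spec (inhabits 0) (fun y => a <= y <= b /\ U1 y = U2 x)), Hex, Hx. }
  apply (linear_decay (fun x => W2 x - r (U2 x))
    (fun x => mu + (A + sg * beta * psi (U2 x)) * (fW (U1 (pre x)) (W1 (pre x)) / fU (U1 (pre x)) (W1 (pre x))))
    w s t Hst).
  - intros x Hx. destruct (Hpre x Hx) as [P1 P2]. destruct (H2 x Hx) as [D1 D2].
    assert (HfU : fU (U1 (pre x)) (W1 (pre x)) <> 0).
    { intro E. specialize (Hpos (pre x) P1). rewrite E in Hpos. lra. }
    assert (Er : r (U2 x) = W1 (pre x)) by (rewrite <- P2; apply Hr, P1).
    replace (- (mu + (A + sg * beta * psi (U2 x)) * (fW (U1 (pre x)) (W1 (pre x)) / fU (U1 (pre x)) (W1 (pre x)))) * (W2 x - r (U2 x)))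
      with (fW (U2 x) (W2 x) - fU (U2 x) (W2 x) * (fW (U1 (pre x)) (W1 (pre x)) / fU (U1 (pre x)) (W1 (pre x)))).
    + apply (is_derive_minus W2 (fun x => r (U2 x))); [exact D2|].
      apply (is_derive_comp r U2); [|exact D1]. rewrite <- P2. apply Dr, P1.
    + rewrite Er, P2. rewrite P2 in HfU.
      (* At equal [U] both components of the field are affine in [W] with the tail taken at the same
         point, so no difference of tail values arises. *)
      assert (EU : fU (U2 x) (W2 x) = fU (U2 x) (W1 (pre x)) + (A + sg * beta * psi (U2 x)) * (W2 x - W1 (pre x)))
        by (unfold fU, field_U; ring).
      assert (EW : fW (U2 x) (W2 x) = fW (U2 x) (W1 (pre x)) - mu * (W2 x - W1 (pre x)))
        by (unfold fW, field_W; ring).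
      rewrite EU, EW. field. exact HfU.
  - intros x Hx. destruct (Hpre x Hx) as [P1 P2]. apply Hrate; assumption.
Qed.

Section HalfMap.
Variables (k : nat) (A kf ks beta sg c psi0 : R) (dl : R -> R) (psi : R -> R -> R) (m m' mu1 : R).
Hypothesis Hks : 0 < ks < kf.
Hypothesis HA : A = kf * ks.
Hypothesis HA1 : 1 + A = kf + ks.
Hypothesis Hbeta : 0 < beta.
Hypothesis Hc : 0 < c.
Hypothesis Hsg : sg = 1 \/ sg = -1.
Hypothesis HT : tail_family k c psi0 dl psi.
Hypothesis HA' : 0 < A + sg * beta.
Hypothesis Hmu1 : 0 <= mu1.
Hypothesis Hm : m < m'.
Hypothesis Hpass : passing k A kf ks (beta * c / A) m'.

Let R0 := beta / (A * (A + sg * beta)).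
Let sol (e : R) := half_solution A beta sg (psi e) (dl e * mu1) (dl e * m).
Let fU (e : R) (U W : R -> R) (t : R) := field_U A beta sg (psi e) (U t) (W t).
Let fW (e : R) (U W : R -> R) (t : R) := field_W (dl e * mu1) (dl e * m) (U t) (W t).

Let A_pos : 0 < A.
Proof. rewrite HA. pos. Qed.

Let R0_pos : 0 < R0.
Proof. unfold R0. pos. Qed.

Let rate_le (e U : R) : 0 < e -> 0 <= U -> A + sg * beta * psi e U <= A + beta.
Proof.
  intros He HU. pose proof (tail_range _ _ _ _ _ HT e U He HU) as Hp.
  pose proof (tail_psi0 _ _ _ _ _ HT) as H0.
  assert (0 <= beta * psi e U <= beta * 1) by (split; [pos | apply Rmult_le_compat_l; lra]).
  destruct Hsg as [-> | ->]; lra.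
Qed.

Let amin := rate_min A beta sg.

(** The two orbits are compared at equal [U] while [U] increases and again while it decreases, and at equal
    times (Gronwall) around the maximum of [U]. The factor [1 / 2] comes from the slow descent, which is
    arbitrarily long as [e -> 0]. *)
Lemma contraction (rad tau c0 T0 K1 pm Cs Um Ym : R) :
  0 < rad <= R0 / 4 -> 0 < tau <= 1 -> 0 < c0 -> 1 <= T0 -> 0 < K1 -> 0 < pm -> 0 < Cs -> 0 < Um -> 0 < Ym ->
  exp (- (kf - ks) * T0) <= 1 / 2 ->
  eventually0 (fun e => forall U1 W1 ts1 T1 U2 W2 ts2 T2,
    sol e U1 W1 0 -> U1 0 = 0 -> Rabs (W1 0 - R0) <= rad ->
    sol e U2 W2 0 -> U2 0 = 0 -> Rabs (W2 0 - R0) <= rad ->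
    transits kf ks (dl e) tau c0 T0 K1 pm Cs Um Ym (fU e U1 W1) (fW e U1 W1) U1 W1 ts1 T1 ->
    transits kf ks (dl e) tau c0 T0 K1 pm Cs Um Ym (fU e U2 W2) (fW e U2 W2) U2 W2 ts2 T2 ->
    Rabs (W2 T2 - W1 T1) <= 1 / 2 * Rabs (W2 0 - W1 0)).
Proof.
  intros Hrad Htau Hc0 HT0 HK1 Hpm HCs HUm HYm Hx0.
  assert (Hamin : 0 < amin) by (apply (rate_min_pos A kf ks); assumption).
  pose proof (Rabs_pos m) as Hm0.
  assert (H1A : 0 < 1 / A) by pos.
  (* Initial heights lie between [3 / 4 * R0] and [5 / 4 * R0]. Waiting [dt] beyond [T0] gains a
     factor [4], enough to bring [U2 t2] below [U1 T0], so that this level is met on the slow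
     descent of the first orbit. *)
  destruct (exp_eventually_small ks (1 / 4)) as (dt & Hdt & Hdt'); [lra | lra |].
  set (t2 := T0 + dt).
  set (qq := 1 - exp (- (kf - ks) * tau)).
  assert (Hqq : 0 < qq).
  { unfold qq. assert (exp (- (kf - ks) * tau) < 1); [|lra]. rewrite <- exp_0. apply exp_increasing.
    assert (0 < (kf - ks) * tau) by pos. lra. }
  set (V0 := kf * ks * (3 / 4 * R0) * (exp (- ks * (t2 + 1)) * qq)).
  assert (HV0 : 0 < V0) by (unfold V0; pos).
  set (cA := c0 * tau). assert (HcA : 0 < cA) by (unfold cA; pos).
  (* Lower bound for [U] throughout the comparison at equal times; on [U >= Ulow] the tail has a
     Lipschitz constant independent of [e]. *)
  set (Ulow := Rmin cA (V0 / (2 * (kf - ks)))).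
  assert (HUlow : 0 < Ulow) by (unfold Ulow; pos).
  destruct (tail_lipschitz _ _ _ _ _ HT Ulow HUlow) as (Lp & HLp & ELp).
  set (LL := 1 + A + beta * (Lp * (1 / A + Ym) + 1) + 1).
  assert (HLL : 0 < LL) by (unfold LL; pos).
  set (Mw := Rabs m + Um + mu1 * Ym). assert (HMw : 0 < Mw) by (unfold Mw; pos).
  set (La := 1 + (A + beta) * (Mw / c0)). assert (HLa : 0 < La) by (unfold La; pos).
  set (ks5 := 5 / (2 * ks)). assert (Hks5 : 0 < ks5) by (unfold ks5; pos).
  (* Contraction rate of the slow descent: [W' / U' >= (3 / 4) / (2 * ks)] by [tr_slow], times the
     least damping [amin]. *)
  set (om := 3 * amin / (8 * ks)). assert (Hom : 0 < om) by (unfold om; pos).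
  set (L3 := (A + beta) * ((Rabs m + K1 + mu1 * Ym) / pm)). assert (HL3 : 0 < L3) by (unfold L3; pos).
  set (G1 := exp (La * 1)). set (G2 := exp (2 * LL * t2)). set (G3 := exp (L3 * Cs)).
  assert (HG1 : 0 < G1) by apply exp_pos. assert (HG2 : 0 < G2) by apply exp_pos. assert (HG3 : 0 < G3) by apply exp_pos.
  (* [G1], [G2], [1 + ks5] and [G3] bound the expansion in the other phases. [S0] is a duration of
     slow descent that beats their product by a factor [2], and small [e] guarantees at least this
     duration. *)
  destruct (exp_eventually_small om (1 / (2 * (G1 * G2 * G3 * (1 + ks5))))) as (S0 & HS0 & HS0'); [lra | pos |].
  set (S := t2 + 1 + S0).
  set (margin := kf * ks * R0 * exp (- ks * T0) / 16).
  assert (Hmargin : 0 < margin) by (unfold margin; pos).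
  set (xd := Rmin (Rmin 1 (exp (- ks * S) / Cs)) (Rmin (margin / (4 * ((kf + ks) * Cs))) (V0 / (4 * ((kf + ks) * Cs))))).
  assert (Hxd : 0 < xd) by (unfold xd; pos).
  eapply eventually0_impl.
  { apply eventually0_and; [exact ELp|]. apply (small_data k c psi0 dl psi m mu1 HT Hmu1 xd Hxd). }
  clear ELp. intros e He (HLip & (Hd & _ & Hdmu)) U1 W1 ts1 T1 U2 W2 ts2 T2 S1 HU10 HW10 S2 HU20 HW20 Tr1 Tr2.
  pose proof (tail_dl_pos _ _ _ _ _ HT e He) as Hd0. set (d := dl e) in *.
  assert (Hx1 : xd <= 1) by (eapply Rle_trans; [apply Rmin_l | apply Rmin_l]).
  assert (HdS : Cs * d < exp (- ks * S)).
  { assert (H : d < exp (- ks * S) / Cs) by (eapply Rlt_le_trans; [exact Hd|]; eapply Rle_trans; [apply Rmin_l | apply Rmin_r]).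
    apply Rmult_lt_compat_l with (r := Cs) in H; [|lra].
    replace (Cs * (exp (- ks * S) / Cs)) with (exp (- ks * S)) in H by (field; lra). exact H. }
  assert (Hdm : 4 * ((kf + ks) * Cs * d) <= margin).
  { assert (H : d < margin / (4 * ((kf + ks) * Cs))) by (eapply Rlt_le_trans; [exact Hd|]; eapply Rle_trans; [apply Rmin_r | apply Rmin_l]).
    apply Rmult_lt_compat_l with (r := 4 * ((kf + ks) * Cs)) in H; [|pos].
    replace (4 * ((kf + ks) * Cs) * (margin / (4 * ((kf + ks) * Cs)))) with margin in H by (field; lra). lra. }
  assert (HdV : 4 * ((kf + ks) * Cs * d) <= V0).
  { assert (H : d < V0 / (4 * ((kf + ks) * Cs))) by (eapply Rlt_le_trans; [exact Hd|]; eapply Rle_trans; [apply Rmin_r | apply Rmin_r]).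
    apply Rmult_lt_compat_l with (r := 4 * ((kf + ks) * Cs)) in H; [|pos].
    replace (4 * ((kf + ks) * Cs) * (V0 / (4 * ((kf + ks) * Cs)))) with V0 in H by (field; lra). lra. }
  assert (Emargin : margin = kf * ks * R0 * exp (- ks * T0) / 16) by reflexivity.
  clearbody xd margin. set (mu := d * mu1) in *.

  (* Estimates for a single orbit *)
  assert (Single : forall U W ts T, sol e U W 0 -> U 0 = 0 -> Rabs (W 0 - R0) <= rad ->
    transits kf ks d tau c0 T0 K1 pm Cs Um Ym (fU e U W) (fW e U W) U W ts T ->
    S < ts /\ (forall t, 0 <= t -> is_derive U t (fU e U W t) /\ is_derive W t (fW e U W t)) /\
    (forall t, 0 <= t <= T -> Rabs (fW e U W t) <= Mw) /\
    (forall t, tau <= t <= t2 + 1 -> Ulow <= U t) /\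
    (forall a b, 0 <= a <= b -> b <= tau -> c0 * (b - a) <= U b - U a) /\
    (forall a b, T0 <= a < b -> b <= T -> U b < U a) /\
    kf * ks * (3 / 8 * R0) * exp (- ks * T0) - (kf + ks) * Cs * d <= (kf - ks) * U T0 /\
    (kf - ks) * U t2 <= kf * ks * (5 / 4 * R0) * (exp (- ks * T0) / 4) + (kf + ks) * Cs * d).
  { clear U1 W1 ts1 T1 U2 W2 ts2 T2 S1 HU10 HW10 S2 HU20 HW20 Tr1 Tr2.
    intros U W ts T Hsol HU0 HW0 Tr. destruct Tr as [Tt Td Tl Tla Tb Tab Tat Tsl Ten Tpo Tde Tli].
    apply Rabs_le_between in HW0.
    assert (HSts : S < ts).
    { apply Rnot_le_lt. intro. assert (exp (- ks * S) <= exp (- ks * ts)); [|lra].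
      apply exp_le. assert (ks * ts <= ks * S) by (apply Rmult_le_compat_l; lra). lra. }
    assert (HD : forall t, 0 <= t -> is_derive U t (fU e U W t) /\ is_derive W t (fW e U W t)).
    { intros t Ht. apply Hsol, Ht. }
    assert (Eu : forall t, (kf - ks) * U t = ks * (kf * W t - U t) - kf * (ks * W t - U t)) by (intros t; ring).
    assert (Elow : forall t, 0 <= t <= T -> kf * ks * W 0 * (exp (- ks * t) - exp (- kf * t)) - (kf + ks) * Cs * d <= (kf - ks) * U t).
    { intros t Ht. destruct (Tli t Ht) as [L1 L2]. apply Rabs_le_between in L1, L2. rewrite Eu.
      assert (ks * (kf * W 0 * exp (- ks * t) - Cs * d) <= ks * (kf * W t - U t)) by (apply Rmult_le_compat_l; lra).
      assert (kf * (ks * W t - U t) <= kf * (ks * W 0 * exp (- kf * t) + Cs * d)) by (apply Rmult_le_compat_l; lra).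
      lra. }
    assert (Hexp : forall t0 t, t0 <= t -> exp (- ks * t) * (1 - exp (- (kf - ks) * t0)) <= exp (- ks * t) - exp (- kf * t)).
    { intros t0 t Ht. assert (exp (- kf * t) <= exp (- ks * t) * exp (- (kf - ks) * t0)); [|lra].
      rewrite <- exp_plus. apply exp_le. assert ((kf - ks) * t0 <= (kf - ks) * t) by (apply Rmult_le_compat_l; lra). lra. }
    split; [exact HSts|]. split; [exact HD|]. split; [|split; [|split; [|split; [|split]]]].
    - intros t Ht. destruct (Tb t Ht) as [B1 B2]. apply Rabs_le_between in B2.
      replace (fW e U W t) with (d * m - U t - d * (mu1 * (W t - U t))) by (unfold fW, field_W; fold d; ring).
      assert (H1 : - (mu1 * Ym) <= mu1 * (W t - U t) <= mu1 * Ym).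
      { split; [rewrite Ropp_mult_distr_r|]; apply Rmult_le_compat_l; lra. }
      assert (H2 : 0 <= mu1 * Ym) by pos.
      assert (H3 : d * (mu1 * Ym) <= 1 * (mu1 * Ym)) by (apply Rmult_le_compat_r; lra).
      assert (H4 : d * - (mu1 * Ym) <= d * (mu1 * (W t - U t)) <= d * (mu1 * Ym)) by (split; apply Rmult_le_compat_l; lra).
      assert (H5 : d * Rabs m <= 1 * Rabs m) by (apply Rmult_le_compat_r; lra).
      pose proof (Rle_abs m) as H6. pose proof (Rle_abs (- m)) as H7. rewrite Rabs_Ropp in H7.
      assert (H8 : d * - Rabs m <= d * m <= d * Rabs m) by (split; apply Rmult_le_compat_l; lra).
      apply Rabs_le. unfold Mw. split; lra.
    - intros t Ht. apply Rle_trans with (V0 / (2 * (kf - ks))); [apply Rmin_r|].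
      apply Rmult_le_reg_l with (kf - ks); [lra|].
      replace ((kf - ks) * (V0 / (2 * (kf - ks)))) with (V0 / 2) by (field; lra).
      assert (Htt : 0 <= t <= T) by (unfold S in HSts; lra).
      eapply Rle_trans; [|apply Elow, Htt].
      assert (V0 <= kf * ks * W 0 * (exp (- ks * t) - exp (- kf * t))); [|lra].
      unfold V0. pose proof (exp_pos (- ks * (t2 + 1))). apply Rmult_le_compat; [pos | pos | |].
      + apply Rmult_le_compat_l; [pos | lra].
      + eapply Rle_trans; [|apply (Hexp tau); lra]. fold qq. apply Rmult_le_compat_r; [lra|].
        apply exp_le. assert (ks * t <= ks * (t2 + 1)) by (apply Rmult_le_compat_l; lra). lra.
    - intros a b Ha Hb. apply (increment_ge U (fU e U W)); [lra | intros t Ht; apply HD; lra |].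
      intros t Ht. apply Tla. lra.
    - intros a b Ha Hb. set (cc := Rmin (ks / 2 * (K1 * d)) (pm * d)).
      assert (Hcc : 0 < cc) by (unfold cc; pos).
      assert (U b - U a <= - cc * (b - a)).
      { apply (increment_le U (fU e U W)); [lra | intros t Ht; apply HD; lra |].
        intros t Ht. destruct (Rle_lt_dec t ts) as [H|H].
        - destruct (Tsl t ltac:(lra)) as [[_ H1] _]. specialize (Tab t ltac:(lra)).
          assert (ks / 2 * (K1 * d) <= ks / 2 * U t) by (apply Rmult_le_compat_l; lra).
          assert (cc <= ks / 2 * (K1 * d)) by apply Rmin_l. lra.
        - destruct (Tde t ltac:(lra)) as (_ & _ & H1). assert (cc <= pm * d) by apply Rmin_r. lra. }
      assert (0 < cc * (b - a)) by pos. lra.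
    - eapply Rle_trans; [|apply Elow; lra].
      assert (kf * ks * (3 / 8 * R0) * exp (- ks * T0) <= kf * ks * W 0 * (exp (- ks * T0) - exp (- kf * T0))); [|lra].
      specialize (Hexp T0 T0 ltac:(lra)). pose proof (exp_pos (- ks * T0)).
      replace (kf * ks * (3 / 8 * R0) * exp (- ks * T0)) with (kf * ks * (3 / 4 * R0) * (exp (- ks * T0) * (1 / 2))) by field.
      apply Rmult_le_compat; [pos | pos | apply Rmult_le_compat_l; [pos | lra] |].
      eapply Rle_trans; [|exact Hexp]. apply Rmult_le_compat_l; lra.
    - assert (Htt : 0 <= t2 <= T) by (unfold S in HSts; unfold t2 in *; lra).
      destruct (Tli t2 Htt) as [L1 L2]. apply Rabs_le_between in L1, L2. rewrite Eu.
      assert (HE : exp (- ks * t2) <= exp (- ks * T0) / 4).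
      { unfold t2. replace (- ks * (T0 + dt)) with (- ks * T0 + - ks * dt) by ring. rewrite exp_plus.
        assert (exp (- ks * T0) * exp (- ks * dt) <= exp (- ks * T0) * (1 / 4)) by (apply Rmult_le_compat_l; [pos | lra]). lra. }
      pose proof (exp_pos (- ks * t2)).
      assert (ks * (kf * W t2 - U t2) <= ks * (kf * W 0 * exp (- ks * t2) + Cs * d)) by (apply Rmult_le_compat_l; lra).
      assert (kf * - (Cs * d) <= kf * (ks * W t2 - U t2)).
      { apply Rmult_le_compat_l; [lra|]. assert (0 <= ks * W 0 * exp (- kf * t2)) by pos. lra. }
      assert (kf * ks * W 0 * exp (- ks * t2) <= kf * ks * (5 / 4 * R0) * (exp (- ks * T0) / 4)).
      { apply Rmult_le_compat; [pos | lra | apply Rmult_le_compat_l; [pos | lra] | exact HE]. }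
      lra. }
  destruct (Single U1 W1 ts1 T1 S1 HU10 HW10 Tr1) as (HSt1 & D1 & HfW1 & HlU1 & Hin1 & Hde1 & HT01 & _).
  destruct (Single U2 W2 ts2 T2 S2 HU20 HW20 Tr2) as (HSt2 & D2 & HfW2 & HlU2 & Hin2 & Hde2 & _ & Ht22).
  clear Single.
  destruct Tr1 as [Tt1 Td1 Tl1 Tla1 Tb1 Tab1 Tat1 Tsl1 Ten1 Tpo1 Tde1 Tli1].
  destruct Tr2 as [Tt2 Td2 Tl2 Tla2 Tb2 Tab2 Tat2 Tsl2 Ten2 Tpo2 Tde2 Tli2].
  assert (CU1 : forall t, 0 <= t -> continuity_pt U1 t) by (intros t Ht; exact (is_derive_continuity_pt _ _ _ (proj1 (D1 t Ht)))).
  assert (CU2 : forall t, 0 <= t -> continuity_pt U2 t) by (intros t Ht; exact (is_derive_continuity_pt _ _ _ (proj1 (D2 t Ht)))).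
  assert (HK1d : 0 < K1 * d) by pos.
  (* Both orbits cross the level [cA = c0 * tau] before [tau]; up to these crossings they are
     compared at equal [U], afterwards at equal times. *)
  destruct (ivt_increasing U1 0 tau cA) as (s1 & Hs1 & Us1); [lra | intros t Ht; apply CU1; lra | |].
  { rewrite HU10. destruct (Tla1 tau ltac:(lra)) as [H _]. unfold cA. split; [pos | exact H]. }
  destruct (ivt_increasing U2 0 tau cA) as (s2 & Hs2 & Us2); [lra | intros t Ht; apply CU2; lra | |].
  { rewrite HU20. destruct (Tla2 tau ltac:(lra)) as [H _]. unfold cA. split; [pos | exact H]. }

  (* Rising phase, at equal [U] *)
  assert (StepA : Rabs (W2 s2 - W1 s1) <= Rabs (W2 0 - W1 0) * G1).
  { assert (H : Rabs (W2 s2 - W1 s1) <= Rabs (W2 0 - W1 0) * exp (- - La * (s2 - 0))).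
    { apply (orbit_comparison 1 A beta sg mu (d * m) (- La) (psi e) U1 W1 U2 W2 0 tau 0 s2); [lra | lra | left; reflexivity | | | | | | lra | lra | lra | lra].
      - intros x Hx. apply (D1 x). lra.
      - intros x Hx. apply (D2 x). lra.
      - intros x Hx. destruct (Tla1 x Hx) as [_ H]. unfold fU in H. lra.
      - intros x Hx. apply ivt_increasing; [lra | intros t Ht; apply CU1; lra |].
        rewrite HU10. split; [apply Tb2; lra|].
        destruct (Tla1 tau ltac:(lra)) as [H _]. fold cA in H.
        specialize (Hin2 x s2 ltac:(lra) ltac:(lra)). assert (0 <= c0 * (s2 - x)) by pos. lra.
      - intros x y Hx Hy Exy. destruct (Tla1 y Hy) as [_ H1]. specialize (HfW1 y ltac:(lra)).
        fold (fU e U1 W1 y). change (field_W mu (d * m) (U1 y) (W1 y)) with (fW e U1 W1 y).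
        assert (HUx : 0 <= U2 x) by (apply Tb2; lra).
        pose proof (rate_le e (U2 x) He HUx) as R1.
        pose proof (rate_ge k A kf ks beta sg c psi0 dl psi m mu1 Hks HA Hbeta Hsg HT HA' e (U2 x) He HUx) as R2. fold amin in R2.
        assert (Hq : Rabs (fW e U1 W1 y / fU e U1 W1 y) <= Mw / c0).
        { unfold Rdiv. rewrite Rabs_mult, (Rabs_pos_eq (/ _)) by pos.
          apply Rmult_le_compat; [apply Rabs_pos | pos | exact HfW1 | apply Rinv_le_contravar; lra]. }
        assert (Hp : Rabs ((A + sg * beta * psi e (U2 x)) * (fW e U1 W1 y / fU e U1 W1 y)) <= (A + beta) * (Mw / c0)).
        { rewrite Rabs_mult, (Rabs_pos_eq (A + _)) by lra. apply Rmult_le_compat; [lra | apply Rabs_pos | exact R1 | exact Hq]. }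
        apply Rabs_le_between in Hp. unfold La. lra. }
    eapply Rle_trans; [exact H|]. apply Rmult_le_compat_l; [apply Rabs_pos|]. unfold G1. apply exp_le.
    rewrite Ropp_involutive. apply Rmult_le_compat_l; lra. }
  (* Both orbits run for the same time [Tb] from the level [cA]; since [s1] and [s2] lie in
     [[0, 1]], the final times [t1] and [t2] differ by at most [1]. *)
  set (Tb := t2 - s2). assert (HTb : 0 <= Tb <= t2) by (unfold Tb, t2; lra).
  set (t1 := s1 + Tb). assert (Ht1 : t2 - 1 <= t1 <= t2 + 1) by (unfold t1, Tb; lra).
  assert (HcAlow : Ulow <= cA) by apply Rmin_l.
  assert (Low1 : forall x, 0 <= x <= Tb -> Ulow <= U1 (s1 + x)).
  { intros x Hx. destruct (Rle_lt_dec (s1 + x) tau).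
    - specialize (Hin1 s1 (s1 + x) ltac:(lra) ltac:(lra)). assert (0 <= c0 * (s1 + x - s1)) by pos. lra.
    - apply HlU1. unfold t1 in Ht1. lra. }
  assert (Low2 : forall x, 0 <= x <= Tb -> Ulow <= U2 (s2 + x)).
  { intros x Hx. destruct (Rle_lt_dec (s2 + x) tau).
    - specialize (Hin2 s2 (s2 + x) ltac:(lra) ltac:(lra)). assert (0 <= c0 * (s2 + x - s2)) by pos. lra.
    - apply HlU2. unfold Tb in Hx. lra. }

  (* Around the maximum of [U], at equal times *)
  assert (StepB : Rabs (U2 t2 - U1 t1) <= Rabs (W2 s2 - W1 s1) * G2 /\ Rabs (W2 t2 - W1 t1) <= Rabs (W2 s2 - W1 s1) * G2).
  { assert (HG : (U2 (s2 + Tb) - U1 (s1 + Tb)) ^ 2 + (W2 (s2 + Tb) - W1 (s1 + Tb)) ^ 2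
        <= ((U2 (s2 + 0) - U1 (s1 + 0)) ^ 2 + (W2 (s2 + 0) - W1 (s1 + 0)) ^ 2) * exp (4 * LL * (Tb - 0))).
    { apply (gronwall2 (fun x => U2 (s2 + x)) (fun x => W2 (s2 + x)) (fun x => U1 (s1 + x)) (fun x => W1 (s1 + x))
        (fun x => fU e U2 W2 (s2 + x) - fU e U1 W1 (s1 + x)) (fun x => fW e U2 W2 (s2 + x) - fW e U1 W1 (s1 + x))); [lra | lra | | | |].
      - intros x Hx. apply (is_derive_minus (fun x => U2 (s2 + x)) (fun x => U1 (s1 + x)));
          apply is_derive_shift; [apply D2 | apply D1]; lra.
      - intros x Hx. apply (is_derive_minus (fun x => W2 (s2 + x)) (fun x => W1 (s1 + x)));
          apply is_derive_shift; [apply D2 | apply D1]; lra.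
      - intros x Hx. specialize (Low1 x Hx). specialize (Low2 x Hx).
        destruct (Tb2 (s2 + x)) as [_ Y2]. { unfold Tb in Hx. unfold S in HSt2. lra. }
        unfold fU, field_U. set (u1 := U1 (s1 + x)) in *. set (u2 := U2 (s2 + x)) in *.
        set (w1 := W1 (s1 + x)) in *. set (w2 := W2 (s2 + x)) in *.
        pose proof (HLip u2 u1 Low2 Low1) as HLi.
        pose proof (tail_range _ _ _ _ _ HT e u1 He ltac:(lra)) as Hp1. pose proof (tail_psi0 _ _ _ _ _ HT) as Hp0.
        replace (A * w2 - (1 + A) * u2 - beta * psi e u2 * (1 / A - sg * (w2 - u2)) -
                 (A * w1 - (1 + A) * u1 - beta * psi e u1 * (1 / A - sg * (w1 - u1))))
          with (A * (w2 - w1) + - ((1 + A) * (u2 - u1)) +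
                - (beta * ((psi e u2 - psi e u1) * (1 / A - sg * (w2 - u2)))) + beta * psi e u1 * (sg * ((w2 - w1) - (u2 - u1)))) by ring.
        pose proof (Rabs_pos (u2 - u1)) as Pu. pose proof (Rabs_pos (w2 - w1)) as Pw.
        assert (T1' : Rabs (A * (w2 - w1)) <= A * Rabs (w2 - w1)) by (rewrite Rabs_mult, (Rabs_pos_eq A); lra).
        assert (T2' : Rabs (- ((1 + A) * (u2 - u1))) <= (1 + A) * Rabs (u2 - u1)) by (rewrite Rabs_Ropp, Rabs_mult, (Rabs_pos_eq (1 + A)); lra).
        assert (T3' : Rabs (- (beta * ((psi e u2 - psi e u1) * (1 / A - sg * (w2 - u2))))) <= beta * (Lp * (1 / A + Ym)) * Rabs (u2 - u1)).
        { rewrite Rabs_Ropp, Rabs_mult, Rabs_mult, (Rabs_pos_eq beta) by lra. rewrite Rmult_assoc.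
          apply Rmult_le_compat_l; [lra|]. replace (Lp * (1 / A + Ym) * Rabs (u2 - u1)) with (Lp * Rabs (u2 - u1) * (1 / A + Ym)) by ring.
          apply Rmult_le_compat; [apply Rabs_pos | apply Rabs_pos | exact HLi |].
          eapply Rle_trans; [apply Rabs_triang|]. rewrite Rabs_Ropp, (sg_mult_abs sg _ Hsg), (Rabs_pos_eq (1 / A)); lra. }
        assert (T4' : Rabs (beta * psi e u1 * (sg * (w2 - w1 - (u2 - u1)))) <= beta * (Rabs (w2 - w1) + Rabs (u2 - u1))).
        { rewrite Rabs_mult, (sg_mult_abs sg _ Hsg), (Rabs_pos_eq (beta * _)) by pos.
          apply Rmult_le_compat; [pos | apply Rabs_pos | |].
          - rewrite <- (Rmult_1_r beta) at 2. apply Rmult_le_compat_l; lra.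
          - eapply Rle_trans; [apply Rabs_triang|]. rewrite Rabs_Ropp. lra. }
        eapply Rle_trans; [apply Rabs_triang|]. eapply Rle_trans; [apply Rplus_le_compat_r, Rabs_triang|].
        eapply Rle_trans; [apply Rplus_le_compat_r, Rplus_le_compat_r, Rabs_triang|].
        unfold LL. assert (0 <= beta * (Lp * (1 / A + Ym)) * Rabs (w2 - w1)) by pos.
        assert (0 <= A * Rabs (w2 - w1)) by pos. assert (0 <= A * Rabs (u2 - u1)) by pos. lra.
      - intros x Hx. unfold fW, field_W. fold d mu.
        set (u1 := U1 (s1 + x)) in *. set (u2 := U2 (s2 + x)) in *.
        set (w1 := W1 (s1 + x)) in *. set (w2 := W2 (s2 + x)) in *.
        replace (d * m - ((1 - mu) * u2 + mu * w2) - (d * m - ((1 - mu) * u1 + mu * w1)))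
          with (- ((1 - mu) * (u2 - u1)) + - (mu * (w2 - w1))) by ring.
        eapply Rle_trans; [apply Rabs_triang|]. rewrite !Rabs_Ropp, !Rabs_mult, (Rabs_pos_eq (1 - mu)), (Rabs_pos_eq mu) by lra.
        pose proof (Rabs_pos (u2 - u1)) as Pu. pose proof (Rabs_pos (w2 - w1)) as Pw.
        assert ((1 - mu) * Rabs (u2 - u1) <= 1 * Rabs (u2 - u1)) by (apply Rmult_le_compat_r; lra).
        assert (mu * Rabs (w2 - w1) <= 1 * Rabs (w2 - w1)) by (apply Rmult_le_compat_r; lra).
        assert (0 <= (LL - 1) * (Rabs (u2 - u1) + Rabs (w2 - w1))).
        { apply Rmult_le_pos; [|lra]. unfold LL. assert (0 < beta * (Lp * (1 / A + Ym) + 1)) by pos. lra. }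
        lra. }
    rewrite !Rplus_0_r, Us1, Us2 in HG. replace (s2 + Tb) with t2 in HG by (unfold Tb; ring). fold t1 in HG.
    assert (HE : exp (4 * LL * (Tb - 0)) <= G2 ^ 2).
    { unfold G2. simpl. rewrite Rmult_1_r, <- exp_plus. apply exp_le.
      assert (LL * Tb <= LL * t2) by (apply Rmult_le_compat_l; lra). lra. }
    assert (HG' : (U2 t2 - U1 t1) ^ 2 + (W2 t2 - W1 t1) ^ 2 <= (Rabs (W2 s2 - W1 s1) * G2) ^ 2).
    { eapply Rle_trans; [exact HG|]. rewrite Rpow_mult_distr, pow2_abs.
      replace ((cA - cA) ^ 2 + (W2 s2 - W1 s1) ^ 2) with ((W2 s2 - W1 s1) ^ 2) by ring.
      apply Rmult_le_compat_l; [apply pow2_ge_0 | exact HE]. }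
    pose proof (pow2_ge_0 (U2 t2 - U1 t1)). pose proof (pow2_ge_0 (W2 t2 - W1 t1)).
    pose proof (Rabs_pos (W2 s2 - W1 s1)).
    split; (apply pow2_le_abs; [pos | lra]). }
  destruct StepB as [BU BW].
  assert (HU2t2 : K1 * d <= U2 t2) by (apply Tab2; unfold S, t2 in *; lra).
  assert (HU1T0 : U2 t2 <= U1 T0).
  { apply Rmult_le_reg_l with (kf - ks); [lra|].
    assert (kf * ks * (5 / 4 * R0) * (exp (- ks * T0) / 4) + margin <= kf * ks * (3 / 8 * R0) * exp (- ks * T0))
      by (rewrite Emargin; lra).
    lra. }
  destruct (ivt_decreasing U1 T0 ts1 (U2 t2)) as (y2 & Hy2 & Ey2); [lra | intros t Ht; apply CU1; lra | lra |].
  (* Return from equal times to equal [U]: moving along the first orbit to the level [U2 t2] changes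
     [W] by at most [ks5] times the change of [U], since [Rabs W' <= 5 / 4 * U] and
     [Rabs U' >= ks / 2 * U]. *)
  assert (Slope : forall a b, T0 <= a <= b -> b <= ts1 -> Rabs (W1 b - W1 a) <= ks5 * Rabs (U1 b - U1 a)).
  { intros a b Ha Hb.
    assert (Hsl : forall t, a <= t <= b -> fW e U1 W1 t + ks5 * - fU e U1 W1 t >= 0 /\ fW e U1 W1 t <= 0).
    { intros t Ht. destruct (Tsl1 t ltac:(lra)) as [[_ F1] [F2 F3]]. specialize (Tab1 t ltac:(lra)).
      assert (H : ks5 * (ks / 2 * U1 t) = 5 / 4 * U1 t) by (unfold ks5; field; lra).
      assert (ks5 * (ks / 2 * U1 t) <= ks5 * - fU e U1 W1 t) by (apply Rmult_le_compat_l; lra). lra. }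
    assert (I1 : 0 * (b - a) <= (W1 b - ks5 * U1 b) - (W1 a - ks5 * U1 a)).
    { apply (increment_ge (fun t => W1 t - ks5 * U1 t) (fun t => fW e U1 W1 t - ks5 * fU e U1 W1 t)); [lra | |].
      - intros t Ht. apply (is_derive_minus W1 (fun t => ks5 * U1 t)); [apply D1; lra|].
        apply (is_derive_scal U1 t ks5), D1. lra.
      - intros t Ht. destruct (Hsl t Ht). lra. }
    assert (I2 : W1 b - W1 a <= 0 * (b - a)).
    { apply (increment_le W1 (fW e U1 W1)); [lra | intros t Ht; apply D1; lra | intros t Ht; apply Hsl, Ht]. }
    rewrite Rabs_left1 by lra. pose proof (Rle_abs (- (U1 b - U1 a))) as H. rewrite Rabs_Ropp in H.
    assert (ks5 * - (U1 b - U1 a) <= ks5 * Rabs (U1 b - U1 a)) by (apply Rmult_le_compat_l; lra). lra. }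
  assert (Start : Rabs (W2 t2 - W1 y2) <= (1 + ks5) * (Rabs (W2 s2 - W1 s1) * G2)).
  { assert (H : Rabs (W1 t1 - W1 y2) <= ks5 * Rabs (U1 t1 - U1 y2)).
    { assert (Hr1 : T0 <= t1 <= ts1) by (unfold S, t2 in *; lra).
      destruct (Rle_lt_dec y2 t1); [apply Slope; lra|].
      rewrite Rabs_minus_sym, (Rabs_minus_sym (U1 t1)). apply Slope; lra. }
    rewrite Ey2, (Rabs_minus_sym (U1 t1)) in H.
    replace (W2 t2 - W1 y2) with ((W2 t2 - W1 t1) + (W1 t1 - W1 y2)) by ring.
    eapply Rle_trans; [apply Rabs_triang|].
    assert (ks5 * Rabs (U2 t2 - U1 t1) <= ks5 * (Rabs (W2 s2 - W1 s1) * G2)) by (apply Rmult_le_compat_l; lra). lra. }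
  assert (HT0T1 : T0 < T1) by lra.
  assert (Neg1 : forall x, T0 <= x <= T1 -> 0 < -1 * field_U A beta sg (psi e) (U1 x) (W1 x)).
  { intros x Hx. change (0 < -1 * fU e U1 W1 x). destruct (Rle_lt_dec x ts1).
    - destruct (Tsl1 x ltac:(lra)) as [[_ F1] _]. specialize (Tab1 x ltac:(lra)).
      assert (0 < ks / 2 * U1 x) by pos. lra.
    - destruct (Tde1 x ltac:(lra)) as (_ & _ & F1). assert (0 < pm * d) by pos. lra. }
  assert (Level : forall v, 0 <= v <= U1 T0 -> exists y, T0 <= y <= T1 /\ U1 y = v).
  { intros v Hv. apply ivt_decreasing; [lra | intros t Ht; apply CU1; lra | lra]. }

  (* Slow descent, at equal [U]: the contracting phase *)
  assert (StepC : Rabs (W2 ts2 - W1 ts1) <= Rabs (W2 t2 - W1 y2) * exp (- om * (ts2 - t2))).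
  { apply (orbit_comparison (-1) A beta sg mu (d * m) om (psi e) U1 W1 U2 W2 T0 T1 t2 ts2);
      [lra | unfold S in *; lra | right; reflexivity | | | exact Neg1 | | | lra | lra | exact Ey2 | lra].
    - intros x Hx. apply (D1 x). lra.
    - intros x Hx. apply (D2 x). unfold t2 in *. lra.
    - intros x Hx. apply Level. split; [apply Tb2; unfold t2 in *; lra|].
      destruct (Req_dec x t2) as [->|N]; [lra|]. specialize (Hde2 t2 x ltac:(unfold t2 in *; lra) ltac:(lra)). lra.
    - intros x y Hx Hy Exy. fold (fU e U1 W1 y). change (field_W mu (d * m) (U1 y) (W1 y)) with (fW e U1 W1 y).
      specialize (Tab2 x ltac:(unfold t2 in *; lra)) as HUx.
      assert (Hyts : y <= ts1).
      { apply Rnot_lt_le. intro. specialize (Hde1 ts1 y ltac:(lra) ltac:(lra)). lra. }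
      destruct (Tsl1 y ltac:(lra)) as [[F1 F2] [F3 F4]]. rewrite Exy in *.
      pose proof (rate_ge k A kf ks beta sg c psi0 dl psi m mu1 Hks HA Hbeta Hsg HT HA' e (U2 x) He ltac:(lra)) as R2. fold amin in R2.
      assert (Hu : 0 < U2 x) by lra. set (u := U2 x) in *.
      assert (Hq : 3 / (8 * ks) <= fW e U1 W1 y / fU e U1 W1 y).
      { assert (0 < ks / 2 * u) by pos.
        replace (fW e U1 W1 y / fU e U1 W1 y) with ((- fW e U1 W1 y) / (- fU e U1 W1 y)) by (field; lra).
        apply Rle_trans with ((3 / 4 * u) / (2 * ks * u)); [right; field; lra|].
        unfold Rdiv. apply Rmult_le_compat; [pos | pos | lra | apply Rinv_le_contravar; lra]. }
      assert (amin * (3 / (8 * ks)) <= (A + sg * beta * psi e u) * (fW e U1 W1 y / fU e U1 W1 y)).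
      { assert (0 < 3 / (8 * ks)) by pos. apply Rmult_le_compat; lra. }
      assert (om = amin * (3 / (8 * ks))) by (unfold om; field; lra). lra. }

  (* From [U = K1 * d] to the line, at equal [U] *)
  assert (StepD : Rabs (W2 T2 - W1 T1) <= Rabs (W2 ts2 - W1 ts1) * exp (- - L3 * (T2 - ts2))).
  { apply (orbit_comparison (-1) A beta sg mu (d * m) (- L3) (psi e) U1 W1 U2 W2 T0 T1 ts2 T2);
      [lra | lra | right; reflexivity | | | exact Neg1 | | | lra | lra | lra | lra].
    - intros x Hx. apply (D1 x). lra.
    - intros x Hx. apply (D2 x). lra.
    - intros x Hx. apply Level. split; [apply Tb2; lra|].
      destruct (Tde2 x ltac:(lra)) as (F & _). lra.
    - intros x y Hx Hy Exy. fold (fU e U1 W1 y). change (field_W mu (d * m) (U1 y) (W1 y)) with (fW e U1 W1 y).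
      assert (HUx : 0 <= U2 x) by (apply Tb2; lra).
      pose proof (rate_le e (U2 x) He HUx) as R1.
      pose proof (rate_ge k A kf ks beta sg c psi0 dl psi m mu1 Hks HA Hbeta Hsg HT HA' e (U2 x) He HUx) as R2. fold amin in R2.
      destruct (Rle_lt_dec y ts1) as [Hle|Hgt].
      + destruct (Tsl1 y ltac:(lra)) as [[F1 F2] [F3 F4]]. specialize (Tab1 y ltac:(lra)).
        assert (0 < ks / 2 * U1 y) by pos.
        assert (0 <= fW e U1 W1 y / fU e U1 W1 y).
        { replace (fW e U1 W1 y / fU e U1 W1 y) with ((- fW e U1 W1 y) / (- fU e U1 W1 y)) by (field; lra). pos. }
        assert (0 <= (A + sg * beta * psi e (U2 x)) * (fW e U1 W1 y / fU e U1 W1 y)) by (apply Rmult_le_pos; lra).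
        lra.
      + destruct (Tde1 y ltac:(lra)) as (F1 & _ & F3). destruct (Tb1 y ltac:(lra)) as [B1 B2].
        assert (Hpd : 0 < pm * d) by pos.
        assert (HfW : Rabs (fW e U1 W1 y) <= (Rabs m + K1 + mu1 * Ym) * d).
        { apply Rabs_le_between in B2.
          replace (fW e U1 W1 y) with (d * m - U1 y - d * (mu1 * (W1 y - U1 y))) by (unfold fW, field_W; fold d; ring).
          assert (H1 : - (mu1 * Ym) <= mu1 * (W1 y - U1 y) <= mu1 * Ym).
          { split; [rewrite Ropp_mult_distr_r|]; apply Rmult_le_compat_l; lra. }
          assert (H4 : d * - (mu1 * Ym) <= d * (mu1 * (W1 y - U1 y)) <= d * (mu1 * Ym)) by (split; apply Rmult_le_compat_l; lra).
          pose proof (Rle_abs m) as H6. pose proof (Rle_abs (- m)) as H7. rewrite Rabs_Ropp in H7.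
          assert (H8 : d * - Rabs m <= d * m <= d * Rabs m) by (split; apply Rmult_le_compat_l; lra).
          apply Rabs_le. split; lra. }
        assert (Hq : Rabs (fW e U1 W1 y / fU e U1 W1 y) <= (Rabs m + K1 + mu1 * Ym) / pm).
        { replace (fW e U1 W1 y / fU e U1 W1 y) with (- (fW e U1 W1 y / (- fU e U1 W1 y))) by (field; lra).
          rewrite Rabs_Ropp. unfold Rdiv. rewrite Rabs_mult, (Rabs_pos_eq (/ _)) by pos.
          apply Rle_trans with ((Rabs m + K1 + mu1 * Ym) * d * / (pm * d)); [|right; field; lra].
          apply Rmult_le_compat; [apply Rabs_pos | pos | exact HfW | apply Rinv_le_contravar; lra]. }
        assert (Hp : Rabs ((A + sg * beta * psi e (U2 x)) * (fW e U1 W1 y / fU e U1 W1 y)) <= L3).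
        { rewrite Rabs_mult, (Rabs_pos_eq (A + _)) by lra. unfold L3. apply Rmult_le_compat; [lra | apply Rabs_pos | exact R1 | exact Hq]. }
        apply Rabs_le_between in Hp. lra. }
  assert (HG3' : exp (- - L3 * (T2 - ts2)) <= G3).
  { unfold G3. apply exp_le. rewrite Ropp_involutive. apply Rmult_le_compat_l; lra. }
  assert (HS' : exp (- om * (ts2 - t2)) <= 1 / (2 * (G1 * G2 * G3 * (1 + ks5)))).
  { eapply Rle_trans; [|exact HS0']. apply exp_le. unfold S in HSt2.
    assert (om * S0 <= om * (ts2 - t2)) by (apply Rmult_le_compat_l; lra). lra. }
  pose proof (exp_pos (- om * (ts2 - t2))) as HP.
  set (Z := Rabs (W2 0 - W1 0)) in *. assert (HZ : 0 <= Z) by apply Rabs_pos.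
  apply Rle_trans with (Z * G1 * G2 * (1 + ks5) * (1 / (2 * (G1 * G2 * G3 * (1 + ks5)))) * G3); [|right; field; lra].
  eapply Rle_trans; [exact StepD|].
  apply Rmult_le_compat; [apply Rabs_pos | pos | | exact HG3'].
  eapply Rle_trans; [exact StepC|].
  apply Rmult_le_compat; [apply Rabs_pos | lra | | exact HS'].
  eapply Rle_trans; [exact Start|].
  assert (Rabs (W2 s2 - W1 s1) * G2 <= Z * G1 * G2) by (apply Rmult_le_compat_r; lra).
  assert ((1 + ks5) * (Rabs (W2 s2 - W1 s1) * G2) <= (1 + ks5) * (Z * G1 * G2)) by (apply Rmult_le_compat_l; lra).
  lra.
Qed.

(** The return time is characterized by the orbit alone, so that the contraction can be stated
    without the phase data of [transits]. *)
Definition first_return (U : R -> R) (T : R) : Prop :=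
  0 < T /\ U T = 0 /\ forall t, 0 < t < T -> 0 < U t.

Lemma first_return_unique (U : R -> R) (S T : R) : first_return U S -> first_return U T -> S = T.
Proof.
  intros (HS & ES & PS) (HT' & ET & PT). destruct (Rtotal_order S T) as [H|[H|H]]; [|exact H|].
  - specialize (PT S ltac:(lra)). lra.
  - specialize (PS T ltac:(lra)). lra.
Qed.

Lemma half_map : exists rad Cs, 0 < rad <= R0 / 4 /\ 0 < Cs /\
  eventually0 (fun e => exists Tmax, 0 < Tmax /\
    (forall U W, sol e U W 0 -> U 0 = 0 -> Rabs (W 0 - R0) <= rad ->
      0 < fU e U W 0 /\ exists T, T <= Tmax /\ first_return U T /\ fU e U W T < 0 /\
        Rabs (W T) <= Cs * dl e /\ exp (- ks * T) <= Cs * dl e /\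
        forall t, 0 <= t <= T ->
          Rabs (ks * W t - U t - ks * W 0 * exp (- kf * t)) <= Cs * dl e /\
          Rabs (kf * W t - U t - kf * W 0 * exp (- ks * t)) <= Cs * dl e) /\
    (forall U1 W1 T1 U2 W2 T2,
      sol e U1 W1 0 -> U1 0 = 0 -> Rabs (W1 0 - R0) <= rad -> first_return U1 T1 ->
      sol e U2 W2 0 -> U2 0 = 0 -> Rabs (W2 0 - R0) <= rad -> first_return U2 T2 ->
      Rabs (W2 T2 - W1 T1) <= 1 / 2 * Rabs (W2 0 - W1 0))).
Proof.
  destruct (transit k A kf ks beta sg c psi0 dl psi m m' mu1) as
    (rad & tau & c0 & T0 & K1 & pm & Cs & Um & Ym & Hrad & Htau & Hc0 & HT0 & HK1 & Hpm & HCs & HUm & HYm & Hx0 & ET);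
    try assumption.
  fold R0 in Hrad, ET. exists rad, Cs. split; [exact Hrad|]. split; [exact HCs|].
  eapply eventually0_impl.
  { apply eventually0_and; [exact ET|].
    apply (contraction rad tau c0 T0 K1 pm Cs Um Ym); assumption. }
  clear ET. intros e He ((Tmax & HTr) & Hcon).
  pose proof (tail_dl_pos _ _ _ _ _ HT e He) as Hd0. set (d := dl e) in *.
  assert (Hret : forall U W ts T, U 0 = 0 ->
    transits kf ks d tau c0 T0 K1 pm Cs Um Ym (fU e U W) (fW e U W) U W ts T -> first_return U T).
  { intros U W ts T HU0 Tr. destruct Tr as [Tt Td Tl Tla Tb Tab Tat Tsl Ten Tpo Tde Tli].
    split; [lra|]. split; [exact Ten|]. intros t Ht.
    destruct (Rle_lt_dec t tau) as [H1|H1].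
    - destruct (Tla t ltac:(lra)) as [H _]. assert (0 < c0 * t) by pos. lra.
    - destruct (Rle_lt_dec t ts) as [H2|H2]; [|apply Tpo; lra].
      specialize (Tab t ltac:(lra)). assert (0 < K1 * d) by pos. lra. }
  exists (Rmax Tmax 1). split; [apply Rlt_le_trans with 1; [lra | apply Rmax_r]|]. split.
  - intros U W HS HU0 HW0. destruct (HTr U W HS HU0 HW0) as (ts & T & HTm & Tr).
    pose proof (Hret U W ts T HU0 Tr) as Hf. destruct Tr as [Tt Td Tl Tla Tb Tab Tat Tsl Ten Tpo Tde Tli].
    split.
    + destruct (Tla 0 ltac:(lra)) as [_ H]. exact (Rlt_le_trans _ _ _ Hc0 H).
    + exists T. split; [eapply Rle_trans; [exact HTm | apply Rmax_l]|]. split; [exact Hf|].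
      destruct (Tde T ltac:(lra)) as (_ & D1 & D2). assert (0 < pm * d) by pos.
      assert (D3 : fU e U W T <= - pm * d) by exact D2.
      split; [lra|]. split; [exact D1|]. split; [|exact Tli].
      eapply Rle_trans; [|exact Tl]. apply exp_le. assert (ks * ts <= ks * T) by (apply Rmult_le_compat_l; lra). lra.
  - intros U1 W1 T1 U2 W2 T2 S1 HU10 HW10 F1 S2 HU20 HW20 F2.
    destruct (HTr U1 W1 S1 HU10 HW10) as (ts1 & T1' & _ & Tr1).
    destruct (HTr U2 W2 S2 HU20 HW20) as (ts2 & T2' & _ & Tr2).
    rewrite (first_return_unique U1 T1 T1' F1 (Hret U1 W1 ts1 T1' HU10 Tr1)).
    rewrite (first_return_unique U2 T2 T2' F2 (Hret U2 W2 ts2 T2' HU20 Tr2)).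
    apply (Hcon U1 W1 ts1 T1' U2 W2 ts2 T2'); assumption.
Qed.

End HalfMap.

(** * Tails of the sigmoid *)

Lemma is_derive_halfline_eps (f : R -> R) (x l e : R) : is_derive_halfline f x l -> 0 < e ->
  exists d, 0 < d /\ forall y, 0 <= y -> Rabs (y - x) < d -> Rabs (f y - f x - l * (y - x)) <= e * Rabs (y - x).
Proof.
  intros H He.
  assert (HL : locally l (fun v => Rabs (v - l) < e)).
  { exists (mkposreal e He). intros v Hv. exact Hv. }
  destruct (H _ HL) as [d Hd]. exists d. split; [apply cond_pos|].
  intros y Hy Hyx. destruct (Req_dec y x) as [->|N].
  - rewrite !Rminus_diag, Rmult_0_r, Rminus_0_r, !Rabs_R0, Rmult_0_r. lra.
  - specialize (Hd y Hyx N Hy). simpl in Hd.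
    assert (Hyn : y - x <> 0) by lra.
    replace (f y - f x - l * (y - x)) with (((f y - f x) / (y - x) - l) * (y - x)) by (field; exact Hyn).
    rewrite Rabs_mult. apply Rmult_le_compat_r; [apply Rabs_pos | left; exact Hd].
Qed.

Lemma is_derive_halfline_interior (f : R -> R) (x l : R) : 0 < x -> is_derive_halfline f x l -> is_derive f x l.
Proof.
  intros Hx H. apply is_derive_Reals. intros e He.
  destruct (is_derive_halfline_eps f x l (e / 2) H ltac:(lra)) as (d & Hd & Hf).
  assert (Hm : 0 < Rmin d x) by pos. exists (mkposreal _ Hm). simpl. intros h Hh Hhd.
  assert (H1 : Rabs h < d) by (eapply Rlt_le_trans; [exact Hhd | apply Rmin_l]).
  assert (H2 : Rabs h < x) by (eapply Rlt_le_trans; [exact Hhd | apply Rmin_r]).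
  apply Rabs_lt_between in H2. specialize (Hf (x + h) ltac:(lra)).
  replace (x + h - x) with h in Hf by ring. specialize (Hf H1).
  replace ((f (x + h) - f x) / h - l) with ((f (x + h) - f x - l * h) / h) by (field; exact Hh).
  unfold Rdiv. rewrite Rabs_mult, Rabs_inv.
  pose proof (Rabs_pos_lt h Hh) as Hp. apply Rmult_lt_reg_r with (Rabs h); [exact Hp|].
  rewrite Rmult_assoc, Rinv_l, Rmult_1_r by lra. assert (0 < e * Rabs h) by pos. lra.
Qed.

(** The derivative of [f] is itself differentiable from the right at [0], hence bounded near [0],
    and the mean value theorem gives the second bound. That bound concerns positive arguments, where
    one-sided derivatives are ordinary ones. *)
Lemma profile_near_zero (f : R -> R) : smooth_halfline f -> exists h L, 0 < h /\ 0 < L /\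
  (forall s, 0 <= s <= h -> Rabs (f s - f 0) <= L * s) /\
  (forall s t, 0 < s <= h -> 0 < t <= h -> Rabs (f s - f t) <= L * Rabs (s - t)).
Proof.
  intros (D & D0 & DD).
  destruct (is_derive_halfline_eps (D 0%nat) 0 (D 1%nat 0) 1 (DD 0%nat 0 (Rle_refl 0)) ltac:(lra)) as (d0 & Hd0 & H0).
  destruct (is_derive_halfline_eps (D 1%nat) 0 (D 2%nat 0) 1 (DD 1%nat 0 (Rle_refl 0)) ltac:(lra)) as (d1 & Hd1 & H1).
  set (h := Rmin d0 d1 / 2). assert (Hh : 0 < h) by (unfold h; pos).
  assert (Hhd : h < d0 /\ h < d1).
  { unfold h. pose proof (Rmin_l d0 d1). pose proof (Rmin_r d0 d1). assert (0 < Rmin d0 d1) by pos. lra. }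
  pose proof (Rabs_pos (D 1%nat 0)) as P1. pose proof (Rabs_pos (D 2%nat 0)) as P2.
  assert (PB : 0 <= (Rabs (D 2%nat 0) + 1) * h) by (apply Rmult_le_pos; lra).
  exists h, (Rabs (D 1%nat 0) + 1 + (Rabs (D 2%nat 0) + 1) * h). split; [exact Hh|]. split; [lra|].
  assert (near : forall g l s e, 0 <= s -> Rabs (g - l * s) <= 1 * s -> e = Rabs l + 1 -> Rabs g <= e * s).
  { intros g l s e Hs Hg ->. replace g with ((g - l * s) + l * s) by ring.
    eapply Rle_trans; [apply Rabs_triang|]. rewrite (Rabs_mult l s), (Rabs_pos_eq s) by exact Hs. lra. }
  split.
  - intros s Hs. rewrite <- (D0 s), <- (D0 0) by lra.
    specialize (H0 s ltac:(lra)). rewrite Rminus_0_r, Rabs_pos_eq in H0 by lra. specialize (H0 ltac:(lra)).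
    eapply Rle_trans; [exact (near _ _ s _ (proj1 Hs) H0 eq_refl)|]. apply Rmult_le_compat_r; lra.
  - assert (B : forall s, 0 < s <= h -> Rabs (D 1%nat s) <= Rabs (D 1%nat 0) + 1 + (Rabs (D 2%nat 0) + 1) * h).
    { intros s Hs. specialize (H1 s ltac:(lra)). rewrite Rminus_0_r, Rabs_pos_eq in H1 by lra. specialize (H1 ltac:(lra)).
      assert (N : Rabs (D 1%nat s - D 1%nat 0) <= (Rabs (D 2%nat 0) + 1) * s) by exact (near _ _ s _ ltac:(lra) H1 eq_refl).
      replace (D 1%nat s) with ((D 1%nat s - D 1%nat 0) + D 1%nat 0) by ring.
      eapply Rle_trans; [apply Rabs_triang|].
      assert ((Rabs (D 2%nat 0) + 1) * s <= (Rabs (D 2%nat 0) + 1) * h) by (apply Rmult_le_compat_l; lra). lra. }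
    assert (W : forall s t, 0 < s <= t -> t <= h -> Rabs (f t - f s) <=
      (Rabs (D 1%nat 0) + 1 + (Rabs (D 2%nat 0) + 1) * h) * (t - s)).
    { intros s t Hs Ht. rewrite <- (D0 s), <- (D0 t) by lra.
      apply (increment_abs (D 0%nat) (D 1%nat)); [lra | |].
      - intros x Hx. apply is_derive_halfline_interior; [lra|]. apply DD. lra.
      - intros x Hx. apply B. lra. }
    intros s t Hs Ht. destruct (Rle_lt_dec s t).
    + rewrite Rabs_minus_sym, (Rabs_minus_sym s), (Rabs_pos_eq (t - s)) by lra. apply W; lra.
    + rewrite (Rabs_pos_eq (s - t)) by lra. apply W; lra.
Qed.

Lemma inv_pow_lipschitz (k : nat) (u1 u v : R) : 0 < u1 -> u1 <= u -> u1 <= v ->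
  Rabs (/ u ^ k - / v ^ k) <= INR k * / u1 ^ (k + 1) * Rabs (u - v).
Proof.
  intros Hu1 Hu Hv.
  assert (W : forall u v, u1 <= u <= v -> Rabs (/ v ^ k - / u ^ k) <= INR k * / u1 ^ (k + 1) * (v - u)).
  { clear u v Hu Hv. intros u v Huv. apply (increment_abs (fun u => / u ^ k) (fun u => - INR k * / u ^ (k + 1))); [lra| |].
    - intros t Ht. apply is_derive_inv_pow. lra.
    - intros t Ht. rewrite Rabs_mult, Rabs_Ropp, (Rabs_pos_eq (INR k)) by pos.
      apply Rmult_le_compat_l; [pos|]. pose proof (inv_pow_pos (k + 1) t ltac:(lra)).
      rewrite Rabs_pos_eq by lra. apply inv_pow_le. lra. }
  destruct (Rle_lt_dec u v).
  - rewrite Rabs_minus_sym, (Rabs_minus_sym u), (Rabs_pos_eq (v - u)) by lra. apply W; lra.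
  - rewrite (Rabs_pos_eq (u - v)) by lra. apply W; lra.
Qed.

Section Scale.
Variable k : nat.
Hypothesis Hk : (0 < k)%nat.

(** With [t = eps ^ (1 / (k + 1))] one has [eps = t ^ (k + 1)] and [delta = t ^ k], so the
    rescalings become integer powers. *)
Definition eps_root (eps : R) : R := Rpower eps (/ INR (k + 1)).

Lemma eps_root_pos (eps : R) : 0 < eps_root eps.
Proof. apply exp_pos. Qed.

Let INR_k1 : 0 < INR (k + 1).
Proof. apply lt_0_INR. lia. Qed.

Lemma eps_scale_root (eps : R) : eps_scale k eps = eps_root eps ^ k.
Proof.
  rewrite <- Rpower_pow by apply eps_root_pos. unfold eps_scale, eps_root. rewrite Rpower_mult.
  f_equal. unfold Rdiv. ring.
Qed.

Lemma eps_root_pow (eps : R) : 0 < eps -> eps_root eps ^ (k + 1) = eps.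
Proof.
  intros He. rewrite <- Rpower_pow by apply eps_root_pos. unfold eps_root. rewrite Rpower_mult, Rinv_l by lra.
  apply Rpower_1, He.
Qed.

Lemma eps_root_small (x : R) : 0 < x -> eventually0 (fun e => eps_root e < x).
Proof.
  intros Hx. exists (x ^ (k + 1)). split; [pos|]. intros e He.
  apply Rnot_le_lt. intro H.
  assert (x ^ (k + 1) <= eps_root e ^ (k + 1)) by (apply pow_incr; lra).
  rewrite eps_root_pow in H0 by lra. lra.
Qed.

Lemma eps_scale_pos (eps : R) : 0 < eps_scale k eps.
Proof. apply exp_pos. Qed.

Lemma eps_scale_small (x : R) : 0 < x -> eventually0 (fun e => eps_scale k e < x).
Proof.
  intros Hx. eapply eventually0_impl; [apply (eps_root_small (Rmin x 1)); pos|].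
  intros e He H. rewrite eps_scale_root. pose proof (eps_root_pos e) as Hp.
  pose proof (Rmin_l x 1). pose proof (Rmin_r x 1).
  destruct k as [|j]; [lia|]. simpl.
  assert (eps_root e ^ j <= 1) by (rewrite <- (pow1 j); apply pow_incr; lra).
  pose proof (pow_lt _ j Hp). assert (eps_root e * eps_root e ^ j <= eps_root e * 1) by (apply Rmult_le_compat_l; lra). lra.
Qed.

(** In terms of [t] one has [delta * u / eps = u / t], so the rescaled tail
    [psi (delta * u) / delta * u ^ k] is exactly [La (t / u)], which tends to [La 0] uniformly on
    [u >= u1]. Away from the line the tail is [(e / U) ^ k * La (e / U)], with a Lipschitz constant
    in [U] bounded for small [e]. *)
Lemma tail_family_of_profile (Psi La : R -> R) :
  (forall s, 0 < Psi s < 1) -> (forall s t, s <= t -> Psi t <= Psi s) ->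
  (forall s, 0 < s -> Psi s = / s ^ k * La (/ s)) -> halfline_profile La ->
  tail_family k (La 0) (Psi 0) (eps_scale k) (fun e U => Psi (/ e * U)).
Proof.
  intros Hr Hdec HPsi [Hsm Hnn H0].
  destruct (profile_near_zero La Hsm) as (h & L & Hh & HL & HL0 & HL1).
  constructor.
  - intros e _. apply eps_scale_pos.
  - exact eps_scale_small.
  - apply Hr.
  - intros e U He HU. split; [apply Hr|]. apply Hdec. assert (0 < / e) by pos. pos.
  - intros e U V He HUV. apply Hdec. apply Rmult_le_compat_l; [assert (0 < / e) by pos; lra | lra].
  - intros u1 x Hu1 Hx. eapply eventually0_impl.
    { apply (eps_root_small (Rmin (h * u1) (x * u1 / L))). pos. }
    intros e He Ht u Hu. pose proof (eps_root_pos e) as Hp. set (t := eps_root e) in *.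
    assert (Ee : e = t ^ (k + 1)) by (symmetry; apply eps_root_pow, He).
    rewrite eps_scale_root. fold t.
    pose proof (pow_lt t k Hp) as Htk. pose proof (pow_lt u k ltac:(lra)) as Huk.
    assert (Es : / e * (t ^ k * u) = u / t).
    { rewrite Ee. rewrite pow_add, pow_1. field. split; lra. }
    rewrite Es, HPsi by pos. replace (/ (u / t)) with (t / u) by (field; lra).
    replace (/ (u / t) ^ k * La (t / u) / t ^ k * u ^ k) with (La (t / u)).
    + assert (Htu : t / u <= t / u1).
      { unfold Rdiv. apply Rmult_le_compat_l; [lra | apply Rinv_le_contravar; lra]. }
      assert (H1 : t / u1 <= h).
      { apply Rmult_le_reg_r with u1; [lra|]. unfold Rdiv. rewrite Rmult_assoc, Rinv_l, Rmult_1_r by lra.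
        left. eapply Rlt_le_trans; [exact Ht | apply Rmin_l]. }
      assert (H2 : L * (t / u1) <= x).
      { assert (Ht2 : t <= x * u1 / L) by (left; eapply Rlt_le_trans; [exact Ht | apply Rmin_r]).
        apply Rmult_le_compat_l with (r := L / u1) in Ht2; [|pos].
        replace (L / u1 * (x * u1 / L)) with x in Ht2 by (field; lra).
        replace (L * (t / u1)) with (L / u1 * t) by (field; lra). exact Ht2. }
      eapply Rle_trans; [apply HL0; split; [pos | lra]|].
      assert (L * (t / u) <= L * (t / u1)) by (apply Rmult_le_compat_l; lra). lra.
    + unfold Rdiv; rewrite Rpow_mult_distr, pow_inv. field. split; lra.
  - intros U1 HU1. set (M := La 0 + L * h).
    set (K := INR k * / U1 ^ (k + 1) * M + / U1 ^ k * (L * (/ U1 * / U1)) + 1).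
    pose proof (pos_INR k) as HIk. pose proof (inv_pow_pos k U1 HU1) as Hi. pose proof (inv_pow_pos (k + 1) U1 HU1) as Hi1.
    assert (HM : 0 < M) by (unfold M; pos).
    assert (HK1 : 0 <= INR k * / U1 ^ (k + 1) * M) by pos.
    assert (HiU : 0 < / U1) by pos.
    assert (HK2 : 0 <= / U1 ^ k * (L * (/ U1 * / U1))) by pos.
    exists K. split; [unfold K; lra|].
    exists (Rmin 1 (h * U1)). split; [pos|]. intros e He U V HU HV.
    assert (He1 : e <= 1) by (left; eapply Rlt_le_trans; [apply He | apply Rmin_l]).
    assert (He2 : e <= h * U1) by (left; eapply Rlt_le_trans; [apply He | apply Rmin_r]).
    assert (Hie : 0 < / e) by (assert (0 < e) by lra; pos).
    assert (Hek : 0 < e ^ k <= 1).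
    { split; [apply pow_lt; lra|]. rewrite <- (pow1 k). apply pow_incr. lra. }
    assert (Hform : forall W, U1 <= W -> Psi (/ e * W) = e ^ k * (/ W ^ k * La (e / W)) /\ 0 < e / W <= h).
    { intros W HW. split.
      - rewrite HPsi by pos. replace (/ (/ e * W)) with (e / W) by (field; lra).
        rewrite Rpow_mult_distr, pow_inv, Rinv_mult, Rinv_inv. ring.
      - split; [assert (0 < e) by lra; pos|].
        apply Rmult_le_reg_r with W; [lra|]. unfold Rdiv. rewrite Rmult_assoc, Rinv_l, Rmult_1_r by lra.
        assert (h * U1 <= h * W) by (apply Rmult_le_compat_l; lra). lra. }
    destruct (Hform U HU) as [EU HeU]. destruct (Hform V HV) as [EV HeV]. rewrite EU, EV.
    rewrite <- Rmult_minus_distr_l, Rabs_mult, (Rabs_pos_eq (e ^ k)) by lra.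
    replace (/ U ^ k * La (e / U) - / V ^ k * La (e / V))
      with ((/ U ^ k - / V ^ k) * La (e / U) + / V ^ k * (La (e / U) - La (e / V))) by ring.
    assert (T1 : Rabs ((/ U ^ k - / V ^ k) * La (e / U)) <= INR k * / U1 ^ (k + 1) * M * Rabs (U - V)).
    { rewrite Rabs_mult. replace (INR k * / U1 ^ (k + 1) * M * Rabs (U - V)) with (INR k * / U1 ^ (k + 1) * Rabs (U - V) * M) by ring.
      apply Rmult_le_compat; [apply Rabs_pos | apply Rabs_pos | apply inv_pow_lipschitz; assumption |].
      replace (La (e / U)) with ((La (e / U) - La 0) + La 0) by ring.
      eapply Rle_trans; [apply Rabs_triang|]. rewrite (Rabs_pos_eq (La 0)) by lra.
      specialize (HL0 (e / U) ltac:(lra)). assert (L * (e / U) <= L * h) by (apply Rmult_le_compat_l; lra). unfold M. lra. }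
    assert (T2 : Rabs (/ V ^ k * (La (e / U) - La (e / V))) <= / U1 ^ k * (L * (/ U1 * / U1)) * Rabs (U - V)).
    { pose proof (inv_pow_pos k V ltac:(lra)). rewrite Rabs_mult, (Rabs_pos_eq (/ V ^ k)) by lra. rewrite Rmult_assoc.
      apply Rmult_le_compat; [lra | apply Rabs_pos | apply inv_pow_le; lra |].
      eapply Rle_trans; [apply HL1; assumption|]. rewrite Rmult_assoc. apply Rmult_le_compat_l; [lra|].
      replace (e / U - e / V) with (e * (/ U * / V) * (V - U)) by (field; lra).
      assert (0 < / U <= / U1) by (split; [apply Rinv_0_lt_compat; lra | apply Rinv_le_contravar; lra]).
      assert (0 < / V <= / U1) by (split; [apply Rinv_0_lt_compat; lra | apply Rinv_le_contravar; lra]).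
      rewrite Rabs_mult, (Rabs_minus_sym V). apply Rmult_le_compat_r; [apply Rabs_pos|].
      assert (0 < / U * / V) by pos. assert (/ U * / V <= / U1 * / U1) by (apply Rmult_le_compat; lra).
      rewrite Rabs_pos_eq by (apply Rmult_le_pos; lra).
      assert (e * (/ U * / V) <= 1 * (/ U * / V)) by (apply Rmult_le_compat_r; lra). lra. }
    pose proof (Rabs_triang ((/ U ^ k - / V ^ k) * La (e / U)) (/ V ^ k * (La (e / U) - La (e / V)))) as T3.
    pose proof (Rabs_pos (U - V)).
    set (Q := Rabs ((/ U ^ k - / V ^ k) * La (e / U) + / V ^ k * (La (e / U) - La (e / V)))) in *.
    assert (0 <= Q) by apply Rabs_pos.
    assert (e ^ k * Q <= 1 * Q) by (apply Rmult_le_compat_r; lra). unfold K. lra.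
Qed.

Variables phi phiL phiR : R -> R.
Hypothesis Hphi : sigmoidal k phi phiL phiR.

Lemma sigmoidal_monotone (s t : R) : s <= t -> phi s <= phi t.
Proof.
  intros Hst. assert (H : 0 * (t - s) <= phi t - phi s); [|lra].
  apply (increment_ge phi (Derive phi)); [exact Hst| |].
  - intros z _. apply Derive_correct. apply (sigmoidal_smooth _ _ _ _ Hphi 1%nat z).
  - intros z _. left. apply (sigmoidal_increasing _ _ _ _ Hphi).
Qed.

Lemma tail_family_left : tail_family k (phiL 0) (phi 0) (eps_scale k) (fun e U => phi (/ e * - U)).
Proof.
  assert (H := tail_family_of_profile (fun s => phi (- s)) phiL).
  simpl in H. rewrite Ropp_0 in H.
  replace (fun e U => phi (/ e * - U)) with (fun e U : R => phi (- (/ e * U))).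
  - apply H.
    + intros s. apply (sigmoidal_range _ _ _ _ Hphi).
    + intros s t Hst. apply sigmoidal_monotone. lra.
    + intros s Hs. rewrite (sigmoidal_decayL _ _ _ _ Hphi) by lra. rewrite Ropp_involutive. reflexivity.
    + apply (sigmoidal_profileL _ _ _ _ Hphi).
  - apply functional_extensionality. intros e.
    apply functional_extensionality. intros U. f_equal. ring.
Qed.

Lemma tail_family_right : tail_family k (phiR 0) (1 - phi 0) (eps_scale k) (fun e U => 1 - phi (/ e * U)).
Proof.
  apply (tail_family_of_profile (fun s => 1 - phi s) phiR).
  - intros s. pose proof (sigmoidal_range _ _ _ _ Hphi s). lra.
  - intros s t Hst. pose proof (sigmoidal_monotone s t Hst). lra.
  - intros s Hs. rewrite (sigmoidal_decayR _ _ _ _ Hphi) by lra. ring.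
  - apply (sigmoidal_profileR _ _ _ _ Hphi).
Qed.

(** It serves only at fixed [eps], for existence, uniqueness and orbital stability; the estimates
    uniform in [eps] rest on [tail_lipschitz]. *)
Lemma sigmoidal_lipschitz (M : R) : exists L, 0 < L /\
  forall z w, Rabs z <= M -> Rabs w <= M -> Rabs (phi z - phi w) <= L * Rabs (z - w).
Proof.
  destruct (Rlt_le_dec M 0) as [HM|HM].
  { exists 1. split; [lra|]. intros z w Hz. pose proof (Rabs_pos z). lra. }
  destruct (continuity_ab_maj (Derive phi) (- M) M) as (zm & Hmax & _).
  { lra. }
  { intros z _. destruct (sigmoidal_smooth _ _ _ _ Hphi 2%nat z) as [l Hl].
    exact (is_derive_continuity_pt _ _ _ Hl). }
  pose proof (sigmoidal_increasing _ _ _ _ Hphi zm) as Hp.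
  exists (Derive phi zm). split; [exact Hp|].
  assert (W : forall z w, - M <= z <= w -> w <= M -> Rabs (phi w - phi z) <= Derive phi zm * (w - z)).
  { intros z w Hz Hw. apply (increment_abs phi (Derive phi)); [lra| |].
    - intros t _. apply Derive_correct. apply (sigmoidal_smooth _ _ _ _ Hphi 1%nat t).
    - intros t Ht. pose proof (sigmoidal_increasing _ _ _ _ Hphi t). rewrite Rabs_pos_eq by lra. apply Hmax. lra. }
  intros z w Hz Hw. apply Rabs_le_between in Hz, Hw. destruct (Rle_lt_dec z w).
  - rewrite Rabs_minus_sym, (Rabs_minus_sym z), (Rabs_pos_eq (w - z)) by lra. apply W; lra.
  - rewrite (Rabs_pos_eq (z - w)) by lra. apply W; lra.
Qed.

End Scale.

(** * Limit cycles from a contracting return map *)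

Lemma contraction_fixed_point (P : R -> R) (c r : R) : 0 <= r ->
  (forall w, Rabs (w - c) <= r -> Rabs (P w - c) <= r) ->
  (forall w v, Rabs (w - c) <= r -> Rabs (v - c) <= r -> Rabs (P w - P v) <= 1 / 2 * Rabs (w - v)) ->
  exists l, Rabs (l - c) <= r /\ P l = l.
Proof.
  intros Hr Hself Hcon. set (u := fix u n := match n with O => c | S n => P (u n) end).
  assert (Hu : forall n, Rabs (u n - c) <= r).
  { induction n; simpl; [rewrite Rminus_diag, Rabs_R0; exact Hr | apply Hself, IHn]. }
  assert (Hd : forall n, Rabs (u (S n) - u n) <= r * (1 / 2) ^ n).
  { induction n.
    - change (u 0%nat) with c. simpl pow. rewrite Rmult_1_r. apply (Hu 1%nat).
    - change (u (S (S n))) with (P (u (S n))). change (u (S n)) with (P (u n)) at 2.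
      eapply Rle_trans; [apply Hcon; apply Hu|]. simpl pow. lra. }
  destruct (geometric_limit u r Hd) as [l Hl].
  assert (small : forall x, 0 < x -> exists n, 2 * r * (1 / 2) ^ n <= x).
  { intros x Hx. destruct (pow_lt_1_zero (1 / 2) ltac:(rewrite Rabs_pos_eq; lra) (x / (2 * r + 1)) ltac:(pos)) as [N HN].
    exists N. specialize (HN N (Nat.le_refl N)). rewrite Rabs_pos_eq in HN by (apply pow_le; lra).
    apply Rmult_lt_compat_l with (r := 2 * r + 1) in HN; [|lra].
    replace ((2 * r + 1) * (x / (2 * r + 1))) with x in HN by (field; lra).
    assert (0 <= (1 / 2) ^ N) by (apply pow_le; lra). lra. }
  assert (Hlr : Rabs (l - c) <= r).
  { apply Rle_plus_epsilon. intros x Hx. destruct (small x Hx) as [n Hn].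
    replace (l - c) with (- (u n - l) + (u n - c)) by ring.
    eapply Rle_trans; [apply Rabs_triang|]. rewrite Rabs_Ropp. specialize (Hl n). specialize (Hu n). lra. }
  exists l. split; [exact Hlr|].
  apply cond_eq. intros x Hx. destruct (small (x / 2) ltac:(lra)) as [n Hn].
  replace (P l - l) with ((P l - P (u n)) + (u (S n) - l)) by (simpl; ring).
  eapply Rle_lt_trans; [apply Rabs_triang|].
  pose proof (Hcon l (u n) Hlr (Hu n)) as Hc. rewrite Rabs_minus_sym in Hc. pose proof (Hl n) as H0. pose proof (Hl (S n)) as H1.
  rewrite (Rabs_minus_sym l) in Hc. rewrite Rabs_minus_sym in Hc. simpl pow in H1. lra.
Qed.

(** Solutions are taken forward in time because the box that carries the Lipschitz bounds is
    invariant in that direction. *)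
Definition forward_solution (f1 f2 : R -> R -> R) (x y : R -> R) : Prop :=
  forall t, 0 <= t -> is_derive x t (f1 (x t) (y t)) /\ is_derive y t (f2 (x t) (y t)).

Lemma forward_solution_shift (f1 f2 : R -> R -> R) (x y : R -> R) (a : R) : 0 <= a ->
  forward_solution f1 f2 x y -> forward_solution f1 f2 (fun t => x (a + t)) (fun t => y (a + t)).
Proof.
  intros Ha H t Ht. destruct (H (a + t) ltac:(lra)) as [H1 H2].
  split; apply is_derive_shift; assumption.
Qed.

Lemma periodic_multiples (x : R -> R) (T : R) : 0 < T -> (forall t, 0 <= t -> x (t + T) = x t) ->
  forall (n : nat) t, 0 <= t -> x (t + INR n * T) = x t.
Proof.
  intros HT H n. induction n; intros t Ht.
  - simpl. f_equal. ring.
  - rewrite S_INR. replace (t + (INR n + 1) * T) with ((t + INR n * T) + T) by ring.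
    rewrite H; [apply IHn, Ht|]. assert (0 <= INR n * T) by (pose proof (pos_INR n); pos). lra.
Qed.

Lemma nat_multiple_above (T t : R) : 0 < T -> exists n : nat, 0 <= t + INR n * T.
Proof.
  intros HT. destruct (archimed_cor1 (T / (Rabs t + 1)) ltac:(pose proof (Rabs_pos t); pos)) as (n & Hn & Hn0).
  exists n. pose proof (Rabs_pos t) as Ha. pose proof (lt_0_INR n Hn0) as Hp.
  apply Rmult_lt_compat_r with (r := INR n * (Rabs t + 1)) in Hn; [|pos].
  replace (/ INR n * (INR n * (Rabs t + 1))) with (Rabs t + 1) in Hn by (field; lra).
  replace (T / (Rabs t + 1) * (INR n * (Rabs t + 1))) with (INR n * T) in Hn by (field; lra).
  pose proof (Rle_abs (- t)). rewrite Rabs_Ropp in H. lra.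
Qed.

(** [solution] demands the whole line while the fixed point supplies a forward solution; the value
    at [t] is read off at any [t + INR n * T >= 0]. *)
Lemma periodic_extension (f1 f2 : R -> R -> R) (x y : R -> R) (T : R) : 0 < T ->
  forward_solution f1 f2 x y -> (forall t, 0 <= t -> x (t + T) = x t /\ y (t + T) = y t) ->
  exists X Y : R -> R,
    (forall t, is_derive X t (f1 (X t) (Y t)) /\ is_derive Y t (f2 (X t) (Y t))) /\
    (forall t, X (t + T) = X t /\ Y (t + T) = Y t) /\
    (forall t, 0 <= t -> X t = x t /\ Y t = y t) /\
    (forall t, exists s, 0 <= s /\ X t = x s /\ Y t = y s).
Proof.
  intros HT Hsol Hper.
  assert (N : forall t, {n : nat | 0 <= t + INR n * T}).
  { intros t. apply constructive_indefinite_description. apply nat_multiple_above, HT. }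
  assert (same : forall (z : R -> R), (forall t, 0 <= t -> z (t + T) = z t) ->
    forall t (n m : nat), 0 <= t + INR n * T -> 0 <= t + INR m * T -> z (t + INR n * T) = z (t + INR m * T)).
  { intros z Hz t n m Hn Hm. destruct (Nat.le_ge_cases n m) as [H|H].
    - replace (t + INR m * T) with ((t + INR n * T) + INR (m - n) * T) by (rewrite minus_INR by lia; ring).
      symmetry. apply periodic_multiples; assumption.
    - replace (t + INR n * T) with ((t + INR m * T) + INR (n - m) * T) by (rewrite minus_INR by lia; ring).
      apply periodic_multiples; assumption. }
  assert (Hx : forall t, 0 <= t -> x (t + T) = x t) by (intros; apply Hper; assumption).
  assert (Hy : forall t, 0 <= t -> y (t + T) = y t) by (intros; apply Hper; assumption).
  set (e := fun (z : R -> R) t => z (t + INR (proj1_sig (N t)) * T)).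
  assert (He : forall z, (forall t, 0 <= t -> z (t + T) = z t) ->
     forall t (n : nat), 0 <= t + INR n * T -> e z t = z (t + INR n * T)).
  { intros z Hz t n Hn. unfold e. apply same; [exact Hz | apply (proj2_sig (N t)) | exact Hn]. }
  assert (Hder : forall z, (forall t, 0 <= t -> z (t + T) = z t) -> forall t l (n : nat), 1 <= t + INR n * T ->
     is_derive z (t + INR n * T) l -> is_derive (e z) t l).
  { intros z Hz t l n Hn Hd.
    apply (is_derive_ext_loc (fun s => z (INR n * T + s))).
    - exists (mkposreal 1 Rlt_0_1). intros s Hs. change (Rabs (s - t) < 1) in Hs. apply Rabs_lt_between in Hs.
      rewrite (He z Hz s n) by lra. f_equal. ring.
    - apply is_derive_shift. rewrite Rplus_comm. exact Hd. }
  exists (e x), (e y). split; [|split; [|split]].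
  - intros t. destruct (nat_multiple_above T (t - 1) HT) as [n Hn].
    rewrite (He x Hx t n), (He y Hy t n) by lra. destruct (Hsol (t + INR n * T) ltac:(lra)) as [D1 D2].
    split; [apply (Hder x Hx t _ n) | apply (Hder y Hy t _ n)]; (assumption || lra).
  - intros t. destruct (nat_multiple_above T t HT) as [n Hn].
    rewrite (He x Hx t n), (He x Hx (t + T) n), (He y Hy t n), (He y Hy (t + T) n) by lra.
    replace (t + T + INR n * T) with (t + INR n * T + T) by ring. apply Hper, Hn.
  - intros t Ht. split; [rewrite (He x Hx t 0%nat) | rewrite (He y Hy t 0%nat)]; simpl; solve [f_equal; ring | lra].
  - intros t. exists (t + INR (proj1_sig (N t)) * T). split; [apply (proj2_sig (N t)) | split; reflexivity].
Qed.

Definition open2 (U : R -> R -> Prop) : Prop := forall x y, U x y ->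
  exists d, 0 < d /\ forall x' y', Rabs (x' - x) < d -> Rabs (y' - y) < d -> U x' y'.

(** A Lebesgue number for a compact arc in an open set, obtained by continuous induction along the
    arc. *)
Lemma tube (X Y : R -> R) (T : R) (U : R -> R -> Prop) : 0 < T ->
  (forall t, continuity_pt X t /\ continuity_pt Y t) -> open2 U -> (forall t, U (X t) (Y t)) ->
  exists d, 0 < d /\ forall s x y, 0 <= s <= T -> Rabs (x - X s) < d -> Rabs (y - Y s) < d -> U x y.
Proof.
  intros HT HC HU HX.
  assert (loc : forall t, exists h d, 0 < h /\ 0 < d /\ forall s x y, Rabs (s - t) < h ->
    Rabs (x - X s) < d -> Rabs (y - Y s) < d -> U x y).
  { intros t. destruct (HU _ _ (HX t)) as (d & Hd & Hb). destruct (HC t) as [C1 C2].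
    destruct (continuity_pt_eps X t (d / 2) C1 ltac:(lra)) as (h1 & Hh1 & K1).
    destruct (continuity_pt_eps Y t (d / 2) C2 ltac:(lra)) as (h2 & Hh2 & K2).
    exists (Rmin h1 h2), (d / 2). split; [pos|]. split; [lra|]. intros s x y Hs Hx Hy.
    specialize (K1 s (Rlt_le_trans _ _ _ Hs (Rmin_l _ _))). specialize (K2 s (Rlt_le_trans _ _ _ Hs (Rmin_r _ _))).
    apply Hb; [replace (x - X t) with ((x - X s) + (X s - X t)) by ring | replace (y - Y t) with ((y - Y s) + (Y s - Y t)) by ring];
      (eapply Rle_lt_trans; [apply Rabs_triang | lra]). }
  set (P := fun b => exists d, 0 < d /\ forall s x y, 0 <= s <= b -> Rabs (x - X s) < d -> Rabs (y - Y s) < d -> U x y).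
  assert (step : forall a b t h, P a -> t - h < a -> b < t + h -> (exists d, 0 < d /\ forall s x y, Rabs (s - t) < h ->
    Rabs (x - X s) < d -> Rabs (y - Y s) < d -> U x y) -> P b).
  { intros a b t h (d & Hd & Ha) H1 H2 (d' & Hd' & Hl). exists (Rmin d d'). split; [pos|]. intros s x y Hs Hx Hy.
    pose proof (Rmin_l d d'). pose proof (Rmin_r d d'). destruct (Rle_lt_dec s a).
    - apply (Ha s); lra.
    - apply (Hl s); [apply Rabs_lt_between; lra | lra | lra]. }
  apply (real_induction P 0 T); [| | |lra].
  - destruct (loc 0) as (h & d & Hh & Hd & H). exists d. split; [exact Hd|]. intros s x y Hs.
    apply H. replace s with 0 by lra. rewrite Rminus_diag, Rabs_R0. exact Hh.
  - intros t Ht IH. destruct (loc t) as (h & d & Hh & Hd & H).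
    apply (step (Rmax 0 (t - h / 2)) t t h); [apply IH; split; [apply Rmax_l | apply Rmax_lub_lt; lra] | | lra | eauto].
    pose proof (Rmax_r 0 (t - h / 2)). lra.
  - intros t Ht IH. destruct (loc t) as (h & d & Hh & Hd & H). exists h. split; [exact Hh|]. intros s Hs.
    apply (step t s t h); [apply IH; lra | lra | lra | eauto].
Qed.

(** * Return map: periodic solution, stability and attraction *)

Section Poincare.
Variables (f1 f2 : R -> R -> R) (Box : R -> R -> Prop) (L M : R).
Hypothesis HL : 0 < L.
Hypothesis HM : 0 < M.
Hypothesis Box_open : open2 Box.
Hypothesis Box_invariant : forall x y, forward_solution f1 f2 x y -> Box (x 0) (y 0) -> forall t, 0 <= t -> Box (x t) (y t).
Hypothesis Box_lipschitz : forall x y x' y', Box x y -> Box x' y' ->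
  Rabs (f1 x y - f1 x' y') <= L * (Rabs (x - x') + Rabs (y - y')) /\
  Rabs (f2 x y - f2 x' y') <= L * (Rabs (x - x') + Rabs (y - y')).
Hypothesis Box_bound : forall x y, Box x y -> Rabs (f1 x y) <= M /\ Rabs (f2 x y) <= M.
Hypothesis Box_existence : forall x0 y0, Box x0 y0 -> exists x y, x 0 = x0 /\ y 0 = y0 /\ forward_solution f1 f2 x y.

Lemma flow_close (x1 y1 x2 y2 : R -> R) (rho Tm t : R) :
  forward_solution f1 f2 x1 y1 -> forward_solution f1 f2 x2 y2 -> Box (x1 0) (y1 0) -> Box (x2 0) (y2 0) ->
  Rabs (x1 0 - x2 0) <= rho -> Rabs (y1 0 - y2 0) <= rho -> 0 <= t <= Tm ->
  Rabs (x1 t - x2 t) <= 2 * exp (2 * L * Tm) * rho /\ Rabs (y1 t - y2 t) <= 2 * exp (2 * L * Tm) * rho.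
Proof.
  intros S1 S2 B1 B2 Dx Dy Ht.
  assert (G := gronwall2 x1 y1 x2 y2 (fun t => f1 (x1 t) (y1 t) - f1 (x2 t) (y2 t))
    (fun t => f2 (x1 t) (y1 t) - f2 (x2 t) (y2 t)) L 0 t ltac:(lra) ltac:(lra)).
  assert (Hr : 0 <= rho) by (pose proof (Rabs_pos (x1 0 - x2 0)); lra).
  assert (Q : (x1 t - x2 t) ^ 2 + (y1 t - y2 t) ^ 2 <= (2 * exp (2 * L * Tm) * rho) ^ 2).
  { eapply Rle_trans; [apply G|].
    - intros s Hs. apply @is_derive_minus; [exact (proj1 (S1 s ltac:(lra))) | exact (proj1 (S2 s ltac:(lra)))].
    - intros s Hs. apply @is_derive_minus; [exact (proj2 (S1 s ltac:(lra))) | exact (proj2 (S2 s ltac:(lra)))].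
    - intros s Hs. apply (proj1 (Box_lipschitz _ _ _ _ (Box_invariant _ _ S1 B1 s ltac:(lra)) (Box_invariant _ _ S2 B2 s ltac:(lra)))).
    - intros s Hs. apply (proj2 (Box_lipschitz _ _ _ _ (Box_invariant _ _ S1 B1 s ltac:(lra)) (Box_invariant _ _ S2 B2 s ltac:(lra)))).
    - assert (Sq : forall z, Rabs z <= rho -> z ^ 2 <= rho ^ 2).
      { intros z Hz. rewrite <- (pow2_abs z). apply pow_incr. split; [apply Rabs_pos | exact Hz]. }
      replace ((2 * exp (2 * L * Tm) * rho) ^ 2) with ((rho ^ 2 + rho ^ 2) * (2 * exp (4 * L * Tm))).
      2:{ replace (4 * L * Tm) with (2 * L * Tm + 2 * L * Tm) by ring. rewrite exp_plus. ring. }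
      apply Rmult_le_compat; [| apply Rlt_le, exp_pos | |].
      + pose proof (pow2_ge_0 (x1 0 - x2 0)). pose proof (pow2_ge_0 (y1 0 - y2 0)). lra.
      + pose proof (Sq _ Dx). pose proof (Sq _ Dy). lra.
      + assert (exp (4 * L * (t - 0)) <= exp (4 * L * Tm)) by (apply exp_le; apply Rmult_le_compat_l; lra).
        pose proof (exp_pos (4 * L * Tm)). lra. }
  pose proof (pow2_ge_0 (x1 t - x2 t)). pose proof (pow2_ge_0 (y1 t - y2 t)).
  assert (0 <= 2 * exp (2 * L * Tm) * rho) by (pose proof (exp_pos (2 * L * Tm)); pos).
  split; apply pow2_le_abs; lra.
Qed.

Lemma flow_unique (x1 y1 x2 y2 : R -> R) (t : R) :
  forward_solution f1 f2 x1 y1 -> forward_solution f1 f2 x2 y2 -> Box (x1 0) (y1 0) ->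
  x1 0 = x2 0 -> y1 0 = y2 0 -> 0 <= t -> x1 t = x2 t /\ y1 t = y2 t.
Proof.
  intros S1 S2 B Ex Ey Ht.
  destruct (flow_close x1 y1 x2 y2 0 t t S1 S2 B ltac:(rewrite <- Ex, <- Ey; exact B)) as [H1 H2];
    [rewrite Ex, Rminus_diag, Rabs_R0; lra | rewrite Ey, Rminus_diag, Rabs_R0; lra | lra |].
  rewrite Rmult_0_r in H1, H2.
  apply Rabs_le_between in H1, H2. lra.
Qed.

(** [hit x T] stands for [T] being the return time of [x]. Keeping it abstract separates the
    stability theory from the two-stage definition of the return. *)
Variables (ys r Tmin Tmax : R) (hit : (R -> R) -> R -> Prop).
Hypothesis Hr : 0 < r.
Hypothesis HTmin : 0 < Tmin.
Hypothesis section_box : forall w, Rabs (w - ys) <= r -> Box 1 w.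
Hypothesis hit_ext : forall x x' T, (forall t, 0 <= t -> x t = x' t) -> hit x T -> hit x' T.
Hypothesis hit_section : forall x y, forward_solution f1 f2 x y -> x 0 = 1 -> Rabs (y 0 - ys) <= r ->
  f1 1 (y 0) < 0 /\ exists T, Tmin <= T <= Tmax /\ hit x T /\ x T = 1 /\ Rabs (y T - ys) <= r / 2.
Hypothesis hit_contraction : forall x1 y1 T1 x2 y2 T2,
  forward_solution f1 f2 x1 y1 -> x1 0 = 1 -> Rabs (y1 0 - ys) <= r -> hit x1 T1 ->
  forward_solution f1 f2 x2 y2 -> x2 0 = 1 -> Rabs (y2 0 - ys) <= r -> hit x2 T2 ->
  Rabs (y1 T1 - y2 T2) <= 1 / 2 * Rabs (y1 0 - y2 0).

(** The fixed point of the return map closes up: the solution shifted by [T] starts at the same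
    point, so uniqueness makes it periodic. *)
Lemma periodic_solution : exists (X Y : R -> R) (T l : R),
  (forall t, is_derive X t (f1 (X t) (Y t)) /\ is_derive Y t (f2 (X t) (Y t))) /\
  (forall t, X (t + T) = X t /\ Y (t + T) = Y t) /\ (forall t, Box (X t) (Y t)) /\
  X 0 = 1 /\ Y 0 = l /\ Rabs (l - ys) <= r / 2 /\ Tmin <= T <= Tmax /\ hit X T.
Proof.
  assert (A : forall w, exists v, Rabs (w - ys) <= r -> exists x y T, forward_solution f1 f2 x y /\
    x 0 = 1 /\ y 0 = w /\ Tmin <= T <= Tmax /\ hit x T /\ x T = 1 /\ y T = v /\ Rabs (v - ys) <= r / 2).
  { intros w. destruct (Rle_lt_dec (Rabs (w - ys)) r) as [Hw|Hw]; [|exists 0; intros; lra].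
    destruct (Box_existence 1 w (section_box w Hw)) as (x & y & E1 & E2 & Hs).
    destruct (hit_section x y Hs E1 ltac:(rewrite E2; exact Hw)) as (_ & T & HT & Hh & H1 & H2).
    exists (y T). intros _. exists x, y, T. auto 10. }
  set (P := fun w => proj1_sig (constructive_indefinite_description _ (A w))).
  assert (HP : forall w, Rabs (w - ys) <= r -> exists x y T, forward_solution f1 f2 x y /\
    x 0 = 1 /\ y 0 = w /\ Tmin <= T <= Tmax /\ hit x T /\ x T = 1 /\ y T = P w /\ Rabs (P w - ys) <= r / 2).
  { intros w. exact (proj2_sig (constructive_indefinite_description _ (A w))). }
  destruct (contraction_fixed_point P ys r ltac:(lra)) as (l & Hl & Hfix).
  { intros w Hw. destruct (HP w Hw) as (x & y & T & _ & _ & _ & _ & _ & _ & _ & H). lra. }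
  { intros w v Hw Hv. destruct (HP w Hw) as (x & y & T & S1 & E1 & E2 & _ & H1 & _ & <- & _).
    destruct (HP v Hv) as (x' & y' & T' & S1' & E1' & E2' & _ & H1' & _ & <- & _).
    rewrite <- E2, <- E2'. apply (hit_contraction x y T x' y' T'); try assumption; [rewrite E2 | rewrite E2']; assumption. }
  destruct (HP l Hl) as (x & y & T & S1 & E1 & E2 & HT & Hh & E3 & E4 & Hl2). rewrite Hfix in E4, Hl2.
  assert (Bl : Box (x 0) (y 0)) by (rewrite E1, E2; apply section_box, Hl).
  assert (Hper : forall t, 0 <= t -> x (t + T) = x t /\ y (t + T) = y t).
  { intros t Ht. rewrite Rplus_comm.
    destruct (flow_unique x y _ _ t S1 (forward_solution_shift f1 f2 x y T ltac:(lra) S1) Bl) as [H1 H2];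
      [rewrite Rplus_0_r; congruence | rewrite Rplus_0_r; congruence | exact Ht |]. split; congruence. }
  destruct (periodic_extension f1 f2 x y T ltac:(lra) S1 Hper) as (X & Y & D & Per & Eq & Cov).
  destruct (Eq 0 (Rle_refl 0)) as [EX EY].
  exists X, Y, T, l. split; [exact D|]. split; [exact Per|]. split; [|split; [congruence | split; [congruence | split; [exact Hl2 | split; [exact HT|]]]]].
  - intros t. destruct (Cov t) as (s & Hs & -> & ->). apply Box_invariant; assumption.
  - apply (hit_ext x); [|exact Hh]. intros t Ht. symmetry. apply (Eq t Ht).
Qed.

Variables (X Y : R -> R) (T l : R).
Hypothesis XY_sol : forall t, is_derive X t (f1 (X t) (Y t)) /\ is_derive Y t (f2 (X t) (Y t)).
Hypothesis XY_periodic : forall t, X (t + T) = X t /\ Y (t + T) = Y t.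
Hypothesis XY_box : forall t, Box (X t) (Y t).
Hypothesis X0 : X 0 = 1.
Hypothesis Y0 : Y 0 = l.
Hypothesis Hl : Rabs (l - ys) <= r / 2.
Hypothesis HT : Tmin <= T <= Tmax.
Hypothesis XT : hit X T.

Lemma XY_multiple (z : Z) (t : R) : X (t + IZR z * T) = X t /\ Y (t + IZR z * T) = Y t.
Proof.
  assert (N : forall (n : nat) t, X (t + INR n * T) = X t /\ Y (t + INR n * T) = Y t).
  { induction n; intros u.
    - simpl. rewrite Rmult_0_l, Rplus_0_r. auto.
    - rewrite S_INR. replace (u + (INR n + 1) * T) with ((u + INR n * T) + T) by ring.
      destruct (XY_periodic (u + INR n * T)) as [-> ->]. apply IHn. }
  destruct (Z.le_gt_cases 0 z) as [Hz|Hz].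
  - rewrite <- (Z2Nat.id z Hz), <- INR_IZR_INZ. apply N.
  - destruct (N (Z.to_nat (- z)) (t + IZR z * T)) as [<- <-].
    rewrite INR_IZR_INZ, Z2Nat.id by lia. rewrite opp_IZR. split; f_equal; ring.
Qed.

(** The shift is taken in [[T, 2 * T]] rather than [[0, T]], so that a small step back from [tau] is
    still a nonnegative time. *)
Lemma XY_reduce (s : R) : exists tau, T <= tau <= 2 * T /\ forall u, X (s + tau + u) = X u /\ Y (s + tau + u) = Y u.
Proof.
  destruct (archimed ((s + T) / T)) as [H1 H2]. set (z := up ((s + T) / T)) in *.
  exists (IZR z * T - s). split.
  - apply Rmult_gt_compat_r with (r := T) in H1; [|lra].
    apply Rmult_le_compat_r with (r := T) in H2; [|lra].
    replace ((s + T) / T * T) with (s + T) in H1 by (field; lra).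
    replace ((IZR z - (s + T) / T) * T) with (IZR z * T - (s + T)) in H2 by (field; lra). lra.
  - intros u. replace (s + (IZR z * T - s) + u) with (u + IZR z * T) by ring. apply XY_multiple.
Qed.

Lemma XY_forward (s : R) : forward_solution f1 f2 (fun t => X (s + t)) (fun t => Y (s + t)).
Proof. intros t _. destruct (XY_sol (s + t)). split; apply is_derive_shift; assumption. Qed.

Lemma XY_forward0 : forward_solution f1 f2 X Y.
Proof. intros t _. apply XY_sol. Qed.

Lemma XY_continuous (t : R) : continuity_pt X t /\ continuity_pt Y t.
Proof. destruct (XY_sol t) as [H1 H2]. split; [exact (is_derive_continuity_pt _ _ _ H1) | exact (is_derive_continuity_pt _ _ _ H2)]. Qed.

Definition near_orbit (rho x y : R) : Prop := exists s, Rabs (x - X s) <= rho /\ Rabs (y - Y s) <= rho.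

Lemma near_orbit_mono (rho rho' x y : R) : rho <= rho' -> near_orbit rho x y -> near_orbit rho' x y.
Proof. intros H (s & H1 & H2). exists s. lra. Qed.

Let E := 2 * exp (2 * L * Tmax).

Lemma first_lap (x y : R -> R) (kap : R) :
  kap <= r / 2 -> forward_solution f1 f2 x y -> x 0 = 1 -> Rabs (y 0 - l) <= kap ->
  exists S, Tmin <= S <= Tmax /\ x S = 1 /\ Rabs (y S - l) <= kap / 2 /\
    forall t, 0 <= t <= S -> near_orbit (E * kap) (x t) (y t).
Proof.
  intros Hk Hs E1 Hd.
  assert (Hys : Rabs (y 0 - ys) <= r).
  { replace (y 0 - ys) with ((y 0 - l) + (l - ys)) by ring. eapply Rle_trans; [apply Rabs_triang | lra]. }
  destruct (hit_section x y Hs E1 Hys) as (_ & S & HS & Hh & E2 & _).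
  exists S. split; [exact HS|]. split; [exact E2|]. split.
  - destruct (hit_section X Y XY_forward0 X0 ltac:(rewrite Y0; lra)) as (_ & S' & _).
    assert (YT : Y T = l). { rewrite <- (Rplus_0_l T), <- Y0. apply XY_periodic. }
    pose proof (hit_contraction x y S X Y T Hs E1 Hys Hh XY_forward0 X0 ltac:(rewrite Y0; lra) XT) as C.
    rewrite YT, Y0 in C. lra.
  - intros t Ht. exists t.
    apply (flow_close x y X Y kap Tmax t Hs XY_forward0); [| | | | lra].
    + rewrite E1. apply section_box, Hys.
    + apply XY_box.
    + rewrite E1, X0, Rminus_diag, Rabs_R0. pose proof (Rabs_pos (y 0 - l)). lra.
    + rewrite Y0. exact Hd.
Qed.

(** Each lap lasts at least [Tmin], so [n] laps cover the time [INR n * Tmin], and the distance on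
    the section only shrinks from lap to lap. *)
Lemma section_stable (n : nat) (x y : R -> R) (kap t : R) :
  kap <= r / 2 -> forward_solution f1 f2 x y -> x 0 = 1 -> Rabs (y 0 - l) <= kap ->
  0 <= t <= INR n * Tmin -> near_orbit (E * kap) (x t) (y t).
Proof.
  revert x y kap t. induction n; intros x y kap t Hk Hs E1 Hd Ht.
  - destruct (first_lap x y kap Hk Hs E1 Hd) as (S & HS & _ & _ & H). apply H. simpl in Ht. lra.
  - destruct (first_lap x y kap Hk Hs E1 Hd) as (S & HS & E2 & D2 & H).
    destruct (Rle_lt_dec t S) as [HtS|HtS]; [apply H; lra|].
    rewrite S_INR in Ht. pose proof (Rabs_pos (y 0 - l)).
    apply (near_orbit_mono (E * (kap / 2))).
    { apply Rmult_le_compat_l; [unfold E; pos | lra]. }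
    replace (x t) with (x (S + (t - S))) by (f_equal; ring). replace (y t) with (y (S + (t - S))) by (f_equal; ring).
    apply (IHn (fun u => x (S + u)) (fun u => y (S + u))); [lra | apply forward_solution_shift; [lra | exact Hs] | | | lra].
    + rewrite Rplus_0_r. exact E2.
    + rewrite Rplus_0_r. exact D2.
Qed.

(** Each lap lasts at most [Tmax], so by time [INR n * Tmax] at least [n] halvings have taken
    place. *)
Lemma section_attracting (n : nat) (x y : R -> R) (kap t : R) :
  kap <= r / 2 -> forward_solution f1 f2 x y -> x 0 = 1 -> Rabs (y 0 - l) <= kap ->
  INR n * Tmax <= t -> near_orbit (E * kap * (1 / 2) ^ n) (x t) (y t).
Proof.
  revert x y kap t. induction n; intros x y kap t Hk Hs E1 Hd Ht.
  - simpl pow. rewrite Rmult_1_r. simpl in Ht. destruct (nat_multiple_above Tmin (- t) HTmin) as [n Hn].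
    apply (section_stable n); (assumption || lra).
  - destruct (first_lap x y kap Hk Hs E1 Hd) as (S & HS & E2 & D2 & H).
    rewrite S_INR in Ht. pose proof (Rabs_pos (y 0 - l)).
    replace (E * kap * (1 / 2) ^ Datatypes.S n) with (E * (kap / 2) * (1 / 2) ^ n) by (simpl; field).
    replace (x t) with (x (S + (t - S))) by (f_equal; ring). replace (y t) with (y (S + (t - S))) by (f_equal; ring).
    apply (IHn (fun u => x (S + u)) (fun u => y (S + u))); [lra | apply forward_solution_shift; [lra | exact Hs] | | | lra].
    + rewrite Rplus_0_r. exact E2.
    + rewrite Rplus_0_r. exact D2.
Qed.

(** The cycle crosses [x = 1] transversally, with [x] decreasing at speed at least [v] near the
    crossing. A solution that stays [E3 * rho] close must cross within time [h' = 2 * E3 * rho / v]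
    of the same instant, hence at distance [O(rho)] from [l]. *)
Lemma reach_section : exists rho1 C, 0 < rho1 /\ 0 < C /\ forall x y s rho, 0 < rho <= rho1 ->
  forward_solution f1 f2 x y -> Box (x 0) (y 0) -> Rabs (x 0 - X s) <= rho -> Rabs (y 0 - Y s) <= rho ->
  exists th, 0 <= th /\ x th = 1 /\ Rabs (y th - l) <= C * rho /\ forall t, 0 <= t <= th -> near_orbit (C * rho) (x t) (y t).
Proof.
  destruct (hit_section X Y XY_forward0 X0 ltac:(rewrite Y0; lra)) as (Hneg & _).
  set (v := - f1 1 (Y 0) / 2). assert (Hv : 0 < v) by (unfold v; lra).
  set (h := v / (2 * L * M)). assert (Hh : 0 < h) by (unfold h; pos).
  set (E3 := 2 * exp (2 * L * (3 * Tmax))). assert (HE3 : 0 < E3) by (unfold E3; pos).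
  assert (Hm : 0 < Rmin h Tmin) by pos.
  assert (Xinc : forall a b, a <= b -> Rabs (X b - X a) <= M * (b - a) /\ Rabs (Y b - Y a) <= M * (b - a)).
  { intros a b Hab. split.
    - apply (increment_abs X (fun t => f1 (X t) (Y t))); [exact Hab | intros; apply XY_sol | intros; apply Box_bound, XY_box].
    - apply (increment_abs Y (fun t => f2 (X t) (Y t))); [exact Hab | intros; apply XY_sol | intros; apply Box_bound, XY_box]. }
  assert (Xinc' : forall a, Rabs (X a - X 0) <= M * Rabs a /\ Rabs (Y a - Y 0) <= M * Rabs a).
  { intros a. destruct (Rle_lt_dec 0 a).
    - rewrite (Rabs_pos_eq a) by assumption. pose proof (Xinc 0 a r0). rewrite Rminus_0_r in H. exact H.
    - rewrite (Rabs_left a) by assumption. pose proof (Xinc a 0 ltac:(lra)). rewrite Rminus_0_l in H.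
      rewrite (Rabs_minus_sym (X a)), (Rabs_minus_sym (Y a)). exact H. }
  assert (Xslope : forall a, Rabs a <= h -> f1 (X a) (Y a) <= - v).
  { intros a Ha. destruct (Xinc' a) as [H1 H2]. pose proof (proj1 (Box_lipschitz _ _ _ _ (XY_box a) (XY_box 0))) as H3.
    rewrite X0 in H1, H3. apply Rabs_le_between in H3.
    assert (H4 : L * (Rabs (X a - 1) + Rabs (Y a - Y 0)) <= L * (2 * M * h)).
    { apply Rmult_le_compat_l; [lra|]. assert (M * Rabs a <= M * h) by (apply Rmult_le_compat_l; lra). lra. }
    replace (L * (2 * M * h)) with v in H4 by (unfold h; field; lra). unfold v in *. lra. }
  set (C := E3 + 2 * M * E3 / v). assert (HC : 0 < 2 * M * E3 / v) by pos.
  (* This bound on [rho] is equivalent to [h' <= Rmin h Tmin]: the crossing window stays where the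
     speed bound holds and does not reach back to negative times. *)
  exists (v * Rmin h Tmin / (2 * E3)), C. split; [pos|]. split; [unfold C; lra|].
  intros x y s rho Hrho Hs HB Hx Hy.
  destruct (XY_reduce s) as (tau & Htau & Hred).
  set (h' := 2 * E3 * rho / v). assert (Hh' : 0 < h') by (unfold h'; pos).
  assert (Hh'm : h' <= Rmin h Tmin).
  { destruct Hrho as [_ Hrho]. apply Rmult_le_compat_l with (r := 2 * E3 / v) in Hrho; [|pos].
    replace (2 * E3 / v * (v * Rmin h Tmin / (2 * E3))) with (Rmin h Tmin) in Hrho by (field; lra).
    replace h' with (2 * E3 / v * rho) by (unfold h'; field; lra). exact Hrho. }
  pose proof (Rmin_l h Tmin) as Hm1. pose proof (Rmin_r h Tmin) as Hm2.
  assert (Cl : forall t, 0 <= t <= 3 * Tmax -> Rabs (x t - X (s + t)) <= E3 * rho /\ Rabs (y t - Y (s + t)) <= E3 * rho).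
  { intros t Ht. apply (flow_close x y (fun t => X (s + t)) (fun t => Y (s + t)) rho (3 * Tmax) t Hs (XY_forward s) HB);
      try rewrite Rplus_0_r; [apply XY_box | exact Hx | exact Hy | exact Ht]. }
  assert (Evh : v * h' = 2 * (E3 * rho)) by (unfold h'; field; lra).
  assert (Erho : 0 < E3 * rho) by (apply Rmult_lt_0_compat; lra).
  assert (Hup : 0 < x (tau - h') - 1).
  { destruct (Cl (tau - h') ltac:(lra)) as [H1 _]. replace (s + (tau - h')) with (s + tau + - h') in H1 by ring.
    rewrite (proj1 (Hred (- h'))) in H1. apply Rabs_le_between in H1.
    assert (H2 : X 0 - X (- h') <= - v * (0 - - h')).
    { apply (increment_le X (fun t => f1 (X t) (Y t))); [lra | intros; apply XY_sol |].
      intros t Ht. apply Xslope. apply Rabs_le_between. lra. }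
    rewrite X0 in H2. lra. }
  assert (Hdn : x (tau + h') - 1 <= 0).
  { destruct (Cl (tau + h') ltac:(lra)) as [H1 _]. replace (s + (tau + h')) with (s + tau + h') in H1 by ring.
    rewrite (proj1 (Hred h')) in H1. apply Rabs_le_between in H1.
    assert (H2 : X h' - X 0 <= - v * (h' - 0)).
    { apply (increment_le X (fun t => f1 (X t) (Y t))); [lra | intros; apply XY_sol |].
      intros t Ht. apply Xslope. apply Rabs_le_between. lra. }
    rewrite X0 in H2. lra. }
  destruct (first_zero (fun t => x t - 1) (tau - h') (tau + h') ltac:(lra)) as (th & Hth & E1 & _).
  { intros t Ht. apply continuity_pt_minus_const.
    exact (is_derive_continuity_pt _ _ _ (proj1 (Hs t ltac:(lra)))). }
  { exact Hup. }
  { exact Hdn. }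
  assert (HCE : E3 * rho <= C * rho).
  { apply Rmult_le_compat_r; [lra | unfold C; lra]. }
  exists th. split; [lra|]. split; [lra|]. split.
  - destruct (Cl th ltac:(lra)) as [_ H1]. replace (s + th) with (s + tau + (th - tau)) in H1 by ring.
    rewrite (proj2 (Hred (th - tau))) in H1. destruct (Xinc' (th - tau)) as [_ H2].
    assert (H3 : Rabs (th - tau) <= h') by (apply Rabs_le_between; lra).
    assert (H4 : M * Rabs (th - tau) <= M * h') by (apply Rmult_le_compat_l; lra).
    replace (C * rho) with (E3 * rho + M * h') by (unfold C, h'; field; lra).
    replace (y th - l) with ((y th - Y (th - tau)) + (Y (th - tau) - Y 0)) by (rewrite Y0; ring).
    eapply Rle_trans; [apply Rabs_triang | lra].
  - intros t Ht. exists (s + t). destruct (Cl t ltac:(lra)). split; lra.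
Qed.

Lemma orbit_stable : exists rho0 C, 0 < rho0 /\ 0 < C /\ forall x y s rho, 0 < rho <= rho0 ->
  forward_solution f1 f2 x y -> Rabs (x 0 - X s) <= rho -> Rabs (y 0 - Y s) <= rho ->
  (forall t, 0 <= t -> Box (x t) (y t) /\ near_orbit (C * rho) (x t) (y t)) /\
  (forall e, 0 < e -> exists t0, forall t, t0 <= t -> near_orbit e (x t) (y t)).
Proof.
  destruct reach_section as (rho1 & C & Hrho1 & HC & Hreach).
  destruct (tube X Y T Box ltac:(lra) XY_continuous Box_open XY_box) as (d & Hd & Htube).
  assert (HE : 1 <= E).
  { unfold E. assert (0 <= 2 * L * Tmax) by (assert (0 < Tmax) by lra; pos). pose proof (exp_ineq1_le (2 * L * Tmax)). lra. }
  set (rho0 := Rmin (d / 2) (Rmin rho1 (r / 2 / C))). assert (Hrho0 : 0 < rho0) by (unfold rho0; pos).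
  assert (Hm : rho0 <= d / 2 /\ rho0 <= rho1 /\ C * rho0 <= r / 2).
  { unfold rho0. pose proof (Rmin_l (d / 2) (Rmin rho1 (r / 2 / C))). pose proof (Rmin_r (d / 2) (Rmin rho1 (r / 2 / C))).
    pose proof (Rmin_l rho1 (r / 2 / C)). pose proof (Rmin_r rho1 (r / 2 / C)). split; [lra|]. split; [lra|].
    replace (r / 2) with (C * (r / 2 / C)) at 2 by (field; lra). apply Rmult_le_compat_l; lra. }
  exists rho0, (E * C). split; [exact Hrho0|]. split; [pos|]. intros x y s rho Hrho Hs Hx Hy.
  assert (HB : Box (x 0) (y 0)).
  { destruct (XY_reduce (s)) as (tau & Htau & Hred).
    apply (Htube (2 * T - tau)); [lra | |].
    - assert (ES : X (2 * T - tau) = X s).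
      { rewrite <- (proj1 (Hred (2 * T - tau))). replace (s + tau + (2 * T - tau)) with (s + T + T) by ring.
        rewrite (proj1 (XY_periodic (s + T))). apply XY_periodic. }
      rewrite ES. lra.
    - assert (ES : Y (2 * T - tau) = Y s).
      { rewrite <- (proj2 (Hred (2 * T - tau))). replace (s + tau + (2 * T - tau)) with (s + T + T) by ring.
        rewrite (proj2 (XY_periodic (s + T))). apply XY_periodic. }
      rewrite ES. lra. }
  destruct (Hreach x y s rho ltac:(lra) Hs HB Hx Hy) as (th & Hth & E1 & D1 & N1).
  assert (Hk : C * rho <= r / 2).
  { assert (C * rho <= C * rho0) by (apply Rmult_le_compat_l; lra). lra. }
  pose proof (forward_solution_shift f1 f2 x y th Hth Hs) as Hs'.
  assert (HCr : 0 < C * rho) by (apply Rmult_lt_0_compat; lra).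
  assert (After : forall (n : nat) t, th + INR n * Tmax <= t -> near_orbit (E * (C * rho) * (1 / 2) ^ n) (x t) (y t)).
  { intros n t Ht. replace (x t) with (x (th + (t - th))) by (f_equal; ring). replace (y t) with (y (th + (t - th))) by (f_equal; ring).
    apply (section_attracting n (fun u => x (th + u)) (fun u => y (th + u)) (C * rho) (t - th) Hk Hs');
      [rewrite Rplus_0_r; exact E1 | rewrite Rplus_0_r; exact D1 | lra]. }
  split.
  - intros t Ht. split; [apply Box_invariant; assumption|]. destruct (Rle_lt_dec t th).
    + apply (near_orbit_mono (C * rho)); [|apply N1; lra].
      assert (1 * (C * rho) <= E * (C * rho)) by (apply Rmult_le_compat_r; lra). lra.
    + specialize (After 0%nat t). simpl in After. rewrite Rmult_1_r, <- Rmult_assoc in After. apply After. lra.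
  - intros e He. assert (HQ : 0 < E * (C * rho)) by (apply Rmult_lt_0_compat; lra).
    destruct (pow_lt_1_zero (1 / 2) ltac:(rewrite Rabs_pos_eq; lra) (e / (E * (C * rho))) ltac:(pos)) as [N HN].
    specialize (HN N (Nat.le_refl N)). rewrite Rabs_pos_eq in HN by (apply pow_le; lra).
    exists (th + INR N * Tmax). intros t Ht. apply (near_orbit_mono (E * (C * rho) * (1 / 2) ^ N)); [|apply After, Ht].
    apply Rmult_lt_compat_l with (r := E * (C * rho)) in HN; [|exact HQ].
    replace (E * (C * rho) * (e / (E * (C * rho)))) with e in HN by (field; lra). lra.
Qed.

End Poincare.

(** * From components to the plane: derivatives, neighborhoods, Hausdorff distance *)

Lemma is_derive_pair (x y : R -> R) (t l1 l2 : R) : is_derive x t l1 -> is_derive y t l2 ->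
  is_derive (fun s => (x s, y s) : plane) t (l1, l2).
Proof.
  intros H1 H2.
  apply (is_derive_ext (fun s => plus (scal (x s) ((1, 0) : plane)) (scal (y s) ((0, 1) : plane)))).
  { intros s. unfold plus, scal; simpl. unfold prod_plus, prod_scal, plus, scal, mult; simpl. unfold mult; simpl. f_equal; ring. }
  replace ((l1, l2) : plane) with (plus (scal l1 ((1, 0) : plane)) (scal l2 ((0, 1) : plane))).
  2:{ unfold plus, scal; simpl. unfold prod_plus, prod_scal, plus, scal, mult; simpl. unfold mult; simpl. f_equal; ring. }
  apply @is_derive_plus; apply @is_derive_scal_l; assumption.
Qed.

Lemma is_derive_fst_snd (Z : R -> plane) (t : R) (l : plane) : is_derive Z t l ->
  is_derive (fun s => fst (Z s)) t (fst l) /\ is_derive (fun s => snd (Z s)) t (snd l).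
Proof.
  intros H. split.
  - apply (filterdiff_comp Z fst (fun y => scal y l) fst H). apply filterdiff_linear, is_linear_fst.
  - apply (filterdiff_comp Z snd (fun y => scal y l) snd H). apply filterdiff_linear, is_linear_snd.
Qed.

Lemma plane_open (U : plane -> Prop) : open U <-> open2 (fun x y => U (x, y)).
Proof.
  split.
  - intros H x y HU. destruct (H (x, y) HU) as [d Hd]. exists d. split; [apply cond_pos|].
    intros x' y' Hx Hy. apply (Hd (x', y')). split; assumption.
  - intros H [x y] HU. destruct (H x y HU) as (d & Hd & Hb). exists (mkposreal d Hd). intros [x' y'] [Hx Hy].
    apply Hb; assumption.
Qed.
Lemma dist2_sqrt (p q : plane) : dist2 p q = sqrt (Rabs (fst p - fst q) ^ 2 + Rabs (snd p - snd q) ^ 2).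
Proof. destruct p as [a b], q as [c d]. reflexivity. Qed.

Lemma dist2_le (p q : plane) : dist2 p q <= Rabs (fst p - fst q) + Rabs (snd p - snd q).
Proof.
  rewrite dist2_sqrt. pose proof (Rabs_pos (fst p - fst q)) as Ha. pose proof (Rabs_pos (snd p - snd q)) as Hb.
  set (a := Rabs (fst p - fst q)) in *. set (b := Rabs (snd p - snd q)) in *.
  apply Rsqr_incr_0_var; [|lra]. rewrite Rsqr_sqrt; unfold Rsqr; [assert (0 <= a * b) by pos; lra |].
  pose proof (pow2_ge_0 a). pose proof (pow2_ge_0 b). lra.
Qed.

Lemma dist2_ge (p q : plane) : Rabs (fst p - fst q) <= dist2 p q /\ Rabs (snd p - snd q) <= dist2 p q.
Proof.
  rewrite dist2_sqrt. pose proof (pow2_ge_0 (Rabs (fst p - fst q))) as Ha. pose proof (pow2_ge_0 (Rabs (snd p - snd q))) as Hb.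
  split.
  - rewrite <- (sqrt_pow2 (Rabs (fst p - fst q))) at 1 by apply Rabs_pos. apply sqrt_le_1_alt. lra.
  - rewrite <- (sqrt_pow2 (Rabs (snd p - snd q))) at 1 by apply Rabs_pos. apply sqrt_le_1_alt. lra.
Qed.

Lemma hausdorff_dist_le (A B : plane -> Prop) (d : R) : 0 <= d ->
  (forall a, A a -> exists b, B b /\ dist2 a b <= d) -> (forall b, B b -> exists a, A a /\ dist2 a b <= d) ->
  Rbar_le (hausdorff_dist A B) d.
Proof. intros Hd HA HB. apply (proj1 (Glb_Rbar_correct _)). auto. Qed.

(** An infimum strictly below [c] provides an admissible radius strictly below [c]; whether the
    infimum is attained does not matter. *)
Lemma hausdorff_dist_lt (A B : plane -> Prop) (c : R) : Rbar_lt (hausdorff_dist A B) c ->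
  forall b, B b -> exists a, A a /\ dist2 a b < c.
Proof.
  intros H. destruct (classic (exists d, d < c /\ forall b, B b -> exists a, A a /\ dist2 a b <= d)) as [(d & Hd & HB)|N].
  - intros b Hb. destruct (HB b Hb) as (a & Ha & Hab). exists a. split; [exact Ha | lra].
  - exfalso. apply (Rbar_lt_not_le _ _ H). apply (proj2 (Glb_Rbar_correct _)).
    intros d (_ & _ & Hd). simpl. apply Rnot_lt_le. intros Hdc. apply N. exists d. auto.
Qed.

Section PoincarePlane.
Variables (F : plane -> plane) (f1 f2 : R -> R -> R) (Box : R -> R -> Prop) (L M : R).
Hypothesis F_eq : forall x y, F (x, y) = (f1 x y, f2 x y).
Hypothesis HL : 0 < L.
Hypothesis HM : 0 < M.
Hypothesis Box_open : open2 Box.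
Hypothesis Box_invariant : forall x y, forward_solution f1 f2 x y -> Box (x 0) (y 0) -> forall t, 0 <= t -> Box (x t) (y t).
Hypothesis Box_lipschitz : forall x y x' y', Box x y -> Box x' y' ->
  Rabs (f1 x y - f1 x' y') <= L * (Rabs (x - x') + Rabs (y - y')) /\
  Rabs (f2 x y - f2 x' y') <= L * (Rabs (x - x') + Rabs (y - y')).
Hypothesis Box_bound : forall x y, Box x y -> Rabs (f1 x y) <= M /\ Rabs (f2 x y) <= M.
Variables (ys r Tmin Tmax : R) (hit : (R -> R) -> R -> Prop).
Hypothesis Hr : 0 < r.
Hypothesis HTmin : 0 < Tmin.
Hypothesis section_box : forall w, Rabs (w - ys) <= r -> Box 1 w.
Hypothesis hit_section : forall x y, forward_solution f1 f2 x y -> x 0 = 1 -> Rabs (y 0 - ys) <= r ->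
  f1 1 (y 0) < 0 /\ exists T, Tmin <= T <= Tmax /\ hit x T /\ x T = 1 /\ Rabs (y T - ys) <= r / 2.
Hypothesis hit_contraction : forall x1 y1 T1 x2 y2 T2,
  forward_solution f1 f2 x1 y1 -> x1 0 = 1 -> Rabs (y1 0 - ys) <= r -> hit x1 T1 ->
  forward_solution f1 f2 x2 y2 -> x2 0 = 1 -> Rabs (y2 0 - ys) <= r -> hit x2 T2 ->
  Rabs (y1 T1 - y2 T2) <= 1 / 2 * Rabs (y1 0 - y2 0).
Variables (X Y : R -> R) (T l : R).
Hypothesis XY_sol : forall t, is_derive X t (f1 (X t) (Y t)) /\ is_derive Y t (f2 (X t) (Y t)).
Hypothesis XY_periodic : forall t, X (t + T) = X t /\ Y (t + T) = Y t.
Hypothesis XY_box : forall t, Box (X t) (Y t).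
Hypothesis X0 : X 0 = 1.
Hypothesis Y0 : Y 0 = l.
Hypothesis Hl : Rabs (l - ys) <= r / 2.
Hypothesis HT : Tmin <= T <= Tmax.
Hypothesis XT : hit X T.

Definition orbit_of (X Y : R -> R) (p : plane) : Prop := exists t, (X t, Y t) = p.
Let G := orbit_of X Y.

Lemma solution_components (Z : R -> plane) : solution F Z ->
  forall t, is_derive (fun s => fst (Z s)) t (f1 (fst (Z t)) (snd (Z t))) /\
            is_derive (fun s => snd (Z s)) t (f2 (fst (Z t)) (snd (Z t))).
Proof.
  intros HZ t. specialize (HZ t). rewrite (surjective_pairing (Z t)), F_eq in HZ.
  apply (is_derive_fst_snd Z t _ HZ).
Qed.

Lemma solution_forward (Z : R -> plane) (s : R) : solution F Z ->
  forward_solution f1 f2 (fun t => fst (Z (s + t))) (fun t => snd (Z (s + t))).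
Proof.
  intros HZ t _. destruct (solution_components Z HZ (s + t)) as [H1 H2].
  split; [apply (is_derive_shift (fun u => fst (Z u))) | apply (is_derive_shift (fun u => snd (Z u)))]; assumption.
Qed.

Lemma orbit_periodic : periodic_orbit F G.
Proof.
  exists (fun t => (X t, Y t)), T. split; [|split; [lra | split; [|split]]].
  - intros t. rewrite F_eq. destruct (XY_sol t). apply is_derive_pair; assumption.
  - intros t. destruct (XY_periodic t) as [-> ->]. reflexivity.
  - destruct (hit_section X Y (fun t _ => XY_sol t) X0 ltac:(rewrite Y0; lra)) as (Hneg & _).
    apply not_all_not_ex. intros N.
    assert (H0 : is_derive X 0 0).
    { apply (is_derive_ext (fun _ => 1)).
      - intros t. specialize (N t). apply NNPP in N. injection N as -> _. symmetry. exact X0.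
      - apply @is_derive_const. }
    assert (H1 := is_derive_unique _ _ _ H0). assert (H2 := is_derive_unique _ _ _ (proj1 (XY_sol 0))).
    rewrite X0 in H2. lra.
  - intros p. reflexivity.
Qed.

Lemma orbit_tube (U : plane -> Prop) : open_nbhd G U ->
  exists d, 0 < d /\ forall x y, near_orbit X Y d x y -> U (x, y).
Proof.
  intros [HU HG].
  destruct (tube X Y T (fun x y => U (x, y)) ltac:(lra)) as (d & Hd & H).
  - apply (XY_continuous f1 f2 X Y XY_sol).
  - apply plane_open, HU.
  - intros t. apply HG. exists t. reflexivity.
  - exists (d / 2). split; [lra|]. intros x y (s & Hx & Hy).
    destruct (XY_reduce Tmin Tmax HTmin X Y T XY_periodic HT s) as (tau & Htau & Hred).
    assert (ES : X (2 * T - tau) = X s /\ Y (2 * T - tau) = Y s).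
    { destruct (Hred (2 * T - tau)) as [<- <-]. replace (s + tau + (2 * T - tau)) with (s + T + T) by ring.
      destruct (XY_periodic (s + T)) as [-> ->]. apply XY_periodic. }
    destruct ES as [E1 E2].
    apply (H (2 * T - tau)); [lra | rewrite E1; lra | rewrite E2; lra].
Qed.

Lemma tube_nbhd (rho : R) : 0 < rho ->
  open_nbhd G (fun p => exists s, Rabs (fst p - X s) < rho /\ Rabs (snd p - Y s) < rho).
Proof.
  intros Hrho. split.
  - apply plane_open. intros x y (s & Hx & Hy). simpl in Hx, Hy.
    exists (Rmin (rho - Rabs (x - X s)) (rho - Rabs (y - Y s))). split; [apply Rmin_pos; lra|].
    intros x' y' Hx' Hy'. exists s. simpl.
    pose proof (Rmin_l (rho - Rabs (x - X s)) (rho - Rabs (y - Y s))).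
    pose proof (Rmin_r (rho - Rabs (x - X s)) (rho - Rabs (y - Y s))).
    pose proof (Rabs_triang (x' - x) (x - X s)) as H1. pose proof (Rabs_triang (y' - y) (y - Y s)) as H2.
    replace (x' - x + (x - X s)) with (x' - X s) in H1 by ring. replace (y' - y + (y - Y s)) with (y' - Y s) in H2 by ring.
    split; lra.
  - intros p [s <-]. exists s. simpl. rewrite !Rminus_diag, Rabs_R0. lra.
Qed.

Lemma orbit_attracting : attracting F G.
Proof.
  destruct (orbit_stable f1 f2 Box L M HL HM Box_open Box_invariant Box_lipschitz Box_bound ys r Tmin Tmax hit Hr HTmin
    section_box hit_section hit_contraction X Y T l XY_sol XY_periodic XY_box X0 Y0 Hl HT XT) as (rho0 & C & Hrho0 & HC & H).
  split.
  - intros U HU. destruct (orbit_tube U HU) as (d & Hd & Htube).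
    set (rho := Rmin rho0 (d / C)). assert (Hrho : 0 < rho) by (unfold rho; pos).
    eexists. split; [apply (tube_nbhd rho Hrho)|].
    intros Z HZ (s & Hx & Hy) t Ht. rewrite (surjective_pairing (Z t)). apply Htube.
    pose proof (Rmin_l rho0 (d / C)) as H1. pose proof (Rmin_r rho0 (d / C)) as H2. fold rho in H1, H2.
    apply (near_orbit_mono X Y (C * rho)).
    { replace d with (C * (d / C)) by (field; lra). apply Rmult_le_compat_l; lra. }
    pose proof (solution_forward Z 0 HZ) as Hf.
    destruct (H _ _ s rho ltac:(lra) Hf) as [H3 _]; simpl; try rewrite Rplus_0_r; [lra | lra |].
    specialize (H3 t Ht). simpl in H3. rewrite Rplus_0_l in H3. apply H3.
  - eexists. split; [apply (tube_nbhd rho0 Hrho0)|].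
    intros Z HZ (s & Hx & Hy) U HU. destruct (orbit_tube U HU) as (d & Hd & Htube).
    pose proof (solution_forward Z 0 HZ) as Hf.
    destruct (H _ _ s rho0 ltac:(lra) Hf) as [_ H3]; simpl; try rewrite Rplus_0_r; [lra | lra |].
    destruct (H3 d Hd) as [t0 Ht0]. exists t0. intros t Ht. rewrite (surjective_pairing (Z t)). apply Htube.
    specialize (Ht0 t ltac:(lra)). simpl in Ht0. rewrite Rplus_0_l in Ht0. exact Ht0.
Qed.

(** Isolation follows from attraction: the complement of a point off the cycle is a neighbourhood of the
    cycle, so a periodic orbit in the basin cannot pass through that point. *)
Lemma orbit_limit_cycle : limit_cycle F G.
Proof.
  split; [exact orbit_periodic|].
  destruct orbit_attracting as [_ (V & HV & HVa)]. exists V. split; [exact HV|].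
  intros G' (Z & S & HZ & HS & HZp & _ & HG') Hin p.
  assert (Zn : forall (n : nat) t, Z (t + INR n * S) = Z t).
  { induction n; intros t; [simpl; f_equal; ring|]. rewrite S_INR.
    replace (t + (INR n + 1) * S) with ((t + INR n * S) + S) by ring. rewrite HZp. apply IHn. }
  assert (sub : forall p, G' p -> G p).
  { intros q Hq. apply NNPP. intros Nq.
    assert (Hopen : open_nbhd G (fun u => u <> q)).
    { split.
      - apply plane_open. intros x y Hxy. destruct q as [a b].
        destruct (Req_dec x a) as [->|N].
        + assert (Hyb : 0 < Rabs (y - b)) by (apply Rabs_pos_lt; intros E; apply Hxy; f_equal; lra).
          exists (Rabs (y - b)). split; [exact Hyb|]. intros x' y' _ Hy' E. injection E as _ ->.
          rewrite Rabs_minus_sym in Hy'. lra.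
        + assert (Hxa : 0 < Rabs (x - a)) by (apply Rabs_pos_lt; lra).
          exists (Rabs (x - a)). split; [exact Hxa|]. intros x' y' Hx' _ E. injection E as -> _.
          rewrite Rabs_minus_sym in Hx'. lra.
      - intros u Hu ->. exact (Nq Hu). }
    destruct (HVa Z HZ (Hin _ (proj2 (HG' _) (ex_intro _ 0 eq_refl))) _ Hopen) as [t0 Ht0].
    destruct (proj1 (HG' q) Hq) as [tq Htq].
    destruct (nat_multiple_above S (tq - t0 - 1) HS) as [n Hn].
    apply (Ht0 (tq + INR n * S)).
    - lra.
    - rewrite Zn. exact Htq. }
  (* For the converse inclusion, the periodic orbit contains a point of the cycle, and by uniqueness
     the solution through that point runs through the whole cycle. *)
  split; [apply sub|].
  intros [t <-].
  destruct (sub (Z 0) (proj2 (HG' _) (ex_intro _ 0 eq_refl))) as [s Hs].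
  apply HG'.
  destruct (nat_multiple_above T (t - s) ltac:(lra)) as [n Hn].
  assert (Xn : X (t + INR n * T) = X t /\ Y (t + INR n * T) = Y t).
  { rewrite INR_IZR_INZ. apply (XY_multiple X Y T XY_periodic). }
  destruct Xn as [<- <-]. exists (t + INR n * T - s).
  destruct (flow_unique f1 f2 Box L HL Box_invariant Box_lipschitz (fun u => X (s + u)) (fun u => Y (s + u))
    (fun u => fst (Z (0 + u))) (fun u => snd (Z (0 + u))) (t + INR n * T - s)) as [E1 E2].
  - apply (XY_forward f1 f2 X Y XY_sol).
  - apply solution_forward, HZ.
  - apply XY_box.
  - rewrite !Rplus_0_r, <- Hs. reflexivity.
  - rewrite !Rplus_0_r, <- Hs. reflexivity.
  - lra.
  - simpl in E1, E2. rewrite Rplus_0_l in E1, E2.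
    replace (s + (t + INR n * T - s)) with (t + INR n * T) in E1, E2 by ring.
    rewrite E1, E2. apply surjective_pairing.
Qed.

End PoincarePlane.

(** * Assembly *)

(** On the side [sg * (1 - x) >= 0] of the switching line (left for [sg = 1], right for [sg = -1]),
   [U = sg * (1 - x)] and [W = sg * (1 + 1 / A - (x + y))]. *)
Definition side_point (sg A U W : R) : plane := (1 - sg * U, 1 / A - sg * (W - U)).

Lemma dist2_side_point (sg A U W U' W' d : R) : sg = 1 \/ sg = -1 -> Rabs (U - U') <= d -> Rabs (W - W') <= d ->
  dist2 (side_point sg A U W) (side_point sg A U' W') <= 3 * d.
Proof.
  intros Hsg HU HW. eapply Rle_trans; [apply dist2_le|]. simpl.
  replace (1 - sg * U - (1 - sg * U')) with (sg * - (U - U')) by ring.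
  replace (1 / A - sg * (W - U) - (1 / A - sg * (W' - U'))) with (sg * ((U - U') + - (W - W'))) by ring.
  rewrite !(sg_mult_abs sg _ Hsg), Rabs_Ropp.
  pose proof (Rabs_triang (U - U') (- (W - W'))) as H. rewrite Rabs_Ropp in H. lra.
Qed.

(** A crude bound for the inverse of the change to eigencoordinates, of determinant [kf - ks], plus
    a bound for the part of the linear orbit that comes after the true passage has ended. *)
Definition tracking_constant (kf ks R0 : R) : R :=
  (2 * (1 + kf) * (1 + kf) + kf * (1 + kf) * (R0 + 1)) / (kf - ks) + 1.

Section LinearOrbit.
Variables sg A kf ks R0 : R.
Hypothesis Hks : 0 < ks < kf.
Hypothesis HA : A = kf * ks.
Hypothesis HA1 : 1 + A = kf + ks.
Hypothesis Hsg : sg = 1 \/ sg = -1.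
Hypothesis HR0 : 0 < R0.

Let A_pos : 0 < A.
Proof. rewrite HA. pos. Qed.

Lemma lin_derive (t : R) : is_derive (lin_U kf ks R0) t (A * lin_W kf ks R0 t - (1 + A) * lin_U kf ks R0 t) /\
  is_derive (lin_W kf ks R0) t (- lin_U kf ks R0 t).
Proof.
  split.
  - rewrite HA1, HA. unfold lin_U, lin_W. auto_derive; [lra|]. field. lra.
  - unfold lin_U, lin_W. auto_derive; [lra|]. field. lra.
Qed.

Lemma lin_initial : lin_U kf ks R0 0 = 0 /\ lin_W kf ks R0 0 = R0.
Proof. unfold lin_U, lin_W. rewrite !Rmult_0_r, exp_0. split; field; lra. Qed.

Lemma side_point_derive (U W : R -> R) (t U' W' : R) : is_derive U t U' -> is_derive W t W' ->
  is_derive (fun s => 1 - sg * U s) t (- sg * U') /\ is_derive (fun s => 1 / A - sg * (W s - U s)) t (- sg * (W' - U')).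
Proof.
  intros HU HW. assert (C : forall c (g : R -> R) g', is_derive g t g' -> is_derive (fun s => c - sg * g s) t (- sg * g')).
  { intros c g g' Hg. replace (- sg * g') with (minus 0 (sg * g')) by (unfold minus, plus, opp; simpl; ring).
    apply @is_derive_minus; [apply @is_derive_const | apply is_derive_scal, Hg]. }
  split; apply C; [exact HU | apply @is_derive_minus; assumption].
Qed.

Lemma linear_orbit_solution : solution (vf_linear A) (fun t => side_point sg A (lin_U kf ks R0 t) (lin_W kf ks R0 t)).
Proof.
  intros t. destruct (lin_derive t) as [HU HW]. destruct (side_point_derive _ _ _ _ _ HU HW) as [H1 H2].
  apply (is_derive_pair _ _ _ _ _) with (1 := H1) in H2. unfold side_point, vf_linear.
  eapply eq_rect; [exact H2|]. f_equal; field; lra.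
Qed.

Lemma linear_unique (Z1 Z2 : R -> plane) (t : R) : solution (vf_linear A) Z1 -> solution (vf_linear A) Z2 ->
  Z1 0 = Z2 0 -> 0 <= t -> Z1 t = Z2 t.
Proof.
  intros S1 S2 E0 Ht.
  set (l1 := fun x y : R => A * y - x). set (l2 := fun x y : R => 1 - A * y).
  assert (Eq : forall x y, vf_linear A (x, y) = (l1 x y, l2 x y)) by reflexivity.
  pose proof (solution_components _ _ _ Eq Z1 S1) as C1. pose proof (solution_components _ _ _ Eq Z2 S2) as C2.
  set (x1 := fun s => fst (Z1 s)). set (y1 := fun s => snd (Z1 s)). set (x2 := fun s => fst (Z2 s)). set (y2 := fun s => snd (Z2 s)).
  assert (G := gronwall2 x1 y1 x2 y2 (fun s => l1 (x1 s) (y1 s) - l1 (x2 s) (y2 s))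
    (fun s => l2 (x1 s) (y1 s) - l2 (x2 s) (y2 s)) (A + 1) 0 t Ht ltac:(lra)).
  assert (H : (x1 t - x2 t) ^ 2 + (y1 t - y2 t) ^ 2 <= 0).
  { eapply Rle_trans; [apply G|].
    - intros s _. apply @is_derive_minus; [apply C1 | apply C2].
    - intros s _. apply @is_derive_minus; [apply C1 | apply C2].
    - intros s _. unfold l1. replace (A * y1 s - x1 s - (A * y2 s - x2 s)) with (A * (y1 s - y2 s) + - (x1 s - x2 s)) by ring.
      eapply Rle_trans; [apply Rabs_triang|]. rewrite Rabs_Ropp, Rabs_mult, (Rabs_pos_eq A) by lra.
      pose proof (Rabs_pos (x1 s - x2 s)). pose proof (Rabs_pos (y1 s - y2 s)).
      assert (0 <= A * Rabs (x1 s - x2 s)) by pos. lra.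
    - intros s _. unfold l2. replace (1 - A * y1 s - (1 - A * y2 s)) with (A * - (y1 s - y2 s)) by ring.
      rewrite Rabs_mult, Rabs_Ropp, (Rabs_pos_eq A) by lra.
      pose proof (Rabs_pos (x1 s - x2 s)). pose proof (Rabs_pos (y1 s - y2 s)).
      assert (0 <= A * Rabs (x1 s - x2 s)) by pos. lra.
    - unfold x1, x2, y1, y2. rewrite E0, !Rminus_diag. lra. }
  pose proof (pow2_ge_0 (x1 t - x2 t)). pose proof (pow2_ge_0 (y1 t - y2 t)).
  assert (Hx : Rabs (x1 t - x2 t) <= 0) by (apply pow2_le_abs; lra).
  assert (Hy : Rabs (y1 t - y2 t) <= 0) by (apply pow2_le_abs; lra).
  apply Rabs_le_between in Hx, Hy. rewrite (surjective_pairing (Z1 t)), (surjective_pairing (Z2 t)).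
  unfold x1, x2, y1, y2 in *. f_equal; lra.
Qed.

Lemma linear_forward_orbit (p0 p : plane) : p0 = side_point sg A 0 R0 ->
  (forward_orbit (vf_linear A) p0 p <-> exists t, 0 <= t /\ p = side_point sg A (lin_U kf ks R0 t) (lin_W kf ks R0 t)).
Proof.
  intros ->. destruct lin_initial as [EU EW]. split.
  - intros (Z & HZ & Z0 & t & Ht & <-). exists t. split; [exact Ht|].
    apply (linear_unique Z _ t HZ linear_orbit_solution); [|exact Ht]. rewrite EU, EW. exact Z0.
  - intros (t & Ht & ->). eexists. split; [apply linear_orbit_solution|]. split.
    + cbv beta. rewrite EU, EW. reflexivity.
    + exists t. split; [exact Ht | reflexivity].
Qed.

Lemma lin_U_nonneg (t : R) : 0 <= t -> 0 <= lin_U kf ks R0 t.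
Proof.
  intros [Ht|<-]; [apply Rlt_le, lin_U_pos; assumption|]. rewrite (proj1 lin_initial). lra.
Qed.

End LinearOrbit.

(** The two eigencoordinates determine [U] and [W]. The linear orbit takes infinite time to reach
    the node, the true passage only [T]; what the linear orbit does after [T] has size
    [O(exp (- ks * T))], at most a multiple of [err], and is matched with the end point of the
    passage. *)
Lemma side_tracking (kf ks R0 : R) (Hks : 0 < ks < kf) (HR0 : 0 < R0) (U W : R -> R) (T err : R) : 0 < T -> Rabs (W 0 - R0) <= err -> U T = 0 -> Rabs (W T) <= err ->
  exp (- ks * T) <= err ->
  (forall t, 0 <= t <= T -> Rabs (ks * W t - U t - ks * W 0 * exp (- kf * t)) <= err /\
     Rabs (kf * W t - U t - kf * W 0 * exp (- ks * t)) <= err) ->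
  let K := tracking_constant kf ks R0 in
  (forall t, 0 <= t <= T -> Rabs (U t - lin_U kf ks R0 t) <= K * err /\ Rabs (W t - lin_W kf ks R0 t) <= K * err) /\
  (forall t, 0 <= t -> exists s, 0 <= s <= T /\ Rabs (U s - lin_U kf ks R0 t) <= K * err /\ Rabs (W s - lin_W kf ks R0 t) <= K * err).
Proof.
  intros HT H0 UT WT Hexp Htr K.
  assert (Herr : 0 <= err) by (pose proof (Rabs_pos (W T)); lra).
  set (g := / (kf - ks)). assert (Hg : 0 < g) by (unfold g; pos).
  assert (EK : K = (2 * (1 + kf) * (1 + kf) + kf * (1 + kf) * (R0 + 1)) * g + 1) by reflexivity.
  assert (HK1 : 2 * (1 + kf) * (1 + kf) * g * err <= K * err).
  { apply Rmult_le_compat_r; [exact Herr|]. rewrite EK. assert (0 < kf * (1 + kf) * (R0 + 1) * g) by pos. lra. }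
  assert (HK2 : (kf * (1 + kf) * R0 * g + 1) * err <= K * err).
  { apply Rmult_le_compat_r; [exact Herr|]. rewrite EK. assert (0 < 2 * (1 + kf) * (1 + kf) * g) by pos.
    assert (0 < kf * (1 + kf) * g) by pos. lra. }
  assert (A1 : forall t, 0 <= t <= T -> Rabs (U t - lin_U kf ks R0 t) <= K * err /\ Rabs (W t - lin_W kf ks R0 t) <= K * err).
  { intros t Ht. destruct (Htr t Ht) as [T1 T2].
    assert (D : forall c a, 0 < c <= kf -> 0 < a -> Rabs (c * W 0 * exp (- a * t) - c * R0 * exp (- a * t)) <= kf * err).
    { intros c a Hc Ha. replace (c * W 0 * exp (- a * t) - c * R0 * exp (- a * t)) with (c * (W 0 - R0) * exp (- a * t)) by ring.
      pose proof (exp_nonpos_le_1 (- a * t) ltac:(assert (0 <= a * t) by pos; lra)) as E1. pose proof (exp_pos (- a * t)) as E2.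
      rewrite !Rabs_mult, (Rabs_pos_eq c), (Rabs_pos_eq (exp _)) by lra. pose proof (Rabs_pos (W 0 - R0)).
      assert (c * Rabs (W 0 - R0) <= kf * err) by (apply Rmult_le_compat; lra).
      assert (0 <= c * Rabs (W 0 - R0)) by pos.
      assert (c * Rabs (W 0 - R0) * exp (- a * t) <= c * Rabs (W 0 - R0) * 1) by (apply Rmult_le_compat_l; lra). lra. }
    pose proof (D ks kf ltac:(lra) ltac:(lra)) as D1. pose proof (D kf ks ltac:(lra) ltac:(lra)) as D2.
    set (e1 := ks * W t - U t - ks * R0 * exp (- kf * t)). set (e2 := kf * W t - U t - kf * R0 * exp (- ks * t)).
    assert (B1 : Rabs e1 <= (1 + kf) * err).
    { replace e1 with ((ks * W t - U t - ks * W 0 * exp (- kf * t)) + (ks * W 0 * exp (- kf * t) - ks * R0 * exp (- kf * t))) by (unfold e1; ring).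
      eapply Rle_trans; [apply Rabs_triang | lra]. }
    assert (B2 : Rabs e2 <= (1 + kf) * err).
    { replace e2 with ((kf * W t - U t - kf * W 0 * exp (- ks * t)) + (kf * W 0 * exp (- ks * t) - kf * R0 * exp (- ks * t))) by (unfold e2; ring).
      eapply Rle_trans; [apply Rabs_triang | lra]. }
    assert (Hp : 0 <= (1 + kf) * err) by (apply Rmult_le_pos; lra).
    assert (EU : U t - lin_U kf ks R0 t = (ks * e2 - kf * e1) * g) by (unfold e1, e2, lin_U, g; field; lra).
    assert (EW : W t - lin_W kf ks R0 t = (e2 - e1) * g) by (unfold e1, e2, lin_W, g; field; lra).
    rewrite EU, EW, !Rabs_mult, (Rabs_pos_eq g) by lra. split.
    - assert (Hs : Rabs (ks * e2 - kf * e1) <= 2 * (1 + kf) * ((1 + kf) * err)).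
      { replace (ks * e2 - kf * e1) with (ks * e2 + - (kf * e1)) by ring. eapply Rle_trans; [apply Rabs_triang|].
        rewrite Rabs_Ropp, !Rabs_mult, (Rabs_pos_eq ks), (Rabs_pos_eq kf) by lra.
        assert (ks * Rabs e2 <= (1 + kf) * ((1 + kf) * err)) by (apply Rmult_le_compat; try apply Rabs_pos; lra).
        assert (kf * Rabs e1 <= (1 + kf) * ((1 + kf) * err)) by (apply Rmult_le_compat; try apply Rabs_pos; lra). lra. }
      apply Rmult_le_compat_r with (r := g) in Hs; lra.
    - assert (Hs : Rabs (e2 - e1) <= 2 * (1 + kf) * ((1 + kf) * err)).
      { replace (e2 - e1) with (e2 + - e1) by ring. eapply Rle_trans; [apply Rabs_triang|]. rewrite Rabs_Ropp.
        assert (1 * ((1 + kf) * err) <= (1 + kf) * ((1 + kf) * err)) by (apply Rmult_le_compat_r; lra). lra. }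
      apply Rmult_le_compat_r with (r := g) in Hs; lra. }
  split; [exact A1|]. intros t Ht. destruct (Rle_lt_dec t T) as [HtT|HtT]; [exists t; split; [lra | apply A1; lra]|].
  exists T. split; [lra|]. rewrite UT.
  assert (Ht1 : exp (- ks * t) <= err).
  { eapply Rle_trans; [|exact Hexp]. apply exp_le. assert (ks * T <= ks * t) by (apply Rmult_le_compat_l; lra). lra. }
  assert (Ht2 : exp (- kf * t) <= exp (- ks * t)).
  { apply exp_le. assert (ks * t <= kf * t) by (apply Rmult_le_compat_r; lra). lra. }
  pose proof (exp_pos (- ks * t)) as P1. pose proof (exp_pos (- kf * t)) as P2.
  assert (Bf : kf * (1 + kf) * R0 * g * exp (- ks * t) <= kf * (1 + kf) * R0 * g * err).
  { apply Rmult_le_compat_l; [pos | exact Ht1]. }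
  split.
  - replace (0 - lin_U kf ks R0 t) with (- (kf * ks * R0 * g * (exp (- ks * t) - exp (- kf * t)))) by (unfold lin_U, g; field; lra).
    rewrite Rabs_Ropp, Rabs_pos_eq.
    2:{ apply Rmult_le_pos; [pos | lra]. }
    assert (kf * ks * R0 * g * (exp (- ks * t) - exp (- kf * t)) <= kf * (1 + kf) * R0 * g * exp (- ks * t)).
    { apply Rmult_le_compat; [pos | lra | | lra]. apply Rmult_le_compat_r; [lra|]. apply Rmult_le_compat_r; [lra|].
      apply Rmult_le_compat_l; lra. }
    lra.
  - replace (W T - lin_W kf ks R0 t) with (W T + - (R0 * g * (kf * exp (- ks * t) - ks * exp (- kf * t)))) by (unfold lin_W, g; field; lra).
    eapply Rle_trans; [apply Rabs_triang|]. rewrite Rabs_Ropp.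
    assert (0 <= ks * exp (- kf * t)) by pos.
    assert (ks * exp (- kf * t) <= kf * exp (- ks * t)) by (apply Rmult_le_compat; lra).
    rewrite (Rabs_pos_eq (R0 * g * _)) by (apply Rmult_le_pos; [pos | lra]).
    assert (R0 * g * (kf * exp (- ks * t) - ks * exp (- kf * t)) <= R0 * g * ((kf * (1 + kf)) * exp (- ks * t))).
    { apply Rmult_le_compat_l; [pos|]. assert (0 <= kf * kf * exp (- ks * t)) by pos. lra. }
    lra.
Qed.

(** * The planar field: invariant box, Lipschitz bounds, existence *)

Section Field.
Variables alpha beta : R.
Hypothesis Halpha : 0 < alpha.
Hypothesis Hbeta : 0 < beta.

(** [q] is any function that is the identity on [[0, Yb]], so that the lemma applies to the true
    field and to the truncated one used for existence. The coefficient [a] is a function of time, so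
    that only its bounds matter. *)
Lemma box_stay (x y a q : R -> R) (eta mu Xb Yb : R) : 0 < eta -> 0 <= mu -> eta < alpha * Yb -> (alpha + beta) * Yb < Xb ->
  (forall t, alpha < a t < alpha + beta) -> (forall v, 0 <= v <= Yb -> q v = v) ->
  (forall t, 0 <= t -> is_derive x t (a t * q (y t) - x t)) ->
  (forall t, 0 <= t -> is_derive y t (eta - (mu + a t) * q (y t))) ->
  0 < x 0 < Xb -> 0 < y 0 < Yb -> forall t, 0 <= t -> 0 < x t < Xb /\ 0 < y t < Yb.
Proof.
  intros Heta Hmu HY HX Ha Hq Dx Dy x0 y0.
  assert (HYb : 0 < Yb) by (apply Rmult_lt_reg_l with alpha; lra).
  assert (Hopp : forall c (g : R -> R) t d, is_derive g t d -> is_derive (fun s => c - g s) t (- d)).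
  { intros c g t d Hd. replace (- d) with (minus 0 d) by (unfold minus, plus, opp; simpl; ring).
    apply @is_derive_minus; [apply @is_derive_const | exact Hd]. }
  assert (Y1 : forall t, 0 <= t -> 0 < y t).
  { intros t Ht. apply (stay_pos y (fun t => eta - (mu + a t) * q (y t)) 0 t); [lra | | | lra].
    - intros s Hs. apply Dy. lra.
    - intros s Hs _ E. rewrite E, Hq by lra. lra. }
  assert (Y2 : forall t, 0 <= t -> 0 < Yb - y t).
  { intros t Ht. apply (stay_pos (fun t => Yb - y t) (fun t => - (eta - (mu + a t) * q (y t))) 0 t); [lra | | | lra].
    - intros s Hs. apply Hopp, Dy. lra.
    - intros s Hs _ E. replace (y s) with Yb by lra. rewrite Hq by lra. pose proof (Ha s) as Has.
      assert (alpha * Yb <= (mu + a s) * Yb) by (apply Rmult_le_compat_r; lra). lra. }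
  assert (X1 : forall t, 0 <= t -> 0 < x t).
  { intros t Ht. apply (stay_pos x (fun t => a t * q (y t) - x t) 0 t); [lra | | | lra].
    - intros s Hs. apply Dx. lra.
    - intros s Hs _ E. pose proof (Ha s). specialize (Y1 s ltac:(lra)). specialize (Y2 s ltac:(lra)).
      rewrite E, Hq by lra. assert (0 < a s * y s) by (apply Rmult_lt_0_compat; lra). lra. }
  intros t Ht. split; [split; [apply X1, Ht|] | specialize (Y1 t Ht); specialize (Y2 t Ht); lra].
  assert (X2 : 0 < Xb - x t); [|lra].
  apply (stay_pos (fun t => Xb - x t) (fun t => - (a t * q (y t) - x t)) 0 t); [lra | | | lra].
  - intros s Hs. apply Hopp, Dx. lra.
  - intros s Hs _ E. pose proof (Ha s). specialize (Y1 s ltac:(lra)). specialize (Y2 s ltac:(lra)).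
    rewrite Hq by lra. assert (a s * y s <= (alpha + beta) * Yb) by (apply Rmult_le_compat; lra). lra.
Qed.

Definition clamp (b v : R) : R := Rmax 0 (Rmin b v).

Lemma clamp_range (b v : R) : 0 <= b -> 0 <= clamp b v <= b.
Proof. intros Hb. unfold clamp. split; [apply Rmax_l|]. apply Rmax_lub; [exact Hb | apply Rmin_l]. Qed.

Lemma clamp_id (b v : R) : 0 <= v <= b -> clamp b v = v.
Proof. intros H. unfold clamp. rewrite Rmin_right, Rmax_right by lra. reflexivity. Qed.

Lemma clamp_lipschitz (b v w : R) : Rabs (clamp b v - clamp b w) <= Rabs (v - w).
Proof.
  unfold clamp, Rmax, Rmin, Rabs.
  repeat (destruct Rle_dec || destruct Rcase_abs); lra.
Qed.

Variables (k : nat) (phi phiL phiR : R -> R).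
Hypothesis Hphi : sigmoidal k phi phiL phiR.

Definition rate (eps x : R) : R := alpha + beta * phi (/ eps * (x - 1)).
Definition vf1 (eps x y : R) : R := rate eps x * y - x.
Definition vf2 (eps eta mu x y : R) : R := eta - (mu + rate eps x) * y.

Lemma vf_eq (eps eta mu x y : R) : vf alpha beta phi eps eta mu (x, y) = (vf1 eps x y, vf2 eps eta mu x y).
Proof. reflexivity. Qed.

Lemma rate_range (eps x : R) : alpha < rate eps x < alpha + beta.
Proof.
  unfold rate. pose proof (sigmoidal_range _ _ _ _ Hphi (/ eps * (x - 1))) as H.
  assert (0 < beta * phi (/ eps * (x - 1))) by pos.
  assert (beta * phi (/ eps * (x - 1)) < beta * 1) by (apply Rmult_lt_compat_l; lra). lra.
Qed.

Lemma rate_lipschitz (eps Xb : R) : 0 < eps -> 0 < Xb -> exists L, 0 < L /\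
  forall x x', 0 <= x <= Xb -> 0 <= x' <= Xb -> Rabs (rate eps x - rate eps x') <= L * Rabs (x - x').
Proof.
  intros He HX. destruct (sigmoidal_lipschitz k phi phiL phiR Hphi (/ eps * (Xb + 1))) as (L & HL & H).
  assert (Hi : 0 < / eps) by pos.
  exists (beta * (L * / eps)). split; [pos|]. intros x x' Hx Hx'.
  assert (B : forall z, 0 <= z <= Xb -> Rabs (/ eps * (z - 1)) <= / eps * (Xb + 1)).
  { intros z Hz. rewrite Rabs_mult, (Rabs_pos_eq (/ eps)) by lra. apply Rmult_le_compat_l; [lra|].
    apply Rabs_le_between. lra. }
  specialize (H _ _ (B x Hx) (B x' Hx')). unfold rate.
  replace (alpha + beta * phi (/ eps * (x - 1)) - (alpha + beta * phi (/ eps * (x' - 1))))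
    with (beta * (phi (/ eps * (x - 1)) - phi (/ eps * (x' - 1)))) by ring.
  rewrite Rabs_mult, (Rabs_pos_eq beta), Rmult_assoc by lra. apply Rmult_le_compat_l; [lra|].
  replace (/ eps * (x - 1) - / eps * (x' - 1)) with (/ eps * (x - x')) in H by ring.
  rewrite Rabs_mult, (Rabs_pos_eq (/ eps)) in H by lra. lra.
Qed.

Lemma growth_lipschitz (eps Xb Yb : R) : 0 < eps -> 0 < Xb -> 0 < Yb -> exists L, 0 < L /\
  forall x y x' y', 0 <= x <= Xb -> 0 <= y <= Yb -> 0 <= x' <= Xb -> 0 <= y' <= Yb ->
    Rabs (rate eps x * y - rate eps x' * y') <= L * (Rabs (x - x') + Rabs (y - y')).
Proof.
  intros He HX HY. destruct (rate_lipschitz eps Xb He HX) as (L & HL & H).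
  exists (L * Yb + (alpha + beta)). split; [pos|]. intros x y x' y' Hx Hy Hx' Hy'.
  replace (rate eps x * y - rate eps x' * y') with ((rate eps x - rate eps x') * y + rate eps x' * (y - y')) by ring.
  eapply Rle_trans; [apply Rabs_triang|]. rewrite !Rabs_mult. pose proof (rate_range eps x') as Hr.
  rewrite (Rabs_pos_eq y), (Rabs_pos_eq (rate eps x')) by lra.
  pose proof (Rabs_pos (x - x')). pose proof (Rabs_pos (y - y')).
  assert (Rabs (rate eps x - rate eps x') * y <= L * Rabs (x - x') * Yb).
  { apply Rmult_le_compat; [apply Rabs_pos | lra | apply H; assumption | lra]. }
  assert (rate eps x' * Rabs (y - y') <= (alpha + beta) * Rabs (y - y')) by (apply Rmult_le_compat_r; lra).
  assert (0 <= L * Yb * Rabs (y - y')) by pos. assert (0 <= (alpha + beta) * Rabs (x - x')) by pos. lra.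
Qed.

(** Here [eta] and [mu] combine into one drift. With [eta = 1 + delta * eta1] and [mu = delta * mu1]
    it is [delta] times [m = - sg * (eta1 - mu1 / A)], so [m < mc] is a half line in [eta1] whose
    end point moves by [mu1 / A]: the affine form of [etaL] and [etaR]. *)
Lemma half_solution_of_vf (sg A : R) (psi : R -> R) (eps eta mu : R) (x y : R -> R) (a : R) : sg = 1 \/ sg = -1 -> 0 < A ->
  (forall x, rate eps x = A + sg * beta * psi (sg * (1 - x))) ->
  (forall t, a <= t -> is_derive x t (vf1 eps (x t) (y t)) /\ is_derive y t (vf2 eps eta mu (x t) (y t))) ->
  half_solution A beta sg psi mu (- sg * (eta - 1 - mu / A))
    (fun t => sg * (1 - x t)) (fun t => sg * (1 + 1 / A - (x t + y t))) a.
Proof.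
  intros Hsg HA Hrate Hs t Ht. destruct (Hs t Ht) as [Dx Dy].
  assert (Haff : forall c (g : R -> R) d, is_derive g t d -> is_derive (fun s => sg * (c - g s)) t (sg * - d)).
  { intros c g d Hd. apply is_derive_scal. replace (- d) with (minus 0 d) by (unfold minus, plus, opp; simpl; ring).
    apply @is_derive_minus; [apply @is_derive_const | exact Hd]. }
  assert (HU := Haff 1 x _ Dx). assert (HW := Haff (1 + 1 / A) (fun s => x s + y s) _ (is_derive_plus x y t _ _ Dx Dy)).
  unfold vf1, vf2 in *. rewrite Hrate in HU, HW. unfold plus in HW; simpl in HW.
  set (p := psi (sg * (1 - x t))) in *.
  split; [refine (eq_rect _ (fun v => is_derive _ t v) HU _ _) | refine (eq_rect _ (fun v => is_derive _ t v) HW _ _)];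
    unfold field_U, field_W; fold p; destruct Hsg as [-> | ->]; simpl; field; lra.
Qed.

Variables eps eta mu Xb Yb : R.
Hypothesis Heps : 0 < eps.
Hypothesis Heta : 0 < eta.
Hypothesis Hmu : 0 <= mu.
Hypothesis HYb : eta < alpha * Yb.
Hypothesis HXb : (alpha + beta) * Yb < Xb.

Definition box (x y : R) : Prop := 0 < x < Xb /\ 0 < y < Yb.

Let Yb_pos : 0 < Yb.
Proof. apply Rmult_lt_reg_l with alpha; lra. Qed.

Let Xb_pos : 0 < Xb.
Proof. assert (0 < (alpha + beta) * Yb) by pos. lra. Qed.

Lemma box_open : open2 box.
Proof.
  intros x y [Hx Hy]. set (d := Rmin (Rmin x (Xb - x)) (Rmin y (Yb - y))).
  exists d. split; [unfold d; repeat apply Rmin_pos; lra|].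
  intros x' y' Hx' Hy'.
  pose proof (Rmin_l (Rmin x (Xb - x)) (Rmin y (Yb - y))). pose proof (Rmin_r (Rmin x (Xb - x)) (Rmin y (Yb - y))).
  pose proof (Rmin_l x (Xb - x)). pose proof (Rmin_r x (Xb - x)). pose proof (Rmin_l y (Yb - y)). pose proof (Rmin_r y (Yb - y)).
  fold d in H, H0. apply Rabs_lt_between in Hx', Hy'. unfold box. lra.
Qed.

Lemma box_invariant (x y : R -> R) : forward_solution (vf1 eps) (vf2 eps eta mu) x y -> box (x 0) (y 0) ->
  forall t, 0 <= t -> box (x t) (y t).
Proof.
  intros Hs [Hx Hy]. apply (box_stay x y (fun t => rate eps (x t)) (fun v => v) eta mu Xb Yb); try assumption.
  - intros t. apply rate_range.
  - reflexivity.
  - intros t Ht. apply (Hs t Ht).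
  - intros t Ht. apply (Hs t Ht).
Qed.

Lemma box_lipschitz : exists L, 0 < L /\ forall x y x' y', box x y -> box x' y' ->
  Rabs (vf1 eps x y - vf1 eps x' y') <= L * (Rabs (x - x') + Rabs (y - y')) /\
  Rabs (vf2 eps eta mu x y - vf2 eps eta mu x' y') <= L * (Rabs (x - x') + Rabs (y - y')).
Proof.
  destruct (growth_lipschitz eps Xb Yb Heps Xb_pos Yb_pos) as (L & HL & H).
  exists (L + 1 + mu). split; [lra|]. intros x y x' y' [Hx Hy] [Hx' Hy'].
  specialize (H x y x' y' ltac:(lra) ltac:(lra) ltac:(lra) ltac:(lra)).
  pose proof (Rabs_pos (x - x')). pose proof (Rabs_pos (y - y')).
  assert (0 <= mu * Rabs (y - y')) by pos. assert (0 <= mu * Rabs (x - x')) by pos.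
  unfold vf1, vf2. split.
  - replace (rate eps x * y - x - (rate eps x' * y' - x')) with ((rate eps x * y - rate eps x' * y') + - (x - x')) by ring.
    eapply Rle_trans; [apply Rabs_triang|]. rewrite Rabs_Ropp. lra.
  - replace (eta - (mu + rate eps x) * y - (eta - (mu + rate eps x') * y'))
      with (- ((rate eps x * y - rate eps x' * y') + mu * (y - y'))) by ring.
    rewrite Rabs_Ropp. eapply Rle_trans; [apply Rabs_triang|]. rewrite Rabs_mult, (Rabs_pos_eq mu) by lra. lra.
Qed.

Lemma box_bound : exists M, 0 < M /\ forall x y, box x y -> Rabs (vf1 eps x y) <= M /\ Rabs (vf2 eps eta mu x y) <= M.
Proof.
  exists (Xb + eta + (mu + alpha + beta) * Yb). assert (0 <= mu * Yb) by pos. assert (0 < (alpha + beta) * Yb) by pos. split; [lra|].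
  intros x y [Hx Hy]. pose proof (rate_range eps x) as Hr.
  assert (0 < rate eps x * y) by (apply Rmult_lt_0_compat; lra).
  assert (rate eps x * y <= (alpha + beta) * Yb) by (apply Rmult_le_compat; lra).
  assert (0 <= mu * y) by pos. assert (mu * y <= mu * Yb) by (apply Rmult_le_compat_l; lra).
  unfold vf1, vf2. split; apply Rabs_le_between; lra.
Qed.

(** Truncation makes the field globally Lipschitz. The box is invariant for the truncated field too,
    so its solution never feels the truncation. *)
Lemma vf_existence (x0 y0 : R) : box x0 y0 ->
  exists x y, x 0 = x0 /\ y 0 = y0 /\ forward_solution (vf1 eps) (vf2 eps eta mu) x y.
Proof.
  intros [Hx Hy].
  destruct (growth_lipschitz eps Xb Yb Heps Xb_pos Yb_pos) as (L & HL & H).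
  set (P := fun x y => rate eps (clamp Xb x) * clamp Yb y).
  assert (HP : forall x y x' y', Rabs (P x y - P x' y') <= L * (Rabs (x - x') + Rabs (y - y'))).
  { intros x y x' y'. eapply Rle_trans; [apply H; apply clamp_range; lra|]. apply Rmult_le_compat_l; [lra|].
    apply Rplus_le_compat; apply clamp_lipschitz. }
  destruct (picard (fun x y => P x y - x) (fun x y => eta - (P x y + mu * clamp Yb y)) (L + 1 + mu) x0 y0) as (x & y & E1 & E2 & Hs).
  { lra. }
  { intros x y x' y'. pose proof (HP x y x' y') as H1. pose proof (Rabs_pos (x - x')). pose proof (Rabs_pos (y - y')).
    assert (0 <= mu * Rabs (y - y')) by pos. assert (0 <= mu * Rabs (x - x')) by pos.
    replace (P x y - x - (P x' y' - x')) with ((P x y - P x' y') + - (x - x')) by ring.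
    eapply Rle_trans; [apply Rabs_triang|]. rewrite Rabs_Ropp. lra. }
  { intros x y x' y'. pose proof (HP x y x' y') as H1. pose proof (Rabs_pos (x - x')). pose proof (Rabs_pos (y - y')).
    assert (mu * Rabs (clamp Yb y - clamp Yb y') <= mu * Rabs (y - y')) by (apply Rmult_le_compat_l; [lra | apply clamp_lipschitz]).
    assert (0 <= mu * Rabs (x - x')) by pos.
    replace (eta - (P x y + mu * clamp Yb y) - (eta - (P x' y' + mu * clamp Yb y')))
      with (- ((P x y - P x' y') + mu * (clamp Yb y - clamp Yb y'))) by ring.
    rewrite Rabs_Ropp. eapply Rle_trans; [apply Rabs_triang|]. rewrite Rabs_mult, (Rabs_pos_eq mu) by lra. lra. }
  exists x, y. split; [exact E1|]. split; [exact E2|].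
  assert (HB : forall t, 0 <= t -> 0 < x t < Xb /\ 0 < y t < Yb).
  { apply (box_stay x y (fun t => rate eps (clamp Xb (x t))) (clamp Yb) eta mu Xb Yb); try assumption.
    - intros t. apply rate_range.
    - intros v Hv. apply clamp_id, Hv.
    - intros t _. apply Hs.
    - intros t _. destruct (Hs t) as [_ D]. refine (eq_rect _ (fun v => is_derive _ t v) D _ _). unfold P. simpl. ring.
    - rewrite E1. exact Hx.
    - rewrite E2. exact Hy. }
  intros t Ht. destruct (HB t Ht) as [Bx By]. destruct (Hs t) as [D1 D2].
  unfold P in D1, D2. rewrite (clamp_id Xb (x t)) in D1, D2 by lra. rewrite (clamp_id Yb (y t)) in D1, D2 by lra.
  split; [exact D1|]. refine (eq_rect _ (fun v => is_derive _ t v) D2 _ _). unfold vf2. simpl. ring.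
Qed.

End Field.

Definition side_U (sg x : R) : R := sg * (1 - x).
Definition side_W (sg A x y : R) : R := sg * (1 + 1 / A - (x + y)).

Lemma side_coordinates (sg A x y : R) : sg = 1 \/ sg = -1 -> (x, y) = side_point sg A (side_U sg x) (side_W sg A x y).
Proof. intros [-> | ->]; unfold side_point, side_U, side_W; f_equal; ring. Qed.

Section Assembly.
Variables alpha beta : R.
Hypothesis Halpha : 0 < alpha < 1.
Hypothesis Hab : 1 < alpha + beta.

Let R0 := beta / (alpha * (alpha + beta)).

Let R0_pos : 0 < R0.
Proof. unfold R0. apply Rdiv_lt_0_compat; [lra | apply Rmult_lt_0_compat; lra]. Qed.

Definition left_point (t : R) : plane := side_point 1 alpha (lin_U 1 alpha R0 t) (lin_W 1 alpha R0 t).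
Definition right_point (t : R) : plane :=
  side_point (-1) (alpha + beta) (lin_U (alpha + beta) 1 R0 t) (lin_W (alpha + beta) 1 R0 t).

(** The restriction to one side in [Gamma0L] and [Gamma0R] is automatic, since [lin_U] is
    nonnegative; both halves are the linear orbit with the same initial height [R0]. *)
Lemma Gamma0_iff (p : plane) : Gamma0 alpha beta p <->
  (exists t, 0 <= t /\ p = left_point t) \/ (exists t, 0 <= t /\ p = right_point t).
Proof.
  assert (EL : pR alpha beta = side_point 1 alpha 0 R0).
  { unfold pR, side_point, R0. f_equal; field; lra. }
  assert (ER : pL alpha = side_point (-1) (alpha + beta) 0 R0).
  { unfold pL, side_point, R0. f_equal; field; lra. }
  pose proof (linear_forward_orbit 1 alpha 1 alpha R0 ltac:(lra) ltac:(lra) ltac:(lra) (pR alpha beta) p EL) as HL.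
  pose proof (linear_forward_orbit (-1) (alpha + beta) (alpha + beta) 1 R0 ltac:(lra) ltac:(lra) ltac:(lra) (pL alpha) p ER) as HR.
  unfold Gamma0, Gamma0L, Gamma0R. fold (left_point) in HL. split.
  - intros [[H _]|[H _]]; [left; apply HL, H | right; apply HR, H].
  - intros [(t & Ht & E)|(t & Ht & E)]; [left | right].
    + split; [apply HL; exists t; auto|]. rewrite E. simpl.
      pose proof (lin_U_nonneg 1 alpha R0 ltac:(lra) R0_pos t Ht). lra.
    + split; [apply HR; exists t; auto|]. rewrite E. simpl.
      pose proof (lin_U_nonneg (alpha + beta) 1 R0 ltac:(lra) R0_pos t Ht). lra.
Qed.

Variables (k : nat) (phi phiL phiR : R -> R).
Hypothesis Hphi : sigmoidal k phi phiL phiR.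

Lemma rate_left (eps x : R) : rate alpha beta phi eps x = alpha + 1 * beta * phi (/ eps * - (1 * (1 - x))).
Proof. unfold rate. replace (/ eps * - (1 * (1 - x))) with (/ eps * (x - 1)) by ring. ring. Qed.

Lemma rate_right (eps x : R) : rate alpha beta phi eps x = (alpha + beta) + -1 * beta * (1 - phi (/ eps * (-1 * (1 - x)))).
Proof. unfold rate. replace (/ eps * (-1 * (1 - x))) with (/ eps * (x - 1)) by ring. ring. Qed.

(** An orbit within Hausdorff distance [c] comes close to the centre [p] of the trapped neighborhood
    and also to [q], which lies on the other side. Trapping forbids the second visit after the
    first, while periodicity makes every visit recur later. *)
Lemma trapped_excludes (sg A kf ks : R) (psi : R -> R) (eps eta mu t0 rad c : R) (q : plane) : sg = 1 \/ sg = -1 -> 0 < A ->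
  (forall x, rate alpha beta phi eps x = A + sg * beta * psi (sg * (1 - x))) ->
  (forall U W a, half_solution A beta sg psi mu (- sg * (eta - 1 - mu / A)) U W a ->
     Rabs (U a - lin_U kf ks R0 t0) <= rad -> Rabs (W a - lin_W kf ks R0 t0) <= rad -> forall t, a <= t -> 0 < U t) ->
  2 * c <= rad -> Gamma0 alpha beta (side_point sg A (lin_U kf ks R0 t0) (lin_W kf ks R0 t0)) ->
  Gamma0 alpha beta q -> side_U sg (fst q) <= - c ->
  no_limit_cycle_within c (vf alpha beta phi eps eta mu) (Gamma0 alpha beta).
Proof.
  intros Hsg HA Hrate Htrap Hc Hp Hq Hqc (G' & [[(Z & T & HZ & HT & Hper & _ & HG) _] Hd]).
  set (p := side_point sg A (lin_U kf ks R0 t0) (lin_W kf ks R0 t0)) in *.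
  destruct (hausdorff_dist_lt _ _ _ Hd p Hp) as (a & Ga & Da). destruct (hausdorff_dist_lt _ _ _ Hd q Hq) as (b & Gb & Db).
  destruct (proj1 (HG a) Ga) as [s Hs]. destruct (proj1 (HG b) Gb) as [s' Hs'].
  destruct (dist2_ge a p) as [A1 A2]. destruct (dist2_ge b q) as [B1 _].
  pose proof (solution_components _ _ _ (vf_eq alpha beta phi eps eta mu) Z HZ) as HZc.
  assert (HU : forall t, s <= t -> 0 < sg * (1 - fst (Z t))).
  { apply (Htrap (fun t => sg * (1 - fst (Z t))) (fun t => sg * (1 + 1 / A - (fst (Z t) + snd (Z t)))) s).
    - apply half_solution_of_vf with (eps := eps) (phi := phi) (alpha := alpha); try assumption.
      intros t _. apply HZc.
    - rewrite Hs.
      replace (sg * (1 - fst a) - lin_U kf ks R0 t0) with (sg * - (fst a - fst p)).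
      2:{ unfold p, side_point; simpl. destruct Hsg as [-> | ->]; ring. }
      rewrite (sg_mult_abs sg _ Hsg), Rabs_Ropp. pose proof (Rabs_pos (fst a - fst p)). lra.
    - rewrite Hs.
      replace (sg * (1 + 1 / A - (fst a + snd a)) - lin_W kf ks R0 t0) with (sg * - ((fst a - fst p) + (snd a - snd p))).
      2:{ unfold p, side_point; simpl. destruct Hsg as [-> | ->]; ring. }
      rewrite (sg_mult_abs sg _ Hsg), Rabs_Ropp. eapply Rle_trans; [apply Rabs_triang | lra]. }
  destruct (nat_multiple_above T (s' - s) HT) as [n Hn].
  assert (Zn : forall (n : nat) t, Z (t + INR n * T) = Z t).
  { clear n Hn. induction n; intros t; [simpl; f_equal; ring|]. rewrite S_INR.
    replace (t + (INR n + 1) * T) with ((t + INR n * T) + T) by ring. rewrite Hper. apply IHn. }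
  specialize (HU (s' + INR n * T) ltac:(lra)). rewrite Zn, Hs' in HU.
  assert (E : sg * (1 - fst b) = side_U sg (fst q) + sg * - (fst b - fst q)) by (unfold side_U; ring).
  assert (Hb : sg * - (fst b - fst q) <= Rabs (fst b - fst q)).
  { rewrite <- (Rabs_Ropp (fst b - fst q)), <- (sg_mult_abs sg _ Hsg). apply Rle_abs. }
  lra.
Qed.

Definition half_passage (A kf ks sg : R) (psi : R -> R) (mu m0 rad err Tmax : R) : Prop :=
  (forall U W, half_solution A beta sg psi mu m0 U W 0 -> U 0 = 0 -> Rabs (W 0 - R0) <= rad ->
    0 < field_U A beta sg psi (U 0) (W 0) /\
    exists T, T <= Tmax /\ first_return U T /\ field_U A beta sg psi (U T) (W T) < 0 /\
      Rabs (W T) <= err /\ exp (- ks * T) <= err /\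
      forall t, 0 <= t <= T ->
        Rabs (ks * W t - U t - ks * W 0 * exp (- kf * t)) <= err /\
        Rabs (kf * W t - U t - kf * W 0 * exp (- ks * t)) <= err) /\
  (forall U1 W1 T1 U2 W2 T2,
    half_solution A beta sg psi mu m0 U1 W1 0 -> U1 0 = 0 -> Rabs (W1 0 - R0) <= rad -> first_return U1 T1 ->
    half_solution A beta sg psi mu m0 U2 W2 0 -> U2 0 = 0 -> Rabs (W2 0 - R0) <= rad -> first_return U2 T2 ->
    Rabs (W2 T2 - W1 T1) <= 1 / 2 * Rabs (W2 0 - W1 0)).

Lemma half_passage_weaken (A kf ks sg : R) (psi : R -> R) (mu m0 rad err err' Tmax : R) : err <= err' ->
  half_passage A kf ks sg psi mu m0 rad err Tmax -> half_passage A kf ks sg psi mu m0 rad err' Tmax.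
Proof.
  intros He [H1 H2]. split; [|exact H2]. intros U W Hs HU HW.
  destruct (H1 U W Hs HU HW) as (Hf & T & HT & Hr & Hn & HWT & Hexp & Htr).
  split; [exact Hf|]. exists T. split; [exact HT|]. split; [exact Hr|]. split; [exact Hn|]. split; [lra|]. split; [lra|].
  intros t Ht. destruct (Htr t Ht). lra.
Qed.

Section Cycle.
Variables eps eta mu Xb Yb r radL radR err TL TR : R.
Hypothesis Heps : 0 < eps.
Hypothesis Heta : 0 < eta.
Hypothesis Hmu : 0 <= mu.
Hypothesis HYb : eta < alpha * Yb.
Hypothesis HXb : (alpha + beta) * Yb < Xb.
Hypothesis HXb1 : 1 < Xb.
Hypothesis HPL : half_passage alpha 1 alpha 1 (fun U => phi (/ eps * - U)) mu (- (1) * (eta - 1 - mu / alpha)) radL err TL.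
Hypothesis HPR : half_passage (alpha + beta) (alpha + beta) 1 (-1) (fun U => 1 - phi (/ eps * U)) mu
  (- -1 * (eta - 1 - mu / (alpha + beta))) radR err TR.
Hypothesis Hr : 0 < r < / (alpha + beta).
Hypothesis HrL : r <= radL.
Hypothesis HrY : / (alpha + beta) + r < Yb.
Hypothesis Herr : err <= radR /\ err <= r / 2 /\ err <= 1 / 2.

Let ys := / (alpha + beta).
Let F := vf alpha beta phi eps eta mu.
Let f1 := vf1 alpha beta phi eps.
Let f2 := vf2 alpha beta phi eps eta mu.

Definition lap (x y : R -> R) (T1 T2 : R) : Prop :=
  let UL := fun t => side_U 1 (x t) in let WL := fun t => side_W 1 alpha (x t) (y t) in
  let UR := fun t => side_U (-1) (x (T1 + t)) in let WR := fun t => side_W (-1) (alpha + beta) (x (T1 + t)) (y (T1 + t)) in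
  (T1 <= TL /\ first_return UL T1 /\ Rabs (WL T1) <= err /\ exp (- alpha * T1) <= err /\
   forall t, 0 <= t <= T1 ->
     Rabs (alpha * WL t - UL t - alpha * WL 0 * exp (- (1) * t)) <= err /\
     Rabs (1 * WL t - UL t - 1 * WL 0 * exp (- alpha * t)) <= err) /\
  (Rabs (WR 0 - R0) <= err /\ T2 <= TR /\ first_return UR T2 /\ Rabs (WR T2) <= err /\ exp (- (1) * T2) <= err /\
   forall t, 0 <= t <= T2 ->
     Rabs (1 * WR t - UR t - 1 * WR 0 * exp (- (alpha + beta) * t)) <= err /\
     Rabs ((alpha + beta) * WR t - UR t - (alpha + beta) * WR 0 * exp (- (1) * t)) <= err).

Lemma left_half (x y : R -> R) : forward_solution f1 f2 x y ->
  half_solution alpha beta 1 (fun U => phi (/ eps * - U)) mu (- (1) * (eta - 1 - mu / alpha))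
    (fun t => side_U 1 (x t)) (fun t => side_W 1 alpha (x t) (y t)) 0.
Proof.
  intros Hs. apply (half_solution_of_vf alpha beta phi 1 alpha (fun U => phi (/ eps * - U)) eps eta mu x y 0);
    [left; reflexivity | lra | intros z; apply rate_left | exact Hs].
Qed.

Lemma right_half (x y : R -> R) : forward_solution f1 f2 x y ->
  half_solution (alpha + beta) beta (-1) (fun U => 1 - phi (/ eps * U)) mu (- -1 * (eta - 1 - mu / (alpha + beta)))
    (fun t => side_U (-1) (x t)) (fun t => side_W (-1) (alpha + beta) (x t) (y t)) 0.
Proof.
  intros Hs. apply (half_solution_of_vf alpha beta phi (-1) (alpha + beta) (fun U => 1 - phi (/ eps * U)) eps eta mu x y 0);
    [right; reflexivity | lra | intros z; apply rate_right | exact Hs].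
Qed.

Lemma section_left (y : R) : side_U 1 1 = 0 /\ side_W 1 alpha 1 y - R0 = - (y - ys).
Proof. unfold side_U, side_W, R0, ys. split; [ring | field; lra]. Qed.

(** The exit height on the left is, up to sign, the deviation of the entry height on the right from
    [R0]. Exits lie [O(delta)] from the node, so entries lie [O(delta)] from [R0]; this links the
    two half maps. *)
Lemma section_right (y : R) : side_U (-1) 1 = 0 /\ side_W (-1) (alpha + beta) 1 y = y - ys /\
  side_W (-1) (alpha + beta) 1 y - R0 = - side_W 1 alpha 1 y.
Proof. unfold side_U, side_W, R0, ys. split; [ring | split; field; lra]. Qed.

Lemma side_U_zero (sg x : R) : sg = 1 \/ sg = -1 -> side_U sg x = 0 -> x = 1.
Proof. unfold side_U. intros [-> | ->] H; lra. Qed.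

Lemma lap_exists (x y : R -> R) : forward_solution f1 f2 x y -> x 0 = 1 -> Rabs (y 0 - ys) <= r ->
  f1 1 (y 0) < 0 /\ exists T1 T2, lap x y T1 T2.
Proof.
  intros Hs E1 Hy. destruct HPL as [HL _]. destruct HPR as [HR _].
  destruct (section_left (y 0)) as [EU EW].
  destruct (HL _ _ (left_half x y Hs)) as (Hf & T1 & HT1 & Hr1 & _ & HW1 & He1 & Htr1); cbv beta.
  { rewrite E1. exact EU. }
  { rewrite E1, EW, Rabs_Ropp. lra. }
  cbv beta in Hf. rewrite E1 in Hf. split.
  { replace (f1 1 (y 0)) with (- field_U alpha beta 1 (fun U => phi (/ eps * - U)) (side_U 1 1) (side_W 1 alpha 1 (y 0))); [lra|].
    unfold f1, vf1. rewrite rate_left. unfold field_U, side_U, side_W.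
    set (p := phi (/ eps * - (1 * (1 - 1)))). field. lra. }
  exists T1. pose proof Hr1 as (HT1p & EU1 & _).
  apply (side_U_zero 1 (x T1) (or_introl eq_refl)) in EU1.
  pose proof (forward_solution_shift f1 f2 x y T1 (Rlt_le _ _ HT1p) Hs) as Hs1.
  destruct (section_right (y T1)) as (EU2 & EW2 & EW3).
  assert (HW0 : Rabs (side_W (-1) (alpha + beta) (x (T1 + 0)) (y (T1 + 0)) - R0) <= err).
  { pose proof HW1 as HW1'. rewrite EU1 in HW1'. rewrite Rplus_0_r, EU1, EW3, Rabs_Ropp. exact HW1'. }
  destruct (HR _ _ (right_half _ _ Hs1)) as (_ & T2 & HT2 & Hr2 & _ & HW2 & He2 & Htr2); cbv beta.
  { rewrite Rplus_0_r, EU1. exact EU2. }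
  { lra. }
  exists T2. split; [exact (conj HT1 (conj Hr1 (conj HW1 (conj He1 Htr1)))) | exact (conj HW0 (conj HT2 (conj Hr2 (conj HW2 (conj He2 Htr2)))))].
Qed.

Definition full_return (x : R -> R) (T : R) : Prop := exists T1 T2, T = T1 + T2 /\
  first_return (fun t => side_U 1 (x t)) T1 /\ first_return (fun t => side_U (-1) (x (T1 + t))) T2.

Lemma full_return_ext (x x' : R -> R) (T : R) : (forall t, 0 <= t -> x t = x' t) -> full_return x T -> full_return x' T.
Proof.
  intros E (T1 & T2 & ET & (P1 & Z1 & N1) & (P2 & Z2 & N2)). exists T1, T2. split; [exact ET|]. split; split; try assumption.
  - rewrite <- E by lra. split; [exact Z1|]. intros t Ht. rewrite <- E by lra. apply N1, Ht.
  - rewrite <- E by lra. split; [exact Z2|]. intros t Ht. rewrite <- E by lra. apply N2, Ht.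
Qed.

Lemma return_section (x y : R -> R) : forward_solution f1 f2 x y -> x 0 = 1 -> Rabs (y 0 - ys) <= r ->
  f1 1 (y 0) < 0 /\ exists T, 1 / 2 <= T <= TL + TR /\ full_return x T /\ x T = 1 /\ Rabs (y T - ys) <= r / 2.
Proof.
  intros Hs E1 Hy. destruct (lap_exists x y Hs E1 Hy) as (Hf & T1 & T2 & (HT1 & R1 & _ & He1 & _) & (_ & HT2 & R2 & HW2 & _ & _)).
  split; [exact Hf|]. exists (T1 + T2). pose proof R1 as (P1 & _ & _). pose proof R2 as (P2 & Z2 & _).
  apply (side_U_zero (-1) _ (or_intror eq_refl)) in Z2. split; [|split; [|split; [exact Z2|]]].
  (* [exp (- alpha * T1) <= 1 / 2] and [alpha < 1] force [T1 >= 1 / 2]. *)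
  - split; [|lra]. pose proof (exp_ineq1_le (- alpha * T1)).
    assert (alpha * T1 <= 1 * T1) by (apply Rmult_le_compat_r; lra). lra.
  - exists T1, T2. auto.
  - rewrite Z2 in HW2. rewrite (proj1 (proj2 (section_right (y (T1 + T2))))) in HW2. lra.
Qed.

Lemma return_contraction (x1 y1 : R -> R) (T1 : R) (x2 y2 : R -> R) (T2 : R) :
  forward_solution f1 f2 x1 y1 -> x1 0 = 1 -> Rabs (y1 0 - ys) <= r -> full_return x1 T1 ->
  forward_solution f1 f2 x2 y2 -> x2 0 = 1 -> Rabs (y2 0 - ys) <= r -> full_return x2 T2 ->
  Rabs (y1 T1 - y2 T2) <= 1 / 2 * Rabs (y1 0 - y2 0).
Proof.
  intros S1 E1 D1 (a1 & b1 & -> & A1 & B1) S2 E2 D2 (a2 & b2 & -> & A2 & B2).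
  destruct (lap_exists x1 y1 S1 E1 D1) as (_ & a1' & b1' & (_ & A1' & _) & (W1 & _ & B1' & _)).
  destruct (lap_exists x2 y2 S2 E2 D2) as (_ & a2' & b2' & (_ & A2' & _) & (W2 & _ & B2' & _)).
  pose proof (first_return_unique _ _ _ A1 A1'); subst a1'. pose proof (first_return_unique _ _ _ A2 A2'); subst a2'.
  pose proof A1 as (P1 & Z1 & _). pose proof A2 as (P2 & Z2 & _). pose proof B1 as (_ & Z3 & _). pose proof B2 as (_ & Z4 & _).
  apply (side_U_zero 1 _ (or_introl eq_refl)) in Z1, Z2. apply (side_U_zero (-1) _ (or_intror eq_refl)) in Z3, Z4.
  assert (HL : Rabs (side_W 1 alpha (x1 a1) (y1 a1) - side_W 1 alpha (x2 a2) (y2 a2)) <= 1 / 2 * Rabs (y1 0 - y2 0)).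
  { destruct HPL as [_ HC].
    assert (C := fun I1 I2 I3 => HC _ _ a2 _ _ a1 (left_half x2 y2 S2) I1 I2 I3 (left_half x1 y1 S1)).
    cbv beta in C. rewrite E1, E2, !(proj2 (section_left _)), !Rabs_Ropp, (proj1 (section_left 0)) in C.
    eapply Rle_trans; [apply C; (assumption || reflexivity || lra)|]. apply Req_le. f_equal.
    rewrite <- Rabs_Ropp. f_equal. unfold side_W. ring. }
  assert (HR : Rabs (y1 (a1 + b1) - y2 (a2 + b2)) <= 1 / 2 * Rabs (side_W 1 alpha (x1 a1) (y1 a1) - side_W 1 alpha (x2 a2) (y2 a2))).
  { destruct HPR as [_ HC].
    pose proof (right_half _ _ (forward_solution_shift f1 f2 x1 y1 a1 (Rlt_le _ _ P1) S1)) as H1.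
    pose proof (right_half _ _ (forward_solution_shift f1 f2 x2 y2 a2 (Rlt_le _ _ P2) S2)) as H2.
    assert (C := fun I1 I2 I3 => HC _ _ b2 _ _ b1 H2 I1 I2 I3 H1).
    cbv beta in C. rewrite !Rplus_0_r, Z1, Z2, Z3, Z4, (proj1 (section_right 0)) in C.
    rewrite Rplus_0_r, Z1 in W1. rewrite Rplus_0_r, Z2 in W2.
    specialize (C eq_refl ltac:(lra) B2 eq_refl ltac:(lra) B1).
    rewrite Z1, Z2. eapply Rle_trans; [|eapply Rle_trans; [exact C|]]; apply Req_le.
    - f_equal. unfold side_W. ring.
    - f_equal. rewrite <- Rabs_Ropp. f_equal. unfold side_W. ring. }
  pose proof (Rabs_pos (y1 0 - y2 0)). lra.
Qed.

Let K := tracking_constant 1 alpha R0 + tracking_constant (alpha + beta) 1 R0.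

Lemma tracking_constant_pos (kf ks : R) : 0 < ks < kf -> 0 < tracking_constant kf ks R0.
Proof. intros H. unfold tracking_constant. assert (0 < kf - ks) by lra. assert (0 < (2 * (1 + kf) * (1 + kf) + kf * (1 + kf) * (R0 + 1)) / (kf - ks)) by pos. lra. Qed.

Lemma relaxation_cycle : exists G, limit_cycle F G /\ attracting F G /\
  (forall a, G a -> exists b, Gamma0 alpha beta b /\ dist2 a b <= 3 * (K * err)) /\
  (forall b, Gamma0 alpha beta b -> exists a, G a /\ dist2 a b <= 3 * (K * err)).
Proof.
  assert (Hb : 0 < beta) by lra.
  destruct (box_lipschitz alpha beta ltac:(lra) Hb k phi phiL phiR Hphi eps eta mu Xb Yb) as (L & HL & Hlip); try assumption.
  destruct (box_bound alpha beta ltac:(lra) Hb k phi phiL phiR Hphi eps eta mu Xb Yb) as (M & HM & Hbd); try assumption.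
  pose proof (box_invariant alpha beta ltac:(lra) Hb k phi phiL phiR Hphi eps eta mu Xb Yb) as Hinv.
  specialize (Hinv ltac:(assumption) ltac:(assumption) ltac:(assumption) ltac:(assumption)).
  pose proof (vf_existence alpha beta ltac:(lra) Hb k phi phiL phiR Hphi eps eta mu Xb Yb) as Hex.
  specialize (Hex ltac:(assumption) ltac:(assumption) ltac:(assumption) ltac:(assumption) ltac:(assumption)).
  assert (Hsec : forall w, Rabs (w - ys) <= r -> box Xb Yb 1 w).
  { intros w Hw. apply Rabs_le_between in Hw. unfold ys in Hw. unfold box. lra. }
  destruct (periodic_solution f1 f2 (box Xb Yb) L HL Hinv Hlip Hex ys r (1 / 2) (TL + TR) full_return
    ltac:(lra) ltac:(lra) Hsec full_return_ext return_section return_contraction)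
    as (X & Y & T & l & Hsol & Hper & Hbox & X0 & Y0 & Hl & HT & HXT).
  exists (orbit_of X Y).
  split; [|split].
  - apply (orbit_limit_cycle F f1 f2 (box Xb Yb) L M (vf_eq alpha beta phi eps eta mu) HL HM (box_open Xb Yb) Hinv Hlip Hbd
      ys r (1 / 2) (TL + TR) full_return ltac:(lra) ltac:(lra) Hsec return_section return_contraction X Y T l); assumption.
  - apply (orbit_attracting F f1 f2 (box Xb Yb) L M (vf_eq alpha beta phi eps eta mu) HL HM (box_open Xb Yb) Hinv Hlip Hbd
      ys r (1 / 2) (TL + TR) full_return ltac:(lra) ltac:(lra) Hsec return_section return_contraction X Y T l); assumption.
  - destruct (lap_exists X Y (fun t _ => Hsol t) X0 ltac:(rewrite Y0; lra)) as (_ & T1 & T2 &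
      (HT1 & R1 & HW1 & He1 & Htr1) & (HW0 & HT2 & R2 & HW2 & He2 & Htr2)).
    destruct HXT as (T1' & T2' & ET & R1' & R2').
    pose proof (first_return_unique _ _ _ R1' R1); subst T1'. pose proof (first_return_unique _ _ _ R2' R2); subst T2'.
    pose proof R1 as (P1 & Z1 & _). pose proof R2 as (P2 & Z2 & _).
    (* A priori the starting height is only within [r] of [R0]. By periodicity it is also the height
       at the end of the right half, where the deviation is at most [err]. *)
    assert (HWL0 : Rabs (side_W 1 alpha (X 0) (Y 0) - R0) <= err).
    { assert (YT : Y (T1 + T2) = Y 0).
      { rewrite <- ET. rewrite <- (Rplus_0_l T). apply Hper. }
      rewrite X0, (proj2 (section_left (Y 0))), Rabs_Ropp, <- YT.
      rewrite (side_U_zero _ _ (or_intror eq_refl) Z2) in HW2. rewrite (proj1 (proj2 (section_right _))) in HW2. exact HW2. }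
    destruct (side_tracking 1 alpha R0 ltac:(lra) R0_pos (fun t => side_U 1 (X t)) (fun t => side_W 1 alpha (X t) (Y t))
      T1 err P1 HWL0 Z1 HW1 He1 Htr1) as [TL1 TL2].
    destruct (side_tracking (alpha + beta) 1 R0 ltac:(lra) R0_pos (fun t => side_U (-1) (X (T1 + t)))
      (fun t => side_W (-1) (alpha + beta) (X (T1 + t)) (Y (T1 + t))) T2 err P2 HW0 Z2 HW2 He2 Htr2) as [TR1 TR2].
    pose proof (tracking_constant_pos 1 alpha ltac:(lra)) as K1. pose proof (tracking_constant_pos (alpha + beta) 1 ltac:(lra)) as K2.
    assert (Herr0 : 0 <= err) by (pose proof (Rabs_pos (side_W 1 alpha (X 0) (Y 0) - R0)); lra).
    assert (KL : tracking_constant 1 alpha R0 * err <= K * err) by (apply Rmult_le_compat_r; [exact Herr0 | unfold K; lra]).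
    assert (KR : tracking_constant (alpha + beta) 1 R0 * err <= K * err) by (apply Rmult_le_compat_r; [exact Herr0 | unfold K; lra]).
    assert (DL : forall t s, Rabs (side_U 1 (X s) - lin_U 1 alpha R0 t) <= tracking_constant 1 alpha R0 * err /\
      Rabs (side_W 1 alpha (X s) (Y s) - lin_W 1 alpha R0 t) <= tracking_constant 1 alpha R0 * err ->
      dist2 (X s, Y s) (left_point t) <= 3 * (K * err)).
    { intros t s [D1 D2]. rewrite (side_coordinates 1 alpha) by (left; reflexivity).
      apply dist2_side_point; [left; reflexivity | lra | lra]. }
    assert (DR : forall t s, Rabs (side_U (-1) (X (T1 + s)) - lin_U (alpha + beta) 1 R0 t) <= tracking_constant (alpha + beta) 1 R0 * err /\
      Rabs (side_W (-1) (alpha + beta) (X (T1 + s)) (Y (T1 + s)) - lin_W (alpha + beta) 1 R0 t) <= tracking_constant (alpha + beta) 1 R0 * err ->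
      dist2 (X (T1 + s), Y (T1 + s)) (right_point t) <= 3 * (K * err)).
    { intros t s [D1 D2]. rewrite (side_coordinates (-1) (alpha + beta)) by (right; reflexivity).
      apply dist2_side_point; [right; reflexivity | lra | lra]. }
    split.
    + intros a [t <-].
      assert (Hred : exists s, 0 <= s <= T /\ X s = X t /\ Y s = Y t).
      { destruct (XY_reduce (1 / 2) (TL + TR) ltac:(lra) X Y T Hper HT t) as (tau & Htau & Hred).
        exists (2 * T - tau). split; [lra|]. destruct (Hred (2 * T - tau)) as [<- <-].
        replace (t + tau + (2 * T - tau)) with (t + T + T) by ring.
        destruct (Hper (t + T)) as [-> ->]. apply Hper. }
      destruct Hred as (s & Hs & <- & <-). destruct (Rle_lt_dec s T1) as [H|H].
      * exists (left_point s). split; [apply Gamma0_iff; left; exists s; split; [lra | reflexivity]|].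
        apply DL, TL1. lra.
      * exists (right_point (s - T1)). split; [apply Gamma0_iff; right; exists (s - T1); split; [lra | reflexivity]|].
        replace (X s, Y s) with (X (T1 + (s - T1)), Y (T1 + (s - T1))) by (f_equal; f_equal; ring).
        apply DR, TR1. lra.
    + intros b Hbb. apply Gamma0_iff in Hbb. destruct Hbb as [(t & Ht & ->)|(t & Ht & ->)].
      * destruct (TL2 t Ht) as (s & _ & Ds). exists (X s, Y s). split; [exists s; reflexivity | apply DL, Ds].
      * destruct (TR2 t Ht) as (s & _ & Ds). exists (X (T1 + s), Y (T1 + s)). split; [exists (T1 + s); reflexivity | apply DR, Ds].
Qed.

End Cycle.
End Assembly.

Lemma no_limit_cycle_within_le (c c' : R) (F : plane -> plane) (G : plane -> Prop) : c <= c' ->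
  no_limit_cycle_within c' F G -> no_limit_cycle_within c F G.
Proof.
  intros Hc H (G' & HG & Hd). apply H. exists G'. split; [exact HG|].
  apply (Rbar_lt_le_trans _ c); [exact Hd | exact Hc].
Qed.

Section Conclusion.
Variables (k : nat) (alpha beta cL cR : R).
Hypothesis Hk : (0 < k)%nat.
Hypothesis Halpha : 0 < alpha < 1.
Hypothesis Hab : 1 < alpha + beta.
Hypothesis HcL : 0 < cL.
Hypothesis HcR : 0 < cR.
Variables phi phiL phiR : R -> R.
Hypothesis Hphi : sigmoidal k phi phiL phiR.
Hypothesis EcL : phiL 0 = cL.
Hypothesis EcR : phiR 0 = cR.

Let R0 := beta / (alpha * (alpha + beta)).
Let dl := eps_scale k.

Let R0_pos : 0 < R0.
Proof. unfold R0. apply Rdiv_lt_0_compat; [lra | apply Rmult_lt_0_compat; lra]. Qed.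

Let tail_left : tail_family k cL (phi 0) dl (fun e U => phi (/ e * - U)).
Proof. rewrite <- EcL. apply (tail_family_left k Hk phi phiL phiR Hphi). Qed.

Let tail_right : tail_family k cR (1 - phi 0) dl (fun e U => 1 - phi (/ e * U)).
Proof. rewrite <- EcR. apply (tail_family_right k Hk phi phiL phiR Hphi). Qed.

Lemma side_exclusion (sg A kf ks c psi0 : R) (psi : R -> R -> R) (m' m mu1 : R) (q : plane) :
  0 < ks < kf -> A = kf * ks -> 1 + A = kf + ks -> 0 < c -> sg = 1 \/ sg = -1 -> tail_family k c psi0 dl psi ->
  (forall e x, rate alpha beta phi e x = A + sg * beta * psi e (sg * (1 - x))) ->
  (forall t, 0 <= t -> Gamma0 alpha beta (side_point sg A (lin_U kf ks R0 t) (lin_W kf ks R0 t))) ->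
  Gamma0 alpha beta q -> side_U sg (fst q) < 0 -> 0 <= mu1 -> m' < m -> blocking k A kf ks (beta * c / A) m' ->
  exists d th, 0 < d /\ 0 < th /\ eventually0 (fun e => forall eta,
    dl e * m <= - sg * (eta - 1 - dl e * mu1 / A) <= th ->
    no_limit_cycle_within d (vf alpha beta phi e eta (dl e * mu1)) (Gamma0 alpha beta)).
Proof.
  intros Hks HA HA1 Hc Hsg HT Hrate HG Hq Hqn Hmu Hm Hbl.
  destruct (trapping k A kf ks beta sg c psi0 dl psi Hks HA HA1 ltac:(lra) Hc Hsg HT m' m mu1 R0 R0_pos Hmu Hm Hbl)
    as (t0 & rad & th & Ht0 & Hrad & Hth & Hev).
  exists (Rmin (rad / 2) (- side_U sg (fst q))), th. split; [apply Rmin_pos; lra|]. split; [exact Hth|].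
  eapply eventually0_impl; [exact Hev|]. intros e He H eta Heta.
  pose proof (Rmin_l (rad / 2) (- side_U sg (fst q))). pose proof (Rmin_r (rad / 2) (- side_U sg (fst q))).
  apply (trapped_excludes alpha beta phi sg A kf ks (psi e) e eta (dl e * mu1) t0 rad _ q Hsg).
  - rewrite HA. apply Rmult_lt_0_compat; lra.
  - intros x. apply Hrate.
  - intros U W a. apply (H (- sg * (eta - 1 - dl e * mu1 / A))). exact Heta.
  - lra.
  - apply HG. lra.
  - exact Hq.
  - lra.
Qed.

Lemma left_exclusion (m' m mu1 : R) : 0 <= mu1 -> m' < m -> blocking k alpha 1 alpha (beta * cL / alpha) m' ->
  exists d th, 0 < d /\ 0 < th /\ eventually0 (fun e => forall eta,
    dl e * m <= - (1) * (eta - 1 - dl e * mu1 / alpha) <= th ->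
    no_limit_cycle_within d (vf alpha beta phi e eta (dl e * mu1)) (Gamma0 alpha beta)).
Proof.
  intros Hmu Hm Hbl.
  apply (side_exclusion 1 alpha 1 alpha cL (phi 0) (fun e U => phi (/ e * - U)) m' m mu1 (right_point alpha beta 1));
    try assumption; try lra.
  - intros e x. apply rate_left.
  - intros t Ht. apply Gamma0_iff; [assumption | assumption|]. left. exists t. split; [exact Ht | reflexivity].
  - apply Gamma0_iff; [assumption | assumption|]. right. exists 1. split; [lra | reflexivity].
  - unfold right_point, side_U. simpl fst. pose proof (lin_U_pos (alpha + beta) 1 R0 1 ltac:(lra) R0_pos Rlt_0_1). fold R0. lra.
Qed.

Lemma right_exclusion (m' m mu1 : R) : 0 <= mu1 -> m' < m -> blocking k (alpha + beta) (alpha + beta) 1 (beta * cR / (alpha + beta)) m' ->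
  exists d th, 0 < d /\ 0 < th /\ eventually0 (fun e => forall eta,
    dl e * m <= - -1 * (eta - 1 - dl e * mu1 / (alpha + beta)) <= th ->
    no_limit_cycle_within d (vf alpha beta phi e eta (dl e * mu1)) (Gamma0 alpha beta)).
Proof.
  intros Hmu Hm Hbl.
  apply (side_exclusion (-1) (alpha + beta) (alpha + beta) 1 cR (1 - phi 0) (fun e U => 1 - phi (/ e * U)) m' m mu1 (left_point alpha beta 1));
    try assumption; try lra.
  - intros e x. apply rate_right.
  - intros t Ht. apply Gamma0_iff; [assumption | assumption|]. right. exists t. split; [exact Ht | reflexivity].
  - apply Gamma0_iff; [assumption | assumption|]. left. exists 1. split; [lra | reflexivity].
  - unfold left_point, side_U. simpl fst. pose proof (lin_U_pos 1 alpha R0 1 ltac:(lra) R0_pos Rlt_0_1). fold R0. lra.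
Qed.

Lemma relaxation_cycles (mL mR mu1 eta1 : R) : 0 <= mu1 ->
  - (eta1 - mu1 / alpha) < mL -> passing k alpha 1 alpha (beta * cL / alpha) mL ->
  eta1 - mu1 / (alpha + beta) < mR -> passing k (alpha + beta) (alpha + beta) 1 (beta * cR / (alpha + beta)) mR ->
  exists Q, 0 < Q /\ eventually0 (fun e => exists G,
    let F := vf alpha beta phi e (1 + dl e * eta1) (dl e * mu1) in
    limit_cycle F G /\ attracting F G /\ Rbar_le (hausdorff_dist G (Gamma0 alpha beta)) (Q * dl e)).
Proof.
  intros Hmu HmL HpL HmR HpR.
  assert (EL : beta / (alpha * (alpha + 1 * beta)) = R0) by (unfold R0; rewrite Rmult_1_l; reflexivity).
  assert (ER : beta / ((alpha + beta) * (alpha + beta + -1 * beta)) = R0) by (unfold R0; field; lra).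
  destruct (half_map k alpha 1 alpha beta 1 cL (phi 0) dl (fun e U => phi (/ e * - U)) (- (eta1 - mu1 / alpha)) mL mu1
    ltac:(lra) ltac:(lra) ltac:(lra) ltac:(lra) HcL ltac:(left; reflexivity) tail_left ltac:(lra) Hmu HmL HpL)
    as (radL & CL & HradL & HCL & HevL).
  destruct (half_map k (alpha + beta) (alpha + beta) 1 beta (-1) cR (1 - phi 0) dl (fun e U => 1 - phi (/ e * U))
    (eta1 - mu1 / (alpha + beta)) mR mu1
    ltac:(lra) ltac:(lra) ltac:(lra) ltac:(lra) HcR ltac:(right; reflexivity) tail_right ltac:(lra) Hmu HmR HpR)
    as (radR & CR & HradR & HCR & HevR).
  rewrite EL in HevL. rewrite ER in HevR.
  set (K := tracking_constant 1 alpha R0 + tracking_constant (alpha + beta) 1 R0).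
  assert (HK : 0 < K).
  { pose proof (tracking_constant_pos alpha beta Halpha Hab 1 alpha ltac:(lra)).
    pose proof (tracking_constant_pos alpha beta Halpha Hab (alpha + beta) 1 ltac:(lra)). unfold K, R0. lra. }
  exists (3 * (K * (CL + CR))). split; [pos|].
  assert (Hys : 0 < / (alpha + beta) < 1).
  { split; [apply Rinv_0_lt_compat; lra | rewrite <- Rinv_1; apply Rinv_lt_contravar; lra]. }
  set (r := Rmin radL (/ (alpha + beta) / 2)). assert (Hr : 0 < r) by (apply Rmin_pos; lra).
  assert (Hr1 : r <= radL) by apply Rmin_l. assert (Hr2 : r <= / (alpha + beta) / 2) by apply Rmin_r.
  (* A bound for the exit error: it must fit into the right entry interval, map the section into its
     own half, and keep return times above [1 / 2]. *)
  set (s := Rmin radR (Rmin (r / 2) (1 / 2))). assert (Hs : 0 < s) by (unfold s; repeat apply Rmin_pos; lra).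
  assert (Hs1 : s <= radR /\ s <= r / 2 /\ s <= 1 / 2).
  { unfold s. pose proof (Rmin_l radR (Rmin (r / 2) (1 / 2))). pose proof (Rmin_r radR (Rmin (r / 2) (1 / 2))).
    pose proof (Rmin_l (r / 2) (1 / 2)). pose proof (Rmin_r (r / 2) (1 / 2)). lra. }
  pose proof (Rabs_pos eta1) as Ha1.
  eapply eventually0_impl.
  { apply eventually0_and; [exact HevL|]. apply eventually0_and; [exact HevR|].
    apply eventually0_and; [apply (eps_scale_small k Hk (s / (CL + CR))); pos | apply (eps_scale_small k Hk (/ (Rabs eta1 + 1))); pos]. }
  intros e He ((TL & HTL & HPL) & (TR & HTR & HPR) & Hd1 & Hd2).
  fold dl in Hd1, Hd2. set (d := dl e) in *. assert (Hd : 0 < d) by apply eps_scale_pos.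
  assert (Herr : (CL + CR) * d <= s).
  { apply Rmult_lt_compat_l with (r := CL + CR) in Hd1; [|lra].
    replace ((CL + CR) * (s / (CL + CR))) with s in Hd1 by (field; lra). lra. }
  assert (Heta : Rabs (d * eta1) < 1).
  { rewrite Rabs_mult, (Rabs_pos_eq d) by lra.
    apply Rmult_lt_compat_r with (r := Rabs eta1 + 1) in Hd2; [|lra].
    rewrite Rinv_l in Hd2 by lra. lra. }
  apply Rabs_lt_between in Heta.
  assert (Hmud : 0 <= d * mu1) by (apply Rmult_le_pos; lra).
  assert (HPL' : half_passage alpha beta alpha 1 alpha 1 (fun U => phi (/ e * - U)) (d * mu1)
    (- (1) * (1 + d * eta1 - 1 - d * mu1 / alpha)) radL ((CL + CR) * d) TL).
  { apply (half_passage_weaken _ _ _ _ _ _ _ _ _ _ (CL * d)).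
    - assert (0 < CR * d) by (apply Rmult_lt_0_compat; lra). lra.
    - replace (- (1) * (1 + d * eta1 - 1 - d * mu1 / alpha)) with (d * - (eta1 - mu1 / alpha)) by (field; lra). exact HPL. }
  assert (HPR' : half_passage alpha beta (alpha + beta) (alpha + beta) 1 (-1) (fun U => 1 - phi (/ e * U)) (d * mu1)
    (- -1 * (1 + d * eta1 - 1 - d * mu1 / (alpha + beta))) radR ((CL + CR) * d) TR).
  { apply (half_passage_weaken _ _ _ _ _ _ _ _ _ _ (CR * d)).
    - assert (0 < CL * d) by (apply Rmult_lt_0_compat; lra). lra.
    - replace (- -1 * (1 + d * eta1 - 1 - d * mu1 / (alpha + beta))) with (d * (eta1 - mu1 / (alpha + beta))) by (field; lra). exact HPR. }
  assert (Ha2 : alpha * (2 / alpha + 2) = 2 + 2 * alpha) by (field; lra).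
  assert (Ha3 : 0 < 2 / alpha) by (apply Rdiv_lt_0_compat; lra).
  assert (Ha4 : 0 < (alpha + beta) * (2 / alpha + 2)) by (apply Rmult_lt_0_compat; lra).
  (* The box uses [Yb = 2 / alpha + 2], sufficient because [eta < 2]; [Xb] exceeds
     [(alpha + beta) * Yb] by [2]. *)
  destruct (relaxation_cycle alpha beta Halpha Hab k phi phiL phiR Hphi e (1 + d * eta1) (d * mu1)
    ((alpha + beta) * (2 / alpha + 2) + 2) (2 / alpha + 2) r radL radR ((CL + CR) * d) TL TR) as (G & HG1 & HG2 & HG3 & HG4);
    try assumption; try lra.
  exists G. split; [exact HG1|]. split; [exact HG2|].
  apply hausdorff_dist_le.
  - apply Rmult_le_pos; [|lra]. apply Rlt_le. pos.
  - intros a Ga. destruct (HG3 a Ga) as (b & Hb & Hab'). exists b. split; [exact Hb|]. fold R0 in Hab'. fold K in Hab'. lra.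
  - intros b Gb. destruct (HG4 b Gb) as (a & Ha & Hab'). exists a. split; [exact Ha|]. fold R0 in Hab'. fold K in Hab'. lra.
Qed.

End Conclusion.

Theorem theorem1 :
  forall (k : nat) (alpha beta cL cR : R),
    (0 < k)%nat -> 0 < alpha < 1 -> 1 < alpha + beta -> 0 < cL -> 0 < cR ->
  exists etaL0 etaR0 : R, etaL0 < 0 /\ 0 < etaR0 /\
  let etaL := fun mu1 : R => etaL0 + mu1 / alpha in
  let etaR := fun mu1 : R => etaR0 + mu1 / (alpha + beta) in
  let is_mustar := fun mustar : R =>
    0 < mustar /\
    (forall mu1, 0 <= mu1 < mustar -> etaL mu1 < etaR mu1) /\
    etaL mustar = etaR mustar /\
    (forall mu1, mustar < mu1 -> etaR mu1 < etaL mu1) in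
  (exists! mustar : R, is_mustar mustar) /\
  forall (phi phiL phiR : R -> R),
    sigmoidal k phi phiL phiR -> phiL 0 = cL -> phiR 0 = cR ->
  forall mustar : R, is_mustar mustar ->
    (forall mu1 eta1 : R, 0 <= mu1 < mustar ->
       let F := fun eps : R =>
         vf alpha beta phi eps (1 + eps_scale k eps * eta1) (eps_scale k eps * mu1) in
       (etaL mu1 < eta1 < etaR mu1 ->
          exists (eps0 : R) (Gamma : R -> plane -> Prop),
            0 < eps0 /\
            (forall eps, 0 < eps < eps0 ->
               limit_cycle (F eps) (Gamma eps) /\ attracting (F eps) (Gamma eps)) /\
            (forall delta, 0 < delta ->
               exists eps1, 0 < eps1 /\
               forall eps, 0 < eps < eps0 -> eps < eps1 ->
                 Rbar_lt (hausdorff_dist (Gamma eps) (Gamma0 alpha beta)) delta)) /\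
       (~ (etaL mu1 <= eta1 <= etaR mu1) ->
          exists eps0 c : R, 0 < eps0 /\ 0 < c /\
            forall eps, 0 < eps < eps0 ->
              no_limit_cycle_within c (F eps) (Gamma0 alpha beta)))
    /\
    (forall mu1 : R, mustar < mu1 ->
       exists (eps0 c : R) (I : R -> Prop), 0 < eps0 /\ 0 < c /\ locally 1 I /\
         forall eps eta : R, 0 < eps < eps0 -> I eta ->
           no_limit_cycle_within c
             (vf alpha beta phi eps eta (eps_scale k eps * mu1))
             (Gamma0 alpha beta)).

Proof.
  intros k alpha beta cL cR Hk Halpha Hab HcL HcR.
  assert (Hb : 0 < beta) by lra.
  assert (cancel : forall a b : R, 0 < b -> a / b * b = a) by (intros a b Hpos; field; lra).
  destruct (critical_value k alpha 1 alpha (beta * cL / alpha) Hk ltac:(lra) ltac:(lra) ltac:(lra) ltac:(pos))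
    as (mL & HmL & HpassL & HblockL).
  destruct (critical_value k (alpha + beta) (alpha + beta) 1 (beta * cR / (alpha + beta)) Hk ltac:(lra) ltac:(lra) ltac:(lra) ltac:(pos))
    as (mR & HmR & HpassR & HblockR).
  exists (- mL), mR. split; [lra|]. split; [exact HmR|]. intros etaL etaR is_mustar.
  (* [etaR - etaL] is affine in [mu1], positive at [0] and of slope [- D], so its only zero is
     [(mL + mR) / D]. *)
  set (D := / alpha - / (alpha + beta)).
  assert (HD : 0 < D).
  { unfold D. assert (/ (alpha + beta) < / alpha) by (apply Rinv_lt_contravar; [apply Rmult_lt_0_compat; lra | lra]). lra. }
  assert (gap : forall mu1, etaR mu1 - etaL mu1 = mL + mR - D * mu1).
  { intros mu1. unfold etaR, etaL, D. field. lra. }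
  assert (gap0 : D * ((mL + mR) / D) = mL + mR) by (field; lra).
  split.
  - exists ((mL + mR) / D). split.
    + split; [pos|]. split; [|split].
      * intros mu1 Hmu. assert (D * mu1 < D * ((mL + mR) / D)) by (apply Rmult_lt_compat_l; lra). specialize (gap mu1). lra.
      * specialize (gap ((mL + mR) / D)). lra.
      * intros mu1 Hmu. assert (D * ((mL + mR) / D) < D * mu1) by (apply Rmult_lt_compat_l; lra). specialize (gap mu1). lra.
    + intros mu (_ & _ & E & _). specialize (gap mu). apply Rmult_eq_reg_l with D; lra.
  - intros phi phiL phiR Hphi EcL EcR mustar (Hmu0 & Hbelow & _ & Habove). split.
    + intros mu1 eta1 Hmu F. split.
      * intros [H1 H2]. unfold etaL in H1. unfold etaR in H2.
        destruct (HpassL (- (eta1 - mu1 / alpha)) ltac:(lra)) as (mL' & HmL' & HpL).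
        destruct (HpassR (eta1 - mu1 / (alpha + beta)) ltac:(lra)) as (mR' & HmR' & HpR).
        destruct (relaxation_cycles k alpha beta cL cR Hk Halpha Hab HcL HcR phi phiL phiR Hphi EcL EcR mL' mR' mu1 eta1
          ltac:(lra) HmL' HpL HmR' HpR) as (Q & HQ & eps0 & Heps0 & Hcyc).
        (* A cycle is chosen for every [e]; outside [(0, eps0)] an arbitrary set is supplied. *)
        assert (Ch : forall e, exists G, 0 < e < eps0 -> limit_cycle (F e) G /\ attracting (F e) G /\
          Rbar_le (hausdorff_dist G (Gamma0 alpha beta)) (Q * eps_scale k e)).
        { intros e. destruct (classic (0 < e < eps0)) as [He|He].
          - destruct (Hcyc e He) as (G & HG). exists G. intros _. exact HG.
          - exists (fun _ => True). intros H. contradiction. }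
        exists eps0, (fun e => proj1_sig (constructive_indefinite_description _ (Ch e))). split; [exact Heps0|].
        assert (HCh : forall e, 0 < e < eps0 -> _) by (intros e; exact (proj2_sig (constructive_indefinite_description _ (Ch e)))).
        split.
        -- intros e He. destruct (HCh e He) as (A1 & A2 & _). split; assumption.
        -- intros delta Hdelta. destruct (eps_scale_small k Hk (delta / Q) ltac:(pos)) as (eps1 & Heps1 & Hsmall).
           exists eps1. split; [exact Heps1|]. intros e He He1. destruct (HCh e He) as (_ & _ & A3).
           eapply Rbar_le_lt_trans; [exact A3|]. simpl.
           specialize (Hsmall e ltac:(lra)). apply Rmult_lt_compat_l with (r := Q) in Hsmall; [|exact HQ].
           replace (Q * (delta / Q)) with delta in Hsmall by (field; lra). exact Hsmall.
      * intros Hout. destruct (Rlt_le_dec eta1 (etaL mu1)) as [H1|H1].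
        -- unfold etaL in H1. destruct (HblockL (- (eta1 - mu1 / alpha)) ltac:(lra)) as (m' & Hm' & Hbl).
           destruct (left_exclusion k alpha beta cL Hk Halpha Hab HcL phi phiL phiR Hphi EcL m' _ mu1 ltac:(lra) Hm' Hbl)
             as (c & th & Hc & Hth & Hev).
           destruct (eventually0_and _ _ Hev (eps_scale_small k Hk (th / - (eta1 - mu1 / alpha)) ltac:(pos))) as (eps0 & Heps0 & H).
           exists eps0, c. split; [exact Heps0|]. split; [exact Hc|]. intros e He. destruct (H e He) as [Hex Hs].
           apply Hex. apply Rmult_lt_compat_r with (r := - (eta1 - mu1 / alpha)) in Hs; [|lra].
           rewrite cancel in Hs by lra.
           replace (- (1) * (1 + eps_scale k e * eta1 - 1 - eps_scale k e * mu1 / alpha))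
             with (eps_scale k e * - (eta1 - mu1 / alpha)) by (field; lra). lra.
        -- assert (H2 : etaR mu1 < eta1) by lra. unfold etaR in H2.
           destruct (HblockR (eta1 - mu1 / (alpha + beta)) ltac:(lra)) as (m' & Hm' & Hbl).
           destruct (right_exclusion k alpha beta cR Hk Halpha Hab HcR phi phiL phiR Hphi EcR m' _ mu1 ltac:(lra) Hm' Hbl)
             as (c & th & Hc & Hth & Hev).
           destruct (eventually0_and _ _ Hev (eps_scale_small k Hk (th / (eta1 - mu1 / (alpha + beta))) ltac:(pos))) as (eps0 & Heps0 & H).
           exists eps0, c. split; [exact Heps0|]. split; [exact Hc|]. intros e He. destruct (H e He) as [Hex Hs].
           apply Hex. apply Rmult_lt_compat_r with (r := eta1 - mu1 / (alpha + beta)) in Hs; [|lra].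
           rewrite cancel in Hs by lra.
           replace (- -1 * (1 + eps_scale k e * eta1 - 1 - eps_scale k e * mu1 / (alpha + beta)))
             with (eps_scale k e * (eta1 - mu1 / (alpha + beta))) by (field; lra). lra.
    + intros mu1 Hmu. specialize (Habove mu1 Hmu). unfold etaL, etaR in Habove.
      (* The thresholds have crossed, so for [mid] between them the left side blocks for all
         [eta <= 1 + d * mid] near [1] and the right side for all larger ones near [1]. The
         admissible drifts have fixed bounds [th1] and [th2], so together the two sides cover a
         fixed neighborhood of [1]. *)
      set (mid := (- mL + mu1 / alpha + (mR + mu1 / (alpha + beta))) / 2).
      destruct (HblockL (mu1 / alpha - mid) ltac:(unfold mid; lra)) as (m'L & Hm'L & HblL).
      destruct (HblockR (mid - mu1 / (alpha + beta)) ltac:(unfold mid; lra)) as (m'R & Hm'R & HblR).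
      destruct (left_exclusion k alpha beta cL Hk Halpha Hab HcL phi phiL phiR Hphi EcL m'L _ mu1 ltac:(lra) Hm'L HblL)
        as (c1 & th1 & Hc1 & Hth1 & Hev1).
      destruct (right_exclusion k alpha beta cR Hk Halpha Hab HcR phi phiL phiR Hphi EcR m'R _ mu1 ltac:(lra) Hm'R HblR)
        as (c2 & th2 & Hc2 & Hth2 & Hev2).
      assert (Hma : 0 < mu1 / alpha) by (apply Rdiv_lt_0_compat; lra).
      assert (Hmb : 0 < mu1 / (alpha + beta)) by (apply Rdiv_lt_0_compat; lra).
      (* The left drift is [1 - eta + d * (mu1 / alpha)]; half of [th1] is reserved for the second
         term, the other half for [1 - eta]. *)
      destruct (eventually0_and _ _ (eventually0_and _ _ Hev1 Hev2)
        (eps_scale_small k Hk (th1 / 2 / (mu1 / alpha)) ltac:(pos))) as (eps0 & Heps0 & H).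
      assert (Hth : 0 < Rmin (th1 / 2) th2) by (apply Rmin_pos; lra).
      exists eps0, (Rmin c1 c2), (fun eta => Rabs (eta - 1) < Rmin (th1 / 2) th2).
      split; [exact Heps0|]. split; [pos|]. split.
      { exists (mkposreal _ Hth). intros eta Heta. exact Heta. }
      intros e eta He Heta. destruct (H e He) as [[Hex1 Hex2] Hs].
      pose proof (Rmin_l (th1 / 2) th2). pose proof (Rmin_r (th1 / 2) th2).
      apply Rabs_lt_between in Heta. pose proof (eps_scale_pos k e) as Hd. set (d := eps_scale k e) in *.
      apply Rmult_lt_compat_r with (r := mu1 / alpha) in Hs; [|lra].
      rewrite cancel in Hs by lra.
      assert (Ed1 : d * mu1 / alpha = d * (mu1 / alpha)) by (field; lra).
      assert (Ed2 : d * mu1 / (alpha + beta) = d * (mu1 / (alpha + beta))) by (field; lra).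
      assert (Hdb : 0 < d * (mu1 / (alpha + beta))) by pos.
      destruct (Rle_lt_dec (eta - 1) (d * mid)).
      * apply (no_limit_cycle_within_le _ c1); [apply Rmin_l|]. apply Hex1. rewrite Ed1. lra.
      * apply (no_limit_cycle_within_le _ c2); [apply Rmin_r|]. apply Hex2. rewrite Ed2. lra.
Qed.
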